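(* Let $n \ge 5$ and let $F \subseteq E(Q_n)$ be a set of (faulty) edges of the $n$-dimensional hypercube $Q_n$ with $|F| \le 4n-17$. Suppose that $\delta(Q_n - F) \ge 2$ and that at most one vertex of $Q_n - F$ has degree exactly $2$. Then $Q_n - F$ is Hamiltonian laceable; that is, for any two vertices $x, y$ of $Q_n$ with $p(x) \neq p(y)$, the graph $Q_n - F$ contains a Hamiltonian path with end vertices $x$ and $y$.
   Context: $Q_n$ is the graph with vertex set $\{0,1\}^n$ in which two vertices are adjacent iff they differ in exactly one coordinate. The parity of a vertex $u = u^1\cdots u^n$ is $p(u) = \sum_{i=1}^n u^i \pmod 2$; vertices of different parity lie in different partite sets of the bipartite graph $Q_n$. $Q_n - F$ denotes the graph obtained from $Q_n$ by deleting the edges in $F$ (keeping all vertices), and $\delta(G)$ denotes the minimum degree of $G$. A bipartite graph is Hamiltonian laceable if any two vertices from different partite sets are joined by a Hamiltonian path. *)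

(* Defs.v *)
From mathcomp Require Import all_boot.
Set Implicit Arguments. Unset Strict Implicit. Unset Printing Implicit Defensive.

Definition vert (n : nat) := {ffun 'I_n -> bool}.

Definition hdist n (u v : vert n) : nat := #|[set i | u i != v i]|.

Definition qadj n (u v : vert n) : bool := hdist u v == 1.

Definition parity n (u : vert n) : bool := odd #|[set i | u i]|.

Definition qedge n (e : {set vert n}) : bool :=
  [exists u, exists v, qadj u v && (e == [set u; v])].

Definition adjF n (F : {set {set vert n}}) (u v : vert n) : bool :=
  qadj u v && ([set u; v] \notin F).

Definition degF n (F : {set {set vert n}}) (u : vert n) : nat :=
  #|[set v | adjF F u v]|.

Definition ham_path n (F : {set {set vert n}}) (x y : vert n) (p : seq (vert n)) : Prop :=
  [/\ uniq p, (forall v : vert n, v \in p), head x p = x, last x p = y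
    & path (adjF F) x (behead p)].

(* Main.v *)
Require Import Defs.
From mathcomp Require Import perm all_boot zify.
From Stdlib Require Import BinNat.
Set Implicit Arguments. Unset Strict Implicit. Unset Printing Implicit Defensive.

(** The proof is an induction on the dimension. A direction [d] cuts the cube into two halves joined
    by a perfect matching, some of whose edges may be faulty. If both halves are laceable and few
    matching edges are faulty, then the cube is laceable ([joinG_laceable]): a spanning path of one
    half is cut at an edge whose ends both cross safely, and a spanning path of the other half is
    inserted. So a direction is wanted for which both halves again have few faults, minimum degree
    two and at most one vertex of degree two. The inductive statement is [T], with the fault bound
    [bnd]: 3, 5, 8 in dimensions 4, 5, 6 and 4m-17 from dimension 7 on.

    Directions are weighed from a centre [c]. A fault violates [d] if it does not lie in the half of
    [c] for the direction [d], and [vnum G c d] counts such faults. A fault not incident with [c]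
    violates at least two directions, so double counting ([viol_total], [low_sum]) produces
    directions violated often. If the best direction still leaves one fault too many in a half, one
    fault of that half is treated as healthy, and a path that uses it is repaired through the other
    half ([cube_single], [fix_v]). That half has so few faults that it is [strong]: it also has
    paths missing just one prescribed vertex and pairs of disjoint paths that together span.

    Vertices of degree two or three restrict the choice of [d], since a healthy edge in direction
    [d] is lost when passing to a half. Edge counting in a bipartite graph shows that there are at
    most three of them ([four_inc]). The cases of none, one, two and three are [no_low], [one_low],
    [two_low] and [three_low]. The hard configurations have all faults, or all but one, at three
    vertices. They are described by [tri] through healthy directions at these vertices and settled
    by [tri_meet], [pure_top], [pure_shared] and [part_lace], mostly by descending to smaller cubes
    while exchanging healthy directions.

    The bottom of the induction is computed: Q_3 is strong by exhaustive search, Q_4 with three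
    faults is checked against an explicit list of Hamiltonian paths, and the configurations of three
    fault vertices in Q_5 are reduced to Q_4 or solved by rotating one path. *)

Section Paths.
Variable T : eqType.
Implicit Types (e : rel T) (x y : T) (s : seq T).

(** * Walks as vertex lists *)

Definition pth e x s y := exists2 p, s = x :: p & path e x p /\ last x p = y.

Lemma pth_cat e x s y x' s' y' :
  pth e x s y -> pth e x' s' y' -> e y x' -> pth e x (s ++ s') y'.
Proof.
move=> [p -> [pp lp]] [p' -> [pp' lp']] h; exists (p ++ x' :: p') => //.
by rewrite cat_path last_cat /= pp lp h pp' lp'.
Qed.

Lemma pth_rev e x s y : symmetric e -> pth e x s y -> pth e y (rev s) x.
Proof.
move=> se [p -> [pp lp]]; exists (rev (belast x p)).
  by rewrite lastI lp rev_rcons.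
have := rev_path e x p; rewrite lp => ->; split.
  by rewrite (eq_path (e' := e)) // => a b; rewrite se.
by case: (p) lp => [|z q] //= _; rewrite rev_cons last_rcons.
Qed.

Lemma pth_cons e x z s y : e x z -> pth e z s y -> pth e x (x :: s) y.
Proof. by move=> h [p -> [p1 p2]]; exists (z :: p) => //=; rewrite h p1 p2. Qed.

Lemma pth_cut e x s y (X : pred T) : pth e x s y -> (count X s).*2.+1 < size s ->
  exists s1 s2 g h,
    [/\ s = s1 ++ s2, pth e x s1 g, pth e h s2 y, e g h & ~~ X g && ~~ X h].
Proof.
have [n] := ubnP (size s); elim: n x s => // n IH x s sn [p def_s [pp lp]].
rewrite {}def_s in sn *; case: p pp lp sn => [|z p] /=; first by case: (X x).
move=> /andP[exz pp] lp sn hc.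
have cons1 t s' : pth e t s' y -> e x t ->
    (exists s1 s2 g h, [/\ s' = s1 ++ s2, pth e t s1 g, pth e h s2 y, e g h & ~~ X g && ~~ X h]) ->
    exists s1 s2 g h, [/\ x :: s' = s1 ++ s2, pth e x s1 g, pth e h s2 y, e g h & ~~ X g && ~~ X h].
  move=> _ ext [s1 [s2 [g [h [-> h1 h2 h3 h4]]]]].
  by exists (x :: s1), s2, g, h; split=> //; apply: pth_cons h1.
case Xx: (X x) hc => /= hc.
  apply: (cons1 z) => //; first by exists p.
  by apply: IH; [rewrite /=; lia | exists p | rewrite /=; lia].
case Xz: (X z) hc => /= hc; last first.
  exists [:: x], (z :: p), x, z; rewrite Xx Xz; split=> //; first by exists [::].
  by exists p.
case: p pp lp sn hc => [|t p] //=.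
move=> /andP[ezt pp] lp sn hc.
have [s1 [s2 [g [h [eq h1 h2 h3 h4]]]]] :
  exists s1 s2 g h, [/\ t :: p = s1 ++ s2, pth e t s1 g, pth e h s2 y, e g h & ~~ X g && ~~ X h].
  by apply: IH; [rewrite /=; lia | exists p | rewrite /=; lia].
exists [:: x, z & s1], s2, g, h; rewrite eq; split=> //.
by apply: pth_cons exz _; apply: pth_cons ezt h1.
Qed.
End Paths.

Lemma pth_map (T T' : eqType) (h : T -> T') (e : rel T) (e' : rel T') x s y :
  (forall a b, e a b -> e' (h a) (h b)) -> pth e x s y -> pth e' (h x) (map h s) (h y).
Proof.
move=> he [p -> [pp lp]]; exists (map h p) => //; split; last by rewrite last_map lp.
by rewrite path_map; apply: sub_path pp => a b /he.
Qed.

(** * Hamiltonian paths in two graphs joined by a matching *)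

Section Ham.
Variable T : finType.
Implicit Types (e : rel T) (c : T -> bool).

Definition ham e x y := exists2 s, pth e x s y & forall z, count_mem z s = 1.

Definition laceable c e := forall x y, c x != c y -> ham e x y.

Lemma ham_rev e x y : symmetric e -> ham e x y -> ham e y x.
Proof. by move=> se [s h1 h2]; exists (rev s); [exact: pth_rev|move=> z; rewrite count_rev]. Qed.

Lemma span_perm (s : seq T) : (forall z, count_mem z s = 1) -> perm_eq s (enum T).
Proof.
move=> h; have sE z : z \in s by rewrite -has_pred1 has_count h.
apply: uniq_perm; rewrite ?enum_uniq //; first by apply: count_mem_uniq => z; rewrite h sE.
by move=> z; rewrite sE mem_enum.
Qed.

Lemma span_count (s : seq T) (X : pred T) : (forall z, count_mem z s = 1) -> count X s = #|X|.
Proof. by move/span_perm/permP->; rewrite -size_filter cardE enumT. Qed.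

Lemma span_size (s : seq T) : (forall z, count_mem z s = 1) -> size s = #|T|.
Proof. by move/span_perm/perm_size->; rewrite -cardE. Qed.
End Ham.

(* Two copies of T joined by a matching; X marks the absent matching edges. *)
Definition joinG (T : finType) (e0 e1 : rel T) (X : pred T) : rel (bool * T) :=
  fun u v => if u.1 == v.1 then (if u.1 then e1 else e0) u.2 v.2
             else (u.2 == v.2) && ~~ X u.2.


Lemma joinG_sym (T : finType) (e0 e1 : rel T) (X : pred T) :
  symmetric e0 -> symmetric e1 -> symmetric (joinG e0 e1 X).
Proof.
move=> s0 s1 [a u] [b v]; rewrite /joinG /= (eq_sym b a); case: eqP => [->|_].
  by case: b; [rewrite s1 | rewrite s0].
by rewrite eq_sym; case: eqP => // ->.
Qed.

Lemma joinG_same (T : finType) (e0 e1 : rel T) (X : pred T) a x y :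
  joinG e0 e1 X (a, x) (a, y) = (if a then e1 else e0) x y.
Proof. by rewrite /joinG /= eqxx. Qed.

Lemma joinG_cross (T : finType) (e0 e1 : rel T) (X : pred T) a x :
  ~~ X x -> joinG e0 e1 X (a, x) (~~ a, x).
Proof. by rewrite /joinG /=; case: a; rewrite eqxx. Qed.

Lemma count_pair (T : eqType) (a b : bool) (z : T) (s : seq T) :
  count_mem (a, z) (map (pair b) s) = (a == b :> bool) * count_mem z s.
Proof.
rewrite count_map; case: (eqVneq a b) => [->|ab].
  by rewrite mul1n; apply: eq_count => t; rewrite /= xpair_eqE eqxx.
rewrite mul0n; apply/eqP; rewrite -leqn0 leqNgt -has_count; apply/hasPn => t _ /=.
by apply: contra ab => /eqP[->].
Qed.

(** Ends in one copy: a spanning path of that copy is cut at an edge with unmarked ends, and the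
    other copy is inserted there. Ends in different copies: the path crosses at an unmarked vertex
    whose colour is opposite to that of [x]. *)
Lemma joinG_laceable (T : finType) (c : T -> bool) e0 e1 (X : pred T) :
  symmetric e0 -> symmetric e1 ->
  (forall x y, e0 x y || e1 x y -> c x != c y) ->
  laceable c e0 -> laceable c e1 -> (#|X|).*2.+1 < #|T| ->
  (forall b, #|X| < #|[pred x | c x == b]|) ->
  laceable (fun u : bool * T => u.1 (+) c u.2) (joinG e0 e1 X).
Proof.
move=> s0 s1 bip l0 l1 hX hc; set E := joinG e0 e1 X.
have lE a : laceable c (if a then e1 else e0) by case: a.
have pthE a x s y : pth (if a then e1 else e0) x s y -> pth E (a, x) (map (pair a) s) (a, y).
  by apply: pth_map => u v; rewrite /E joinG_same.
move=> [a x] [b y] /= xy; case: (eqVneq a b) xy => [<-{b}|ab] xy.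
  have {}xy : c x != c y by case: (a) xy; rewrite //= (inj_eq negb_inj).
  have [s ps cs] := lE a _ _ xy.
  have [|t1 [t2 [g [h [eqs p1 p2 gh /andP[Xg Xh]]]]]] := pth_cut (X := X) ps.
    by rewrite span_count // span_size.
  have cgh : c g != c h by apply: bip; move: gh; case: (a) => ->; rewrite ?orbT.
  have [r pr cr] := lE (~~ a) _ _ cgh.
  exists (map (pair a) t1 ++ map (pair (~~ a)) r ++ map (pair a) t2).
    apply: pth_cat (pthE _ _ _ _ p1) (pth_cat (pthE _ _ _ _ pr) (pthE _ _ _ _ p2) _) _.
      by rewrite /E joinG_sym //; apply: joinG_cross.
    exact: joinG_cross.
  move=> [d z]; move: (cs z) (cr z); rewrite eqs !count_cat !count_pair.
  by case: (a); case: d => /=; lia.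
have eb : b = ~~ a by case: (a) (b) ab => -[].
move: xy; rewrite {ab}eb => xy.
have {}xy : c x = c y by case: (a) (c x) (c y) xy => -[] [].
have [u cu Xu] : exists2 u, c u == ~~ c x & ~~ X u.
  case: (pickP [pred u | (c u == ~~ c x) && ~~ X u]) => [u /andP[]|h]; first by exists u.
  have := hc (~~ c x); rewrite ltnNge => /negP[].
  apply/subset_leq_card/subsetP => v; rewrite !inE => cv.
  by have := h v; rewrite /= cv /= => /negbFE.
move/eqP: cu => cu.
have [s ps cs] : ham (if a then e1 else e0) x u by apply: lE; rewrite cu; case: (c x).
have [r pr cr] : ham (if ~~ a then e1 else e0) u y by apply: lE; rewrite cu xy; case: (c y).
exists (map (pair a) s ++ map (pair (~~ a)) r).
  by apply: pth_cat (pthE _ _ _ _ ps) (pthE _ _ _ _ pr) _; apply: joinG_cross.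
move=> [d z]; move: (cs z) (cr z); rewrite !count_cat !count_pair.
by case: (a); case: d => /=; lia.
Qed.

Lemma ham_iso (T T' : finType) (h : T -> T') (e : rel T) (e' : rel T') x y :
  bijective h -> (forall a b, e a b -> e' (h a) (h b)) -> ham e x y -> ham e' (h x) (h y).
Proof.
move=> [k hk kh] he [s ps cs]; exists (map h s); first exact: pth_map ps.
move=> z; rewrite count_map -(cs (k z)); apply: eq_count => t /=.
by rewrite -{1}(kh z) (can_eq hk).
Qed.

(** * Strong laceability and its inheritance by joined graphs *)

Section Strong.
Variables (T : finType) (c : T -> bool).
Implicit Types (e : rel T).

Definition skip e z p q := exists2 s, pth e p s q & forall t, count_mem t s = (t != z).
Definition link e x1 y1 x2 y2 := exists s1 s2,
  [/\ pth e x1 s1 y1, pth e x2 s2 y2 & forall t, count_mem t s1 + count_mem t s2 = 1].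
(** What a half with very few faults offers when a path of the other half has to be repaired: [skip]
    passes around a vertex already used as an end, and [link] replaces two pieces of a path at
    once. *)
Definition strong e := [/\ laceable c e,
  forall z p q, c p = c q -> c z != c p -> p != q -> skip e z p q
  & forall x1 y1 x2 y2, c x1 != c y1 -> c x2 != c y2 ->
      x1 != x2 -> x1 != y2 -> y1 != x2 -> y1 != y2 -> link e x1 y1 x2 y2].

Lemma linkC e x1 y1 x2 y2 : link e x1 y1 x2 y2 -> link e x2 y2 x1 y1.
Proof. by case=> s1 [s2 [p1 p2 h]]; exists s2, s1; split=> // t; rewrite addnC. Qed.
Lemma link_rev e x1 y1 x2 y2 : symmetric e -> link e x1 y1 x2 y2 -> link e y1 x1 x2 y2.
Proof.
move=> se [s1 [s2 [p1 p2 h]]]; exists (rev s1), s2; split=> //; first exact: pth_rev.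
by move=> t; rewrite count_rev.
Qed.
Lemma skip_rev e z p q : symmetric e -> skip e z p q -> skip e z q p.
Proof. by move=> se [s h1 h2]; exists (rev s); [exact: pth_rev|move=> t; rewrite count_rev]. Qed.

Lemma pick_free b (X : pred T) (L : seq T) :
  #|X| + size L < #|[pred x | c x == b]| -> exists t, [/\ c t = b, ~~ X t & t \notin L].
Proof.
move=> h; case: (pickP [pred t | [&& c t == b, ~~ X t & t \notin L]]) => [t /and3P[/eqP ? ? ?]|no].
  by exists t.
have : #|[pred x | c x == b]| <= #|[predU X & mem L]|.
  apply/subset_leq_card/subsetP => t; rewrite !inE => ct; have := no t.
  by rewrite /= ct /= -negb_or => /negbFE.
move=> h3; have h1 := cardUI X (mem L); have h2 := card_size L.
move: h; rewrite ltnNge => /negP[]; apply: leq_trans h3 _; apply: leq_trans (leq_addr #|[predI X & mem L]| _) _.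
by rewrite h1 leq_add2l.
Qed.
Lemma col_neq x y : c x = ~~ c y -> x != y.
Proof. by move=> h; apply/eqP => xy; move: h; rewrite xy; case: (c y). Qed.

Lemma card_color : #|[pred x | c x == true]| + #|[pred x | c x == false]| = #|T|.
Proof.
rewrite -(cardC [pred x | c x == true]); congr (_ + _).
by apply: eq_card => x; rewrite !inE; case: (c x).
Qed.
End Strong.

Section JoinStrong.
Variables (T : finType) (c : T -> bool) (e0 e1 : rel T) (X : pred T).
Hypotheses (s0 : symmetric e0) (s1 : symmetric e1).
Hypothesis bip : forall x y, e0 x y || e1 x y -> c x != c y.
Let E := joinG e0 e1 X.
Let eS (a : bool) := if a then e1 else e0.

Lemma eS_sym a : symmetric (eS a). Proof. by case: a. Qed.
Lemma E_sym : symmetric E. Proof. exact: joinG_sym. Qed.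
Lemma eS_bip a x y : eS a x y -> c x != c y.
Proof. by move=> h; apply: bip; case: a h => /= ->; rewrite ?orbT. Qed.

Lemma pthE a x s y : pth (eS a) x s y -> pth E (a, x) (map (pair a) s) (a, y).
Proof. by apply: pth_map => u v; rewrite /E joinG_same. Qed.
Lemma crossE a x : ~~ X x -> E (a, x) (~~ a, x).
Proof. exact: joinG_cross. Qed.
Lemma crossE' a x : ~~ X x -> E (~~ a, x) (a, x).
Proof. by move=> h; rewrite E_sym; exact: joinG_cross. Qed.

Let cE (u : bool * T) := u.1 (+) c u.2.
(** The first bound guarantees a cut in the longer of two linked paths, which has at least half of
    all vertices. The second leaves an unmarked vertex of a given colour after two more vertices are
    excluded. *)
Hypothesis hK : forall b, #|X|.*2.+1 < #|[pred x | c x == b]| /\ #|X| + 2 < #|[pred x | c x == b]|.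
Hypothesis st : forall a, strong c (eS a).

Lemma big_T : #|X|.*2.+2 < #|T|.
Proof.
have [h1 _] := hK true; have [h2 _] := hK false.
by rewrite -(card_color c); lia.
Qed.

(** The cases are the distributions of [z], [p], [q] over the copies. If all lie together ([main])
    or just one of [p], [q] is apart ([two]), the second copy is inserted or appended. If [z] is
    alone ([three]), two disjoint paths from [p] and [q] to crossing vertices are connected in the
    other copy by a path missing [z]. *)
Lemma join_skip z p q : cE p = cE q -> cE z != cE p -> p != q -> skip E z p q.
Proof.
have sk a := let: And3 _ h _ := st a in h.
have lk a := let: And3 _ _ h := st a in h.
have lc a := let: And3 h _ _ := st a in h.
have main a zz x y : c x = c y -> c zz != c x -> x != y -> skip E (a, zz) (a, x) (a, y).
  move=> cxy czx xy; have [s ps cs] := sk a _ _ _ cxy czx xy.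
  have szs : size s = #|T|.-1.
    have := @span_size T (zz :: s); rewrite /= => <- // t /=; rewrite cs eq_sym; by case: eqP.
  have ctX : count X s <= #|X|.
    have := @span_count T (zz :: s) X; rewrite /= => <-; first by lia.
    by move=> t /=; rewrite cs eq_sym; case: eqP.
  have [|t1 [t2 [g [h [eqs p1 p2 gh /andP[Xg Xh]]]]]] := pth_cut (X := X) ps.
    have bT : (count X s).*2.+2 < #|T| by apply: leq_ltn_trans big_T; rewrite !ltnS leq_double.
    by rewrite szs -ltnS prednK // (leq_ltn_trans _ bT).
  have [r pr cr] := lc (~~ a) _ _ (eS_bip gh).
  exists (map (pair a) t1 ++ map (pair (~~ a)) r ++ map (pair a) t2).
    apply: pth_cat (pthE p1) (pth_cat (pthE pr) (pthE p2) _) _; last exact: crossE.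
    exact: crossE'.
  move=> [d t]; move: (cs t) (cr t); rewrite eqs !count_cat !count_pair xpair_eqE.
  by case: (_ == zz); case: (a); case: d => /=; clear; lia.
have two a zz x y : c x != c y -> c zz != c x -> skip E (a, zz) (a, x) (~~ a, y).
  move=> cxy czx; have [|t [ct Xt]] := pick_free (c := c) (b := c x) (X := X) (L := [:: x]).
    by have [_] := hK (c x); rewrite /=; lia.
  rewrite inE eq_sym => xt.
  have [s ps cs] := sk a _ _ _ (esym ct) czx xt.
  have [r pr cr] := lc (~~ a) t y (ltac:(by rewrite ct)).
  exists (map (pair a) s ++ map (pair (~~ a)) r).
    by apply: pth_cat (pthE ps) (pthE pr) _; exact: crossE.
  move=> [d u]; move: (cs u) (cr u); rewrite !count_cat !count_pair xpair_eqE.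
  by case: (_ == zz); case: (a); case: d => /=; clear; lia.
have three a zz x y : c x = c y -> c zz = c x -> x != y -> skip E (~~ a, zz) (a, x) (a, y).
  move=> cxy czx xy.
  have [|t [ct Xt _]] := pick_free (c := c) (b := ~~ c x) (X := X) (L := [::]).
    by have [_] := hK (~~ c x); rewrite /=; lia.
  have [|u [cu Xu]] := pick_free (c := c) (b := ~~ c x) (X := X) (L := [:: t]).
    by have [_] := hK (~~ c x); rewrite /=; lia.
  rewrite inE => ut.
  have [||||||r1 [r2 [pr1 pr2 cr]]] := lk a x t u y.
  - by rewrite ct; case: (c x).
  - by rewrite cu -cxy; case: (c x).
  - by apply: (@col_neq _ c); rewrite cu negbK.
  - exact: xy.
  - by rewrite eq_sym.
  - by apply: (@col_neq _ c); rewrite ct cxy.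
  have [|||s ps cs] := sk (~~ a) zz t u; rewrite ?ct ?cu ?czx //; first by case: (c x).
    by rewrite eq_sym.
  exists (map (pair a) r1 ++ map (pair (~~ a)) s ++ map (pair a) r2).
    apply: pth_cat (pthE pr1) (pth_cat (pthE ps) (pthE pr2) _) _; last exact: crossE.
    exact: crossE'.
  move=> [d v]; move: (cs v) (cr v); rewrite !count_cat !count_pair xpair_eqE.
  by case: (_ == zz); case: (a); case: d => /=; clear; lia.
case: z p q => [az z] [ap p] [aq q]; rewrite /cE /= xpair_eqE.
have [Ep|Ep] := altP (ap =P az); have [Eq|Eq] := altP (aq =P az).
- subst ap aq; rewrite eqxx /= => h1 h2 h3; apply: main => //; first exact: (addbI h1).
  by move: h2; case: (az) => //=; rewrite (inj_eq negb_inj).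
- have -> : aq = ~~ az by case: (aq) (az) Eq => -[].
  subst ap => h1 h2 _; apply: two; move: h1 h2; by case: (az); case: (c p); case: (c q); case: (c z).
- have -> : ap = ~~ az by case: (ap) (az) Ep => -[].
  subst aq => h1 h2 _; apply: skip_rev; first exact: E_sym.
  by apply: two; move: h1 h2; case: (az); case: (c p); case: (c q); case: (c z).
- have -> : ap = ~~ az by case: (ap) (az) Ep => -[].
  have -> : aq = ~~ az by case: (aq) (az) Eq => -[].
  rewrite eqxx /= => h1 h2 h3.
  have -> : (az, z) = (~~ ~~ az, z) by rewrite negbK.
  by apply: three => //; move: h1 h2; case: (az); case: (c p); case: (c q); case: (c z).
Qed.

Ltac bsolve :=
  repeat match goal with |- context [c ?x] => case: (c x) end;
  repeat match goal with |- context [?b (+) _] => is_var b; case: (b) end; by [].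

(** The four ends may lie in one copy ([aa]), pairwise in different copies ([ab]), with one pair
    split ([sp]) or with both pairs split ([ss]). A split pair is connected through an unmarked
    crossing vertex, chosen away from the other ends. *)
Lemma join_link x1 y1 x2 y2 : cE x1 != cE y1 -> cE x2 != cE y2 ->
  x1 != x2 -> x1 != y2 -> y1 != x2 -> y1 != y2 -> link E x1 y1 x2 y2.
Proof.
have lk a := let: And3 _ _ h := st a in h.
have lc a := let: And3 h _ _ := st a in h.
have aa a u1 v1 u2 v2 : c u1 != c v1 -> c u2 != c v2 -> u1 != u2 -> u1 != v2 ->
    v1 != u2 -> v1 != v2 -> link E (a, u1) (a, v1) (a, u2) (a, v2).
  move=> c1 c2 d1 d2 d3 d4; have [r1 [r2 [p1 p2 cr]]] := lk a _ _ _ _ c1 c2 d1 d2 d3 d4.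
  have szs : size r1 + size r2 = #|T|.
    rewrite -size_cat; apply: span_size => t; by rewrite count_cat.
  have ctX : count X r1 + count X r2 = #|X|.
    rewrite -count_cat; apply: span_count => t; by rewrite count_cat.
  wlog big : u1 v1 u2 v2 r1 r2 c1 c2 d1 d2 d3 d4 p1 p2 cr szs ctX / size r2 <= size r1.
    move=> wl; case: (leqP (size r2) (size r1)) => h; first exact: (wl u1 v1 u2 v2 r1 r2).
    apply: linkC; apply: (wl u2 v2 u1 v1 r2 r1) => //; try by rewrite eq_sym.
    - by move=> t; rewrite addnC.
    - by rewrite addnC.
    - by rewrite addnC.
    - exact: ltnW.
  have [|t1 [t2 [g [h [eqs q1 q2 gh /andP[Xg Xh]]]]]] := pth_cut (X := X) p1.
    have [h1 _] := hK true; have [h2 _] := hK false.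
    have cX : count X r1 <= #|X| by rewrite -ctX leq_addr.
    apply: (@leq_ltn_trans (#|X|).*2.+1); first by rewrite ltnS leq_double.
    have := card_color c; rewrite -szs; move: h1 h2 big; clear; lia.
  have [r pr cr'] := lc (~~ a) _ _ (eS_bip gh).
  exists (map (pair a) t1 ++ map (pair (~~ a)) r ++ map (pair a) t2), (map (pair a) r2); split.
  - apply: pth_cat (pthE q1) (pth_cat (pthE pr) (pthE q2) _) _; last exact: crossE.
    exact: crossE'.
  - exact: pthE.
  move=> [d t]; move: (cr t) (cr' t); rewrite eqs !count_cat !count_pair.
  by case: (a); case: d => /=; clear; lia.
have ab a u1 v1 u2 v2 : c u1 != c v1 -> c u2 != c v2 -> link E (a, u1) (a, v1) (~~ a, u2) (~~ a, v2).
  move=> /(lc a) [r1 p1 k1] /(lc (~~ a)) [r2 p2 k2].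
  exists (map (pair a) r1), (map (pair (~~ a)) r2); split; try exact: pthE.
  by move=> [d t]; move: (k1 t) (k2 t); rewrite !count_pair; case: (a); case: d => /=; clear; lia.
have sp a u1 v1 u2 v2 : c u1 != c v1 -> c u2 = c v2 -> u1 != u2 -> v1 != u2 ->
    link E (a, u1) (a, v1) (a, u2) (~~ a, v2).
  move=> c1 c2 d1 d3.
  (* [w] is the end of the first pair that has the colour of the crossing vertex [t]. The other end
     differs from [t] by colour. *)
  pose w := if c u1 == c u2 then v1 else u1.
  have cw : c w = ~~ c u2 by rewrite /w; case: eqP => h; move: c1 h; case: (c u1); case: (c v1); case: (c u2).
  have [|t [ct Xt tw]] := pick_free (c := c) (b := ~~ c u2) (X := X) (L := [:: w]).
    by have [_] := hK (~~ c u2); rewrite /=; lia.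
  have [t1 t2] : u1 != t /\ v1 != t.
    move: tw; rewrite inE eq_sym /w; case: (c u1 =P c u2) => cc tw; split=> //; apply: (@col_neq _ c); rewrite ct ?negbK //.
    by move: c1 cc; case: (c u1); case: (c v1); case: (c u2).
  have [||||||r1 [r2 [p1 p2 cr]]] := lk a u1 v1 u2 t => //; first by rewrite ct; case: (c u2).
  have [|s ps cs] := lc (~~ a) t v2; first by rewrite ct c2; case: (c v2).
  exists (map (pair a) r1), (map (pair a) r2 ++ map (pair (~~ a)) s); split; first exact: pthE.
    by apply: pth_cat (pthE p2) (pthE ps) _; exact: crossE.
  move=> [d u]; move: (cr u) (cs u); rewrite !count_cat !count_pair.
  by case: (a); case: d => /=; clear; lia.
have ss a u1 v1 u2 v2 : c u1 = c v1 -> c u2 = c v2 -> u1 != u2 -> v1 != v2 ->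
    link E (a, u1) (~~ a, v1) (a, u2) (~~ a, v2).
  move=> c1 c2 d1 d2.
  pose L1 := if c u1 == c u2 then [::] else [:: u2; v2].
  have [|t1 [ct1 Xt1 t1L]] := pick_free (c := c) (b := ~~ c u1) (X := X) (L := L1).
    by have [_] := hK (~~ c u1); rewrite /L1; case: ifP => _ /=; clear; lia.
  pose L2 := if c u1 == c u2 then [:: t1] else [:: u1; v1].
  have [|t2 [ct2 Xt2 t2L]] := pick_free (c := c) (b := ~~ c u2) (X := X) (L := L2).
    by have [_] := hK (~~ c u2); rewrite /L2; case: ifP => _ /=; clear; lia.
  have [n1 n2 n3 n4 n5] : [/\ u1 != t2, t1 != u2, t1 != t2, t1 != v2 & v1 != t2].
    move: t1L t2L; rewrite /L1 /L2; case: eqP => cc.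
      rewrite inE => _; rewrite eq_sym => tt; split=> //.
      - by apply: (@col_neq _ c); rewrite ct2 cc negbK.
      - by apply: (@col_neq _ c); rewrite ct1 cc.
      - by apply: (@col_neq _ c); rewrite ct1 cc c2.
      - by apply: (@col_neq _ c); rewrite ct2 -cc c1 negbK.
    rewrite !inE !negb_or => /andP[-> ->] /andP[h1 h2]; rewrite (eq_sym u1) (eq_sym v1) h1 h2; split=> //.
    by apply/eqP => tt; apply: cc; apply: negb_inj; rewrite -ct1 -ct2 tt.
  have [||||||r1 [r2 [p1 p2 cr]]] := lk a u1 t1 u2 t2 => //; rewrite ?ct1 ?ct2; try by case: (c _).
  have [||||||q1 [q2 [p3 p4 cq]]] := lk (~~ a) t1 v1 t2 v2 => //; rewrite ?ct1 ?ct2 -?c1 -?c2; try by case: (c _).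
  exists (map (pair a) r1 ++ map (pair (~~ a)) q1), (map (pair a) r2 ++ map (pair (~~ a)) q2); split.
  - by apply: pth_cat (pthE p1) (pthE p3) _; exact: crossE.
  - by apply: pth_cat (pthE p2) (pthE p4) _; exact: crossE.
  move=> [d u]; move: (cr u) (cq u); rewrite !count_cat !count_pair.
  by case: (a); case: d => /=; clear; lia.
have neg (a b : bool) : a != b -> b = ~~ a by case: a b => -[].
case: x1 y1 x2 y2 => [a1 x1] [b1 y1] [a2 x2] [b2 y2]; rewrite /cE /= !xpair_eqE.
have [E1|/neg E1] := altP (a1 =P b1); have [E2|/neg E2] := altP (a2 =P b2);
  have [E3|/neg E3] := altP (a1 =P a2); subst; rewrite ?negbK ?eqxx ?andTb => h1 h2 h3 h4 h5 h6.
- by apply: aa => //; move: h1 h2; bsolve.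
- by apply: ab => //; move: h1 h2; bsolve.
- by apply: sp => //; move: h1 h2; bsolve.
- apply: linkC; apply: link_rev; first exact: E_sym.
  apply: linkC; apply: sp => //; move: h1 h2; bsolve => //.
- apply: linkC; apply: sp; rewrite 1?eq_sym //; move: h1 h2; bsolve => //.
- apply: link_rev; first exact: E_sym.
  apply: linkC; have := sp (~~ a1) x2 y2 y1 x1; rewrite negbK; apply; rewrite 1?eq_sym //; move: h1 h2; bsolve => //.
- apply: ss => //; move: h1 h2; bsolve => //.
- apply: linkC; apply: link_rev; first exact: E_sym.
  apply: linkC; apply: ss => //; move: h1 h2; bsolve => //.
Qed.

Lemma join_strong : strong cE E.
Proof.
split; [|exact: join_skip|exact: join_link].
by apply: joinG_laceable => //; [case: (st false)|case: (st true)|have := big_T; lia|move=> b; have [] := hK b; lia].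
Qed.
End JoinStrong.

(** * Adding one edge to a graph *)

Section Restore.
Variables (T : finType) (e : rel T) (u v : T).

Definition restore : rel T :=
  fun a b => [|| e a b, (a == u) && (b == v) | (a == v) && (b == u)].

Lemma restore_path z q : (u \notin z :: q) || (v \notin z :: q) -> path restore z q -> path e z q.
Proof.
elim: q z => //= t q IH z h /andP[zt pq].
apply/andP; split; last by apply: IH pq; move: h; rewrite !inE !negb_or; case/orP => /andP[_ ->]; rewrite ?orbT.
case/or3P: zt => // /andP[/eqP ez /eqP et]; subst; move: h; rewrite !inE !eqxx ?orbT //=.
Qed.

(** A simple path traverses the added edge at most once, and the pieces before and after it are
    paths of [e]. *)
Lemma restore_use x s y : pth restore x s y -> uniq s ->
  pth e x s y \/ exists s1 s2 a b, [/\ s = s1 ++ s2, pth e x s1 a, pth e b s2 y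
    & (a = u /\ b = v) \/ (a = v /\ b = u)].
Proof.
case=> p ->; elim: p x => [|z p IH] x /= [].
  by move=> _ <- _; left; exists [::].
move=> /andP[xz pz] lp /andP[xn un].
have [exz|nxz] := boolP (e x z).
  case: (IH z (conj pz lp) un) => [h|[s1 [s2 [a [b [-> h1 h2 h3]]]]]].
    by left; apply: pth_cons h.
  by right; exists (x :: s1), s2, a, b; split=> //; apply: pth_cons h1.
right; exists [:: x], (z :: p), x, z; split=> //; first by exists [::].
  exists p => //; split=> //; apply: restore_path pz.
  move: xz; rewrite /restore (negPf nxz) /= => /orP[] /andP[/eqP ex /eqP ez]; subst; by rewrite xn ?orbT.
move: xz; rewrite /restore (negPf nxz) /= => /orP[] /andP[/eqP ex /eqP ez]; by [left|right].
Qed.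
End Restore.

Lemma restoreC (T : finType) (e : rel T) u v a b : restore e u v a b = restore e v u a b.
Proof. by rewrite /restore; congr (_ || _); rewrite orbC. Qed.

Lemma pth_head (T : eqType) (e : rel T) x s y : pth e x s y -> x \in s /\ y \in s.
Proof. by case=> p -> [_ <-]; rewrite mem_head mem_last. Qed.

Lemma pth_loop (T : eqType) (e : rel T) x s : pth e x s x -> uniq s -> s = [:: x].
Proof. by case=> -[|z p] -> //= [_ lp]; rewrite -{1}lp mem_last. Qed.

Lemma span_uniq (T : finType) (s : seq T) : (forall z, count_mem z s = 1) -> uniq s.
Proof. by move/span_perm/perm_uniq->; exact: enum_uniq. Qed.

Lemma span_mem (T : finType) (s : seq T) z : (forall z, count_mem z s = 1) -> z \in s.
Proof. by move=> h; rewrite -has_pred1 has_count h. Qed.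

Lemma pth_split (T : eqType) (e : rel T) x s y z : pth e x s y -> z \in s -> z != y ->
  exists l1 w l2, [/\ s = l1 ++ l2, pth e x l1 z, pth e w l2 y & e z w].
Proof.
case=> p -> [pp lp]; rewrite inE => /orP[/eqP->|zp] zy.
  case: p pp lp => [|w p] /= pp lp; first by rewrite lp eqxx in zy.
  exists [:: x], w, (w :: p); split=> //; [by exists [::]|exists p|]; case/andP: pp => //.
case/splitPr: zp pp lp => p1 p2; rewrite cat_path last_cat /= => /and3P[h1 h2 h3] lp.
case: p2 h3 lp => [|w p2] /= h3 lp; first by rewrite lp eqxx in zy.
case/andP: h3 => h3 h4; exists (x :: rcons p1 z), w, (w :: p2); split=> //.
- by rewrite -cats1 /= -catA.
- by exists (rcons p1 z) => //; rewrite rcons_path h1 h2 last_rcons.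
- by exists p2.
Qed.

Lemma pth_last (T : eqType) (e : rel T) x s z : pth e x s z -> z != x ->
  exists l w, [/\ s = rcons l z, pth e x l w & e w z].
Proof.
case=> p -> [pp lp] zx; case/lastP: p pp lp => [|p t]; first by move=> _ /= xz; rewrite xz eqxx in zx.
rewrite rcons_path last_rcons => /andP[h1 h2] ez; subst t.
by exists (x :: p), (last x p); split=> //; exists p.
Qed.

(** * Repairing a path that uses one restored edge *)

Section Single.
Variables (T : finType) (c : T -> bool) (e0 e1 : rel T) (X : pred T) (u v : T).
Hypotheses (s0 : symmetric e0) (s1 : symmetric e1).
Hypothesis bip : forall x y, e0 x y || e1 x y -> c x != c y.
Hypothesis cuv : c v = ~~ c u.
Hypotheses (Xu : ~~ X u) (Xv : ~~ X v).
Hypothesis hK : forall b, #|X|.*2.+3 < #|[pred x | c x == b]|.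
Hypothesis lh : laceable c (restore e0 u v).
Hypothesis st : strong c e1.
Let E := joinG e0 e1 X.

Let E_sy : symmetric E. Proof. exact: E_sym. Qed.
Let pE0 x s y : pth e0 x s y -> pth E (false, x) (map (pair false) s) (false, y).
Proof. exact: (@pthE T e0 e1 X false). Qed.
Let pE1 x s y : pth e1 x s y -> pth E (true, x) (map (pair true) s) (true, y).
Proof. exact: (@pthE T e0 e1 X true). Qed.
Let cr01 x : ~~ X x -> E (false, x) (true, x). Proof. exact: (@crossE T e0 e1 X false). Qed.
Let cr10 x : ~~ X x -> E (true, x) (false, x). Proof. exact: (@crossE T e0 e1 X true). Qed.
Let lc1 : laceable c e1. Proof. by case: st. Qed.
Let sk1 : forall z p q, c p = c q -> c z != c p -> p != q -> skip e1 z p q. Proof. by case: st. Qed.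
Let lk1 : forall x1 y1 x2 y2, c x1 != c y1 -> c x2 != c y2 ->
      x1 != x2 -> x1 != y2 -> y1 != x2 -> y1 != y2 -> link e1 x1 y1 x2 y2. Proof. by case: st. Qed.
Let bigT : #|X|.*2.+4 < #|T|.
Proof. by have := hK true; have := hK false; rewrite -(card_color c); clear; lia. Qed.
Let neqb (a b : bool) : (a != b) = (b == ~~ a). Proof. by case: a b => -[]. Qed.

(** If the spanning path of copy 0 uses the restored edge, that edge is replaced by a spanning path
    of copy 1 between the partners of [u] and [v]. Otherwise the path is cut elsewhere, as for
    laceability. *)
Lemma single00 x y : c x != c y -> ham E (false, x) (false, y).
Proof.
move=> xy; have [s ps cs] := lh xy.
case: (restore_use ps (span_uniq cs)) => [qs|[t1 [t2 [a [b [eqs p1 p2 ab]]]]]].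
  have [|t1 [t2 [g [h [eqs p1 p2 gh /andP[Xg Xh]]]]]] := pth_cut (X := X) qs.
    by rewrite span_count // span_size //; move: bigT; clear; lia.
  have [r pr cr] := lc1 (bip (x := g) (y := h) (ltac:(by rewrite gh))).
  exists (map (pair false) t1 ++ map (pair true) r ++ map (pair false) t2).
    by apply: pth_cat (pE0 p1) (pth_cat (pE1 pr) (pE0 p2) _) _; [exact: cr10|exact: cr01].
  move=> [d t]; move: (cs t) (cr t); rewrite eqs !count_cat !count_pair.
  by case: d => /=; clear; lia.
have cab : c a != c b /\ (~~ X a /\ ~~ X b).
  by case: ab => -[-> ->]; rewrite cuv neqb ?negbK eqxx.
have [r pr cr] := lc1 cab.1.
exists (map (pair false) t1 ++ map (pair true) r ++ map (pair false) t2).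
  by case: cab => _ [? ?]; apply: pth_cat (pE0 p1) (pth_cat (pE1 pr) (pE0 p2) _) _; [exact: cr10|exact: cr01].
move=> [d t]; move: (cs t) (cr t); rewrite eqs !count_cat !count_pair.
by case: d => /=; clear; lia.
Qed.

(* A detour through u --> b or a reinsertion of v is available. *)
Definition exit_ok := (exists b, [/\ e0 u b, ~~ X b & b != v]) \/
  (exists b1 b2, [/\ b1 != b2, b1 != u, b2 != u, e0 v b1 & e0 v b2] /\
    forall b, b \in [:: b1; b2] -> forall a w, a != w -> e0 b a -> e0 b w -> ~~ (X a && X w)).

(** For [y] different from [u] the path crosses at some [t]. If the path to [t] uses the restored
    edge, two disjoint paths of copy 1 serve: one replaces that edge, the other leads from [t] to
    [y]. For [y = u] these two paths would share an end, which is why an exit is required. *)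
Lemma single01 x y : c x = c u -> c x = c y -> (y = u -> exit_ok) -> ham E (false, x) (true, y).
Proof.
move=> xu xy hy.
have main t r1 r2 : c t = ~~ c x -> ~~ X t -> pth e0 x r1 t -> 
   pth e1 t r2 y -> (forall z, count_mem z r1 = 1) -> (forall z, count_mem z r2 = 1) -> ham E (false, x) (true, y).
  move=> ct Xt p1 p2 k1 k2; exists (map (pair false) r1 ++ map (pair true) r2).
    by apply: pth_cat (pE0 p1) (pE1 p2) _; exact: cr01.
  move=> [d z]; move: (k1 z) (k2 z); rewrite !count_cat !count_pair.
  by case: d => /=; clear; lia.
have [yu|yu] := eqVneq y u; last first.
  have [|t [ct Xt]] := pick_free (c := c) (b := ~~ c x) (X := X) (L := [:: v]).
    by have := hK (~~ c x); rewrite /=; clear; lia.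
  rewrite inE => tv.
  have cxt : c x != c t by rewrite neqb ct.
  have cty : c t != c y by rewrite neqb ct -xy negbK.
  have [s ps cs] := lh cxt.
  case: (restore_use ps (span_uniq cs)) => [qs|[t1 [t2 [a [b [eqs p1 p2 ab]]]]]].
    have [r pr cr] := lc1 cty; exact: (main t s r).
  have ut : u != t by apply: (@col_neq _ c); rewrite ct xu negbK.
  have vy : v != y by apply: (@col_neq _ c); rewrite cuv -xy xu.
  have [r1 [r2 [q1 q2 k]]] : link e1 a b t y.
    by case: ab => -[-> ->]; apply: lk1; rewrite // ?cuv ?neqb ?negbK // eq_sym.
  have [Xa Xb] : ~~ X a /\ ~~ X b by case: ab => -[-> ->].
  exists (map (pair false) t1 ++ map (pair true) r1 ++ map (pair false) t2 ++ map (pair true) r2).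
    apply: pth_cat (pE0 p1) (pth_cat (pE1 q1) (pth_cat (pE0 p2) (pE1 q2) _) _) _; by [exact: cr01|exact: cr10].
  move=> [d z]; move: (cs z) (k z); rewrite eqs !count_cat !count_pair.
  by case: d => /=; clear; lia.
subst y; case: (hy erefl) => [[b [eub Xb bv]]|[b1 [b2 [[b12 b1u b2u v1 v2] hb]]]].
  have cb : c b = ~~ c u by apply/eqP; rewrite -neqb; apply: bip; rewrite eub.
  have [s ps cs] := lh (x := x) (y := b) (ltac:(by rewrite neqb cb xu)).
  case: (restore_use ps (span_uniq cs)) => [qs|[t1 [t2 [a [d [eqs p1 p2 ab]]]]]].
    have [r pr cr] := lc1 (x := b) (y := u) (ltac:(by rewrite neqb cb negbK)).
    by apply: (main b s r) => //; rewrite cb xu.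
  (* If [u] comes before [v], the tail from [v] to [b] is attached backwards to [u] by the healthy
     edge [u b], and the path leaves copy 0 at [v]. If [v] comes first, copy 1 is traversed from [v]
     to [b] without [u], the tail is run backwards from [b] to [u], and the last step crosses to the
     partner of [u]. *)
  case: ab => -[ea ed]; subst a d.
    have [r pr cr] := lc1 (x := v) (y := u) (ltac:(by rewrite neqb cuv negbK)).
    apply: (main v (t1 ++ rev t2) r) => //; first by rewrite cuv xu.
      by apply: pth_cat p1 (pth_rev s0 p2) eub.
    by move=> z; rewrite count_cat count_rev -count_cat -eqs.
  have [r pr cr] : skip e1 u v b by apply: sk1; rewrite ?cb ?cuv ?neqb ?negbK // eq_sym.
  exists (map (pair false) t1 ++ map (pair true) r ++ map (pair false) (rev t2) ++ map (pair true) [:: u]).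
    apply: pth_cat (pE0 p1) (pth_cat (pE1 pr) (pth_cat (pE0 (pth_rev s0 p2)) (pE1 (x := u) (y := u) _) _) _) _;
      by [exact: cr01|exact: cr10|exists [::]].
  move=> [d z]; move: (cs z) (cr z); rewrite eqs !count_cat !count_pair count_rev /= (eq_sym u).
  by case: (z == u); case: d => /=; clear; lia.
(* If the spanning path from [x] to [v] uses the restored edge, it ends with it, and [v] has to be
   reinserted next to its neighbour [b]. As [b] is neither [x] nor [u], it has a predecessor [a] and
   a successor [w] on the path. One of them is unmarked, and the detour through copy 1 joins it to
   [v]. *)
have [b [bx bu evb hb']] : exists b, [/\ b != x, b != u, e0 v b & forall a w, a != w -> e0 b a -> e0 b w -> ~~ (X a && X w)].
  have [E1|] := eqVneq b1 x; last by exists b1; split=> //; apply: hb; rewrite inE eqxx.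
  by exists b2; split=> //; [rewrite -E1 eq_sym | apply: hb; rewrite !inE eqxx orbT].
have cb : c b = c u.
  by have := @bip v b; rewrite evb => /(_ isT); rewrite neqb cuv negbK => /eqP.
have [s ps cs] := lh (x := x) (y := v) (ltac:(by rewrite neqb cuv xu)).
case: (restore_use ps (span_uniq cs)) => [qs|[t1 [t2 [a [d [eqs p1 p2 ab]]]]]].
  have [r pr cr] := lc1 (x := v) (y := u) (ltac:(by rewrite neqb cuv negbK)).
  by apply: (main v s r) => //; rewrite cuv xu.
have us : uniq (t1 ++ t2) by rewrite -eqs; exact: span_uniq cs.
case: ab => -[ea ed]; subst a d; last first.
  have [_ h1] := pth_head p1; have [_ h2] := pth_head p2.
  move: us; rewrite cat_uniq => /and3P[_ /hasPn/(_ _ h2)]; by rewrite /= h1.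
have et2 : t2 = [:: v] by apply: pth_loop p2 _; move: us; rewrite cat_uniq => /and3P[].
subst t2; have bt1 : b \in t1.
  have := span_mem b cs; rewrite eqs mem_cat inE => /orP[//|/eqP bv].
  by move: cb; rewrite bv cuv; case: (c u).
have [l1 [w [l2 [eql q1 q2 bw]]]] := pth_split p1 bt1 bu.
have [l [a [eql1 q3 ab]]] := pth_last q1 bx.
have vt1 : v \notin t1 by move: us; rewrite cats1 rcons_uniq => /andP[].
have [wt1 at1] : w \in t1 /\ a \in t1.
  have [h1 _] := pth_head q2; have [_ h2] := pth_head q3.
  by rewrite eql eql1 !mem_cat !mem_rcons !inE h1 h2 !orbT.
have aw : a != w.
  have [h1 _] := pth_head q2; have [_ h2] := pth_head q3; apply/eqP => aw.
  move: us; rewrite eql eql1 cat_uniq => /andP[]; rewrite cat_uniq => /and3P[_ /hasPn/(_ _ h1)].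
  by rewrite /= mem_rcons inE -aw h2 orbT.
have cw : c w = c v by have := @bip b w; rewrite bw => /(_ isT); rewrite neqb cb -cuv => /eqP.
have ca : c a = c v by have := @bip b a; rewrite s0 ab => /(_ isT); rewrite neqb cb -cuv => /eqP.
have vw : v != w by apply: contraNneq vt1 => ->.
have va : a != v by apply: contraNneq vt1 => <-.
have ucv : c u != c v by rewrite neqb cuv.
have pu : pth e1 u [:: u] u by exists [::].
have pv : pth e0 v [:: v] v by exists [::].
have [Xw|/negPn Xw] := boolP (~~ X w).
  have [r pr cr] : skip e1 u v w by apply: sk1; rewrite ?cw.
  exists (map (pair false) l1 ++ map (pair false) [:: v] ++ map (pair true) r ++ map (pair false) l2 ++ map (pair true) [:: u]).
    apply: pth_cat (pE0 q1) (pth_cat (pE0 pv) (pth_cat (pE1 pr) (pth_cat (pE0 q2) (pE1 pu) _) _) _) _;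
      try by [exact: cr01|exact: cr10].
    by rewrite /E joinG_same s0.
  move=> [d z]; move: (cs z) (cr z); rewrite eqs eql !count_cat !count_pair /= (eq_sym u).
  by case: (z == u); case: d => /=; clear; lia.
have Xa : ~~ X a by move: (hb' a w aw); rewrite s0 ab bw Xw andbT; apply.
have [r pr cr] : skip e1 u a v by apply: sk1; rewrite ?ca.
have pb2 : pth e0 b (b :: l2) u by apply: pth_cons bw q2.
exists (map (pair false) l ++ map (pair true) r ++ map (pair false) [:: v] ++ map (pair false) (b :: l2) ++ map (pair true) [:: u]).
  apply: pth_cat (pE0 q3) (pth_cat (pE1 pr) (pth_cat (pE0 pv) (pth_cat (pE0 pb2) (pE1 pu) _) _) _) _;
    try by [exact: cr01|exact: cr10].
  by rewrite /E joinG_same.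
move=> [d z]; move: (cs z) (cr z); rewrite eqs eql eql1 -cats1 !count_cat !count_pair /= (eq_sym u).
by case: (z == u); case: d => /=; clear; lia.
Qed.

(** A simple path from [u] to [v] that uses the edge [u v] consists of that edge alone, so a
    spanning path in the restored graph does not use it. *)
Lemma single_spine : exists2 s, pth e0 u s v & forall z, count_mem z s = 1.
Proof.
have [s ps cs] := lh (x := u) (y := v) (ltac:(by rewrite neqb cuv)).
have us := span_uniq cs; have ss := span_size cs.
case: (restore_use ps us) => [qs|[t1 [t2 [a [b [eqs p1 p2 ab]]]]]]; first by exists s.
move: us; rewrite eqs cat_uniq => /and3P[u1 /hasPn h u2].
case: ab => -[ea eb]; subst a b.
  have e1' := pth_loop p1 u1; have e2' := pth_loop p2 u2.
  by move: ss bigT; rewrite eqs e1' e2' /= => <-.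
have [_ h1] := pth_head p1; have [_ h2] := pth_head p2.
by have := h _ h2; rewrite /= h1.
Qed.

(** The spine of copy 0 is entered and left at [u] and [v]. If one of these is an end, [skip] covers
    the rest of copy 1. Otherwise two disjoint paths of copy 1 lead to and from the spine. Colours
    decide in which sense the spine is run. *)
Lemma single11 x y : c x != c y -> ~~ ((x == u) && (y == v)) -> ~~ ((x == v) && (y == u)) ->
  ham E (true, x) (true, y).
Proof.
have [s ps cs] := single_spine; have rs := pth_rev s0 ps.
have crs z : count_mem z (rev s) = 1 by rewrite count_rev.
have cvu : c u = ~~ c v by rewrite cuv negbK.
have sk u' v' x' y' t (cuv' : c v' = ~~ c u') : ~~ X u' -> ~~ X v' -> pth e0 u' t v' -> (forall z, count_mem z t = 1) ->
    x' = u' -> c x' != c y' -> y' != v' -> ham E (true, x') (true, y').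
  move=> Xu' Xv' pt ct -> xy yv.
  have [r pr cr] : skip e1 u' v' y'.
    by apply: sk1; [apply/esym/eqP; rewrite cuv' -neqb|rewrite neqb cuv'|rewrite eq_sym].
  have pu : pth e1 u' [:: u'] u' by exists [::].
  exists (map (pair true) [:: u'] ++ map (pair false) t ++ map (pair true) r).
    by apply: pth_cat (pE1 pu) (pth_cat (pE0 pt) (pE1 pr) _) _; [exact: cr01|exact: cr10].
  move=> [d z]; move: (ct z) (cr z); rewrite !count_cat !count_pair /= (eq_sym u').
  by case: (z == u'); case: d => /=; clear; lia.
have gen u' v' x' y' t (cuv' : c v' = ~~ c u') : ~~ X u' -> ~~ X v' -> pth e0 u' t v' -> (forall z, count_mem z t = 1) ->
    c x' != c y' -> c x' != c u' -> x' != v' -> y' != u' -> ham E (true, x') (true, y').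
  move=> Xu' Xv' pt ct xy xu xv yu.
  have cy : c y' = c u' by move: xy xu; case: (c x') (c y') (c u') => -[] [].
  have [r1 [r2 [p1 p2 cr]]] : link e1 x' u' v' y'.
    apply: lk1 => //; [by rewrite cuv' cy; case: (c u')| | |by rewrite eq_sym].
      by apply: contraNneq xy => ->.
    by apply: (@col_neq _ c); rewrite cuv' negbK.
  exists (map (pair true) r1 ++ map (pair false) t ++ map (pair true) r2).
    by apply: pth_cat (pE1 p1) (pth_cat (pE0 pt) (pE1 p2) _) _; [exact: cr01|exact: cr10].
  move=> [d z]; move: (ct z) (cr z); rewrite !count_cat !count_pair /=.
  by case: d => /=; clear; lia.
move=> xy n1 n2.
have [xu|xu] := eqVneq x u.
  by apply: (sk u v x y s) => //; move: n1; rewrite xu eqxx.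
have [xv|xv] := eqVneq x v.
  by apply: (sk v u x y (rev s)) => //; move: n2; rewrite xv eqxx.
have [yu|yu] := eqVneq y u.
  by apply: ham_rev => //; apply: (sk u v y x s) => //; rewrite eq_sym.
have [yv|yv] := eqVneq y v.
  by apply: ham_rev => //; apply: (sk v u y x (rev s)) => //; rewrite eq_sym.
have [h|h] := boolP (c x == c u); last by apply: (gen u v x y s).
by apply: (gen v u x y (rev s)) => //; rewrite cuv (eqP h); case: (c u).
Qed.

(* The special pair: x and y are the copies of the ends of the restored edge. *)
Lemma single11s : laceable c (fun a b => [&& e1 a b, ~~ ((a \in [:: u; v]) && X b) & ~~ ((b \in [:: u; v]) && X a)]) ->
  ham E (true, u) (true, v).
Proof.
move=> hs; have ucv : c u != c v by rewrite neqb cuv.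
have uv : u != v by apply: (@col_neq _ c); rewrite cuv negbK.
have [s [p -> [pp lp]] cs] := hs u v ucv.
have us : uniq (u :: p) := span_uniq cs.
have sz := span_size cs.
case: p pp lp us sz cs => [|r p]; first by move=> _ /= h; rewrite h eqxx in uv.
case/lastP: p => [|p t]; first by move=> _ _ _ h; move: bigT; rewrite -h.
move=> /=; rewrite rcons_path last_rcons => /andP[/and3P[ur Xr _] /andP[pr /and3P[tv _ Xt]]] et.
subst t; move=> us sz cs; set t := last r p in tv Xt.
have {}Xr : ~~ X r by move: Xr; rewrite inE eqxx.
have {}Xt : ~~ X t by move: Xt; rewrite !inE eqxx orbT.
have pr1 : pth e1 r (r :: p) t.
  by exists p => //; split=> //; apply: sub_path pr => a b /and3P[].
have cr : c r = c v by have := @bip u r; rewrite ur orbT => /(_ isT); rewrite neqb -cuv => /eqP.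
have ct : c t = c u by have := @bip v t; rewrite s1 tv orbT => /(_ isT); rewrite neqb cuv negbK => /eqP.
have crt : c r != c t by rewrite cr ct eq_sym.
have pu : pth e1 u [:: u] u by exists [::].
have pv : pth e1 v [:: v] v by exists [::].
have csz z : (z == u) + count_mem z (r :: p) + (z == v) = 1.
  move: (cs z); rewrite -cats1 /= count_cat /= (eq_sym u) (eq_sym v); clear; lia.
(* [r] and [t] are the second and the last but one vertex of the path of copy 1, and both cross
   safely. If the spanning path of copy 0 from [r] to [t] avoids the restored edge, it is put
   between two linked paths of copy 1. If not, its two parts lead from [u] and to [v], with the
   inner path between [r] and [t] of copy 1 traversed in between. *)
have [q pq cq] := lh crt.
case: (restore_use pq (span_uniq cq)) => [qs|[t1 [t2 [a [b [eqs p1 p2 ab]]]]]].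
  have ut : u != t.
    have [+ _] := andP us; rewrite -rcons_cons mem_rcons inE negb_or => /andP[_ h].
    by apply: contraNneq h => ->; exact: mem_last.
  have rv : r != v.
    have [_ /andP[+ _]] := andP us; rewrite mem_rcons inE negb_or => /andP[h _].
    exact: h.
  have [r1 [r2 [q1 q2 k]]] : link e1 u r t v.
    apply: lk1 => //; first by rewrite cr.
      by rewrite ct.
    by apply: contraTneq crt => ->; rewrite eqxx.
  exists (map (pair true) r1 ++ map (pair false) q ++ map (pair true) r2).
    by apply: pth_cat (pE1 q1) (pth_cat (pE0 qs) (pE1 q2) _) _; [exact: cr01|exact: cr10].
  move=> [d z]; move: (cq z) (k z); rewrite !count_cat !count_pair /=.
  by case: d => /=; clear; lia.
case: ab => -[ea eb]; subst a b.
  exists (map (pair true) [:: u] ++ map (pair false) (rev t1) ++ map (pair true) (r :: p) ++ map (pair false) (rev t2) ++ map (pair true) [:: v]).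
    apply: pth_cat (pE1 pu) (pth_cat (pE0 (pth_rev s0 p1)) (pth_cat (pE1 pr1) (pth_cat (pE0 (pth_rev s0 p2)) (pE1 pv) _) _) _) _;
      by [exact: cr01|exact: cr10].
  move=> [d z]; move: (cq z) (csz z); rewrite eqs !count_cat !count_pair !count_rev /= (eq_sym u) (eq_sym v).
  by case: (z == u); case: (z == v); case: d => /=; clear; lia.
exists (map (pair true) [:: u] ++ map (pair false) t2 ++ map (pair true) (rev (r :: p)) ++ map (pair false) t1 ++ map (pair true) [:: v]).
  apply: pth_cat (pE1 pu) (pth_cat (pE0 p2) (pth_cat (pE1 (pth_rev s1 pr1)) (pth_cat (pE0 p1) (pE1 pv) _) _) _) _;
    by [exact: cr01|exact: cr10].
move=> [d z]; move: (cq z) (csz z); rewrite eqs !count_cat !count_pair !count_rev /= (eq_sym u) (eq_sym v).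
by case: (z == u); case: (z == v); case: d => /=; clear; lia.
Qed.
End Single.

(** * The hypercube with faults recorded as endpoint and direction *)

Section Cube.
Variable n : nat.
Implicit Types (u v : vert n) (i : 'I_n).

Definition flip u i : vert n := [ffun j => (j == i) (+) u j].
Definition low u i : vert n := [ffun j => (j != i) && u j].
(* Faulty edges are recorded as pairs (endpoint with i-th coordinate 0, direction i). *)
Definition adjG (G : {set vert n * 'I_n}) : rel (vert n) :=
  fun u v => [exists i, (v == flip u i) && ((low u i, i) \notin G)].

Definition isf (G : {set vert n * 'I_n}) u i := (low u i, i) \in G.
Definition fd (G : {set vert n * 'I_n}) u := #|[set i | isf G u i]|.
(** Properness makes every element of [G] stand for an edge, and every faulty edge for one element,
    so that cardinalities count faulty edges. *)
Definition properG (G : {set vert n * 'I_n}) := forall f, f \in G -> ~~ f.1 f.2.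

Lemma flipE u i j : flip u i j = (j == i) (+) u j. Proof. by rewrite ffunE. Qed.
Lemma flipK u i : flip (flip u i) i = u.
Proof. by apply/ffunP => j; rewrite !flipE addKb. Qed.
Lemma low_flip u i : low (flip u i) i = low u i.
Proof. by apply/ffunP => j; rewrite !ffunE; case: eqP. Qed.

Lemma isf_flip G u i : isf G (flip u i) i = isf G u i. Proof. by rewrite /isf low_flip. Qed.
Lemma flip_inj u : injective (flip u).
Proof.
move=> i j /ffunP/(_ i); rewrite !flipE eqxx => /esym; case: eqP => // _.
by rewrite addFb addTb; case: (u i).
Qed.
Lemma adjG_flip G u i : adjG G u (flip u i) = ~~ isf G u i.
Proof.
apply/existsP/idP => [[j /andP[/eqP/flip_inj<-]]|h] //; by exists i; rewrite eqxx.
Qed.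
Lemma adjGP G u v : reflect (exists2 i, v = flip u i & ~~ isf G u i) (adjG G u v).
Proof.
apply: (iffP existsP) => [[i /andP[/eqP-> h]]|[i -> h]]; exists i => //.
by rewrite eqxx.
Qed.
Lemma adjGS (G H : {set vert n * 'I_n}) u v : H \subset G -> adjG G u v -> adjG H u v.
Proof.
by move=> HG /adjGP[i -> h]; rewrite adjG_flip; apply: contra h; exact: (subsetP HG).
Qed.
Lemma fdS (G H : {set vert n * 'I_n}) u : H \subset G -> fd H u <= fd G u.
Proof.
move=> HG; apply/subset_leq_card/subsetP => i; rewrite !inE; exact: (subsetP HG).
Qed.

Lemma adjG_sym G : symmetric (adjG G).
Proof.
move=> u v; apply/existsP/existsP => -[i /andP[/eqP-> h]]; exists i;
  by rewrite flipK eqxx low_flip.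
Qed.

Lemma parity_flip u i : parity (flip u i) = ~~ parity u.
Proof.
rewrite /parity (cardsD1 i [set _ | _]) (cardsD1 i [set j | u j]) !inE flipE eqxx /=.
have -> : [set j | flip u i j] :\ i = [set j | u j] :\ i.
  by apply/setP => j; rewrite !inE flipE; case: eqP.
by case: (u i) => /=; rewrite ?negbK.
Qed.

Lemma adjG_parity G u v : adjG G u v -> parity u != parity v.
Proof. by case/existsP => i /andP[/eqP-> _]; rewrite parity_flip; case: (parity u). Qed.
End Cube.

(** * Splitting the cube along a direction *)

Section Split.
Variables (n : nat) (d : 'I_n.+1).
Definition emb (p : bool * vert n) : vert n.+1 :=
  [ffun j => if unlift d j is Some k then p.2 k else p.1].
Definition proj (u : vert n.+1) : bool * vert n := (u d, [ffun k => u (lift d k)]).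

Lemma emb_d p : emb p d = p.1. Proof. by rewrite ffunE unlift_none. Qed.
Lemma emb_lift p k : emb p (lift d k) = p.2 k. Proof. by rewrite ffunE liftK. Qed.
Lemma embK : cancel emb proj.
Proof.
by case=> b v; rewrite /proj emb_d; congr pair; apply/ffunP => k; rewrite ffunE emb_lift.
Qed.
Lemma projK : cancel proj emb.
Proof.
move=> u; apply/ffunP => j; case: (unliftP d j) => [k|] ->; rewrite ?emb_d ?emb_lift ?ffunE //.
Qed.
Lemma emb_bij : bijective emb. Proof. exact: Bijective embK projK. Qed.

Lemma flip_emb_lift b v k : flip (emb (b, v)) (lift d k) = emb (b, flip v k).
Proof.
apply/ffunP => j; rewrite flipE; case: (unliftP d j) => [l|] ->; last first.
  by rewrite !emb_d; case: eqP => // /eqP; rewrite (negPf (neq_lift _ _)).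
by rewrite !emb_lift flipE (inj_eq lift_inj).
Qed.
Lemma flip_emb b v : flip (emb (b, v)) d = emb (~~ b, v).
Proof.
apply/ffunP => j; rewrite flipE; case: (unliftP d j) => [l|] ->.
  by rewrite !emb_lift eq_sym (negPf (neq_lift _ _)).
by rewrite !emb_d eqxx.
Qed.
Lemma low_emb_lift b v k : low (emb (b, v)) (lift d k) = emb (b, low v k).
Proof.
apply/ffunP => j; rewrite ffunE; case: (unliftP d j) => [l|] ->; last first.
  by rewrite !emb_d neq_lift.
by rewrite !emb_lift ffunE (inj_eq lift_inj).
Qed.
Lemma low_emb b v : low (emb (b, v)) d = emb (false, v).
Proof.
apply/ffunP => j; rewrite ffunE; case: (unliftP d j) => [l|] ->.
  by rewrite !emb_lift eq_sym neq_lift.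
by rewrite !emb_d eqxx.
Qed.
Lemma parity_emb b v : parity (emb (b, v)) = b (+) parity v.
Proof.
rewrite /parity (cardsD1 d) !inE emb_d /=.
have -> : [set i | emb (b, v) i] :\ d = [set lift d k | k in [set k | v k]].
  apply/setP => j; rewrite !inE; case: (unliftP d j) => [l|] ->.
    by rewrite eq_sym neq_lift emb_lift mem_imset ?inE //; exact: lift_inj.
  rewrite eqxx; apply/esym/imsetP => -[k _ /eqP]; rewrite (negPf (neq_lift _ _)) //.
by rewrite card_imset; [rewrite oddD; case: b | exact: lift_inj].
Qed.

Variable G : {set vert n.+1 * 'I_n.+1}.
Definition halfG b : {set vert n * 'I_n} := [set p | (emb (b, p.1), lift d p.2) \in G].
Definition crossG : pred (vert n) := [pred v | (emb (false, v), d) \in G].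

(** The half with value [b] plays copy [false] of the joined graph, so either half can take either
    role. *)
Definition side b (p : bool * vert n) : vert n.+1 := emb (b (+) p.1, p.2).
Definition unside b (u : vert n.+1) : bool * vert n := (b (+) u d, (proj u).2).
Lemma sideK b : cancel (side b) (unside b).
Proof. by case=> a v; rewrite /unside /side embK emb_d addKb. Qed.
Lemma unsideK b : cancel (unside b) (side b).
Proof. by move=> u; rewrite /side /unside /= addKb -[RHS]projK. Qed.
Lemma side_bij b : bijective (side b). Proof. exact: Bijective (sideK b) (unsideK b). Qed.

Lemma isf_lift b v k : isf (halfG b) v k = isf G (emb (b, v)) (lift d k).
Proof. by rewrite /isf inE /= low_emb_lift. Qed.
Lemma isf_cross b v : isf G (emb (b, v)) d = crossG v.
Proof. by rewrite /isf low_emb. Qed.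

Lemma side_adj b p q : joinG (adjG (halfG b)) (adjG (halfG (~~ b))) crossG p q ->
  adjG G (side b p) (side b q).
Proof.
case: p q => [a u] [a' v]; rewrite /joinG /side /=; case: eqP => [<-|aa'].
  have -> : (if a then adjG (halfG (~~ b)) else adjG (halfG b)) u v = adjG (halfG (b (+) a)) u v.
    by case: a; rewrite ?addbT ?addbF.
  case/existsP => k /andP[/eqP-> h]; apply/existsP; exists (lift d k).
  by rewrite flip_emb_lift eqxx low_emb_lift; move: h; rewrite inE.
case/andP => /eqP<- h; apply/existsP; exists d; rewrite flip_emb low_emb.
have -> : a' = ~~ a by case: (a) (a') aa' => -[].
by rewrite addbN eqxx.
Qed.

Lemma parity_side b p : parity (side b p) = b (+) (p.1 (+) parity p.2).
Proof. by rewrite parity_emb addbA. Qed.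

Lemma fd_split b v : fd G (emb (b, v)) = fd (halfG b) v + crossG v.
Proof.
rewrite /fd (cardsD1 d) inE isf_cross addnC; congr (_ + _).
rewrite -(card_imset _ (@lift_inj _ d)); apply: eq_card => j; rewrite !inE.
case: (unliftP d j) => [k|] ->.
  by rewrite eq_sym neq_lift mem_imset ?inE ?isf_lift //; exact: lift_inj.
by rewrite eqxx; apply/esym/imsetP => -[k _ /eqP]; rewrite (negPf (neq_lift _ _)).
Qed.

Lemma card_half b : #|halfG b| = #|[set f in G | (f.2 != d) && (f.1 d == b)]|.
Proof.
pose f (p : vert n * 'I_n) := (emb (b, p.1), lift d p.2).
have fi : injective f.
  move=> [u k] [v l] h; have := congr1 snd h; have := congr1 fst h => /= /(can_inj embK)[->].
  by move/lift_inj->.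
rewrite -(card_imset _ fi); apply: eq_card => -[u j]; rewrite !inE /=; apply/imsetP/idP.
  by case=> -[v k]; rewrite inE /= => h [-> ->]; rewrite h emb_d eqxx eq_sym neq_lift.
case/and3P => h1 h2 /eqP h3; case: (unliftP d j) h1 h2 => [k|] -> h1; last by rewrite eqxx.
have eu : emb (b, (proj u).2) = u by rewrite -h3 -[RHS](projK).
by exists ((proj u).2, k); rewrite ?inE /f /= eu.
Qed.

Lemma card_cross : #|crossG| <= #|[set f in G | f.2 == d]|.
Proof.
pose f (v : vert n) := (emb (false, v), d).
have fi : injective f by move=> u v [/(can_inj embK)[->]].
rewrite -(card_image fi); apply/subset_leq_card/subsetP => -[u j] /imageP[v].
by rewrite !inE => h [-> ->]; rewrite h eqxx.
Qed.

Lemma proper_half b : properG G -> properG (halfG b).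
Proof. by move=> pG [u k]; rewrite inE => /pG /=; rewrite emb_lift. Qed.

End Split.

Lemma card_parity n (b : bool) : #|[pred u : vert n.+1 | parity u == b]| = 2 ^ n.
Proof.
have tot : #|[pred u : vert n.+1 | parity u == true]| + #|[pred u : vert n.+1 | parity u == false]| = 2 ^ n.+1.
  have <- : #|{: vert n.+1}| = 2 ^ n.+1 by rewrite card_ffun card_bool card_ord.
  rewrite -(cardC [pred u : vert n.+1 | parity u == true]); congr (_ + _).
  by apply: eq_card => u; rewrite !inE; case: (parity u).
have eqc : #|[pred u : vert n.+1 | parity u == true]| = #|[pred u : vert n.+1 | parity u == false]|.
  have fi : injective (fun u : vert n.+1 => flip u ord0) by apply: inv_inj => u; rewrite flipK.
  rewrite -(card_image fi [pred u | parity u == true]); apply: eq_card => u.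
  apply/imageP/idP => [[v] | ]; rewrite inE; first by move=> /eqP pv ->; rewrite inE parity_flip pv.
  by move/eqP => pu; exists (flip u ord0); rewrite ?flipK // inE parity_flip pu.
by rewrite expnS in tot; case: b; lia.
Qed.


Definition lace n (G : {set vert n * 'I_n}) := laceable (@parity n) (adjG G).
Definition stro n (G : {set vert n * 'I_n}) := strong (@parity n) (adjG G).

Lemma laceS n (G H : {set vert n * 'I_n}) : H \subset G -> lace G -> lace H.
Proof.
move=> HG lG x y xy; have [s [p e [pp lp]] cs] := lG x y xy; exists s => //; exists p => //.
by split=> //; apply: sub_path pp => a b; exact: adjGS.
Qed.

Lemma adjG_bip n (G H : {set vert n * 'I_n}) x y : adjG G x y || adjG H x y -> parity x != parity y.
Proof. by case/orP; exact: adjG_parity. Qed.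

Lemma card_vert n : #|{: vert n}| = 2 ^ n.
Proof. by rewrite card_ffun card_bool card_ord. Qed.

Lemma ham_side n d (G : {set vert n.+1 * 'I_n.+1}) b p q :
  ham (joinG (adjG (halfG d G b)) (adjG (halfG d G (~~ b))) (crossG d G)) p q ->
  ham (adjG G) (side d b p) (side d b q).
Proof. by apply: ham_iso; [exact: side_bij | exact: side_adj]. Qed.

Lemma split_lace n d (G : {set vert n.+2 * 'I_n.+2}) :
  #|crossG d G| < 2 ^ n -> lace (halfG d G false) -> lace (halfG d G true) -> lace G.
Proof.
move=> hX l0 l1 x y; rewrite -[x](unsideK d false) -[y](unsideK d false) => xy.
apply: ham_side; apply: (joinG_laceable (c := @parity n.+1)); try exact: adjG_sym.
- exact: adjG_bip.
- exact: l0.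
- exact: l1.
- by rewrite card_vert expnS mul2n ltn_Sdouble.
- by move=> b; rewrite card_parity.
by move: xy; rewrite !parity_side (inj_eq (@addbI false)).
Qed.

Lemma split_stro n d (G : {set vert n.+2 * 'I_n.+2}) :
  #|crossG d G|.*2.+1 < 2 ^ n -> #|crossG d G| + 2 < 2 ^ n ->
  stro (halfG d G false) -> stro (halfG d G true) -> stro G.
Proof.
move=> hX hX2 l0 l1.
have [|||||j1 j2 j3] := @join_strong _ (@parity n.+1) (adjG (halfG d G false)) (adjG (halfG d G true)) (crossG d G).
- exact: adjG_sym.
- exact: adjG_sym.
- exact: adjG_bip.
- by move=> b; rewrite card_parity.
- by case.
have cE (x y : vert n.+2) : (parity x == parity y) =
    ((unside d false x).1 (+) parity (unside d false x).2 == (unside d false y).1 (+) parity (unside d false y).2).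
  by rewrite -{1}[x](unsideK d false) -{1}[y](unsideK d false) !parity_side.
have us := can_inj (unsideK d false).
have tr p s q : pth (joinG (adjG (halfG d G false)) (adjG (halfG d G true)) (crossG d G)) p s q ->
    pth (adjG G) (side d false p) (map (side d false) s) (side d false q).
  by apply: pth_map; exact: side_adj.
have ct z s : count_mem z (map (side d false) s) = count_mem (unside d false z) s.
  by rewrite count_map; apply: eq_count => t /=; rewrite -(inj_eq us) sideK.
split.
- move=> x y xy; rewrite -[x](unsideK d false) -[y](unsideK d false); apply: ham_side.
  by apply: j1; rewrite -cE.
- move=> z p q pq zp npq; have [|||s ps cs] := j2 (unside d false z) (unside d false p) (unside d false q).
  + by apply/eqP; rewrite -cE; apply/eqP.
  + by rewrite -cE.
  + by rewrite (inj_eq us).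
  exists (map (side d false) s); first by have := tr _ _ _ ps; rewrite !unsideK.
  by move=> t; rewrite ct cs (inj_eq us).
move=> x1 y1 x2 y2 c1 c2 n1 n2 n3 n4.
have [||||||s1 [s2 [p1 p2 cs]]] := j3 (unside d false x1) (unside d false y1) (unside d false x2) (unside d false y2);
  rewrite -?cE ?(inj_eq us) //.
exists (map (side d false) s1), (map (side d false) s2); split.
- by have := tr _ _ _ p1; rewrite !unsideK.
- by have := tr _ _ _ p2; rewrite !unsideK.
by move=> t; rewrite !ct.
Qed.

Lemma card_split n d (G : {set vert n.+1 * 'I_n.+1}) b :
  #|halfG d G b| + #|halfG d G (~~ b)| + #|[set f in G | f.2 == d]| = #|G|.
Proof.
rewrite !card_half -(cardsID [set f : vert n.+1 * 'I_n.+1 | f.2 == d] G) addnC; congr (_ + _).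
  by apply: eq_card => f; rewrite !inE.
rewrite -(cardsID [set f : vert n.+1 * 'I_n.+1 | f.1 d == b] (G :\: _)); congr (_ + _);
  apply: eq_card => f; rewrite !inE.
  by case: (f \in G); case: (f.2 == d); case: (f.1 d); case: b.
by case: (f \in G); case: (f.2 == d); case: (f.1 d); case: b.
Qed.

Lemma half_le n d (G : {set vert n.+1 * 'I_n.+1}) b :
  #|halfG d G b| + #|crossG d G| <= #|G|.
Proof. by have := card_split d G b; have := card_cross d G; lia. Qed.

Lemma halfS n d (G : {set vert n.+1 * 'I_n.+1}) f b : f \in G -> f.2 = d -> #|halfG d G b| < #|G|.
Proof.
move=> fG fd; have := card_split d G b.
have : 0 < #|[set f in G | f.2 == d]| by apply/card_gt0P; exists f; rewrite inE fG fd eqxx.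
lia.
Qed.

Lemma vert1_flip (x y : vert 1) : parity x != parity y -> y = flip x ord0.
Proof.
have p1 (u : vert 1) : parity u = u ord0.
  rewrite /parity; case E: (u ord0).
    by rewrite (_ : [set i | u i] = [set ord0]) ?cards1 //; apply/setP => i; rewrite !inE ord1 E eqxx.
  by rewrite (_ : [set i | u i] = set0) ?cards0 //; apply/setP => i; rewrite !inE ord1 E.
rewrite !p1 => xy; apply/ffunP => j; rewrite flipE !ord1 eqxx.
by move: xy; case: (x _); case: (y _).
Qed.

(** Splitting in the direction of a fault removes a fault from each half, so the bound and the
    dimension decrease together. *)
Theorem few_lace n (G : {set vert n.+1 * 'I_n.+1}) : #|G| <= n.-1 -> lace G.
Proof.
elim: n G => [|m IH] G hG.
  have /eqP/cards0_eq G0 : #|G| == 0 by rewrite -leqn0.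
  move=> x y /vert1_flip->; exists [:: x; flip x ord0].
    by exists [:: flip x ord0] => //=; split=> //; rewrite andbT adjG_flip /isf G0 inE.
  move=> z /=; rewrite addn0; have [<-|zx] := eqVneq x z.
    suff -> : (flip x ord0 == x) = false by [].
    by apply/eqP => /ffunP/(_ ord0); rewrite flipE eqxx; case: (x _).
  rewrite (_ : z = flip x ord0) ?eqxx //; apply: vert1_flip.
  apply: contra_neq zx => h; rewrite -[z](flipK _ ord0); apply/esym.
  by rewrite -[RHS](flipK _ ord0); congr flip; apply: vert1_flip; rewrite parity_flip h; case: (parity z).
have [d hd] : exists d, forall b, #|halfG d G b| <= m.-1.
  have [->|/set0Pn[f fG]] := eqVneq G set0.
    exists ord0 => b; rewrite card_half (_ : [set _ in _ | _] = set0) ?cards0 //.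
    by apply/setP => f; rewrite !inE.
  by exists f.2 => b; have := halfS b fG erefl; move: hG => /=; lia.
apply: (@split_lace m d); [|exact: IH|exact: IH].
have := half_le d G false; move: hG => /= h1 h2; apply: leq_ltn_trans (ltn_expl m (ltnSn 1)).
by lia.
Qed.

(** * Restoring one edge in a half of the cube *)

Section CubeSingle.
Variables (n : nat) (d : 'I_n.+2) (G : {set vert n.+2 * 'I_n.+2}) (b : bool) (w : vert n.+1) (j : 'I_n.+1).
Let G0 := halfG d G b.
Let G1 := halfG d G (~~ b).
Let X := crossG d G.
Let q := flip w j.
Hypotheses (Xw : ~~ X w) (Xq : ~~ X q).
Hypothesis hX : #|X|.*2.+3 < 2 ^ n.
Hypothesis lG0 : lace (G0 :\ (low w j, j)).
Hypothesis sG1 : stro G1.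

Definition exitG (u v : vert n.+1) := exit_ok (adjG G0) X u v.

Let lr : laceable (@parity n.+1) (restore (adjG G0) w q).
Proof.
move=> x y xy; have [s [p e [pp lp]] cs] := lG0 xy; exists s => //; exists p => //.
split=> //; apply: sub_path pp => u v /adjGP[k -> h]; rewrite /restore adjG_flip.
move: h; rewrite /isf !inE negb_and negbK => /orP[/eqP[e1 ek]|->//].
subst k; have : u = w \/ u = q.
  have [uj|uj] := eqVneq (u j) (w j).
    left; apply/ffunP => i; have := congr1 (fun f : vert n.+1 => f i) e1; rewrite !ffunE.
    by have [->|] := eqVneq i j.
  right; apply/ffunP => i; have := congr1 (fun f : vert n.+1 => f i) e1; rewrite !ffunE.
  by have [->|] := eqVneq i j => //= _; move: uj; case: (u j); case: (w j).
by case=> ->; rewrite /q ?flipK !eqxx ?orbT.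
Qed.

Let K (c : bool) : #|X|.*2.+3 < #|[pred x | @parity n.+1 x == c]|. Proof. by rewrite card_parity. Qed.
Let pq : parity q = ~~ parity w. Proof. exact: parity_flip. Qed.
Let pw : parity w = ~~ parity q. Proof. by rewrite pq negbK. Qed.

(** Transfers the four distributions of the ends over the copies to the cube. Only the partners of
    [w] and [q] in the far half, taken as the two ends, escape these arguments and are supplied by
    [sp1] and [sp2]. *)
Lemma cube_single x y : parity x != parity y -> exitG w q -> exitG q w ->
  (x = emb d (~~ b, w) -> y = emb d (~~ b, q) -> ham (adjG G) x y) ->
  (x = emb d (~~ b, q) -> y = emb d (~~ b, w) -> ham (adjG G) x y) ->
  ham (adjG G) x y.
Proof.
move=> + ew eq sp1 sp2.
have lr' : laceable (@parity n.+1) (restore (adjG G0) q w).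
  move=> s t st; have [r [p e [pp lp]] cs] := lr st; exists r => //; exists p => //.
  by split=> //; apply: sub_path pp => u v; rewrite restoreC.
have sy := @adjG_sym n.+1; have bp := @adjG_bip n.+1 G0 G1.
have s01 u v : parity u = parity v -> ham (joinG (adjG G0) (adjG G1) X) (false, u) (true, v).
  move=> uv; have [h|h] := eqVneq (parity u) (parity w).
    by apply: (@single01 _ (@parity n.+1) _ _ X w q) => // _.
  apply: (@single01 _ (@parity n.+1) _ _ X q w) => //.
  by rewrite pq; move: h; case: (parity u); case: (parity w).
have [/andP[/eqP ? /eqP ?]|n1] := boolP ((x == emb d (~~ b, w)) && (y == emb d (~~ b, q))); first by move=> _; exact: sp1.
have [/andP[/eqP ? /eqP ?]|n2] := boolP ((x == emb d (~~ b, q)) && (y == emb d (~~ b, w))); first by move=> _; exact: sp2.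
have sE z : side d b (true, z) = emb d (~~ b, z) by rewrite /side addbT.
move=> uv; move: uv n1 n2; rewrite -!sE -[x](unsideK d b) -[y](unsideK d b) !(inj_eq (bij_inj (side_bij d b))).
rewrite !parity_side (inj_eq (@addbI b)).
case: (unside d b x) (unside d b y) => [a u] [c v]; rewrite !xpair_eqE /= => uv n1 n2; apply: ham_side.
case: a c uv n1 n2 => -[] /= uv n1 n2.
- have uv' : parity u != parity v by move: uv; case: (parity u); case: (parity v).
  exact: (@single11 _ (@parity n.+1) _ _ X w q).
- apply: ham_rev; first by apply: joinG_sym; exact: sy.
  by apply: s01; move: uv; case: (parity u); case: (parity v).
- by apply: s01; move: uv; case: (parity u); case: (parity v).
- exact: (@single00 _ (@parity n.+1) _ _ X w q).
Qed.

(** Making the edges from [w] and [q] to vertices with a faulty crossing faulty as well forces a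
    path of the far half to leave [w] and to enter [q] through vertices that cross safely, as
    [single11s] requires. *)
Lemma cube_special (H : {set vert n.+1 * 'I_n.+1}) : G1 \subset H ->
  (forall u k, u \in [:: w; q] -> X (flip u k) -> isf H u k) -> lace H ->
  ham (adjG G) (emb d (~~ b, w)) (emb d (~~ b, q)).
Proof.
move=> G1H hH lH; rewrite -addbT; apply: (@ham_side _ d G b (true, w) (true, q)).
apply: (@single11s _ (@parity n.+1) _ _ X w q); try exact: adjG_sym; try exact: adjG_bip; rewrite // => x y xy.
have [s [p e [pp lp]] cs] := lH x y xy; exists s => //; exists p => //; split=> //.
apply: sub_path pp => u v uv; rewrite (adjGS G1H uv) /=.
apply/andP; split; apply/negP => /andP[h Xh].
  by move: uv => /adjGP[k ev]; rewrite hH // -ev.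
by move: uv; rewrite adjG_sym => /adjGP[k ev]; rewrite hH // -ev.
Qed.
End CubeSingle.

(** * Concrete cubes and verified walks *)

(* Concrete vertices are bit lists; a walk is a start and a list of directions. *)
Definition dec n (s : seq bool) : vert n := [ffun i : 'I_n => nth false s i].
Definition enc n (u : vert n) : seq bool := [seq u i | i <- enum 'I_n].

Fixpoint fl (s : seq bool) (i : nat) : seq bool :=
  match s, i with
  | [::], _ => [::]
  | b :: s', 0 => ~~ b :: s'
  | b :: s', i'.+1 => b :: fl s' i'
  end.

Fixpoint trace (s : seq bool) (ms : seq nat) : seq (seq bool) :=
  s :: if ms is m :: ms' then trace (fl s m) ms' else [::].

Fixpoint steps (s : seq bool) (ms : seq nat) : seq (seq bool * nat) :=
  if ms is m :: ms' then (s, m) :: steps (fl s m) ms' else [::].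

Lemma size_enc n (u : vert n) : size (enc u) = n.
Proof. by rewrite size_map size_enum_ord. Qed.
Lemma encK n : cancel (@enc n) (@dec n).
Proof. by move=> u; apply/ffunP => i; rewrite ffunE (nth_map i) ?size_enum_ord // nth_ord_enum. Qed.
Lemma dec_inj n s t : size s = n -> size t = n -> dec n s = dec n t -> s = t.
Proof.
move=> ss st h; apply: (@eq_from_nth _ false); rewrite ?ss ?st // => i hi.
by move/ffunP/(_ (Ordinal hi)): h; rewrite !ffunE.
Qed.
Lemma size_fl s i : size (fl s i) = size s.
Proof. by elim: s i => //= b s IH [|i] //=; rewrite IH. Qed.
Lemma nth_fl s i k : i < size s -> nth false (fl s i) k = (k == i) (+) nth false s k.
Proof.
elim: s i k => //= b s IH [|i] [|k] //= hi.
by rewrite IH // eqSS.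
Qed.
Lemma dec_fl n s (i : 'I_n) : size s = n -> dec n (fl s i) = flip (dec n s) i.
Proof. by move=> ss; apply/ffunP => k; rewrite flipE !ffunE nth_fl ?ss. Qed.

Lemma trace_size s ms t : t \in trace s ms -> size t = size s.
Proof.
elim: ms s => [|m ms IH] s /=; first by rewrite inE => /eqP->.
by rewrite inE => /orP[/eqP->//|/IH->]; rewrite size_fl.
Qed.

Lemma trace_pth n (G : {set vert n * 'I_n}) s ms : size s = n ->
  (forall t m, (t, m) \in steps s ms -> exists2 i : 'I_n, i = m :> nat & ~~ isf G (dec n t) i) ->
  pth (adjG G) (dec n s) (map (@dec n) (trace s ms)) (dec n (last s (trace s ms))).
Proof.
elim: ms s => [|m ms IH] s ss h; first by exists [::].
have [i im hi] := h s m (mem_head _ _).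
have ssf : size (fl s m) = n by rewrite size_fl.
have := IH _ ssf (fun t k hk => h t k (ltac:(by rewrite /= inE hk orbT))).
rewrite /= (_ : last s (trace (fl s m) ms) = last (fl s m) (trace (fl s m) ms)); last by case: (ms).
apply: pth_cons; apply/adjGP; exists i => //; by rewrite -dec_fl // im.
Qed.

Lemma dec_count n (s : seq (seq bool)) (z : vert n) : (forall t, t \in s -> size t = n) ->
  count_mem z (map (@dec n) s) = count_mem (enc z) s.
Proof.
move=> h; rewrite count_map; apply: eq_in_count => t ts /=.
by apply/eqP/eqP => [<-|->]; rewrite ?encK //; apply: (@dec_inj n); rewrite ?size_enc ?encK //; exact: h.
Qed.

Fixpoint cube n : seq (seq bool) :=
  if n is n'.+1 then map (cons false) (cube n') ++ map (cons true) (cube n') else [:: [::]].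

Lemma mem_cube n s : (s \in cube n) = (size s == n).
Proof.
elim: n s => [|n IH] s /=; first by rewrite inE; case: s.
rewrite mem_cat; case: s => [|b s] /=.
  by apply/negbTE; rewrite negb_or; apply/andP; split; apply/mapP => -[].
have inj c : injective (cons c : seq bool -> seq bool) by move=> ? ? [].
rewrite eqSS -IH; apply/orP/idP => [[] /mapP[t ht [_ ->]]|h] //.
by case: b; [right|left]; rewrite mem_map.
Qed.

Lemma size_cube n : size (cube n) = 2 ^ n.
Proof. by elim: n => //= n IH; rewrite size_cat !size_map IH expnS mul2n addnn. Qed.

Lemma trace_cover n s ms (v : pred (seq bool)) : size s = n -> uniq (trace s ms) ->
  all v (trace s ms) -> size (trace s ms) = count v (cube n) ->
  uniq (cube n) -> forall z : vert n, count_mem (enc z) (trace s ms) = v (enc z).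
Proof.
move=> ss us vs sz uc z; rewrite count_uniq_mem //; congr nat_of_bool.
have sub : {subset trace s ms <= filter v (cube n)}.
  by move=> t ht; rewrite mem_filter (allP vs) //= mem_cube (trace_size ht) ss.
have [_ h] := uniq_min_size us sub (ltac:(by rewrite size_filter sz)).
by rewrite h mem_filter mem_cube size_enc eqxx andbT.
Qed.

Definition ham_chk n (bad : seq bool -> nat -> bool) s ms t :=
  [&& size s == n, uniq (trace s ms), size ms == (2 ^ n).-1, last s (trace s ms) == t
    & all (fun p => (p.2 < n) && ~~ bad p.1 p.2) (steps s ms)].

Lemma size_trace s ms : size (trace s ms) = (size ms).+1.
Proof. by elim: ms s => //= m ms IH s; rewrite IH. Qed.

Lemma uniq_cube n : uniq (cube n).
Proof.
elim: n => //= n IH; have inj c : injective (cons c : seq bool -> seq bool) by move=> ? ? [].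
rewrite cat_uniq !(map_inj_uniq (inj _)) IH !andbT /=.
by apply/hasPn => t /mapP[u _ ->]; apply/mapP => -[].
Qed.

Lemma steps_size s ms p : p \in steps s ms -> size p.1 = size s.
Proof.
elim: ms s => //= m ms IH s; rewrite inE => /orP[/eqP->//|/IH->]; exact: size_fl.
Qed.

Lemma ham_chk_sound n (G : {set vert n * 'I_n}) (bad : seq bool -> nat -> bool) s ms t :
  (forall s' (i : 'I_n), size s' = n -> ~~ bad s' i -> ~~ isf G (dec n s') i) ->
  ham_chk n bad s ms t -> ham (adjG G) (dec n s) (dec n t).
Proof.
move=> hb /and5P[/eqP ss us /eqP sz /eqP <- /allP st].
exists (map (@dec n) (trace s ms)).
  apply: trace_pth => // t' m h; have /andP[/= hm hbad] := st _ h.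
  by exists (Ordinal hm) => //; apply: hb => //; rewrite -ss; exact: (steps_size h).
move=> z; rewrite dec_count; last by move=> t' /trace_size->.
rewrite (@trace_cover n s ms predT) //; first by rewrite all_predT.
by rewrite size_trace sz count_predT size_cube prednK // expn_gt0.
exact: uniq_cube.
Qed.

(** * Exhaustive search in Q_3 and cubes with few faults *)

Definition bpar (s : seq bool) := odd (count id s).
Lemma parity_enc n (u : vert n) : parity u = bpar (enc u).
Proof.
rewrite /parity /bpar count_map; congr odd; rewrite cardE -size_filter; congr size.
by rewrite {1}/enum_mem -enumT; apply: eq_filter => i; rewrite /= inE.
Qed.

(* All simple walks from s that avoid vis, as lists of directions. *)
Fixpoint walks k n s vis : seq (seq nat) :=
  [::] :: if k is k'.+1 then
    flatten [seq [seq i :: w | w <- walks k' n (fl s i) (s :: vis)] | i <- iota 0 n & fl s i \notin s :: vis]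
  else [::].

Definition wok n s ms t := (last s (trace s ms) == t) && all (fun m => m < n) ms.
Lemma wokP n s ms t : size s = n -> wok n s ms t ->
  pth (adjG (set0 : {set vert n * 'I_n})) (dec n s) (map (@dec n) (trace s ms)) (dec n t).
Proof.
move=> ss /andP[/eqP <- /allP h]; apply: trace_pth => // t' m hm.
have hmn : m < n.
  apply: h; elim: ms s {ss} hm => //= k ms IH s; rewrite !inE => /orP[/eqP[_ ->]|/IH->]; by rewrite ?eqxx ?orbT.
by exists (Ordinal hmn) => //; rewrite /isf inE.
Qed.

(* Unlike has, this stops at the first success under call by value. *)
Fixpoint ex (A : Type) (a : A -> bool) (s : seq A) :=
  if s is x :: s' then if a x then true else ex a s' else false.
Lemma exE A (a : A -> bool) s : ex a s = has a s. Proof. by elim: s => //= x s ->. Qed.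

(** A walk of [k] directions has [k]+1 vertices, whence the lengths 7 and 6, and the sum 6 for two
    disjoint walks. The linkage test only takes walks from even to odd vertices; the other cases
    follow by reversal. *)
Definition chk_strong3 :=
  let V := cube 3 in
  [&& all (fun x => all (fun y => if bpar x == bpar y then true else
        ex (fun w => [&& size w == 7, wok 3 x w y & uniq (trace x w)]) (walks 7 3 x [::])) V) V,
      all (fun z => all (fun x => all (fun y => if [|| x == y, bpar x != bpar y | bpar z == bpar x] then true else
        ex (fun w => [&& size w == 6, wok 3 x w y, uniq (trace x w) & z \notin trace x w]) (walks 6 3 x [:: z])) V) V) V
    & all (fun x => all (fun y => if bpar x || ~~ bpar y then true else
      all (fun x' => all (fun y' => if [|| bpar x', ~~ bpar y', x == x' | y == y'] then true else
        ex (fun w => if wok 3 x w y then ex (fun w' => [&& size w + size w' == 6, wok 3 x' w' y' & uniq (trace x w ++ trace x' w')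
          ]) (walks 5 3 x' (trace x w)) else false) (walks 5 3 x [:: x'; y'])) V) V) V) V].

Lemma chk_strong3E : chk_strong3. Proof. by vm_compute. Qed.

Lemma stro3 : stro (set0 : {set vert 3 * 'I_3}).
Proof.
have /and3P[/allP c1 /allP c2 /allP c3] := chk_strong3E.
have mc (x : vert 3) : enc x \in cube 3 by rewrite mem_cube size_enc.
have sz x w : x \in cube 3 -> forall t, t \in trace x w -> size t = 3.
  by rewrite mem_cube => /eqP ex t /trace_size->.
have ei := can_inj (@encK 3).
split.
- move=> x y; rewrite !parity_enc => xy.
  have /allP/(_ _ (mc y)) := c1 _ (mc x); rewrite (negPf xy) exE => /hasP[w _ /and3P[sw wk uw]].
  exists (map (@dec 3) (trace (enc x) w)).
    by have := wokP (size_enc x) wk; rewrite !encK.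
  move=> z; rewrite dec_count; last exact: sz (mc x).
  rewrite (@trace_cover 3 _ w predT) ?size_enc ?all_predT ?uniq_cube //.
  by rewrite size_trace (eqP sw).
- move=> z x y; rewrite !parity_enc => xy zx nxy.
  have /allP/(_ _ (mc x))/allP/(_ _ (mc y)) := c2 _ (mc z).
  rewrite (inj_eq ei) (negPf nxy) xy eqxx -xy (negPf zx) /= exE => /hasP[w _ /and4P[sw wk uw zw]].
  exists (map (@dec 3) (trace (enc x) w)).
    by have := wokP (size_enc x) wk; rewrite !encK.
  move=> t; rewrite dec_count; last exact: sz (mc x).
  rewrite (@trace_cover 3 _ w (predC1 (enc z))) ?size_enc ?uniq_cube //=.
  + by rewrite (inj_eq ei).
  + by apply/allP => u hu /=; apply: contraNneq zw => <-.
  rewrite size_trace (eqP sw).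
  have := count_predC (pred1 (enc z)) (cube 3).
  by rewrite (count_uniq_mem _ (uniq_cube 3)) mc size_cube => /eqP; rewrite eqSS => /eqP<-.
have core x y x' y' : ~~ bpar (enc x) -> bpar (enc y) -> ~~ bpar (enc x') -> bpar (enc y') ->
    x != x' -> y != y' -> link (adjG (set0 : {set vert 3 * 'I_3})) x y x' y'; last first.
  have sy := adjG_sym (set0 : {set vert 3 * 'I_3}).
  move=> x y x' y'; rewrite !parity_enc => xy xy' n1 n2 n3 n4.
  have [px|px] := boolP (bpar (enc x)); have [px'|px'] := boolP (bpar (enc x')).
  - apply: link_rev => //; apply: linkC; apply: link_rev => //; apply: linkC.
    by apply: core; rewrite //; move: xy xy'; rewrite px px'; case: (bpar (enc y)); case: (bpar (enc y')).
  - apply: link_rev => //.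
    by apply: core; rewrite //; move: xy xy'; rewrite px (negPf px'); case: (bpar (enc y)); case: (bpar (enc y')).
  - apply: linkC; apply: link_rev => //; apply: linkC.
    by apply: core; rewrite //; move: xy xy'; rewrite (negPf px) px'; case: (bpar (enc y)); case: (bpar (enc y')).
  by apply: core; rewrite //; move: xy xy'; rewrite (negPf px) (negPf px'); case: (bpar (enc y)); case: (bpar (enc y')).
move=> px py px' py' n1 n2.
have /allP/(_ _ (mc y)) := c3 _ (mc x); rewrite ifF ?(negPf px) ?py // => /allP/(_ _ (mc x'))/allP/(_ _ (mc y')).
rewrite ifF; last by rewrite (negPf px') py' !(inj_eq ei) (negPf n1) (negPf n2).
rewrite exE.
case/hasP => w _; case: ifP => // wk; rewrite exE => /hasP[w' _ /and3P[sw wk' uw]].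
exists (map (@dec 3) (trace (enc x) w)), (map (@dec 3) (trace (enc x') w')); split.
- by have := wokP (size_enc x) wk; rewrite !encK.
- by have := wokP (size_enc x') wk'; rewrite !encK.
move=> t; rewrite !dec_count; try exact: sz (mc _).
rewrite -count_cat count_uniq_mem //.
have sub : {subset trace (enc x) w ++ trace (enc x') w' <= cube 3}.
  by move=> s; rewrite mem_cat mem_cube => /orP[] /trace_size->; rewrite size_enc.
have [_ h] := uniq_min_size uw sub (ltac:(by rewrite size_cube size_cat !size_trace addSn addnS (eqP sw))).
by rewrite h mem_cube size_enc.
Qed.

(** The descent of [few_lace], stopped at the fault-free Q_3. *)
Lemma few_stro n (G : {set vert n.+3 * 'I_n.+3}) : #|G| <= n -> stro G.
Proof.
elim: n G => [|m IH] G hG.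
  by move: hG; rewrite leqn0 cards_eq0 => /eqP->; exact: stro3.
have [d hd] : exists d, forall b, #|halfG d G b| <= m.
  have [->|/set0Pn[f fG]] := eqVneq G set0.
    exists ord0 => b; rewrite card_half (_ : [set _ in _ | _] = set0) ?cards0 //.
    by apply/setP => f; rewrite !inE.
  by exists f.2 => b; have := halfS b fG erefl; move: hG => /=; lia.
have hc : #|crossG d G| <= m.+1 by have := half_le d G false; lia.
have e2 : m.+1 < 2 ^ m.+1 by exact: ltn_expl.
apply: (@split_stro m.+2 d); [| |exact: IH|exact: IH].
  by move: hc e2; rewrite !expnS; set k := #|_|; set p := 2 ^ m; lia.
by move: hc e2; rewrite !expnS; set k := #|_|; set p := 2 ^ m; lia.
Qed.

(** * Automorphisms of the cube *)

Section Affine.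
Variables (n : nat) (s : {perm 'I_n}) (t : vert n).
Definition aff (u : vert n) : vert n := [ffun i => u (s i) (+) t i].
Definition affi (u : vert n) : vert n := [ffun i => u ((s^-1)%g i) (+) t ((s^-1)%g i)].
Lemma affK : cancel aff affi.
Proof. by move=> u; apply/ffunP => i; rewrite !ffunE permKV addbK. Qed.
Lemma affiK : cancel affi aff.
Proof. by move=> u; apply/ffunP => i; rewrite !ffunE permK addbK. Qed.
Lemma aff_bij : bijective aff. Proof. exact: Bijective affK affiK. Qed.
Lemma aff_flip u i : aff (flip u (s i)) = flip (aff u) i.
Proof. by apply/ffunP => j; rewrite !ffunE (inj_eq perm_inj) addbA. Qed.

Variable G : {set vert n * 'I_n}.
(** The preimage of the faults under [aff], recorded again by the endpoint with coordinate 0. *)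
Definition affG : {set vert n * 'I_n} := [set p : vert n * 'I_n | ~~ p.1 p.2 && isf G (aff p.1) ((s^-1)%g p.2)].

Lemma low_eq (u : vert n) i : low u i = u \/ low u i = flip u i.
Proof.
case E: (u i); [right|left]; apply/ffunP => j; rewrite !ffunE; have [->|] := eqVneq j i; rewrite ?E //.
Qed.

Lemma isf_aff u i : isf affG u (s i) = isf G (aff u) i.
Proof.
rewrite {1}/isf inE /= permK ffunE eqxx /=.
by case: (low_eq u (s i)) => ->; rewrite ?aff_flip ?isf_flip.
Qed.
Lemma aff_adj u v : adjG affG u v -> adjG G (aff u) (aff v).
Proof.
case/adjGP => i -> h; rewrite -[i](permKV s) aff_flip adjG_flip -isf_aff permKV; exact: h.
Qed.
Lemma aff_ham u v : ham (adjG affG) u v -> ham (adjG G) (aff u) (aff v).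
Proof. by apply: ham_iso; [exact: aff_bij | exact: aff_adj]. Qed.
Lemma fd_aff u : fd affG u = fd G (aff u).
Proof.
rewrite /fd -(card_imset [set i | isf G (aff u) i] (@perm_inj _ s)); apply: eq_card => j; rewrite inE.
apply/idP/imsetP => [h|[i]]; last by rewrite inE => h ->; rewrite isf_aff.
by exists ((s^-1)%g j); rewrite ?permKV // inE -isf_aff permKV.
Qed.
Lemma proper_aff : properG affG. Proof. by move=> f; rewrite inE => /andP[]. Qed.
Lemma card_aff : #|affG| <= #|G|.
Proof.
pose f (p : vert n * 'I_n) := (low (aff p.1) ((s^-1)%g p.2), (s^-1)%g p.2).
rewrite -(card_in_imset (f := f)); last first.
  move=> [u i] [v j]; rewrite !inE /= => /andP[hu _] /andP[hv _] [e1 e2].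
  have eij : i = j by apply: (@perm_inj _ (s^-1)%g).
  subst j; congr pair; apply/ffunP => k; have [->|ki] := eqVneq k i.
    by rewrite (negPf hu) (negPf hv).
  have := congr1 (fun w : vert n => w ((s^-1)%g k)) e1.
  by rewrite !ffunE (inj_eq perm_inj) ki /= permKV => /addIb.
by apply/subset_leq_card/subsetP => p /imsetP[q]; rewrite inE => /andP[_ h] ->.
Qed.
(** Permuting coordinates preserves parity and the translation adds the parity of [t]. *)
Lemma par_aff u v : (parity (aff u) == parity (aff v)) = (parity u == parity v).
Proof.
have h w : parity (aff w) = parity w (+) parity t.
  rewrite /parity.
  have -> : #|[set i | w i]| = #|[set i | w (s i)]|.
    rewrite -(card_imset [set i | w (s i)] (@perm_inj _ s)); apply: eq_card => j; rewrite inE.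
    apply/idP/imsetP => [hj|[i]]; last by rewrite inE => hi ->.
    by exists ((s^-1)%g j); rewrite ?inE ?permKV.
  rewrite -oddD -[in RHS](cardsID [set i | t i] [set i | w (s i)]) -[in RHS](cardsID [set i | w (s i)] [set i | t i]).
  rewrite (setIC [set i | t i]) addnACA addnn oddD odd_double addFb.
  rewrite -(cardsID [set i | t i] [set i | aff w i]); congr odd; rewrite addnC; congr (_ + _);
    by apply: eq_card => i; rewrite !inE ffunE; case: (t i); case: (w _).
by rewrite !h (inj_eq (@addIb _)).
Qed.
End Affine.

(** Translations act transitively, so for a class of fault sets closed under automorphisms one end
    of the path may be fixed. *)
Lemma lace_origin n (P : {set vert n * 'I_n} -> Prop) (o : vert n) :
  (forall G s t, P G -> P (affG s t G)) ->
  (forall G y, P G -> parity o != parity y -> ham (adjG G) o y) ->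
  forall G, P G -> lace G.
Proof.
move=> hP h G PG x y xy; pose t : vert n := [ffun i => x i (+) o i].
have ex : aff 1%g t o = x by apply/ffunP => i; rewrite !ffunE perm1 addbC addbK.
rewrite -ex -[y](affiK 1%g t); apply: aff_ham; apply: h; first exact: hP.
by rewrite -(par_aff 1%g t) ex affiK.
Qed.

(** * Three faults in Q_4, by computation *)

Fixpoint bval (s : seq bool) : N :=
  if s is b :: s' then (if b then N.succ_double else N.double) (bval s') else 0%num.
Definition clr (s : seq bool) i := if nth false s i then fl s i else s.
(** Numbers the edges of Q_4 injectively, with the direction in the two low bits. A path becomes a
    bit mask, and avoiding an edge a single bit test. *)
Definition ecode (p : seq bool * nat) : N := (4 * bval (clr p.1 p.2) + bin_of_nat p.2)%num.
Definition emask (ps : seq (seq bool * nat)) : N := foldr (fun p m => N.setbit m (ecode p)) 0%num ps.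


(* Hamiltonian paths of Q_4 from the origin, grouped by end point; base 4 digits are directions. *)
Local Open Scope N_scope.
Definition paths4 : seq (seq N) := [::
  [:: 757984557; 316592862; 76665220; 516657964; 577563746; 247786726; 294766985; 162940781;
    613188844; 460446577; 103707492; 752758300; 221398802; 422450097; 767970456; 611175954;
    108628894; 584879385; 477551734; 753790189; 484036040; 300735713; 414325646; 640080153;
    138987078; 82648674; 758258577; 115586872; 188009268; 557082445; 652504684; 303225113;
    454236625; 249329201; 124041294; 483937352; 330752889; 148778385; 767063772; 248327725;
    432958596; 555869734; 194744030; 412982489; 105308770; 477508046; 611394332; 166522312;
    568517090; 610591330; 293921352; 611216614; 75813265; 189221060; 326857177; 433647084;
    461860302; 77433720; 767094200; 238139629; 249482974];
  [:: 960084281; 328307601; 79186036; 248720603; 462535091; 944475000; 484220124; 75990151;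
    309139533; 163072121; 924694301; 305700555; 846041831; 885572792; 124636891; 459578212;
    186747681; 129164844; 865811219; 969773848; 232970524; 330537144; 488486711; 210618569;
    192460875; 495679684; 295571997; 79991249; 971828664; 910588297; 862862156; 409411979;
    206166199; 931772807; 955103469; 965325956; 824385971; 495902413; 462977912; 300802461;
    456774028; 249482139; 194828593; 206353524; 878786121; 924683379; 193432455; 509729649;
    951695545; 82605643; 115586604; 825332499; 294883731; 488163763; 79268276; 454794011;
    328962971];
  [:: 947615867; 757149282; 248636972; 660891492; 105669742; 556868467; 115499718; 836449483;
    881113160; 768470092; 993298274; 659418567; 162604150; 103967975; 610769051; 663298968;
    585256654; 919495460; 880198854; 208090850; 997432211; 139158631; 129469307; 778858092;
    824471844; 123888454; 219902424; 188191160; 774794798; 843531891; 594764916; 124033810;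
    752034100; 951602059; 149054152; 210192268; 616058567; 576931399; 101934235; 610748491;
    920435180; 864832691; 879204574; 991803182; 862402339; 591808354; 965451462; 775637218;
    775396667; 557418100; 164854044; 970038883; 569238126; 878998628; 991107955; 115787623;
    248406754; 772939362];
  [:: 947615854; 294766664; 129159885; 316592567; 555864452; 745434235; 105302409; 618958414;
    996990684; 242014995; 206276913; 149058098; 931761304; 474696116; 432498502; 775396654;
    300699161; 926397260; 77481692; 864838435; 495680327; 993500475; 192628637; 328962534;
    640075874; 578058449; 140699174; 863214812; 413060680; 779205043; 882591821; 79988551;
    585255819; 124210811; 611480024; 233686745; 484519044; 297317602; 294536819; 651737528;
    949164108; 193679054; 589521608; 80846109; 610587025; 880380356; 776397964; 421120098;
    293922342; 414824678; 320052535; 951602894; 213264226; 639228185; 108574408; 994462820;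
    853855005; 160241975; 488843187; 248400779; 932289937; 593978073; 996253074; 779663284;
    864324753; 863580462; 556632952; 75817570; 299569958; 295572023; 865941042; 776767204;
    585266099; 248412344; 122369838; 76669217; 776451979; 994625460; 303223172];
  [:: 423172409; 744779302; 991146907; 556605741; 825367838; 316855075; 774753997; 323372818;
    944476599; 327791739; 879185377; 770514654; 589767463; 852331297; 488862438; 611731889;
    414324914; 997428334; 479763737; 640094739; 931891003; 949700529; 321707235; 842412598;
    768527662; 306668699; 506540573; 421237139; 831233241; 965114002; 567438903; 407789981;
    651763127; 316857902; 778976123; 591795081; 488517938; 774712877; 831631890; 925316903;
    666035342; 496835997; 320418107; 434510310; 773042649; 652288486; 596228333; 456858427;
    517875430; 878785633; 556867889; 414749234; 303981166; 555977099; 993495943; 305771367;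
    824664798];
  [:: 757961426; 317163416; 105301137; 864914573; 991109918; 997079931; 79240012; 309086428;
    139224886; 509836051; 456756806; 294770969; 209416633; 639223880; 555864465; 490228612;
    775502649; 661069239; 885642094; 825331149; 103687347; 421301704; 316857915; 583317684;
    968433374; 517873053; 863214903; 160031009; 231262643; 934442572; 79213794; 770513819; 75818534;
    81939271; 414751534; 298955057; 992816685; 210907667; 415833484; 556674504; 779319601;
    139382370; 610587012; 924376294; 640443515; 778976110; 557216217; 932372164; 484519057;
    148671769; 862862195; 76662342; 433665975; 863717092; 498230054; 997923302; 141451757;
    122140445; 863208657; 656615112; 773043099; 122133815; 768527675; 577997922; 327791726;
    456858414; 757974919; 213266999; 320048589; 775533489; 865897628; 652622265; 81383910;
    613257851; 298103924; 517880249; 82633907; 126292690; 293921892; 105806630; 824664477;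
    303219844; 556634846; 77435319];
  [:: 113670457; 309095878; 774158439; 860413144; 951614254; 616885363; 934359453; 300797412;
    148778372; 555868770; 509829430; 432958609; 82698974; 651762587; 575589665; 775638156;
    910657837; 770518638; 75813252; 242513523; 294546649; 138990098; 993750252; 462654587;
    213264200; 991146470; 842457959; 303220808; 588459319; 495683387; 778972653; 994501811;
    108574434; 843531852; 913710814; 421127268; 248412987; 610592294; 189473249; 490092342;
    657925917; 147350307; 316590968; 934747575; 149365529; 865941427; 76402065; 779218226;
    862735468; 517880699; 421976216; 298245342; 997079481; 577604076; 517875559; 640437956;
    743363483; 208827250; 951357896; 556667447; 105678770; 924437961; 931451319; 947157789;
    315436580; 115109473; 756966097; 421304503; 141451899; 583476038; 105306393; 294773320;
    951610939; 81490809; 81383897; 76667032; 75818521; 293913732];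
  [:: 757971064; 946309042; 297343859; 207907985; 121313457; 422863990; 753692219; 840770763;
    926397556; 81938628; 575366247; 968440699; 652288473; 321774519; 294413420; 495683374; 77435293;
    140710419; 209417070; 993741964; 825955110; 992889032; 124577715; 189287266; 881112209;
    661076409; 490180045; 462543047; 589702984; 193687086; 298420676; 843541721; 651765478;
    583552718; 210530866; 993741707; 776359449; 504503684; 294099099; 320548428; 126590509;
    934359774; 996260131; 79994167; 479763750; 231335453; 773448940; 433663611; 147212002;
    641276217; 824259144; 863212307; 326846900; 141398430; 79116363; 776528365; 147354508;
    933042649; 867397166; 913499848; 434353294; 824664503; 210161361; 498317196; 585551260;
    997322034; 583419592; 651301593; 81384347; 770521966; 661069213; 773042662; 578176632;
    463154798; 122272055; 968437358; 76777867; 79239473]].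
Local Close Scope N_scope.

Fixpoint digits k (m : N) : seq nat :=
  if k is k'.+1 then nat_of_bin (N.land m 3) :: digits k' (N.shiftr m 2) else [::].

Definition org4 := nseq 4 false.
Definition odd4 := [seq y <- cube 4 | bpar y].
Definition valid4 y w := [&& size w == 15, last org4 (trace org4 w) == y, uniq (trace org4 w) & all (fun m => m < 4) w].
Definition groups4 : seq (seq N) := [seq [seq emask (steps org4 (digits 15 m)) | m <- g] | g <- paths4].

Lemma paths4_valid : (size paths4 == size odd4) &&
  all (fun p => all (fun m => valid4 p.1 (digits 15 m)) p.2) (zip odd4 paths4).
Proof. by vm_compute. Qed.

Lemma emask_in p ps : p \in ps -> N.testbit (emask ps) (ecode p).
Proof.
elim: ps => //= q ps IH; rewrite inE => /orP[/eqP<-|/IH h]; rewrite BinNat.N.setbit_eqb ?BinNat.N.eqb_refl //.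
by rewrite h orbT.
Qed.

Lemma size_clr s i : size (clr s i) = size s.
Proof. by rewrite /clr; case: ifP; rewrite ?size_fl. Qed.
Lemma dec_clr n (s : seq bool) (i : 'I_n) : size s = n -> dec n (clr s i) = low (dec n s) i.
Proof.
move=> ss; rewrite /clr; apply/ffunP => j; case: ifP => h; rewrite !ffunE ?nth_fl ?ss //.
  by have [->|] := eqVneq j i; rewrite ?eqxx ?h // => /negPf ji; rewrite (inj_eq val_inj) ji.
by have [->|] := eqVneq j i; rewrite ?h.
Qed.
Lemma enc_low n (s : seq bool) (i : 'I_n) : size s = n -> enc (low (dec n s) i) = clr s i.
Proof. by move=> ss; apply: (@dec_inj n); rewrite ?size_enc ?size_clr // encK dec_clr. Qed.
Lemma ecode_clr s i : i < size s -> ecode (clr s i, i) = ecode (s, i).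
Proof.
move=> hi; rewrite /ecode /=; congr (4 * bval _ + _)%num.
by rewrite /clr; case E: (nth false s i); rewrite ?nth_fl ?eqxx ?E.
Qed.

Definition gpair n (f : vert n * 'I_n) : seq bool * nat := (enc f.1, nat_of_ord f.2).

Lemma avoid_ham (G : {set vert 4 * 'I_4}) y w : valid4 y w ->
  (forall f, f \in G -> ~~ N.testbit (emask (steps org4 w)) (ecode (gpair f))) ->
  ham (adjG G) (dec 4 org4) (dec 4 y).
Proof.
case/and4P => /eqP sw /eqP <- uw /allP hw hG.
exists (map (@dec 4) (trace org4 w)).
  apply: trace_pth => // t m hm.
  have st : size t = 4 by rewrite (steps_size hm).
  have hm4 : m < 4.
    apply: hw; elim: (w) (org4) hm => //= k ms IH s; rewrite !inE => /orP[/eqP[_ ->]|/IH->]; by rewrite ?eqxx ?orbT.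
  exists (Ordinal hm4) => //; apply/negP => h; have := hG _ h.
  by rewrite /gpair /= enc_low //= ecode_clr ?st // (emask_in hm).
move=> z; rewrite dec_count; last by move=> t' /trace_size->.
rewrite (@trace_cover 4 _ w predT) ?uniq_cube ?all_predT //.
by rewrite size_trace sw.
Qed.

Definition elist4 := [seq p <- [seq (s, i) | s <- cube 4, i <- iota 0 4] | ~~ nth false p.1 p.2].
Definition star3 (e1 e2 e3 : seq bool * nat) :=
  if uniq [:: e1; e2; e3] then
    ex (fun v => [&& clr v e1.2 == e1.1, clr v e2.2 == e2.1 & clr v e3.2 == e3.1]) (cube 4)
  else false.
Definition miss (e : seq bool * nat) : pred N := let k := ecode e in fun m => ~~ N.testbit m k.
(** Filtering the masks in the outer loops shares work between triples. The triples exempted by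
    [star3] are three edges at one vertex, which would leave it degree one. *)
Definition chk3 :=
  let el := elist4 in
  all (fun e1 => let g1 := map (filter (miss e1)) groups4 in
  all (fun e2 => let g2 := map (filter (miss e2)) g1 in
  all (fun e3 => if star3 e1 e2 e3 then true else all (ex (miss e3)) g2) el) el) el.

Lemma chk3E : chk3. Proof. by vm_compute. Qed.

Lemma enc_dec n s : size s = n -> enc (dec n s) = s.
Proof. by move=> ss; apply: (@dec_inj n); rewrite ?size_enc ?encK. Qed.

Lemma groups4_nth k : k < size odd4 -> forall m, m \in nth [::] groups4 k ->
  exists w, valid4 (nth [::] odd4 k) w /\ m = emask (steps org4 w).
Proof.
have /andP[/eqP sz /allP v] := paths4_valid => hk m.
rewrite (nth_map [::]) ?sz // => /mapP[c hc ->]; exists (digits 15 c); split=> //.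
have hin : (nth [::] odd4 k, nth [::] paths4 k) \in zip odd4 paths4.
  by rewrite -(nth_zip _ _ _ (esym sz)); apply: mem_nth; rewrite size_zip sz minnn; exact: hk.
by have /allP := v _ hin; apply.
Qed.

Lemma origin_odd (y : vert 4) : parity (dec 4 org4) != parity y -> exists2 k, k < size odd4 & y = dec 4 (nth [::] odd4 k).
Proof.
rewrite !parity_enc enc_dec // => h; have yo : enc y \in odd4.
  by rewrite mem_filter mem_cube size_enc eqxx andbT; move: h; case: (bpar (enc y)).
exists (index (enc y) odd4); first by rewrite index_mem.
by rewrite nth_index // encK.
Qed.

Lemma gpair_elist (f : vert 4 * 'I_4) : ~~ f.1 f.2 -> gpair f \in elist4.
Proof.
move=> h; have h' : ~~ nth false (enc f.1) f.2 by move: h; rewrite -{1}[f.1]encK ffunE.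
rewrite mem_filter; apply/andP; split; first exact: h'.
apply/allpairsP; exists (enc f.1, nat_of_ord f.2); split; [by rewrite mem_cube size_enc | by rewrite mem_iota ltn_ord | by []].
Qed.

Lemma gpair_inj n : injective (@gpair n).
Proof. by move=> [u i] [v j] [/(can_inj (@encK n)) -> /val_inj ->]. Qed.

Lemma gpair_low (f : vert 4 * 'I_4) v : clr v f.2 = enc f.1 -> v \in cube 4 -> f.1 = low (dec 4 v) f.2.
Proof. by rewrite mem_cube => h /eqP sv; apply: (can_inj (@encK 4)); rewrite enc_low. Qed.

(** By symmetry one end is the origin. The degree condition excludes exactly the triples exempted
    from the table, and for all others each odd end has a listed path that misses the three
    faults. *)
Theorem q4_three (G : {set vert 4 * 'I_4}) :
  properG G -> #|G| <= 3 -> (forall u, fd G u <= 2) -> lace G.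
Proof.
move=> pG cG dG; pose P (H : {set vert 4 * 'I_4}) := [/\ properG H, #|H| <= 3 & forall u, fd H u <= 2].
apply: (@lace_origin 4 P (dec 4 org4)) => //.
  move=> H s t [h1 h2 h3]; split; [exact: proper_aff|exact: leq_trans (card_aff s t H) h2|].
  by move=> u; rewrite fd_aff.
move=> {pG cG dG}{}G y [pG cG dG] /origin_odd[k hk ->].
pose L := map (@gpair 4) (enum G).
have sL : size L <= 3 by rewrite size_map -cardE.
have Lin e : e \in L -> exists2 f, f \in G & e = gpair f.
  by case/mapP => f; rewrite mem_enum => h ->; exists f.
have Lel e : e \in L -> e \in elist4 by case/Lin => f /pG h ->; exact: gpair_elist.
have [L0|L0] := eqVneq L [::].
  have [w [hw _]] : exists w, valid4 (nth [::] odd4 k) w /\ nth 0%num (nth [::] groups4 k) 0 = emask (steps org4 w).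
    apply: groups4_nth => //; apply: mem_nth.
    have : all (fun g => 0 < size g) groups4 by vm_compute.
    move/(all_nthP [::]); apply; have /andP[/eqP sz _] := paths4_valid; by rewrite size_map sz.
  apply: avoid_ham hw _ => f fG; have : gpair f \in L by rewrite map_f // mem_enum.
  by rewrite L0.
(* The list of faults is padded to three entries by repeating its first element; [star3] is false on
   triples with repetitions. *)
pose e k := nth (head (nseq 4 false, 0) L) L k.
have eL i : e i \in L.
  have [h|h] := ltnP i (size L); first exact: mem_nth.
  by rewrite /e nth_default //; case: (L) L0 => //= a l _; rewrite mem_head.
have Le f : f \in G -> gpair f \in [:: e 0; e 1; e 2].
  move=> fG; have : gpair f \in L by rewrite map_f // mem_enum.
  case/(nthP (head (nseq 4 false, 0) L)) => i hi <-; rewrite -/(e i).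
  by case: i hi => [|[|[|i]]] hi; rewrite ?inE ?eqxx ?orbT //; have := leq_trans hi sL.
have ns : star3 (e 0) (e 1) (e 2) = false.
  rewrite /star3; case: ifP => // ue; apply: negbTE; rewrite exE; apply/hasPn => v hv.
  apply/negP => /and3P[/eqP h0 /eqP h1 /eqP h2].
  have [f0 g0 e0] := Lin _ (eL 0); have [f1 g1 e1] := Lin _ (eL 1); have [f2 g2 e2] := Lin _ (eL 2).
  rewrite e0 e1 e2 in h0 h1 h2 ue.
  have l0 := gpair_low h0 hv; have l1 := gpair_low h1 hv; have l2 := gpair_low h2 hv.
  have hi f : f \in G -> f.1 = low (dec 4 v) f.2 -> f.2 \in [set i | isf G (dec 4 v) i].
    by case: f => u i /= hf hu; rewrite inE /isf -hu.
  have fe f f' : f.1 = low (dec 4 v) f.2 -> f'.1 = low (dec 4 v) f'.2 -> f.2 = f'.2 -> f = f'.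
    by case: f f' => [u i] [u' i'] /= -> -> ->.
  have : #|[set f0.2; f1.2; f2.2]| <= fd G (dec 4 v).
    by apply/subset_leq_card/subsetP => i; rewrite !inE => /orP[/orP[]|] /eqP->;
      [have := hi _ g0 l0 | have := hi _ g1 l1 | have := hi _ g2 l2]; rewrite inE.
  rewrite -setUA cardsU1 cards2 !inE.
  move: ue; rewrite /= !inE !(inj_eq (@gpair_inj 4)) !andbT => /andP[/norP[n01 n02] n12].
  have d01 : f0.2 != f1.2 by apply: contra n01 => /eqP h; rewrite (fe f0 f1).
  have d02 : f0.2 != f2.2 by apply: contra n02 => /eqP h; rewrite (fe f0 f2).
  have d12 : f1.2 != f2.2 by apply: contra n12 => /eqP h; rewrite (fe f1 f2).
  by rewrite (negPf d01) (negPf d02) d12 => h; have := leq_trans h (dG _).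
have := chk3E; rewrite /chk3 => /allP/(_ _ (Lel _ (eL 0)))/allP/(_ _ (Lel _ (eL 1)))/allP/(_ _ (Lel _ (eL 2))).
rewrite ns => /(all_nthP [::])/(_ k).
have /andP[/eqP sz _] := paths4_valid.
rewrite !size_map sz => /(_ hk); rewrite exE.
rewrite (nth_map [::]) ?size_map ?sz // (nth_map [::]) ?size_map ?sz //.
case/hasP => m; rewrite mem_filter => /andP[m1]; rewrite mem_filter => /andP[m0 hm] m2.
have [w [hw em]] := groups4_nth hk hm.
apply: avoid_ham hw _ => f /Le; rewrite !inE -em => /orP[/eqP->|/orP[]/eqP->].
- exact: m0.
- exact: m1.
- exact: m2.
Qed.

(** * Counting violated directions *)

Section Count.
Variables (n : nat) (G : {set vert n * 'I_n}).
Implicit Types (c u w : vert n) (d i : 'I_n) (f : vert n * 'I_n).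

Definition inc w : {set vert n * 'I_n} := [set f in G | f.1 == low w f.2].

Lemma card_inc w : #|inc w| = fd G w.
Proof.
pose g i : vert n * 'I_n := (low w i, i).
have gi : injective g by move=> i j [].
rewrite /fd -(card_imset _ gi); apply: eq_card => -[u i]; rewrite !inE /=.
apply/andP/imsetP => [[h /eqP e]|[j]]; first by exists i; rewrite ?inE /isf ?/g -e.
by rewrite inE => h [-> ->].
Qed.

Lemma inc_sub w : inc w \subset G. Proof. by apply/subsetP => f; rewrite inE => /andP[]. Qed.
Lemma fd_card w : fd G w <= #|G|.
Proof. by rewrite -card_inc subset_leq_card // inc_sub. Qed.

Lemma low_inj2 u w i : low u i = low w i -> u = w \/ u = flip w i.
Proof.
move=> h; have hj j : j != i -> u j = w j.
  by move=> ji; have := congr1 (fun z : vert n => z j) h; rewrite !ffunE ji.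
have [e|e] := eqVneq (u i) (w i); [left|right]; apply/ffunP => j; rewrite ?flipE.
  by have [->//|/hj] := eqVneq j i.
by have [->|/hj] := eqVneq j i; rewrite ?addFb //; move: e; case: (u i); case: (w i).
Qed.

Lemma inc2 u w f : f \in inc u -> f \in inc w -> u != w -> u = flip w f.2 /\ isf G w f.2.
Proof.
case: f => a i; rewrite !inE /= => /andP[fG /eqP e1] /andP[_ /eqP e2] uw.
have [e|->] : u = w \/ u = flip w i by apply: low_inj2; rewrite -e1.
  by rewrite e eqxx in uw.
by rewrite /isf -e2.
Qed.

Lemma inc_isf w i : isf G w i -> (low w i, i) \in inc w.
Proof. by rewrite inE /= eqxx andbT. Qed.

(** These are the directions whose splitting separates the fault from the half of [c], either as a
    crossing edge or as an edge of the other half. *)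
Definition viol c f : {set 'I_n} := [set d | (f.2 == d) || (f.1 d != c d)].
Definition vnum c d := #|[set f in G | d \in viol c f]|.

Lemma viol_sum c (D : {set 'I_n}) : \sum_(d in D) vnum c d = \sum_(f in G) #|viol c f :&: D|.
Proof.
rewrite (eq_bigr (fun d => \sum_(f in G) (d \in viol c f : nat))); last first.
  move=> d _; rewrite /vnum -sum1_card big_mkcond [RHS]big_mkcond /=; apply: eq_bigr => f _.
  by rewrite inE; case: (f \in G); case: (d \in viol c f).
rewrite exchange_big /=; apply: eq_bigr => f _.
rewrite -sum1_card big_mkcond [RHS]big_mkcond /=; apply: eq_bigr => d _.
by rewrite in_setI; case: (d \in D); case: (d \in viol c f).
Qed.

Lemma viol_self c f : f.2 \in viol c f. Proof. by rewrite inE eqxx. Qed.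

(* A fault violating only its own direction is incident with the center. *)
Lemma viol_center c f : properG G -> f \in G -> #|viol c f| <= 1 -> f \in inc c.
Proof.
move=> pG fG h; have hf := pG _ fG; rewrite inE fG /=; apply/eqP/ffunP => j; rewrite ffunE.
have [->|jf] := eqVneq j f.2; first by rewrite (negPf hf).
apply/eqP; apply: contraTT h => ne; rewrite -ltnNge.
apply: (@leq_trans #|[set f.2; j]|); first by rewrite cards2 eq_sym jf.
by apply/subset_leq_card/subsetP => k; rewrite !inE => /orP[]/eqP->; rewrite ?eqxx ?ne ?orbT.
Qed.

(** Every fault violates its own direction, and another one unless it is incident with [c]. So only
    the incident faults may contribute one instead of two. *)
Lemma viol_total c : properG G -> (#|G|).*2 <= \sum_(f in G) #|viol c f| + fd G c.
Proof.
move=> pG; rewrite -card_inc -sum1_card -muln2 big_distrl /= -sum1_card.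
rewrite (big_setID (inc c)) /= (setIidPr (inc_sub c)).
rewrite [X in _ <= X + _](big_setID (inc c)) /= (setIidPr (inc_sub c)).
have h1 : \sum_(f in inc c) 1 * 2 <= \sum_(f in inc c) #|viol c f| + \sum_(f in inc c) 1.
  rewrite -big_split /=; apply: leq_sum => f fi.
  by rewrite mul1n addn1 ltnS; apply/card_gt0P; exists f.2; exact: viol_self.
have h2 : \sum_(f in G :\: inc c) 1 * 2 <= \sum_(f in G :\: inc c) #|viol c f|.
  apply: leq_sum => f; rewrite inE => /andP[fi fG]; rewrite mul1n ltnNge.
  by apply: contra fi; exact: viol_center.
by apply: leq_trans (leq_add h1 h2) _; rewrite addnAC.
Qed.
End Count.

Section HalfCount.
Variables (n : nat) (d : 'I_n.+1) (G : {set vert n.+1 * 'I_n.+1}).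
Implicit Type c : vert n.+1.

Lemma half_vnum c : #|halfG d G (c d)| + vnum G c d = #|G|.
Proof.
rewrite card_half /vnum -(cardsID [set f : vert n.+1 * 'I_n.+1 | d \notin viol c f] G).
congr (_ + _); apply: eq_card => f; rewrite !inE ?negbK.
  by rewrite negb_or negbK; case: (f \in G).
by rewrite andbC.
Qed.

(** Crossing faults and faults of the half opposite to [c] all violate [d]. *)
Lemma light_vnum c : #|halfG d G (~~ c d)| + #|crossG d G| <= vnum G c d.
Proof. by have := half_vnum c; have := card_split d G (c d); have := card_cross d G; lia. Qed.

Lemma fd_half b v : fd (halfG d G b) v <= fd G (emb d (b, v)).
Proof. by rewrite (fd_split d G b v) leq_addr. Qed.

Lemma fd_half_isf b v : isf G (emb d (b, v)) d -> (fd (halfG d G b) v).+1 = fd G (emb d (b, v)).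
Proof. by rewrite (fd_split d G b v) isf_cross => ->; rewrite addn1. Qed.
End HalfCount.

(** * Exits from the ends of a restored edge *)

Section Exit.
Variables (n : nat) (H : {set vert n * 'I_n}) (X : pred (vert n)) (u : vert n) (j : 'I_n).
Let q := flip u j.
Hypothesis uj : isf H u j.
Hypothesis Xq : ~~ X q.

Lemma card_healthy v : #|[set i | ~~ isf H v i]| + fd H v = n.
Proof.
rewrite addnC -[RHS](card_ord n) /fd -(cardsC [set i | isf H v i]); congr (_ + _).
by apply: eq_card => i; rewrite !inE.
Qed.

(** If a healthy neighbour of [u] is unmarked, it is an exit. Otherwise all healthy neighbours of
    [u] are marked, and by the count [X] consists of them alone. A vertex at distance two from [u],
    reached through [q], has just one common neighbour with [u] besides [q], and [q] is unmarked; so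
    among its neighbours at most one is marked. Two healthy neighbours of [q] other than [u] then
    allow reinserting [q]. *)
Lemma exit_card : fd H u + #|X| <= n -> fd H q + 2 <= n -> exit_ok (adjG H) X u q.
Proof.
move=> hu hq; pose N := [set i | ~~ isf H u i]; pose M := [set flip u i | i in N].
have cM : #|M| = #|N| by rewrite card_imset //; exact: flip_inj.
case: (pickP [pred i | (i \in N) && ~~ X (flip u i)]) => [i /andP[iN Xi]|no].
  left; exists (flip u i); split=> //; first by rewrite adjG_flip; move: iN; rewrite inE.
  by rewrite (inj_eq (@flip_inj _ u)); apply: contraTneq iN => ->; rewrite inE uj.
have MX : M =i X.
  apply/subset_cardP; last by apply/subsetP => v /imsetP[i iN ->]; have := no i; rewrite /= iN /= => /negbFE.
  apply/eqP; rewrite eqn_leq; apply/andP; split; last by rewrite cM -(leq_add2r (fd H u)) card_healthy addnC.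
  by apply/subset_leq_card/subsetP => v /imsetP[i iN ->]; have := no i; rewrite /= iN /= => /negbFE.
right; pose Q := [set i | ~~ isf H q i].
have cQ : 1 < #|Q| by rewrite -(leq_add2r (fd H q)) card_healthy addnC.
have [i1 [i2 [h1 h2 h12]]] := card_gt1P cQ.
have hQ i : i \in Q -> flip q i != u.
  rewrite inE; apply: contra => /eqP; rewrite -[u in RHS](flipK u j) -/q => /flip_inj->.
  by rewrite /q isf_flip.
exists (flip q i1), (flip q i2); split; last first.
  move=> b; rewrite !inE => bb; have [g gQ ->] : exists2 g, g \in Q & b = flip q g.
    by case/orP: bb => /eqP->; [exists i1|exists i2].
  move=> a w aw /adjGP[i ea _] /adjGP[k ew _]; apply/negP => /andP[Xa Xw].
  have key z h : z = flip (flip q g) h -> X z -> z = flip u g.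
    move=> ez Xz; have : z \in M by rewrite MX.
    case/imsetP => h' _ ez'; rewrite ez'; congr flip.
    have gj : g != j by apply: contraNneq (hQ g gQ) => ->; rewrite /q flipK.
    have h'j : h' != j by apply: contraNneq Xq => e; rewrite /q -e -ez'.
    have /ffunP/(_ j) : flip u h' = flip (flip (flip u j) g) h by rewrite -ez' ez.
    rewrite !flipE eqxx ![j == _]eq_sym (negPf gj) (negPf h'j) /=.
    have [ehj _|_] := eqVneq h j; last by case: (u j).
    have /ffunP/(_ h') : flip u h' = flip (flip (flip u j) g) h by rewrite -ez' ez.
    rewrite !flipE eqxx ehj (negPf h'j) /=; have [//|_] := eqVneq h' g.
    by case: (u h').
  by move: aw; rewrite (key _ _ ea Xa) (key _ _ ew Xw) eqxx.
split; rewrite ?hQ ?adjG_flip //; [by rewrite (inj_eq (@flip_inj _ q))|..].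
- by move: h1; rewrite inE.
by move: h2; rewrite inE.
Qed.
End Exit.

(** * Restoring a fault when the far half has few faults *)

Section RestoreCube.
Variables (n : nat) (d : 'I_n.+2) (G : {set vert n.+2 * 'I_n.+2}) (b : bool) (w : vert n.+1) (j : 'I_n.+1).
Let G0 := halfG d G b.
Let G1 := halfG d G (~~ b).
Let X := crossG d G.
Let q := flip w j.
Hypotheses (wj : isf G0 w j) (Xw : ~~ X w) (Xq : ~~ X q).
Hypothesis lG0 : lace (G0 :\ (low w j, j)).

(** Neighbours of [w] and neighbours of [q] have different parities, so each faulty crossing adds at
    most one edge to the fault set of [cube_special]. The enlarged set is still within the reach of
    [few_lace]. *)
Lemma special_few : #|X|.*2.+3 < 2 ^ n -> stro G1 -> #|G1| + #|X| <= n.-1 ->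
  ham (adjG G) (emb d (~~ b, w)) (emb d (~~ b, q)).
Proof.
move=> hX sG1 h; pose B (u : vert n.+1) := [set (low u k, k) | k in [set k | X (flip u k)]].
apply: (@cube_special _ d G b w j Xw Xq hX lG0 sG1 (G1 :|: (B w :|: B q))); first exact: subsetUl.
  move=> u k; rewrite !inE => uw Xk; rewrite /isf !in_setU.
  apply/or3P; case/orP: uw => /eqP e; subst u; [apply: Or32|apply: Or33];
    by apply/imsetP; exists k; rewrite ?inE.
apply: few_lace; apply: leq_trans h; apply: leq_trans (leq_card_setU _ _) _; rewrite leq_add2l.
pose g (u : vert n.+1) (f : vert n.+1 * 'I_n.+1) := flip u f.2.
have Bu u : #|B u| <= #|[set x | X x & parity x != parity u]|.
  have gi : {in B u &, injective (g u)}.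
    by move=> f f' /imsetP[k _ ->] /imsetP[k' _ ->] /flip_inj /= ->.
  rewrite -(card_in_imset gi); apply/subset_leq_card/subsetP => x /imsetP[f /imsetP[k + ->] ->].
  by rewrite !inE /g /= => ->; rewrite parity_flip; case: (parity u).
apply: leq_trans (leq_card_setU _ _) _; apply: leq_trans (leq_add (Bu w) (Bu q)) _.
have -> : #|X| = #|[set x | X x]| by rewrite cardsE.
rewrite -(cardsID [set x | parity x != parity w] [set x | X x]).
by apply/eq_leq; congr (_ + _); apply: eq_card => x; rewrite !inE ?parity_flip;
  case: (parity x); case: (parity w); case: (X x).
Qed.

(** The bound on the far half makes it strong, and the degree conditions at [w] and [q] give exits
    at both ends of the restored edge. *)
Lemma restore_lace : 2 < n -> #|G1| + #|X| <= n.-2 ->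
  (forall z, z \in [:: w; q] -> fd G0 z + #|X| <= n.+1 /\ fd G0 z + 2 <= n.+1) -> lace G.
Proof.
move=> n2 h hz x y xy.
have hX : #|X|.*2.+3 < 2 ^ n.
  have hXn : #|X| <= n.-2 by apply: leq_trans (leq_addl _ _) h.
  apply: (@leq_ltn_trans (n.-2).*2.+3); first by rewrite !ltnS leq_double.
  move: n2; clear; case: n => [|[|[|m]]] // _; rewrite /= -[m.+3]addn3 expnD.
  by have := ltn_expl m.+1 (ltnSn 1); rewrite expnS; lia.
have sG1 : stro G1.
  have : #|G1| <= n.-2 by apply: leq_trans (leq_addr _ _) h.
  move: n2; rewrite /G1; clear; case: n d G b => [|[|m]] d' G' b' // _; exact: few_stro.
have [zw1 zw2] := hz w (mem_head _ _).
have [zq1 zq2] : fd G0 q + #|X| <= n.+1 /\ fd G0 q + 2 <= n.+1 by apply: hz; rewrite !inE eqxx orbT.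
have hs : #|G1| + #|X| <= n.-1 by apply: leq_trans h _; clear; lia.
apply: (@cube_single _ d G b w j) => //.
- exact: exit_card.
- have : exit_ok (adjG G0) X q (flip q j) by apply: exit_card; rewrite ?isf_flip ?flipK.
  by rewrite flipK.
- by move=> -> ->; exact: special_few.
by move=> -> ->; apply: ham_rev; [exact: adjG_sym | exact: special_few].
Qed.
End RestoreCube.

(* lia does not see equations whose type is the eqType structure of nat. *)
Ltac nlia := repeat match goal with H : @eq _ ?a ?b |- _ => progress change (@eq nat a b) in H end; lia.

(** * Choice of directions and the case of dimension five *)

Lemma ex_fin (T : finType) (P : pred T) : (exists w : T, P w) \/ (forall w : T, ~~ P w).
Proof. by case: (pickP P) => [w h|no]; [left; exists w|right=> w; rewrite no]. Qed.
Definition ex_vert n (P : pred (vert n)) : (exists w : vert n, P w) \/ (forall w : vert n, ~~ P w) :=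
  @ex_fin {ffun 'I_n -> bool} P.
Definition ex_dir n (P : pred 'I_n) : (exists w : 'I_n, P w) \/ (forall w : 'I_n, ~~ P w) :=
  @ex_fin 'I_n P.

Lemma halfD1 n d (G : {set vert n.+1 * 'I_n.+1}) b u k :
  halfG d (G :\ (emb d (b, u), lift d k)) b = halfG d G b :\ (u, k).
Proof.
apply/setP => -[v l]; rewrite !inE /= !xpair_eqE; congr (~~ (_ && _) && _).
  by apply/eqP/eqP => [/(can_inj (embK d))[]|->].
by rewrite (inj_eq lift_inj).
Qed.

Lemma half_elem n d (G : {set vert n.+1 * 'I_n.+1}) b f : f \in G -> f.2 != d -> f.1 d = b ->
  exists u k, f = (emb d (b, u), lift d k) /\ (u, k) \in halfG d G b.
Proof.
case: f => v i /= fG; case: (unliftP d i) fG => [k|] -> fG; last by rewrite eqxx.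
move=> _ <-; exists (proj d v).2, k.
have e : emb d (v d, (proj d v).2) = v by rewrite -[RHS](projK d).
by rewrite e inE /= e.
Qed.

Lemma low_id n (u : vert n) k : ~~ u k -> low u k = u.
Proof. by move=> h; apply/ffunP => j; rewrite ffunE; have [->|] := eqVneq j k; rewrite ?(negPf h). Qed.

(** The form of [restore_lace] used in counting: [f] is a fault in the half of the centre [c], its
    ends cross safely in direction [d], and [vnum] bounds the faults of the far half together with
    the crossing ones. *)
Lemma restore_v n d (G : {set vert n.+2 * 'I_n.+2}) (c : vert n.+2) f : properG G -> f \in G ->
  d \notin viol c f -> (forall y, f \in inc G y -> ~~ isf G y d) ->
  lace (halfG d (G :\ f) (c d)) -> 2 < n -> vnum G c d <= n.-2 ->
  (forall y, f \in inc G y -> fd G y + vnum G c d <= n.+1 /\ fd G y + 2 <= n.+1) -> lace G.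
Proof.
move=> pG fG; rewrite inE negb_or negbK => /andP[fd1 /eqP fd2] hX lG n2 vn hf.
have [u [k [ef uk]]] := half_elem fG fd1 fd2; subst f.
have uk0 : ~~ u k by have := proper_half pG uk.
have hin z : z \in [:: u; flip u k] -> (emb d (c d, u), lift d k) \in inc G (emb d (c d, z)).
  rewrite !inE fG /= low_emb_lift => /orP[]/eqP->; by rewrite ?low_flip low_id.
have xz z : z \in [:: u; flip u k] -> ~~ crossG d G z.
  by move/hin/hX; rewrite isf_cross.
have le := light_vnum d G c.
apply: (@restore_lace n d G (c d) u k) => //.
- by rewrite /isf low_id.
- by apply: xz; rewrite inE eqxx.
- by apply: xz; rewrite !inE eqxx orbT.
- by rewrite low_id // -halfD1.
- exact: leq_trans le vn.
move=> z hz; have [h1 h2] := hf _ (hin z hz); have h3 := fd_half d G (c d) z.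
split; first by apply: leq_trans h1; apply: leq_add => //; apply: leq_trans le; exact: leq_addl.
by apply: leq_trans h2; rewrite leq_add2r.
Qed.

Lemma split_center n d (G : {set vert n.+2 * 'I_n.+2}) (c : vert n.+2) : #|G| < 2 ^ n ->
  lace (halfG d G (c d)) -> lace (halfG d G (~~ c d)) -> lace G.
Proof.
move=> hG l0 l1; apply: (@split_lace n d).
- by apply: leq_ltn_trans hG; apply: leq_trans (half_le d G true); exact: leq_addl.
- by case: (c d) l0 l1.
by case: (c d) l0 l1.
Qed.

Lemma half_fd n d (G : {set vert n.+1 * 'I_n.+1}) k : (forall u, fd G u <= k.+1) ->
  (forall u, fd G u = k.+1 -> isf G u d) -> forall b v, fd (halfG d G b) v <= k.
Proof.
move=> h1 h2 b v; have := h1 (emb d (b, v)); rewrite leq_eqVlt => /orP[/eqP e|].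
  by have := fd_half_isf (h2 _ e); rewrite e => -[->].
by rewrite ltnS; apply: leq_trans; exact: fd_half.
Qed.

(** A centre lying in the fuller half for every direction at once, so that the half opposite to it
    never has more than half of the faults. *)
Definition heavy n (G : {set vert n.+1 * 'I_n.+1}) : vert n.+1 :=
  [ffun d => #|halfG d G false| <= #|halfG d G true|].

Lemma heavyP n (G : {set vert n.+1 * 'I_n.+1}) d :
  (#|halfG d G (~~ heavy G d)|).*2 <= #|G|.
Proof.
rewrite ffunE; have e := card_split d G true; case: (leqP #|halfG d G false| #|halfG d G true|) => h; move: e h => /=; clear; lia.
Qed.

Lemma viol_avg n (G : {set vert n * 'I_n}) c (D : {set 'I_n}) k :
  (forall d, d \in D -> vnum G c d <= k) -> \sum_(f in G) #|viol c f :&: D| <= k * #|D|.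
Proof.
move=> h; rewrite -viol_sum; apply: (@leq_trans (\sum_(d in D) k)); first exact: leq_sum.
by rewrite sum_nat_const mulnC.
Qed.

Lemma exists_viol n (G : {set vert n * 'I_n}) c k : properG G -> k * n + fd G c < (#|G|).*2 ->
  exists d, k < vnum G c d.
Proof.
move=> pG h; case: (pickP [pred d | k < vnum G c d]) => [d hd|no]; first by exists d.
have := @viol_avg n G c setT k (fun d _ => ltac:(by rewrite leqNgt; have /= -> := no d)).
rewrite cardsT card_ord (eq_bigr (fun f => #|viol c f|)); last by move=> f _; rewrite setIT.
by move=> h1; have := leq_trans h (leq_trans (viol_total c pG) (leq_add h1 (leqnn _))); rewrite ltnn.
Qed.

Lemma vnum_pos n (G : {set vert n * 'I_n}) c d : isf G c d -> 0 < vnum G c d.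
Proof. by move=> h; apply/card_gt0P; exists (low c d, d); rewrite !inE eqxx andbT. Qed.

Lemma vnum1 n (G : {set vert n * 'I_n}) c d f : isf G c d -> vnum G c d <= 1 ->
  f \in G -> d \in viol c f -> f = (low c d, d).
Proof.
move=> h h1 fG df; apply: (card_le1_eqP h1); by rewrite inE ?fG // !inE eqxx andbT.
Qed.

Lemma other_half n d (G : {set vert n.+1 * 'I_n.+1}) (c : vert n.+1) :
  #|halfG d G (~~ c d)| + fd G c <= #|G|.
Proof.
rewrite card_half -card_inc -(cardsID (inc G c) G) addnC (setIidPr (inc_sub G c)) leq_add2l.
apply/subset_leq_card/subsetP => f; rewrite !inE => /and3P[h1 h2 h3]; rewrite h1 andbT /=.
by apply: contraTN h3 => /eqP->; rewrite ffunE (eq_sym d) h2 /=; case: (c d).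
Qed.

(** A direction is sought that leaves at most three faults in each half and is faulty at each vertex
    with three faults. With no such vertex, averaging finds it. Two such vertices share one of the
    five faults, and its direction works; a third one would be adjacent to both, against parity.
    With a single such vertex [w], the obstruction is that there are five faults and each faulty
    direction at [w] is violated only once; then a fault away from [w] is restored. *)
Theorem q5_five (G : {set vert 5 * 'I_5}) :
  properG G -> #|G| <= 5 -> (forall u, fd G u <= 3) -> lace G.
Proof.
move=> pG cG dG.
have join d (c : vert 5) : #|halfG d G (c d)| <= 3 -> #|halfG d G (~~ c d)| <= 3 ->
    (forall u, fd G u = 3 -> isf G u d) -> lace G.
  move=> h1 h2 h3; have hf := half_fd dG h3.
  refine (@split_center 3 d G c _ _ _); first by apply: leq_ltn_trans cG _.
    by apply: q4_three => //; exact: proper_half.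
  by apply: q4_three => //; exact: proper_half.
case: (ex_vert (fun w => fd G w == 3)) => [[w /eqP fw]|no]; last first.
  have d2 u : fd G u <= 2 by have := dG u; rewrite leq_eqVlt (negPf (no u)).
  have [d hd] : exists d, #|G| <= vnum G (heavy G) d + 3.
    have [h|h] := leqP #|G| 3; first by exists ord0; apply: leq_trans h (leq_addl _ _).
    have [|d hd] := @exists_viol _ G (heavy G) (#|G| - 4) pG; last by exists d; nlia.
    by have := d2 (heavy G); nlia.
  apply: (@join d (heavy G)).
  - by have := half_vnum d G (heavy G); nlia.
  - by have := heavyP G d; nlia.
  by move=> u e; have := d2 u; rewrite e.
case: (ex_vert (fun u => (u != w) && (fd G u == 3))) => [[u /andP[uw /eqP fu]]|no].
  have [f fi] : exists f, f \in inc G u :&: inc G w.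
    apply/set0Pn; rewrite -card_gt0.
    have := cardsUI (inc G u) (inc G w); rewrite !card_inc fu fw.
    have : #|inc G u :|: inc G w| <= #|G| by rewrite subset_leq_card // subUset !inc_sub.
    nlia.
  move: fi; rewrite inE => /andP[fu' fw']; have [eu hi] := inc2 fu' fw' uw.
  pose d := f.2.
  apply: (@join d w).
  - have := other_half d G u; have -> : ~~ u d = w d by rewrite eu flipE eqxx negbK.
    by nlia.
  - by have := other_half d G w; nlia.
  move=> z fz; have [->//|zw] := eqVneq z w.
  have [->|zu] := eqVneq z u; first by rewrite eu isf_flip.
  have adj v v' : v' != v -> fd G v = 3 -> fd G v' = 3 -> exists i, v' = flip v i.
    move=> vv e e'; suff [g] : exists g, g \in inc G v' :&: inc G v.
      by rewrite inE => /andP[g1 g2]; exists g.2; case: (inc2 g1 g2 vv).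
    apply/set0Pn; rewrite -card_gt0.
    have := cardsUI (inc G v') (inc G v); rewrite !card_inc e e'.
    have : #|inc G v' :|: inc G v| <= #|G| by rewrite subset_leq_card // subUset !inc_sub.
    nlia.
  have [i ei] := adj _ _ zw fw fz; have [k ek] := adj _ _ zu fu fz.
  by have := parity_flip w i; rewrite -ei ek parity_flip eu parity_flip negbK; case: (parity w).
have uniqw u : fd G u = 3 -> u = w.
  by move=> e; apply/eqP; have := no u; rewrite e eqxx andbT negbK.
have [d dS hd] : exists2 d, isf G w d & (#|G| <= vnum G w d + 3) || [forall d, isf G w d ==> (vnum G w d + 3 < #|G|)].
  case: (ex_dir (fun d => isf G w d && (#|G| <= vnum G w d + 3))) => [[d /andP[h1 h2]]|no'].
    by exists d; rewrite ?h2.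
  have : 0 < #|[set i | isf G w i]| by rewrite -/(fd G w) fw.
  case/card_gt0P => d; rewrite inE => dS; exists d => //; apply/orP; right.
  by apply/forallP => i; apply/implyP => hi; have := no' i; rewrite hi /= -ltnNge.
case/orP: hd => hd.
  apply: (@join d w).
  - by have := half_vnum d G w; nlia.
  - by have := other_half d G w; nlia.
  by move=> u /uniqw->.
have v1 : vnum G w d = 1 /\ #|G| = 5.
  by have := vnum_pos dS; have := implyP (forallP hd d) dS; nlia.
case: v1 => v1 c5.
have : 0 < #|G :\: inc G w|.
  by have := cardsID (inc G w) G; rewrite (setIidPr (inc_sub G w)) card_inc; nlia.
case/card_gt0P => f; rewrite inE => /andP[fi fG].
have fv : d \notin viol w f.
  apply: contra fi => h; rewrite (vnum1 dS _ fG h) ?v1 //; exact: inc_isf.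
apply: (@restore_v 3 d G w f) => //.
- move=> y fy; apply: contra fi => yd.
  have ey : (low y d, d) = (low w d, d) by apply: (vnum1 dS) => //; rewrite ?v1 // inE eqxx.
  have [e|e] : y = w \/ y = flip w d by apply: low_inj2; case: ey.
    by rewrite -e.
  move: fy fv; rewrite e !inE => /andP[_ /eqP->]; rewrite negb_or negbK => /andP[h].
  by rewrite !ffunE (eq_sym d) h eqxx /=; case: (w d).
- have sub : G :\ f \subset G by exact: subD1set.
  apply: q4_three.
  + apply: proper_half => g; rewrite inE => /andP[_]; exact: pG.
  + have [u [k [ef uk]]] : exists u k, f = (emb d (w d, u), lift d k) /\ (u, k) \in halfG d G (w d).
      by apply: half_elem => //; move: fv; rewrite inE negb_or negbK => /andP[? /eqP].
    rewrite ef halfD1; have e := cardsD1 (u, k) (halfG d G (w d)); rewrite uk add1n in e; rewrite -ltnS -e.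
    by have hv := half_vnum d G w; rewrite v1 c5 addn1 in hv; case: hv => ->.
  move=> v; apply: leq_trans (half_fd dG (d := d) _ (w d) v).
    by rewrite /fd; apply/subset_leq_card/subsetP => i; rewrite !inE /isf !inE => /andP[].
  by move=> u /uniqw->.
- by rewrite v1.
move=> y fy; have : fd G y <= 2.
  have := dG y; rewrite leq_eqVlt => /orP[/eqP/uniqw e|//].
  by rewrite -e fy in fi.
by rewrite v1 => h; split; nlia.
Qed.

(** * A vertex of degree two and the inductive statement *)

Section OneLow.
Variables (n : nat) (G : {set vert n * 'I_n}) (w : vert n).
Hypothesis pG : properG G.
Let S := [set i | isf G w i].

Lemma inc_viol f : f \in inc G w -> f.2 \in viol w f :&: S.
Proof. by case: f => u i; rewrite !inE /= eqxx => /andP[h /eqP e]; rewrite /isf -e. Qed.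

(** The faults counted lie in the subcube through [w] spanned by its healthy directions, of
    dimension at most two, and do not touch [w]. A square has one such edge for each of its two
    directions. *)
Lemma flat_card : #|~: S| <= 2 ->
  #|[set f in G | (f \notin inc G w) && (viol w f :&: S == set0)]| <= #|~: S|.
Proof.
have noS f k : viol w f :&: S = set0 -> k \in viol w f -> k \in S -> False.
  by move=> /setP/(_ k) + h1 h2; rewrite in_set0 in_setI h1 h2.
move=> c2; set A := [set f in G | _].
have hA f : f \in A -> [/\ f \in G, f.2 \in ~: S & exists2 k, k \in ~: S & (k != f.2) && (f.1 k != w k)].
  rewrite inE => /and3P[fG fi /eqP v0].
  have f2 : f.2 \in ~: S.
    rewrite in_setC; apply/negP; exact: noS v0 (viol_self w f).
  split=> //; case: (ex_dir (fun k => (k != f.2) && (f.1 k != w k))) => [[k hk]|no].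
    exists k => //; rewrite in_setC; apply/negP; apply: noS v0 _.
    by rewrite inE; case/andP: hk => _ ->; rewrite orbT.
  case/negP: fi; apply: viol_center => //; apply: (@leq_trans #|[set f.2]|); last by rewrite cards1.
  apply/subset_leq_card/subsetP => k; rewrite !inE => /orP[/eqP->//|hk].
  by have := no k; rewrite hk andbT negbK.
have inj : {in A &, injective (fun f : vert n * 'I_n => f.2)}.
  move=> f g fA gA e; have [fG f2 [k hk /andP[kf kw]]] := hA f fA.
  have [gG g2 [l hl /andP[lg lw]]] := hA g gA.
  have kl : k = l.
    apply/eqP; apply: contraTT c2 => kl; rewrite -ltnNge.
    apply: (@leq_trans #|[set f.2; k; l]|).
      by rewrite -setUA cardsU1 cards2 !inE kl eq_sym (negPf kf) e eq_sym (negPf lg).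
    by apply/subset_leq_card/subsetP => z; rewrite 2!in_setU !in_set1 => /orP[/orP[]|] /eqP->.
  subst l; case: f g fA gA e fG f2 kf kw gG g2 lg lw => [u i] [v j] uA vA /= ij; subst j.
  move=> fG f2 kf kw gG g2 lg lw; congr pair; apply/ffunP => z.
  have [->|zi] := eqVneq z i; first by have := pG fG; have := pG gG; rewrite /= => /negPf-> /negPf->.
  have [->|zk] := eqVneq z k; first by move: kw lw; case: (u k); case: (v k); case: (w k).
  have flat (a : vert n) : (a, i) \in A -> a z = w z.
    rewrite inE => /and3P[_ _ /eqP v0]; apply/eqP; apply: contraTT c2 => zw; rewrite -ltnNge.
    have zS : z \in ~: S.
      by rewrite in_setC; apply/negP; apply: noS v0 _; rewrite inE /= zw orbT.
    apply: (@leq_trans #|[set i; k; z]|).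
      by rewrite -setUA cardsU1 cards2 !inE (eq_sym k) zk eq_sym (negPf kf) eq_sym (negPf zi).
    by apply/subset_leq_card/subsetP => t; rewrite 2!in_setU !in_set1 => /orP[/orP[]|] /eqP->.
  by rewrite !flat.
have sub : [set f.2 | f in A] \subset ~: S by apply/subsetP => i /imsetP[f /hA[_ + _] ->].
by rewrite -(card_in_imset inj); apply: subset_leq_card.
Qed.
End OneLow.

(** All faults but two violate some direction that is faulty at [w]; a fault at [w] violates its
    own. *)
Lemma low_sum n (G : {set vert n * 'I_n}) w : properG G -> n <= fd G w + 2 ->
  #|G| <= \sum_(d in [set i | isf G w i]) vnum G w d + 2.
Proof.
move=> pG hw; set S := [set i | isf G w i].
have cS : #|~: S| <= 2.
  have := cardsC S; rewrite card_ord; change #|S| with (fd G w); move: hw; clear; lia.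
rewrite viol_sum; set A := [set f in G | (f \notin inc G w) && (viol w f :&: S == set0)].
have hA : #|A| <= 2 by apply: leq_trans (flat_card pG cS) cS.
have sub : A \subset G by apply/subsetP => f; rewrite inE => /andP[].
apply: (@leq_trans (#|G :\: A| + #|A|)); first by rewrite addnC -(cardsID A G) (setIidPr sub).
apply: leq_add => //; rewrite (big_setID A) /= (setIidPr sub).
apply: leq_trans (leq_addl _ _); rewrite -sum1_card; apply: leq_sum => f; rewrite inE => /andP[fA fG].
rewrite card_gt0; apply: contra fA => /eqP v0; rewrite inE fG v0 eqxx andbT /=.
by apply/negP => /inc_viol; rewrite v0 inE.
Qed.

(** In dimensions 5 and 6 this exceeds 4m-17. The differences of successive values from dimension 4
    on are 2, 3, 3 and then always 4: this is how many faults a splitting must remove from a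
    half. *)
Definition bnd m := if m <= 4 then 3 else if m == 5 then 5 else if m == 6 then 8 else 4 * m - 17.
Arguments bnd : simpl never.

Definition good m (G : {set vert m * 'I_m}) := [/\ properG G, #|G| <= bnd m, forall u, fd G u + 2 <= m
  & forall u v, fd G u + 2 = m -> fd G v + 2 = m -> m <= 5 \/ u = v].
Definition T m := 4 <= m -> forall G : {set vert m * 'I_m}, good G -> lace G.

Lemma exp_gt n k : 4 <= n -> k <= 4 * n - 1 -> k < 2 ^ n.
Proof.
move=> n4 h; suff : 4 * n - 1 < 2 ^ n by move: h; clear; lia.
elim: n n4 {h} => // n IH; rewrite leq_eqVlt => /orP[/eqP[<-]//|n4].
by have := IH n4; rewrite expnS; move: n4; clear; lia.
Qed.

Lemma good_half n d (G : {set vert n.+2 * 'I_n.+2}) b : properG G -> #|halfG d G b| <= bnd n.+1 ->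
  (forall u : vert n.+2, u d = b -> fd G u + 1 <= n + isf G u d) -> 0 < n ->
  (forall u v : vert n.+2, u d = b -> v d = b -> fd G u + 1 = n + isf G u d -> fd G v + 1 = n + isf G v d -> n <= 4 \/ u = v) ->
  good (halfG d G b).
Proof.
move=> pG h1 h2 n0 h3.
have e v : fd G (emb d (b, v)) = fd (halfG d G b) v + isf G (emb d (b, v)) d by rewrite (fd_split d G b v) isf_cross.
split=> //; first exact: proper_half.
  by move=> v; have := h2 (emb d (b, v)) (emb_d d _); rewrite e; lia.
move=> u v hu hv; have [|||||/(can_inj (embK d))[->]] := h3 (emb d (b, u)) (emb d (b, v)); rewrite ?emb_d ?e //; [lia|lia|left; lia|by right].
Qed.

(** A vertex keeps its degree in its half exactly if its edge in direction [d] is faulty; this is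
    the role of [isf G u d]. The last two hypotheses are the degree conditions of [good] for the
    halves. *)
Lemma join_T n d (G : {set vert n.+2 * 'I_n.+2}) (c : vert n.+2) : T n.+1 -> properG G -> 4 <= n ->
  #|G| <= 4 * n - 1 -> #|G| <= vnum G c d + bnd n.+1 -> #|halfG d G (~~ c d)| <= bnd n.+1 ->
  (forall u : vert n.+2, fd G u + 1 <= n + isf G u d) ->
  (forall u v : vert n.+2, u d = v d -> fd G u + 1 = n + isf G u d -> fd G v + 1 = n + isf G v d -> n <= 4 \/ u = v) ->
  lace G.
Proof.
move=> tn pG n4 cG h1 h2 h3 h4; apply: (@split_center n d G c); first exact: exp_gt.
  apply: tn; [by move: n4; clear; lia|apply: good_half => //].
  - by have := half_vnum d G c; move: h1; clear; lia.
  - by move: n4; clear; lia.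
  by move=> u v ud vd; apply: h4; rewrite ud vd.
apply: tn; [by move: n4; clear; lia|apply: good_half => //].
  by move: n4; clear; lia.
by move=> u v ud vd; apply: h4; rewrite ud vd.
Qed.

Lemma inc_end n (G : {set vert n * 'I_n}) y c f d : f \in inc G y -> d \notin viol c f -> y d = c d.
Proof.
case: f => u i; rewrite !inE negb_or negbK /= => /andP[_ /eqP->] /andP[id] /eqP<-.
by rewrite ffunE eq_sym id.
Qed.

Lemma low_same n (y w : vert n) d : low y d = low w d -> y d = w d -> y = w.
Proof. by move=> h e; have [//|h'] := low_inj2 h; move: e; rewrite h' flipE eqxx; case: (w d). Qed.

Lemma isf_viol n (G : {set vert n * 'I_n}) c y d : isf G y d -> (low y d, d) \in [set f in G | d \in viol c f].
Proof. by move=> h; rewrite inE (_ : _ \in G) // inE eqxx. Qed.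

(** Excluded are the faults violating [d], those at [w], and those at the endpoint [y_of], on the
    side of [w], of another fault in direction [d]. Each of these endpoints excludes at most [t]
    further faults, so the counting hypothesis leaves a fault to restore. *)
Lemma find_restore n (G : {set vert n * 'I_n}) w d t : properG G -> isf G w d -> (forall u, u != w -> fd G u <= t.+1) ->
  vnum G w d + (fd G w).-1 + (vnum G w d).-1 * t < #|G| ->
  exists f, [/\ f \in G, d \notin viol w f, f \notin inc G w & forall y, f \in inc G y -> ~~ isf G y d].
Proof.
move=> pG wd ht hc; pose V := [set f in G | d \in viol w f].
pose e := (low w d, d); have eV : e \in V by exact: isf_viol.
have ee : e \in inc G w by exact: inc_isf.
pose C := [set f in V | f.2 == d] :\ e.
pose y_of (g : vert n * 'I_n) : vert n := if g.1 d == w d then g.1 else flip g.1 d.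
have ylow g : g \in G -> g.2 = d -> low (y_of g) d = g.1.
  move=> gG g2; have := pG _ gG; rewrite g2 => h.
  by rewrite /y_of; case: ifP => _; rewrite ?low_flip low_id.
pose bad := V :|: (inc G w :\ e) :|: \bigcup_(g in C) (inc G (y_of g) :\ g).
have cb : #|bad| < #|G|.
  apply: leq_ltn_trans hc; apply: leq_trans (leq_card_setU _ _) _; apply: leq_add.
    apply: leq_trans (leq_card_setU _ _) _; rewrite leq_add2l -card_inc.
    by have := cardsD1 e (inc G w); rewrite ee; by move=> ->.
  have cC : #|C| <= (vnum G w d).-1.
    have -> : (vnum G w d).-1 = #|V :\ e| by have := cardsD1 e V; rewrite eV; rewrite -/(vnum G w d) => ->.
    by apply: subset_leq_card; apply: setSD; apply/subsetP => f; rewrite inE => /andP[].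
  apply: leq_trans (leq_mul cC (leqnn t)); rewrite -sum_nat_const.
  elim/big_rec2: _ => [|g k B gC IH]; first by rewrite cards0.
  apply: leq_trans (leq_card_setU _ _) _; apply: leq_add IH.
  move: gC; rewrite !inE => /andP[ge /andP[/andP[gG _] /eqP g2]].
  have gi : g \in inc G (y_of g) by rewrite inE gG /= g2 ylow.
  suff : #|inc G (y_of g)| <= t.+1 by rewrite (cardsD1 g) gi.
  rewrite card_inc ht //; apply: contra ge => /eqP yw.
  by rewrite /e -yw ylow // -g2 -surjective_pairing.
have [f] : exists f, f \in G :\: bad.
  apply/set0Pn; rewrite -card_gt0; have := cardsID bad G; have := subset_leq_card (subsetIr G bad).
  by move: cb; clear; lia.
rewrite in_setD /bad !in_setU negb_or negb_or => /andP[/andP[/andP[fV fw] fC] fG].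
have fv : d \notin viol w f by move: fV; rewrite inE fG.
have fi : f \notin inc G w.
  by apply: contra fw => h; rewrite in_setD1 h andbT; apply: contra fV => /eqP->.
exists f; split=> // y fy; apply: contra fC => yd; have yw := inc_end fy fv.
have gV := isf_viol w yd; have ne : (low y d, d) != e.
  by apply: contra fi => /eqP[/low_same/(_ yw) <-].
have gC : (low y d, d) \in C by rewrite in_setD1 ne inE gV eqxx.
apply/bigcupP; exists (low y d, d) => //; have -> : y_of (low y d, d) = y.
  apply: (@low_same _ _ _ d); first by rewrite ylow //; move: gV; rewrite inE => /andP[].
  by rewrite yw /y_of /=; case: eqP => // /eqP; rewrite flipE eqxx; case: (low y d d); case: (w d).
rewrite in_setD1 fy andbT; apply: contraNneq fV => ->; exact: gV.
Qed.

Lemma bndP n : 4 <= n -> (n = 4 /\ bnd n.+1 = 5 /\ bnd n.+2 = 8) \/ (n = 5 /\ bnd n.+1 = 8 /\ bnd n.+2 = 11) \/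
  (6 <= n /\ bnd n.+1 = 4 * n - 13 /\ bnd n.+2 = 4 * n - 9).
Proof.
move: n => [|[|[|[|[|[|n]]]]]] // _; [by left|by right; left|right; right].
by rewrite /bnd /=; split=> //; split; lia.
Qed.

(** * At most one vertex of low degree *)

Section Few.
Variables (n : nat) (G : {set vert n.+2 * 'I_n.+2}).
Hypotheses (tn : T n.+1) (pG : properG G) (n4 : 4 <= n) (cG : #|G| <= bnd n.+2).

Let cG' : #|G| <= 4 * n - 1.
Proof. by move: cG (bndP n4); clear; lia. Qed.

(** All degrees are at least three, so any direction keeps them at least two in the halves.
    Averaging around the heavy centre finds one that removes enough faults. *)
Lemma no_low : (forall u : vert n.+2, fd G u + 1 <= n) ->
  (forall u v : vert n.+2, fd G u + 1 = n -> fd G v + 1 = n -> n <= 4 \/ u = v) -> lace G.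
Proof.
move=> h1 h2.
have [d hd] : exists d, #|G| <= vnum G (heavy G) d + bnd n.+1.
  have [h|h] := leqP #|G| (bnd n.+1); first by exists ord0; exact: leq_trans h (leq_addl _ _).
  have [|d hd] := @exists_viol _ G (heavy G) (#|G| - (bnd n.+1).+1) pG.
    have := h1 (heavy G); move: (fd G _) h cG (bndP n4) => x; clear.
    set g := #|G|; clearbody g => h cG B.
    have k3 : g - (bnd n.+1).+1 <= 3 by lia.
    by case E: (g - _) k3 => [|[|[|[|]]]] // _; lia.
  by exists d; lia.
apply: (@join_T n d G (heavy G)) => //.
- rewrite -leq_double; apply: leq_trans (heavyP G d) _; move: cG (bndP n4); clear; lia.
- by move=> u; apply: leq_trans (h1 u) (leq_addr _ _).
move=> u v _ hu hv; have := h1 u; have := h1 v; case: (isf G u d) hu => hu; case: (isf G v d) hv => hv /=; try lia.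
by rewrite !addn0 in hu hv => _ _; exact: h2.
Qed.

(** Only directions faulty at [w] are admissible. By [low_sum] one of them is violated often enough
    or falls short by one. In the second case [find_restore] supplies a fault to restore. *)
Lemma one_low w t : fd G w = n -> (forall u, u != w -> fd G u <= t.+1) ->
  t + 2 <= n -> n <= 4 \/ t + 3 <= n -> lace G.
Proof.
move=> fw ht t2 t3; have B := bndP n4.
have h3 d : isf G w d -> forall u : vert n.+2, fd G u + 1 <= n + isf G u d.
  move=> wd u; have [->|uw] := eqVneq u w; first by rewrite wd fw.
  by apply: leq_trans (leq_addr _ _); have := ht u uw; move: t2; clear; lia.
have h4 d : isf G w d -> forall u v : vert n.+2, fd G u + 1 = n + isf G u d -> fd G v + 1 = n + isf G v d -> n <= 4 \/ u = v.
  move=> wd u v hu hv; case: t3 => [|t3]; first by left.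
  right; suff k z : fd G z + 1 = n + isf G z d -> z = w by rewrite (k u hu) (k v hv).
  by move=> hz; apply/eqP; apply: contraT => /ht; move: hz t3; clear; lia.
case: (ex_dir (fun d => isf G w d && (#|G| <= vnum G w d + bnd n.+1))) => [[d /andP[wd hd]]|no].
  apply: (@join_T n d G w) => //; last by move=> u v _; exact: h4.
  - by have := other_half d G w; move: fw cG B; clear; lia.
  exact: h3.
have [d wd hd] : exists2 d, isf G w d & #|G| <= vnum G w d + (bnd n.+1).+1.
  case: (ex_dir (fun d => isf G w d && (#|G| <= vnum G w d + (bnd n.+1).+1))) => [[d /andP[wd hd]]|no'].
    by exists d.
  have := @low_sum _ G w pG; rewrite fw addn2 => /(_ (leqnn _)).
  have : \sum_(d in [set i | isf G w i]) vnum G w d <= \sum_(d in [set i | isf G w i]) (#|G| - (bnd n.+1).+2).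
    by apply: leq_sum => d; rewrite inE => wd; have := no' d; rewrite wd /=; clear; lia.
  rewrite sum_nat_const; change #|[set i | isf G w i]| with (fd G w); rewrite fw.
  have : 0 < #|[set i | isf G w i]| by change (0 < fd G w); rewrite fw; move: n4; clear; lia.
  case/card_gt0P => d0; rewrite inE => wd0; have := no' d0; rewrite wd0 /=; have := vnum_pos wd0.
  move: (vnum G w d0) (\sum_(_ in _) _) cG B; set g := #|G|; clearbody g; clear => v0 s cG B v1 hv hs1 hs2.
  have k3 : g - (bnd n.+1).+2 <= 2 by lia.
  by move: hs1; case E: (g - _) k3 => [|[|[|]]] // _; lia.
have hv : #|G| = vnum G w d + (bnd n.+1).+1.
  by have := no d; rewrite wd; move: hd; clear; lia.
have v1 := vnum_pos wd.
have v3 : vnum G w d <= 3 by move: hv cG B; clear; lia.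
have [|f [fG fv fi fe]] := @find_restore _ G w d t pG wd ht.
  rewrite fw hv; move: v1 v3 hv cG B t2 t3; clear; set g := #|G|; clearbody g; case: (vnum G w d) => [|[|[|[|]]]] //= _ _; rewrite ?mul0n ?mul1n; lia.
have fy y : f \in inc G y -> fd G y <= t.+1.
  by move=> h; apply: ht; apply: contraNneq fi => <-.
have v2 : vnum G w d <= n.-2 by move: v3 hv cG B; clear; lia.
have sG : G :\ f \subset G by exact: subD1set.
apply: (@restore_v n d G w f) => //.
- apply: tn; first by move: n4; clear; lia.
  have e := half_vnum d G w.
  have le u : fd (G :\ f) u <= fd G u := fdS u sG.
  have iE (u : vert n.+2) : isf (G :\ f) u d = isf G u d.
    rewrite /isf in_setD1; case: eqP => // ef; case/negP: fv; rewrite -ef; exact: viol_self.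
  apply: good_half; last 1 [idtac] || idtac.
  + by move=> g /(subsetP sG); exact: pG.
  + have [|||u [k [ef uk]]] := @half_elem _ d G (w d) f => //.
    * by move: fv; rewrite inE negb_or => /andP[].
    * by move: fv; rewrite inE negb_or negbK => /andP[_ /eqP].
    rewrite ef halfD1; have e2 := cardsD1 (u, k) (halfG d G (w d)); rewrite uk add1n in e2.
    by rewrite -ltnS -e2 -(leq_add2r (vnum G w d)) e hv addnC.
  + by move=> u _; rewrite iE; apply: leq_trans (h3 d wd u); rewrite leq_add2r.
  + by move: n4; clear; lia.
  move=> u v _ _; rewrite !iE => hu hv'; apply: (h4 d wd).
    by have := h3 d wd u; have := le u; move: hu; clear; lia.
  by have := h3 d wd v; have := le v; move: hv'; clear; lia.
- by move: n4; clear; lia.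
move=> y /fy h; split; move: h v2 v3 t2 t3 B hv cG; clear; lia.
Qed.
End Few.

Lemma T4 : T 4.
Proof. by move=> _ G [h1 h2 h3 _]; apply: q4_three => // u; have := h3 u; clear; lia. Qed.
Lemma T5 : T 5.
Proof. by move=> _ G [h1 h2 h3 _]; apply: q5_five => // u; have := h3 u; clear; lia. Qed.

Lemma T6 : T 6.
Proof.
move=> _ G [pG cG h1 h2].
case: (ex_vert (fun w : vert 6 => fd G w == 4)) => [[w /eqP fw]|no].
  apply: (@one_low 4 G T5 pG isT cG w 2) => //; last by left.
  move=> u uw; have := h1 u; rewrite !addn2 !ltnS leq_eqVlt => /orP[/eqP e|] //.
  by case: (h2 u w) => [|||h] //; [lia|lia|rewrite h eqxx in uw].
apply: (@no_low 4 G T5) => // [u|u v _ _]; last by left.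
by have := h1 u; have := no u; clear; lia.
Qed.

(** * Restoring a fault with a weaker condition on the far half *)

Section Fix.
Variables (n : nat) (d : 'I_n.+2) (G : {set vert n.+2 * 'I_n.+2}).
Let X := crossG d G.

(* The faults of the half away from [w], together with the edges at [w] and [flip w k] leading to crossing faults. *)
Definition spec b (w : vert n.+1) k : {set vert n.+1 * 'I_n.+1} := halfG d G (~~ b) :|:
  [set f : vert n.+1 * 'I_n.+1 | [exists u, [&& u \in [:: w; flip w k], f.1 == low u f.2 & X (flip u f.2)]]].

Lemma isf_spec b w k z i : isf (spec b w k) z i -> [\/ isf (halfG d G (~~ b)) z i,
  z \in [:: w; flip w k] /\ X (flip z i) | X z /\ flip z i \in [:: w; flip w k]].
Proof.
rewrite {1}/isf in_setU => /orP[h|]; first by apply: Or31.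
rewrite inE => /existsP[u /and3P[uw /eqP /= h Xu]].
case: (low_inj2 h) => ->; first by apply: Or32.
by apply: Or33; rewrite flipK.
Qed.

Lemma spec_in b w k u i : u \in [:: w; flip w k] -> X (flip u i) -> isf (spec b w k) u i.
Proof. by move=> h Xu; rewrite /isf in_setU; apply/orP; right; rewrite inE; apply/existsP; exists u; rewrite h eqxx. Qed.

Lemma proper_spec b w k : properG G -> properG (spec b w k).
Proof.
move=> pG f; rewrite in_setU => /orP[|]; first exact: proper_half.
by rewrite inE => /existsP[u /and3P[_ /eqP-> _]]; rewrite ffunE eqxx.
Qed.

(** Each added edge is sent by [g] to the crossing fault it leads to. Neighbours of [w] and of
    [flip w k] have different parities, so [g] is injective. *)
Lemma card_spec b w k : #|spec b w k| <= #|halfG d G (~~ b)| + #|X|.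
Proof.
apply: leq_trans (leq_card_setU _ _) _; rewrite leq_add2l.
set S := [set f | _]; pose g (f : vert n.+1 * 'I_n.+1) : vert n.+1 :=
  if f.1 == low w f.2 then (if X (flip w f.2) then flip w f.2 else flip (flip w k) f.2) else flip (flip w k) f.2.
have hS f : f \in S -> (f.1 = low w f.2 /\ X (flip w f.2)) \/ (f.1 = low (flip w k) f.2 /\ X (flip (flip w k) f.2)).
  by rewrite inE => /existsP[u /and3P[]]; rewrite !inE => /orP[]/eqP-> /eqP h1 h2; [left|right].
have gS f : f \in S -> (f.1 = low w f.2 /\ X (flip w f.2) /\ g f = flip w f.2) \/
   (f.1 = low (flip w k) f.2 /\ X (flip (flip w k) f.2) /\ g f = flip (flip w k) f.2).
  move=> fS; rewrite /g; case: eqP => [e|e].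
    case: ifP => h; first by left.
    by right; case: (hS f fS) => -[h1 h2]; rewrite ?h2 // in h *.
  by case: (hS f fS) => -[h1 h2] //; right.
rewrite -(card_in_imset (f := g)); last first.
  have pp i j : flip w i <> flip (flip w k) j.
    by move=> /(congr1 (@parity n.+1)); rewrite !parity_flip; case: (parity w).
  move=> [a i] [a' i'] /gS /= h /gS /= h' e.
  case: h => -[h1 [h2 h3]]; case: h' => -[h1' [h2' h3']]; rewrite h3 h3' in e.
  - by rewrite h1 h1' (flip_inj e).
  - by case: (pp _ _ e).
  - by case: (pp _ _ (esym e)).
  by rewrite h1 h1' (flip_inj e).
apply/subset_leq_card/subsetP => x /imsetP[f /gS h ->].
by case: h => -[_ [h ->]].
Qed.

(** Three sources of [exit_ok], phrased in the whole cube: a neighbour that crosses safely, the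
    count of [exit_card], or two neighbours beside which the other end can be reinserted. *)
Definition exitv (u : vert n.+2) j :=
  [\/ exists i, [/\ i != d, ~~ isf G u i & ~~ isf G (flip u i) d],
      fd G u + #|X| <= n.+1 /\ fd G (flip u j) + 2 <= n.+1
    | exists i1 i2, [/\ i1 != i2, ~~ isf G (flip u j) i1 & ~~ isf G (flip u j) i2] /\ 
      forall i, i \in [:: i1; i2] -> i != d /\
        forall k l, k != l -> ~~ (isf G (flip (flip (flip u j) i) k) d && isf G (flip (flip (flip u j) i) l) d)].

Lemma exitvP b u k : isf G (emb d (b, u)) (lift d k) -> ~~ X (flip u k) ->
  exitv (emb d (b, u)) (lift d k) -> exit_ok (adjG (halfG d G b)) X u (flip u k).
Proof.
move=> uk Xq [[i [id h1 h2]]|[h1 h2]|[i1 [i2 [[n12 h1 h2] h3]]]].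
- left; case: (unliftP d i) id h1 h2 => [l|] ->; last by rewrite eqxx.
  move=> _ h1; rewrite flip_emb_lift isf_cross => h2; exists (flip u l).
  rewrite adjG_flip isf_lift; split=> //; rewrite (inj_eq (@flip_inj _ u)).
  by apply: contraNneq h1 => ->.
- apply: exit_card => //; first by rewrite isf_lift.
    by apply: leq_trans h1; rewrite leq_add2r fd_half.
  by apply: leq_trans h2; rewrite flip_emb_lift leq_add2r fd_half.
right; have [i1d k1] := h3 i1 (mem_head _ _).
have [|i2d k2] := h3 i2; first by rewrite !inE eqxx orbT.
move: n12 h1 h2 k1 k2; case: (unliftP d i1) i1d => [l1|] ->; last by rewrite eqxx.
case: (unliftP d i2) i2d => [l2|] ->; last by rewrite eqxx.
rewrite !flip_emb_lift => _ _ n12 h1 h2 k1 k2.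
exists (flip (flip u k) l1), (flip (flip u k) l2).
have q (l : 'I_n.+1) : ~~ isf G (emb d (b, flip u k)) (lift d l) -> flip (flip u k) l != u.
  apply: contra => /eqP e; have : flip (flip u k) l = flip (flip u k) k by rewrite flipK.
  by move/flip_inj => ->; rewrite -flip_emb_lift isf_flip.
split.
  by split; rewrite ?adjG_flip ?isf_lift ?q // (inj_eq (@flip_inj _ _)); apply: contra n12 => /eqP->.
move=> a; rewrite !inE => /orP[]/eqP-> x y xy /adjGP[s es _] /adjGP[t et _]; rewrite es et in xy *.
  by have := k1 (lift d s) (lift d t); rewrite !flip_emb_lift !isf_cross; apply; apply: contra xy => /eqP/lift_inj->.
by have := k2 (lift d s) (lift d t); rewrite !flip_emb_lift !isf_cross; apply; apply: contra xy => /eqP/lift_inj->.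
Qed.

(** The special pair is treated through laceability of [spec], which may come from the inductive
    statement; this reaches beyond the count of [special_few]. *)
Lemma fix_v w j : properG G -> j != d -> isf G w j -> ~~ isf G w d -> ~~ isf G (flip w j) d -> #|X|.*2.+3 < 2 ^ n ->
  lace (halfG d (G :\ (low w j, j)) (w d)) -> stro (halfG d G (~~ w d)) ->
  exitv w j -> exitv (flip w j) j ->
  (forall u k, w = emb d (w d, u) -> j = lift d k -> lace (spec (w d) u k)) -> lace G.
Proof.
move=> pG jd wj Xw Xq hX lG0 sG1 e1 e2 sp.
case: (unliftP d j) jd => [k|] ej; last by rewrite ej eqxx.
move=> _; subst j; have ew : emb d (w d, (proj d w).2) = w by rewrite -[RHS](projK d).
move: (w d) ((proj d w).2) ew lG0 sG1 sp => b u ew; subst w => lG0 sG1 sp.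
have lsp : lace (spec b u k) by apply: sp; rewrite ?emb_d.
have Xu : ~~ X u by rewrite /X -(isf_cross d G b).
have Xv : ~~ X (flip u k) by rewrite /X -(isf_cross d G b) -flip_emb_lift.
rewrite low_emb_lift halfD1 in lG0.
have sps : ham (adjG G) (emb d (~~ b, u)) (emb d (~~ b, flip u k)).
  apply: (@cube_special _ d G b u k Xu Xv hX lG0 sG1 (spec b u k)) => //; first exact: subsetUl.
  by move=> z i hz; exact: spec_in.
move=> x y xy; apply: (@cube_single _ d G b u k Xu Xv hX lG0 sG1) => //.
- exact: exitvP e1.
- have : exit_ok (adjG (halfG d G b)) X (flip u k) (flip (flip u k) k).
    by apply: (exitvP (b := b)); rewrite -?flip_emb_lift ?isf_flip ?flipK.
  by rewrite flipK.
- by move=> -> ->.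
by move=> -> ->; apply: ham_rev => //; exact: adjG_sym.
Qed.
End Fix.

(** * Faults concentrated at one or two vertices *)

Definition star1 n (G : {set vert n * 'I_n}) (w : vert n) (H : {set 'I_n}) := forall i, i \in H -> ~~ isf G w i.
Definition covered n (G : {set vert n * 'I_n}) (ws : seq (vert n)) :=
  forall f, f \in G -> exists2 w, w \in ws & f \in inc G w.

Lemma isf_sub n (G K : {set vert n * 'I_n}) u i : K \subset G -> isf K u i -> isf G u i.
Proof. by move=> s; apply: (subsetP s). Qed.

Lemma inc_subG n (G K : {set vert n * 'I_n}) w f : K \subset G -> f \in K -> f \in inc G w -> f \in inc K w.
Proof. by move=> s fK; rewrite !inE fK => /andP[]. Qed.

Lemma covered_sub n (G K : {set vert n * 'I_n}) ws : K \subset G -> covered G ws -> covered K ws.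
Proof. by move=> s h f fK; have [w ww fw] := h f (subsetP s f fK); exists w => //; exact: inc_subG fw. Qed.

Lemma star1_sub n (G K : {set vert n * 'I_n}) w H : K \subset G -> star1 G w H -> star1 K w H.
Proof. by move=> s h i /h; apply: contra; exact: isf_sub. Qed.

Lemma star1_add n (G : {set vert n * 'I_n}) w H j : star1 G w H -> star1 (G :\ (low w j, j)) w (j |: H).
Proof.
move=> h i; rewrite !inE => /orP[/eqP->|/h]; first by rewrite /isf in_setD1 eqxx.
by apply: contra; apply: isf_sub; exact: subD1set.
Qed.

Lemma star_fd n (G : {set vert n * 'I_n}) w H : star1 G w H -> fd G w + #|H| <= n.
Proof.
move=> h; apply: (leq_trans _ (eq_leq (card_healthy G w))); rewrite addnC leq_add2r.
by apply/subset_leq_card/subsetP => i /h; rewrite inE.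
Qed.

Lemma star_fdk n (G : {set vert n * 'I_n}) w H k : star1 G w H -> k <= #|H| -> fd G w + k <= n.
Proof. by move=> /star_fd h hk; apply: leq_trans h; rewrite leq_add2l. Qed.

Lemma cov_end n (G : {set vert n * 'I_n}) ws z i : covered G ws -> isf G z i -> (z \in ws) || (flip z i \in ws).
Proof.
move=> h zi; have [w ww] := h _ zi; rewrite inE => /andP[_ /eqP/= e].
by case: (low_inj2 e) ww => ->; rewrite ?flipK => ->; rewrite ?orbT.
Qed.

Lemma cov_fd n (G : {set vert n * 'I_n}) ws z : covered G ws -> z \notin ws -> fd G z <= size ws.
Proof.
move=> h zw; apply: leq_trans (card_size ws); rewrite /fd.
rewrite -(card_imset _ (@flip_inj _ z)); apply/subset_leq_card/subsetP => x /imsetP[i].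
by rewrite inE => /(cov_end h); rewrite (negPf zw) => /= ? ->.
Qed.

Lemma cov_card n (G : {set vert n * 'I_n}) ws : covered G ws -> #|G| <= \sum_(w <- ws) fd G w.
Proof.
move=> h; apply: (@leq_trans #|\bigcup_(w <- ws) inc G w|).
  apply/subset_leq_card/subsetP => f /h[w ww fw]; rewrite (big_rem w) //= in_setU fw //.
elim: ws {h} => [|w ws IH]; first by rewrite !big_nil cards0.
rewrite !big_cons; apply: leq_trans (leq_card_setU _ _) _.
by apply: leq_add IH; rewrite card_inc.
Qed.

Section StarHalf.
Variables (n : nat) (d : 'I_n.+1) (G : {set vert n.+1 * 'I_n.+1}).
Implicit Types (u w : vert n.+1).
Definition pv (w : vert n.+1) : vert n := (proj d w).2.
Definition pH (H : {set 'I_n.+1}) : {set 'I_n} := [set k | lift d k \in H].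

Lemma embP w : emb d (w d, pv w) = w. Proof. by rewrite -[RHS](projK d). Qed.
Lemma pv_flip w (k : 'I_n) : pv (flip w (lift d k)) = flip (pv w) k.
Proof. by rewrite -{1}(embP w) flip_emb_lift /pv embK. Qed.
Lemma pv_inj u w : u d = w d -> pv u = pv w -> u = w.
Proof. by move=> h1 h2; rewrite -(embP u) -(embP w) h1 h2. Qed.
Lemma pv_eq u w : pv u = pv w -> u = w \/ u = flip w d.
Proof.
move=> h; have [e|e] := eqVneq (u d) (w d); [left|right]; first exact: pv_inj.
rewrite -[RHS]embP flipE eqxx; have -> : pv (flip w d) = pv w by rewrite -{1}(embP w) flip_emb /pv embK.
by rewrite -h -{1}(embP u); congr (emb d (_, _)); move: e; case: (u d); case: (w d).
Qed.

Lemma card_pH H : #|pH H| + (d \in H) = #|H|.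
Proof.
rewrite (cardsD1 d H) addnC; congr (_ + _); rewrite -(card_imset _ (@lift_inj _ d)).
apply: eq_card => j; rewrite !inE; case: (unliftP d j) => [k|] ->.
  by rewrite mem_imset ?inE 1?eq_sym ?neq_lift //; exact: lift_inj.
by rewrite eqxx; apply/negbTE/imsetP => -[k _ /eqP]; rewrite (negPf (neq_lift _ _)).
Qed.

Lemma star_half w H : star1 G w H -> star1 (halfG d G (w d)) (pv w) (pH H).
Proof. by move=> h k; rewrite inE => /h; rewrite isf_lift embP. Qed.

Lemma cov_half ws b : covered G ws -> covered (halfG d G b) [seq pv w | w <- ws & w d == b].
Proof.
move=> h [u k]; rewrite inE /= => fG; have [w ww] := h _ fG; rewrite inE /= => /andP[_ /eqP e].
have wd : w d = b by have := congr1 (fun z : vert n.+1 => z d) e; rewrite emb_d ffunE neq_lift.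
exists (pv w); first by rewrite map_f // mem_filter wd eqxx.
by rewrite !inE fG /=; apply/eqP; move: e; rewrite -{1}(embP w) wd low_emb_lift => /(can_inj (embK d)) [].
Qed.

Lemma cov_cross ws v : covered G ws -> crossG d G v -> exists2 w, w \in ws & isf G w d /\ pv w = v.
Proof.
move=> h; rewrite -(isf_cross d G false) => vd; have pve b : pv (emb d (b, v)) = v by rewrite /pv embK.
case/orP: (cov_end h vd) => hw; first by exists (emb d (false, v)).
by exists (flip (emb d (false, v)) d); rewrite ?isf_flip // flip_emb.
Qed.

Lemma cross_card ws : covered G ws -> #|crossG d G| <= count (isf G ^~ d) ws.
Proof.
move=> h; rewrite -size_filter -(size_map pv); apply: leq_trans (card_size _).
apply/subset_leq_card/subsetP => v /(cov_cross h)[w ww [wd <-]].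
by rewrite map_f // mem_filter wd.
Qed.
End StarHalf.
Arguments star_half [n] d [G w H].
Arguments cov_half [n d G ws] b.

Lemma star_one n (G : {set vert n.+1 * 'I_n.+1}) a A : covered G [:: a] -> star1 G a A -> 1 < #|A| -> lace G.
Proof.
move=> /cov_card; rewrite big_seq1 => h /star_fd hA A2; apply: few_lace; move: h hA A2; clear; lia.
Qed.

Lemma star_none n (G : {set vert n.+1 * 'I_n.+1}) : covered G [::] -> G = set0.
Proof. by move=> h; apply/setP => f; rewrite inE; apply/negP => /h[]. Qed.

Lemma bnd_ge m : 4 <= m -> 2 * m - 5 <= bnd m.
Proof.
by move: m => [|[|[|[|[|[|[|m]]]]]]] // _; rewrite /bnd /=; clear; lia.
Qed.

(** The two vertices carry at most 2m-5 faults, which is within [bnd], and every other vertex is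
    adjacent to at most two fault centres. So only [a] can have degree two unless m is at most 5. *)
Lemma T_pair m (G : {set vert m * 'I_m}) a b A B : T m -> 4 <= m -> properG G -> a != b -> covered G [:: a; b] ->
  star1 G a A -> star1 G b B -> 1 < #|A| -> 2 < #|B| -> lace G.
Proof.
move=> tm m4 pG ab h /star_fd hA /star_fd hB A2 B3; apply: tm => //.
have ho z : z \notin [:: a; b] -> fd G z <= 2 by apply: cov_fd.
have hz z : fd G z + 2 <= m /\ (z != a -> m <= 5 \/ fd G z + 3 <= m).
  have [->|za] := eqVneq z a; first by split=> //; move: hA A2; clear; lia.
  have [->|zb] := eqVneq z b; first by move: hB B3; clear; lia.
  by have := ho z; rewrite !inE (negPf za) (negPf zb) => /(_ isT); move: m4; clear; lia.
split=> //.
- have := cov_card h; rewrite big_cons big_seq1 => c.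
  have : #|G| <= m - 2 + (m - 3) by move: c hA hB A2 B3; clear; lia.
  by have := bnd_ge m4; clear; lia.
- by move=> u; case: (hz u).
move=> u v hu hv; have [_ ku] := hz u; have [_ kv] := hz v.
have [eu|nu] := eqVneq u a; have [ev|nv] := eqVneq v a; first by right; rewrite eu ev.
- by case: (kv nv); [left|move: hv; clear; lia].
- by case: (ku nu); [left|move: hu; clear; lia].
by case: (ku nu); [left|move: hu; clear; lia].
Qed.

Lemma inc_meet n (G : {set vert n * 'I_n}) u v : u != v -> #|inc G u :&: inc G v| <= 1.
Proof.
move=> uv; apply/card_le1_eqP => f g /setIP[f1 f2] /setIP[g1 g2].
have [e1 _] := inc2 f1 f2 uv; have [e2 _] := inc2 g1 g2 uv.
have e : f.2 = g.2 by apply: (@flip_inj _ v); rewrite -e1 -e2.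
move: f2 g2; rewrite !inE => /andP[_ /eqP h1] /andP[_ /eqP h2].
by rewrite [f]surjective_pairing [g]surjective_pairing h1 h2 e.
Qed.

Lemma fd_two n (G : {set vert n * 'I_n}) u v : u != v -> fd G u + fd G v <= #|G| + 1.
Proof.
move=> uv; have := inc_meet G uv; have := cardsUI (inc G u) (inc G v); rewrite !card_inc.
have : #|inc G u :|: inc G v| <= #|G| by rewrite subset_leq_card // subUset !inc_sub.
by clear; lia.
Qed.

Lemma fd_spec n d (G : {set vert n.+2 * 'I_n.+2}) b u k z : ~~ crossG d G u -> ~~ crossG d G (flip u k) ->
  fd (spec d G b u k) z <= fd (halfG d G (~~ b)) z + (if z \in [:: u; flip u k] then #|crossG d G| else 1).
Proof.
move=> Xu Xq; set A := [set i | if z \in [:: u; flip u k] then crossG d G (flip z i) else flip z i \in [:: u; flip u k]].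
apply: (@leq_trans (fd (halfG d G (~~ b)) z + #|A|)).
  apply: leq_trans (leq_card_setU _ _); apply/subset_leq_card/subsetP => i; rewrite inE => /isf_spec h.
  rewrite in_setU inE; case: h => [->//|[hz Xz]|[Xz hz]]; rewrite inE; first by rewrite hz Xz orbT.
  case: ifP => hz'; last by rewrite hz orbT.
  by move: hz' Xz; rewrite !inE => /orP[]/eqP->; rewrite ?(negPf Xu) ?(negPf Xq).
rewrite leq_add2l /A; case: ifP => hz.
  rewrite -(card_imset _ (@flip_inj _ z)); apply/subset_leq_card/subsetP => x /imsetP[i].
  by rewrite inE => h ->.
apply/card_le1_eqP => i j; rewrite !inE => hi hj; apply: (@flip_inj _ z).
case/orP: hi => /eqP hi; case/orP: hj => /eqP hj; rewrite hi hj //.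
  by have := congr1 (@parity n.+1) hi; have := congr1 (@parity n.+1) hj; rewrite !parity_flip => ->; case: (parity u).
by have := congr1 (@parity n.+1) hi; have := congr1 (@parity n.+1) hj; rewrite !parity_flip => -> ; case: (parity u).
Qed.

Lemma few_stro' n (G : {set vert n.+1 * 'I_n.+1}) : 1 < n -> #|G| <= n.-2 -> stro G.
Proof. case: n G => [|[|n]] // G _; exact: few_stro. Qed.

(** The fault set [spec] has at most n faults, two of them for crossings. By [fd_two] two vertices
    of degree two would need more, so [T] applies to it. A vertex with many faults of the far half
    must be [x], and if it is an end of the restored edge, [x] is not a crossing fault. *)
Lemma fix_gen n d (G : {set vert n.+2 * 'I_n.+2}) w j x y : 4 <= n -> T n.+1 -> properG G -> j != d -> isf G w j ->
  ~~ isf G w d -> ~~ isf G (flip w j) d -> (forall v, crossG d G v -> v \in [:: x; y]) ->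
  covered (halfG d G (~~ w d)) [:: x] -> #|halfG d G (~~ w d)| <= n.-2 ->
  lace (halfG d (G :\ (low w j, j)) (w d)) -> exitv d G w j -> exitv d G (flip w j) j -> lace G.
Proof.
move=> n4 tm pG jd wj wd qd hX cQ sQ lQ e1 e2.
have X2 : #|crossG d G| <= 2.
  by apply: leq_trans (card_size [:: x; y]); apply/subset_leq_card/subsetP => v; exact: hX.
apply: (@fix_v n d G w j) => //.
- apply: (@leq_ltn_trans 7); first by move: X2; clear; lia.
  by apply: exp_gt; move: n4; clear; lia.
- by apply: few_stro'; [move: n4; clear; lia|].
move=> u k ew ek.
have Xu : ~~ crossG d G u by rewrite -(isf_cross d G (w d)) -ew.
have Xq : ~~ crossG d G (flip u k) by rewrite -(isf_cross d G (w d)) -flip_emb_lift -ew -ek.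
have cS := card_spec d G (w d) u k.
have h2 z : fd (spec d G (w d) u k) z <= n.-1.
  apply: leq_trans (fd_spec _ _ Xu Xq) _.
  have k1 : z != x -> fd (halfG d G (~~ w d)) z <= 1 by move=> zx; apply: (cov_fd cQ); rewrite inE.
  have k2 := fd_card (halfG d G (~~ w d)) z.
  case: ifP => hz; last first.
    have [zx|/k1] := eqVneq z x; first by move: k2 sQ n4; clear; lia.
    by move: n4; clear; lia.
  have [zx|/k1] := eqVneq z x; last by move: X2 n4; clear; lia.
  suff : #|crossG d G| <= 1 by move: k2 sQ n4; clear; lia.
  apply: leq_trans (card_size [:: y]); apply/subset_leq_card/subsetP => v Xv.
  have := hX v Xv; rewrite !inE => /orP[/eqP vx|//]; move: hz; rewrite zx -vx !inE => /orP[]/eqP e.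
    by rewrite e -topredE /= (negPf Xu) in Xv.
  by rewrite e -topredE /= (negPf Xq) in Xv.
apply: tm; first by move: n4; clear; lia.
split.
- exact: proper_spec.
- have := @bnd_ge n.+1; move: cS X2 sQ n4; clear; lia.
- by move=> z; have := h2 z; move: n4; clear; lia.
move=> z z' hz hz'; right; apply/eqP; apply: contraT => zz'.
by have := fd_two (spec d G (w d) u k) zz'; move: cS X2 sQ n4 hz hz'; clear; lia.
Qed.

(** The healthy neighbours of [u] in its half project to distinct vertices, and there are more of
    them than crossing faults. *)
Lemma alpha_count n d (G : {set vert n.+2 * 'I_n.+2}) (u : vert n.+2) : ~~ isf G u d ->
  fd G u + #|crossG d G| <= n -> exists i, [/\ i != d, ~~ isf G u i & ~~ isf G (flip u i) d].
Proof.
move=> ud h; pose N := [set i | ~~ isf G u i].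
have cN : #|N :\ d| + fd G u = n.+1.
  have := card_healthy G u; rewrite -/N (cardsD1 d N) inE ud; clear; lia.
case: (ex_dir (fun i => [&& i != d, ~~ isf G u i & ~~ isf G (flip u i) d])) => [[i /and3P[h1 h2 h3]]|no].
  by exists i.
suff : #|N :\ d| <= #|crossG d G| by move: cN h; clear; lia.
have hN i : i \in N :\ d -> i != d /\ isf G (flip u i) d.
  by rewrite !inE => /andP[h1 h2]; have := no i; rewrite h1 h2 negbK.
rewrite -(@card_in_imset _ _ (fun i => pv d (flip u i))); last first.
  move=> i j /hN[id _] /hN[jd _] /pv_inj e; apply: (@flip_inj _ u); apply: e.
  by rewrite !flipE (eq_sym d) (negPf id) (eq_sym d) (negPf jd).
apply/subset_leq_card/subsetP => x /imsetP[i /hN[id h'] ->].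
by rewrite -topredE /= -(isf_cross d G (flip u i d)) embP.
Qed.

(** All faults are at three vertices: a narrow one with at least two known healthy directions and
    two wide ones with at least three. The sets need not contain all healthy directions, so they can
    be carried along to halves and to smaller fault sets. *)
Definition tri n (G : {set vert n * 'I_n}) w1 H1 w2 H2 w3 H3 :=
  [/\ properG G, covered G [:: w1; w2; w3], [/\ star1 G w1 H1, star1 G w2 H2 & star1 G w3 H3],
      [/\ w1 != w2, w1 != w3 & w2 != w3] & [/\ 1 < #|H1|, 2 < #|H2| & 2 < #|H3|]].

Lemma tri_swap n (G : {set vert n * 'I_n}) w1 H1 w2 H2 w3 H3 :
  tri G w1 H1 w2 H2 w3 H3 -> tri G w1 H1 w3 H3 w2 H2.
Proof.
move=> [h1 h2 [h3 h4 h5] [h6 h7 h8] [h9 h10 h11]]; split=> //; last by split; rewrite // eq_sym.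
move=> f /h2[w ww fw]; exists w => //; move: ww; by rewrite !inE => /or3P[] ->; rewrite ?orbT.
Qed.

(** * Three fault vertices separated by a direction *)

Section Tri.
Variables (n : nat) (G : {set vert n.+2 * 'I_n.+2}) (w1 w2 w3 : vert n.+2) (H1 H2 H3 : {set 'I_n.+2}).
Hypothesis tr : tri G w1 H1 w2 H2 w3 H3.
Variable d : 'I_n.+2.

Lemma tri_card : #|G| <= 3 * n - 2.
Proof.
case: tr => _ /cov_card + [/star_fd h1 /star_fd h2 /star_fd h3] _ [c1 c2 c3]; rewrite !big_cons big_nil.
by move: h1 h2 h3 c1 c2 c3; clear; lia.
Qed.

Lemma tri_exp : 3 <= n -> #|G| < 2 ^ n.
Proof.
move=> n3; apply: leq_ltn_trans tri_card _; move: n3; rewrite leq_eqVlt => /orP[/eqP<-//|n4].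
by apply: exp_gt n4 _; clear; lia.
Qed.

(** [w1] is alone in its half. The other half has two fault vertices, and the direction [d] costs at
    most one of them a healthy direction. *)
Lemma tri_sepA : 3 <= n -> T n.+1 -> d \notin H1 -> ~~ ((d \in H2) && (d \in H3)) ->
  w2 d = w3 d -> w1 d != w2 d -> lace G.
Proof.
move=> n3 tm dH1 dH e n12; apply: (@split_center n d G w1); first exact: tri_exp.
  case: tr => _ cG [s1 _ _] _ [c1 _ _]; apply: (@star_one _ _ (pv d w1) (pH d H1)).
  - by have := cov_half (d := d) (w1 d) cG; rewrite /= eqxx -e eq_sym (negPf n12).
  - exact: star_half.
  by have := card_pH d H1; rewrite (negPf dH1) addn0 => ->.
have e2 : ~~ w1 d = w2 d by move: n12; case: (w1 d); case: (w2 d).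
rewrite e2; case: tr => pG cG [_ s2 s3] [_ _ n23] [_ c2 c3].
have cv : covered (halfG d G (w2 d)) [:: pv d w2; pv d w3].
  by have := cov_half (d := d) (w2 d) cG; rewrite /= -e eqxx (negPf n12).
have nv : pv d w2 != pv d w3 by apply: contra n23 => /eqP/pv_inj->.
have s2' := star_half d s2; have s3' := star_half d s3; rewrite -e in s3'.
have p := proper_half (d := d) (b := w2 d) pG.
have k2 := card_pH d H2; have k3 := card_pH d H3.
have [d2|d2] := boolP (d \in H2).
  rewrite d2 /= in dH; apply: (T_pair tm n3 p nv cv s2' s3').
    by move: k2 c2; rewrite d2; clear; lia.
  by move: k3 c3; rewrite (negPf dH); clear; lia.
rewrite eq_sym in nv; apply: (T_pair tm n3 p nv _ s3' s2').
- by move=> f /cv[w ww fw]; exists w => //; move: ww; rewrite !inE orbC.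
- by move: k3 c3; case: (d \in H3); clear; lia.
by move: k2 c2; rewrite (negPf d2); clear; lia.
Qed.

Lemma tri_sepB (H3' : {set 'I_n.+2}) : 3 <= n -> T n.+1 -> star1 G w3 H3' -> 2 < #|pH d H3'| ->
  d \notin H1 -> w1 d = w3 d -> w2 d != w1 d -> lace G.
Proof.
move=> n3 tm s3 c3 dH1 e n12; apply: (@split_center n d G w1); first exact: tri_exp.
  case: tr => pG cG [s1 _ _] [_ n13 _] [c1 _ _]; apply: (@T_pair _ _ (pv d w1) (pv d w3) (pH d H1) (pH d H3')) => //.
  - exact: proper_half.
  - by apply: contra n13 => /eqP/pv_inj->.
  - by have := cov_half (d := d) (w1 d) cG; rewrite /= -e eqxx (negPf n12).
  - exact: star_half.
  - by have := star_half d s3; rewrite -e.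
  by have := card_pH d H1; rewrite (negPf dH1) addn0 => ->.
have e2 : ~~ w1 d = w2 d by move: n12; case: (w1 d); case: (w2 d).
rewrite e2; case: tr => pG cG [_ s2 _] _ [_ c2 _].
apply: (@star_one _ _ (pv d w2) (pH d H2)).
- by have := cov_half (d := d) (w2 d) cG; rewrite /= -e eqxx eq_sym (negPf n12).
- exact: star_half.
by have := card_pH d H2; move: c2; case: (d \in H2); clear; lia.
Qed.

Lemma pick_dir (S : {set 'I_n.+2}) (P Q : pred 'I_n.+2) : 3 <= #|S| ->
  (forall i j, P i -> P j -> i = j) -> (forall i j, Q i -> Q j -> i = j) ->
  exists2 j, j \in S & ~~ P j && ~~ Q j.
Proof.
move=> cS hP hQ; case: (ex_dir (fun j => [&& j \in S, ~~ P j & ~~ Q j])) => [[j /andP[h1 h2]]|no]; first by exists j.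
have : #|S| <= #|[set j | P j]| + #|[set j | Q j]|.
  apply: leq_trans (leq_card_setU _ _); apply/subset_leq_card/subsetP => j js; rewrite !inE.
  by have := no j; rewrite js -negb_or negbK.
have k (R : pred 'I_n.+2) : (forall i j, R i -> R j -> i = j) -> #|[set j | R j]| <= 1.
  by move=> hR; apply/card_le1_eqP => i j; rewrite !inE => hi hj; exact: hR.
by move: cS (k P hP) (k Q hQ); clear; lia.
Qed.

(** The half of [w1] and [w3] loses the healthy direction [d] of [w3]. Restoring an edge at [w3] in
    a new direction [j] brings its number of healthy directions back to three. *)
Lemma tri_fixB : 4 <= n -> T n.+1 -> d \notin H1 -> d \notin H2 -> d \in H3 ->
  w1 d = w3 d -> w2 d != w1 d -> lace G.
Proof.
move=> n4 tm dH1 dH2 dH3 e n12; have n3 : 3 <= n by move: n4; clear; lia.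
case: (tr) => pG cG [s1 s2 s3] [_ n13 n23] [c1 c2 c3].
have k3 := card_pH d H3; rewrite dH3 in k3.
have [h3|h3] := ltnP 2 #|pH d H3|; first exact: (tri_sepB n3 tm s3 h3).
(* The two excluded directions are those for which the other end of the restored edge is [w1] or is
   joined to [w2] by an edge in direction [d]. *)
have [|||j jS /andP[q1 q2]] := @pick_dir (~: H3) (fun j => flip w3 j == w1) (fun j => flip (flip w3 j) d == w2).
- have := cardsC H3; rewrite card_ord; move: k3 h3 n4; clear; lia.
- by move=> i j /eqP<- /eqP/flip_inj->.
- by move=> i j /eqP ei /eqP ej; apply: (@flip_inj _ w3); rewrite -[LHS](flipK _ d) ei -ej flipK.
rewrite in_setC in jS; have jd : j != d by apply: contraNneq jS => ->.
have s3' := star1_add (j := j) s3; have k3' := card_pH d (j |: H3).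
rewrite cardsU1 jS in_setU dH3 orbT in k3'.
have h3' : 2 < #|pH d (j |: H3)| by move: k3' c3; clear; lia.
have [wj|wj] := boolP (isf G w3 j); last first.
  apply: (tri_sepB n3 tm _ h3') => // i; rewrite in_setU1 => /orP[/eqP->//|]; exact: s3.
set q := flip w3 j in q1 q2.
have qd : q d = w3 d by rewrite flipE eq_sym (negPf jd).
have qw : q \notin [:: w1; w2; w3].
  rewrite !inE (negPf q1) /=; apply/norP; split.
    by apply: contra n12 => /eqP<-; rewrite qd e.
  by apply/eqP => /(congr1 (@parity n.+2)); rewrite parity_flip; case: (parity w3).
have fq : fd G q <= 3 by exact: (cov_fd cG qw).
have w3d : ~~ isf G w3 d by exact: s3.
have X2 : #|crossG d G| <= 2.
  apply: leq_trans (cross_card d cG) _; rewrite /= (negPf w3d); by case: (isf _ _ _); case: (isf _ _ _).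
have f3 := star_fdk s3 c3.
apply: (@fix_gen n d G w3 j (pv d w2) (pv d w1)) => //.
- apply: contra qw => /(cov_end cG)/orP[//|]; rewrite !inE (negPf q2) /= => /orP[]/eqP h.
    by have := congr1 (fun z : vert n.+2 => z d) h; rewrite flipE eqxx qd e; case: (w3 d).
  by have := congr1 (fun z : vert n.+2 => z d) h; rewrite flipE eqxx qd; case: (w3 d).
- move=> v /(cov_cross cG)[w ww [wd <-]]; move: ww; rewrite !inE => /or3P[] /eqP h; subst w; rewrite ?eqxx ?orbT //.
  by rewrite wd in w3d.
- have := cov_half (d := d) (~~ w3 d) cG; rewrite /= -e; move: n12.
  by case: (w1 d); case: (w2 d).
- rewrite -e; have := cov_half (d := d) (w2 d) cG; rewrite /= -e eqxx eq_sym (negPf n12) => /cov_card.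
  rewrite big_seq1 (_ : w2 d = ~~ w1 d); last by move: n12; case: (w1 d); case: (w2 d).
  have k2 : 2 < #|pH d H2| by have := card_pH d H2; rewrite (negPf dH2) addn0 => ->.
  have := star_fdk (star_half d s2) k2; rewrite (_ : w2 d = ~~ w1 d); last by move: n12; case: (w1 d); case: (w2 d).
  by move=> k k'; apply: leq_trans k' _; move: k n4; clear; lia.
- have sub : G :\ (low w3 j, j) \subset G by exact: subD1set.
  have pG' : properG (G :\ (low w3 j, j)) by move=> f /(subsetP sub); exact: pG.
  apply: (@T_pair _ _ (pv d w1) (pv d w3) (pH d H1) (pH d (j |: H3))) => //.
  + exact: proper_half.
  + by apply: contra n13 => /eqP/pv_inj->.
  + by have := cov_half (d := d) (w1 d) (covered_sub sub cG); rewrite /= -e eqxx (negPf n12).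
  + by have := star_half d (star1_sub sub s1); rewrite -e.
  + exact: star_half.
  by have := card_pH d H1; rewrite (negPf dH1) addn0 => ->.
- rewrite -/q; apply: Or32; split; last by apply: (leq_trans (leq_add fq (leqnn 2))); move: n4; clear; lia.
  by apply: (leq_trans (leq_add (leqnn _) X2)); move: f3; clear; lia.
apply: Or32; rewrite flipK -/q; split; last by move: f3; clear; lia.
by apply: (leq_trans (leq_add fq X2)); move: n4; clear; lia.
Qed.
End Tri.

(** Exactly one vertex is alone in its half. For the narrow one this is [tri_sepA]; for a wide one
    [tri_sepB], or [tri_fixB] when [d] is among the healthy directions of the other wide vertex. *)
Lemma tri_sep n (G : {set vert n.+2 * 'I_n.+2}) w1 w2 w3 H1 H2 H3 d : tri G w1 H1 w2 H2 w3 H3 ->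
  3 <= n -> T n.+1 -> d \notin H1 -> ~~ ((d \in H2) && (d \in H3)) ->
  4 <= n \/ d \notin H2 :|: H3 -> ~~ ((w1 d == w2 d) && (w1 d == w3 d)) -> lace G.
Proof.
move=> tr n3 tm dH1 dH hn ns.
have [e23|n23] := eqVneq (w2 d) (w3 d).
  by apply: (tri_sepA tr n3 tm dH1 dH e23); move: ns; rewrite -e23 andbb.
have B w2' H2' w3' H3' : tri G w1 H1 w2' H2' w3' H3' -> ~~ ((d \in H2') && (d \in H3')) ->
    4 <= n \/ d \notin H2' :|: H3' -> w1 d = w3' d -> w2' d != w1 d -> lace G.
  move=> tr' dH' hn' e ne; have [d3|d3] := boolP (d \in H3'); last first.
    case: (tr') => _ _ [_ _ s3] _ [_ _ c3].
    by apply: (tri_sepB tr' n3 tm s3 _ dH1 e ne); have := card_pH d H3'; rewrite (negPf d3) addn0 => ->.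
  have n4 : 4 <= n by case: hn' => //; rewrite in_setU d3 orbT.
  by apply: (tri_fixB tr' n4 tm dH1 _ d3 e ne); move: dH'; rewrite d3 andbT.
have [e12|n12] := eqVneq (w1 d) (w2 d).
  apply: (B w3 H3 w2 H2) => //; first exact: tri_swap.
  - by rewrite andbC.
  - by rewrite setUC.
  by rewrite e12 eq_sym.
apply: (B w2 H2 w3 H3) => //; last by rewrite eq_sym.
by move: n12 n23; case: (w1 d); case: (w2 d); case: (w3 d).
Qed.

Lemma pH_in n d (H : {set 'I_n.+1}) h : h \in H -> h != d -> exists2 k, h = lift d k & k \in pH d H.
Proof. by case: (unliftP d h) => [k|] ->; [exists k; rewrite ?inE|rewrite eqxx]. Qed.

Lemma pHU n d (H K : {set 'I_n.+1}) : pH d (H :|: K) = pH d H :|: pH d K.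
Proof. by apply/setP => k; rewrite !inE. Qed.
Lemma pHD n d (H K : {set 'I_n.+1}) : pH d (H :\: K) = pH d H :\: pH d K.
Proof. by apply/setP => k; rewrite !inE. Qed.
Lemma pH_out n d (H : {set 'I_n.+1}) : d \notin H -> #|pH d H| = #|H|.
Proof. by move=> h; have := card_pH d H; rewrite (negPf h) addn0. Qed.
Lemma pH_mem n d (H : {set 'I_n.+1}) : d \in H -> #|pH d H|.+1 = #|H|.
Proof. by move=> h; have := card_pH d H; rewrite h addn1. Qed.

(** * Three fault vertices in a common half *)

Section Step.
Variables (n : nat) (G : {set vert n.+2 * 'I_n.+2}) (w1 w2 w3 : vert n.+2) (H1 H2 H3 : {set 'I_n.+2}).
Hypothesis tr : tri G w1 H1 w2 H2 w3 H3.
Variable d : 'I_n.+2.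
Hypotheses (e12 : w1 d = w2 d) (e13 : w1 d = w3 d).

Lemma tri_half (K : {set vert n.+2 * 'I_n.+2}) K2 : K \subset G -> star1 K w2 K2 ->
  1 < #|pH d H1| -> 2 < #|pH d K2| -> 2 < #|pH d H3| ->
  tri (halfG d K (w1 d)) (pv d w1) (pH d H1) (pv d w2) (pH d K2) (pv d w3) (pH d H3).
Proof.
case: tr => pG cG [s1 _ s3] [n12 n13 n23] _ sub s2 c1 c2 c3.
split=> //.
- by apply: proper_half => f /(subsetP sub); exact: pG.
- by have := cov_half (d := d) (w1 d) (covered_sub sub cG); rewrite /= -e12 -e13 eqxx.
- split; first exact: star_half (star1_sub sub s1).
    by rewrite e12; exact: star_half s2.
  by rewrite e13; exact: star_half (star1_sub sub s3).
split; [apply: contra n12|apply: contra n13|apply: contra n23] => /eqP/pv_inj->; by rewrite // -e12.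
Qed.

Lemma tri_far : halfG d G (~~ w1 d) = set0.
Proof.
case: tr => _ cG _ _ _; apply: star_none; have := cov_half (d := d) (~~ w1 d) cG.
by rewrite /= -e12 -e13; case: (w1 d).
Qed.

Lemma tri_join : 3 <= n -> lace (halfG d G (w1 d)) -> lace G.
Proof.
move=> n3 l0; apply: (@split_center n d G w1) => //; first exact: (tri_exp tr).
by rewrite tri_far; apply: few_lace; rewrite cards0.
Qed.

(** The other half is fault-free. Passing to the half takes [d] away from [H2]; restoring the edge
    [f] at [w2], if it is faulty, puts [f] in its place. If that edge leads to [w1], the direction
    [f] separates the two and [tri_sep] applies. *)
Lemma tri_step f : 4 <= n -> T n.+1 -> d \notin H1 -> d \in H2 -> d \notin H3 -> (flip w2 f = w3 -> ~~ isf G w3 f) -> f \notin H2 ->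
  (forall K, tri K (pv d w1) (pH d H1) (pv d w2) (pH d (f |: H2)) (pv d w3) (pH d H3) -> lace K) -> lace G.
Proof.
move=> n4 tm d1 d2 d3 f3 f2 IH; have n3 : 3 <= n by move: n4; clear; lia.
case: (tr) => pG cG [s1 s2 s3] [n12 n13 n23] [c1 c2 c3].
have fd' : f != d by apply: contraNneq f2 => ->.
have cc : 2 < #|pH d (f |: H2)|.
  rewrite -ltnS pH_mem ?in_setU ?d2 ?orbT // cardsU1 f2 add1n; exact: c2.
have c1' : 1 < #|pH d H1| by rewrite pH_out.
have c3' : 2 < #|pH d H3| by rewrite pH_out.
have [wf|wf] := boolP (isf G w2 f); last first.
  apply: tri_join => //; apply: IH; apply: tri_half => // i; rewrite in_setU1 => /orP[/eqP->//|]; exact: s2.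
set q := flip w2 f.
have [q1|q1] := eqVneq q w1.
  apply: (tri_sep tr n3 tm (d := f)).
  - by apply/negP => /s1; rewrite -q1 isf_flip wf.
  - by rewrite (negPf f2).
  - by left.
  by rewrite -q1 flipE eqxx; case: (w2 f).
have qw : q \notin [:: w1; w2; w3].
  rewrite !inE (negPf q1) /=; apply/norP; split.
    by apply/eqP => /(congr1 (@parity n.+2)); rewrite parity_flip; case: (parity w2).
  by apply/negP => /eqP e; have := f3 e; rewrite -e isf_flip wf.
have fq : fd G q <= 3 by exact: (cov_fd cG qw).
have w2d : ~~ isf G w2 d by exact: s2.
have qd : q d = w1 d by rewrite flipE eq_sym (negPf fd') e12.
have X2 : #|crossG d G| <= 2.
  apply: leq_trans (cross_card d cG) _; rewrite /= (negPf w2d); by case: (isf _ _ _); case: (isf _ _ _).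
have ff := star_fdk s2 c2.
have e12' : ~~ w2 d = ~~ w1 d by rewrite e12.
apply: (@fix_gen n d G w2 f (pv d w3) (pv d w1)) => //.
- apply: contra qw => /(cov_end cG)/orP[//|]; rewrite !inE => h; exfalso.
  have k w : flip q d = w -> w d <> w1 d by move=> <-; rewrite flipE eqxx qd; case: (w1 d).
  by case/or3P: h => /eqP/k; rewrite -?e12 -?e13.
- move=> v /(cov_cross cG)[w ww [wd <-]]; move: ww; rewrite !inE => /or3P[] /eqP h; subst w; rewrite ?eqxx ?orbT //.
  by rewrite wd in w2d.
- by rewrite e12' tri_far => g; rewrite inE.
- by rewrite e12' tri_far cards0.
- rewrite -e12; apply: IH; apply: tri_half => //; [exact: subD1set|exact: star1_add].
- apply: Or32; split; last by apply: (leq_trans (leq_add fq (leqnn 2))); move: n4; clear; lia.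
  by apply: (leq_trans (leq_add (leqnn _) X2)); move: ff; clear; lia.
apply: Or32; rewrite flipK -/q; split; last by move: ff; clear; lia.
by apply: (leq_trans (leq_add fq X2)); move: n4; clear; lia.
Qed.
End Step.

(* Both wide stars extend the narrow one by the same directions. *)
Definition aligned n (H1 H2 H3 : {set 'I_n}) :=
  [/\ #|H1| = 2, #|H2| = 3, #|H3| = 3, H2 :\: H1 = H3 :\: H1 & (H2 :|: H3) :&: H1 != set0].

(** As one wide set meets [H1], at most two directions lie outside [H1], so the three sets cover at
    most four directions. *)
Lemma aligned_none n (H1 H2 H3 : {set 'I_n}) : 4 < n -> aligned H1 H2 H3 -> exists d, d \notin H1 :|: H2 :|: H3.
Proof.
move=> n5 [c1 c2 c3 e m].
have cJ : #|H2 :\: H1| <= 2.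
  have [/set0Pn[h]|] := boolP (H2 :&: H1 != set0).
    move=> hh; have := cardsID H1 H2; have : 0 < #|H2 :&: H1| by apply/card_gt0P; exists h.
    by rewrite c2; clear; lia.
  rewrite negbK => /eqP h2; have [/set0Pn[h hh]|] := boolP (H3 :&: H1 != set0).
    have := cardsID H1 H3; have : 0 < #|H3 :&: H1| by apply/card_gt0P; exists h.
    by rewrite c3 e; clear; lia.
  by rewrite negbK => /eqP h3; case/negP: m; rewrite setIUl h2 h3 setU0.
have eU : H1 :|: H2 :|: H3 = H1 :|: (H2 :\: H1).
  apply/setP => z; have : (z \in H2 :\: H1) = (z \in H3 :\: H1) by rewrite e.
  by rewrite !inE; case: (z \in H1); case: (z \in H2); case: (z \in H3).
case: (ex_dir (fun d => d \notin H1 :|: H2 :|: H3)) => // no.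
have : n <= #|H1 :|: H2 :|: H3|.
  rewrite -[X in X <= _](card_ord n); apply/subset_leq_card/subsetP => i _; have := no i; by rewrite negbK.
by rewrite eU => h; have := leq_trans h (leq_card_setU _ _); rewrite c1; move: cJ n5; clear; lia.
Qed.

Definition base5 := forall (G : {set vert 5 * 'I_5}) w1 H1 w2 H2 w3 H3,
  tri G w1 H1 w2 H2 w3 H3 -> aligned H1 H2 H3 -> lace G.

(** Descent on the dimension. In the aligned case a direction outside all three sets either
    separates the vertices or leads to a half, down to [base5]. Otherwise a direction [d] of one
    wide set is exchanged through [tri_step] for a direction [f] of the other, which lowers the
    union of the wide sets and the dimension by one and keeps the meeting with [H1]. *)
Theorem tri_meet (b5 : base5) n (G : {set vert n.+2 * 'I_n.+2}) w1 H1 w2 H2 w3 H3 : (forall m, m <= n.+1 -> T m) -> 3 <= n ->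
  tri G w1 H1 w2 H2 w3 H3 -> #|H1| = 2 -> #|H2| = 3 -> #|H3| = 3 -> (H2 :|: H3) :&: H1 != set0 ->
  H2 :\: H1 = H3 :\: H1 \/ #|H2 :|: H3| <= n -> lace G.
Proof.
move=> Ta; elim: n Ta G w1 H1 w2 H2 w3 H3 => // n IHn Ta G w1 H1 w2 H2 w3 H3 n3 tr c1 c2 c3 mt cu.
have tm : T n.+2 by exact: Ta.
have Ta' m : m <= n.+1 -> T m by move=> h; apply: Ta; exact: leq_trans h _.
have [eJ|neJ] := eqVneq (H2 :\: H1) (H3 :\: H1).
  move: n3; rewrite leq_eqVlt => /orP[/eqP e3|n3].
    by case: e3 => e3; move: G w1 H1 w2 H2 w3 H3 tr c1 c2 c3 mt cu eJ; rewrite -e3 => *; apply: b5; eauto.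
  have [d] : exists d, d \notin H1 :|: H2 :|: H3 by apply: aligned_none => //; move: n3; clear; lia.
  rewrite !in_setU -orbA => /norP[d1 /norP[d2 d3]].
  have n3' : 2 < n.+1 by move: n3; clear; lia.
  have [/andP[/eqP e12 /eqP e13]|ns] := boolP ((w1 d == w2 d) && (w1 d == w3 d)); last first.
    by apply: (tri_sep tr n3' tm d1 _ _ ns); rewrite ?(negPf d2) //; left.
  apply: (tri_join tr e12 e13) => //; case: (tr) => _ _ [s1 s2 s3] _ [k1 k2 k3].
  apply: (IHn Ta' _ _ (pH d H1) _ (pH d H2) _ (pH d H3)); rewrite ?pH_out //.
    by apply: (tri_half tr e12 e13) => //; rewrite pH_out.
    case/set0Pn: mt => h /setIP[h23 h1]; have hd : h != d by apply: contraNneq d1 => <-.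
    have [k ek k1'] := pH_in h1 hd; apply/set0Pn; exists k; rewrite -pHU inE k1' andbT inE -ek //.
  by left; rewrite -!pHD eJ.
have step w2' H2' w3' H3' d : tri G w1 H1 w2' H2' w3' H3' -> #|H2'| = 3 -> #|H3'| = 3 ->
    (H2' :|: H3') :&: H1 != set0 -> #|H2' :|: H3'| <= n.+1 -> d \in (H2' :\: H1) :\: (H3' :\: H1) -> lace G.
  move=> tr' c2' c3' mt' cu' dJ.
  have [d1 d2 d3] : [/\ d \notin H1, d \in H2' & d \notin H3'].
    by move: dJ; rewrite !inE; case: (d \in H1); case: (d \in H2'); case: (d \in H3').
  have n4 : 3 < n.+1.
    have : #|d |: H3'| <= #|H2' :|: H3'|.
      by apply/subset_leq_card/subsetP => z; rewrite in_setU1 in_setU => /orP[/eqP->|->]; rewrite ?d2 ?orbT.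
    by rewrite cardsU1 d3 c3' => h; apply: leq_trans h cu'.
  have [f f3 f2] : exists2 f, f \in H3' & f \notin H2'.
    case: (boolP (H3' \subset H2')) => [s|/subsetPn[f f3 f2]]; last by exists f.
    have : H3' == H2' by rewrite eqEcard s c2' c3'.
    by move/eqP => e3; rewrite e3 d2 in d3.
  have [/andP[/eqP e12 /eqP e13]|ns] := boolP ((w1 d == w2' d) && (w1 d == w3' d)); last first.
    by apply: (tri_sep tr' n3 tm d1 _ _ ns); rewrite ?(negPf d3) ?andbF //; left.
  have n3' : 2 < n by move: n4; clear; lia.
  have f3' : flip w2' f = w3' -> ~~ isf G w3' f by case: (tr') => _ _ [_ _ s3] _ _ _; exact: s3.
  apply: (tri_step tr' e12 e13 n4 tm d1 d2 d3 f3' f2) => K tK.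
  have df : d \in f |: H2' by rewrite in_setU1 d2 orbT.
  apply: (IHn Ta' K _ _ _ _ _ _ n3' tK); rewrite ?(pH_out d1) ?(pH_out d3) //.
  - by apply/eqP; rewrite -eqSS pH_mem // cardsU1 f2 c2'.
  - case/set0Pn: mt' => h /setIP[h23 h1]; have hd : h != d by apply: contraNneq d1 => <-.
    have [k ek k1'] := pH_in h1 hd; apply/set0Pn; exists k; rewrite -pHU inE k1' andbT inE -ek.
    by rewrite -setUA in_setU1 h23 orbT.
  right; rewrite -pHU -ltnS pH_mem; last by rewrite -setUA in_setU1 in_setU d2 orbT.
  apply: leq_trans cu'; apply/subset_leq_card/subsetP => z; rewrite -setUA in_setU1 => /orP[/eqP->|//].
  by rewrite in_setU f3 orbT.
have cu' : #|H2 :|: H3| <= n.+1 by case: cu => // e; rewrite e eqxx in neJ.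
have [/set0Pn[d hd]|] := boolP ((H2 :\: H1) :\: (H3 :\: H1) != set0); first exact: (step w2 H2 w3 H3 d).
rewrite negbK setD_eq0 => s23.
have [/set0Pn[d hd]|] := boolP ((H3 :\: H1) :\: (H2 :\: H1) != set0).
  by apply: (step w3 H3 w2 H2 d) => //; rewrite 1?(setUC H3) //; exact: tri_swap.
by rewrite negbK setD_eq0 => s32; case/negP: neJ; rewrite eqEsubset s23.
Qed.

(** * Computations in Q_4 and Q_5 for faults at few vertices *)

Local Open Scope N_scope.
Definition more4 : seq (seq N) := [:: [:: 147295108; 576906340; 742967404; 305214161; 555868449; 753175684;
    309212961; 506335970; 236789453; 76318414; 75809924; 126584008; 293913745; 555864594]; [:: 958602961;
    122178436; 210161348; 949531025; 490410721; 297343281; 951371972; 867246881; 320049939; 910587012;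
    239488132; 459564952; 76317836; 320938897; 296882737; 126584715]; [:: 997767092; 864503731; 142100600;
    589095220; 242110062; 862007587; 127447355; 944272966; 825021220; 618947812; 910587976; 584156360;
    583307720; 147211976; 611091596; 147948770; 753354290; 951526214; 878913230; 958104755; 842295179]; [::
    578497825; 753329275; 651402129; 926618337; 862861617; 140694034; 576898180; 951469768; 210191922;
    320048243; 105301124; 75818084; 303885384; 842294472; 498375576; 555861137; 583502737; 639230241;
    303220834; 75810374; 147268422; 611092174; 294421683]; [:: 840151954; 776396001; 589180435; 555950371;
    968077627; 878997793; 589411249; 774759137; 926290706; 596742945; 478555209; 957952530; 305271346;
    319964998; 303898926]; [:: 992862945; 583502724; 769760786; 640074884; 864324740; 231283864; 994632315;
    298093644; 212935457; 75813394]; [:: 456781028; 160023697; 81990433; 496178103; 240002276; 147295121;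
    864325190; 305214148; 910903582; 769760644; 75817544; 298370248; 958104716; 210030988; 753175697;
    293917073; 610591009; 842294498; 555861574; 294422222; 207696163; 147949451; 141369659]; [:: 327781252;
    951552913; 506312884; 968072068; 454783409; 651265254; 932372782; 756991176; 578308216; 126125969;
    240005553; 957952388; 297289844; 294421644; 753193356; 78778929; 584156386; 583307746; 864503346;
    455156518; 958105294; 76751139; 878912691; 298370955]].
Local Close Scope N_scope.

Definition paths4x := [seq g.1 ++ g.2 | g <- zip paths4 more4].
Definition groups4x : seq (seq N) := [seq [seq emask (steps org4 (digits 15 m)) | m <- g] | g <- paths4x].

Lemma paths4x_valid : (size paths4x == size odd4) &&
  all (fun p => all (fun m => valid4 p.1 (digits 15 m)) p.2) (zip odd4 paths4x).
Proof. by vm_compute. Qed.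

Lemma groups4x_nth k : k < size odd4 -> forall m, m \in nth [::] groups4x k ->
  exists w, valid4 (nth [::] odd4 k) w /\ m = emask (steps org4 w).
Proof.
have /andP[/eqP sz /allP v] := paths4x_valid => hk m.
rewrite (nth_map [::]) ?sz // => /mapP[c hc ->]; exists (digits 15 c); split=> //.
have hin : (nth [::] odd4 k, nth [::] paths4x k) \in zip odd4 paths4x.
  by rewrite -(nth_zip _ _ _ (esym sz)); apply: mem_nth; rewrite size_zip sz minnn; exact: hk.
by have /allP := v _ hin; apply.
Qed.

(* Edges which may be faulty when every fault is at one of the vertices ws, the listed directions being healthy. *)
Definition elist n := [seq p <- [seq (s, i) | s <- cube n, i <- iota 0 n] | ~~ nth false p.1 p.2].
Definition starE n (ws : seq (seq bool * seq nat)) := [seq e <- elist n |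
  has (fun w => clr w.1 e.2 == e.1) ws && all (fun w => (clr w.1 e.2 == e.1) ==> (e.2 \notin w.2)) ws].

Lemma starE_mem n (G : {set vert n * 'I_n}) (ws : seq (seq bool * seq nat)) : properG G ->
  (forall w, w \in ws -> size w.1 = n) -> covered G [seq dec n w.1 | w <- ws] ->
  (forall w (i : 'I_n), w \in ws -> (i : nat) \in w.2 -> ~~ isf G (dec n w.1) i) ->
  forall f, f \in G -> gpair f \in starE n ws.
Proof.
move=> pG sz cG st f fG; have pf := pG f fG.
have inc_clr w : w \in ws -> clr w.1 f.2 == enc f.1 -> f \in inc G (dec n w.1).
  move=> ww /eqP h; rewrite inE fG /=; apply/eqP; apply: (can_inj (@encK n)).
  by rewrite enc_low ?sz // h.
rewrite mem_filter; apply/andP; split; last first.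
  rewrite mem_filter; apply/andP; split; first by move: pf; rewrite -{1}[f.1]encK ffunE.
  by apply/allpairsP; exists (enc f.1, nat_of_ord f.2); split; [by rewrite mem_cube size_enc | by rewrite mem_iota ltn_ord | by []].
apply/andP; split.
  have [w /mapP[v vw ->] fw] := cG f fG; apply/hasP; exists v => //=.
  by move: fw; rewrite inE => /andP[_ /eqP ->]; rewrite enc_low // sz.
apply/allP => w ww; apply/implyP => /(inc_clr w ww) fw; apply/negP => hi.
by have := st w f.2 ww hi; move: fw; rewrite inE /isf => /andP[h /eqP<-]; rewrite -surjective_pairing h.
Qed.

Definition xorv (s t : seq bool) := [seq p.1 (+) p.2 | p <- zip s t].
Definition miss_all (ks : seq N) (m : N) := all (fun k => ~~ N.testbit m k) ks.
(** The listed paths start at the origin, so a start [t] is treated by translating the faults by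
    [t]. *)
Definition lace4c (g : seq (seq N)) (F : seq (seq bool * nat)) :=
  all (fun t => let ks := [seq ecode (clr (xorv e.1 t) e.2, e.2) | e <- F] in all (ex (miss_all ks)) g) (cube 4).

Lemma xorv_enc n (a b : vert n) : xorv (enc a) (enc b) = enc [ffun i => a i (+) b i].
Proof.
rewrite /xorv /enc; elim: (enum 'I_n) => //= i l ->; by rewrite ffunE.
Qed.

Lemma lace4c_sound (G : {set vert 4 * 'I_4}) F : (forall f, f \in G -> gpair f \in F) -> lace4c groups4x F -> lace G.
Proof.
move=> GF /allP ck x y xy; have ex : aff 1%g x (dec 4 org4) = x.
  apply/ffunP => i; rewrite !ffunE perm1 /org4 nth_nseq; case: ifP => _; exact: addFb.
rewrite -ex -[y](affiK 1%g x); apply: aff_ham.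
have /origin_odd[k hk ->] : parity (dec 4 org4) != parity (affi 1%g x y) by rewrite -(par_aff 1%g x) ex affiK.
have hx : enc x \in cube 4 by rewrite mem_cube size_enc.
have /andP[/eqP sz _] := paths4x_valid.
have /(all_nthP [::])/(_ k) := ck _ hx; rewrite !size_map in sz *; rewrite sz => /(_ hk); rewrite exE => /hasP[m mg /allP hm].
have [w [hw em]] := groups4x_nth hk mg; apply: avoid_ham hw _ => f; rewrite inE invg1 perm1 => /andP[pf fG].
rewrite -em; apply: hm; apply/mapP; exists (gpair (low (aff 1%g x f.1) f.2, f.2)); first exact: GF.
rewrite /gpair /= xorv_enc; congr ecode; congr pair.
rewrite -(enc_low _ (size_enc _)) encK; congr enc; apply/ffunP => i; rewrite !ffunE perm1.
by have [->|_] := eqVneq i f.2; [rewrite (negPf pf)|rewrite addbK].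
Qed.

Definition edge_ok (F : seq (seq bool * nat)) u i := (clr u i, i) \notin F.
Definition nbrs n F u := [seq fl u i | i <- iota 0 n & edge_ok F u i].
Definition rots n F (p : seq (seq bool)) := [seq take (index v p).+1 p ++ rev (drop (index v p).+1 p) | v <- nbrs n F (last [::] p)].
Definition fresh (new seen : seq (seq (seq bool))) :=
  foldl (fun acc q => if ex (fun r => if head [::] r == head [::] q then last [::] r == last [::] q else false) (acc ++ seen)
                      then acc else q :: acc) [::] new.
(* Closure of a set of paths under rotations at both ends, keeping one path for each pair of end points. *)
Fixpoint closure k n F (todo seen : seq (seq (seq bool))) :=
  if k is k'.+1 then if todo is p :: todo' then
    let new := fresh (rots n F p ++ map rev (rots n F (rev p))) seen in closure k' n F (todo' ++ new) (new ++ seen)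
  else seen else seen.

Definition ham_ok n F (p : seq (seq bool)) :=
  [&& uniq p, size p == 2 ^ n, all (fun u => size u == n) p & path (fun u v => v \in nbrs n F u) (head [::] p) (behead p)].
(** There are 4^n ordered pairs of ends and at most one path is kept for each, hence the fuel. Every
    path used is checked again by [ham_ok], so soundness rests only on that test. *)
Definition rotchk n F p0 := let S := closure (4 ^ n) n F [:: p0] [:: p0] in
  all (fun x => all (fun y => if bpar x then true else if bpar y then
    ex (fun p => if head [::] p == x then if last [::] p == y then ham_ok n F p else false else false) S else true) (cube n)) (cube n).

Lemma ham_ok_sound n (G : {set vert n * 'I_n}) F p : (forall f, f \in G -> gpair f \in F) -> ham_ok n F p ->
  ham (adjG G) (dec n (head [::] p)) (dec n (last [::] p)).
Proof.
move=> GF /and4P[up /eqP sp /allP ap pp].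
have ap' u : u \in p -> size u = n by move/ap/eqP.
exists (map (@dec n) p).
  case: p up sp ap ap' pp => [|x p] _ sp _ ap pp; first by have := expn_gt0 2 n; rewrite -sp.
  exists (map (@dec n) p) => //; split; last by rewrite last_map.
  rewrite path_map; move: pp => /=; elim: p x ap {sp} => //= y p IH x ap /andP[xy pp]; apply/andP; split; last first.
    by apply: IH pp => u hu; apply: ap; rewrite inE hu orbT.
  have sx : size x = n by apply: ap; rewrite mem_head.
  case/mapP: xy => i; rewrite mem_filter mem_iota add0n => /andP[hi /= ltin] ->.
  have -> : i = Ordinal ltin by [].
  rewrite dec_fl // adjG_flip; apply: contra hi => /GF; rewrite /gpair /= enc_low //.
move=> z; rewrite dec_count // count_uniq_mem //.
have [||_ ->] := @uniq_min_size _ p (cube n) up; last by rewrite mem_cube size_enc eqxx.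
- by move=> u /ap'; rewrite mem_cube => ->.
by rewrite size_cube sp.
Qed.

Lemma rotchk_sound n (G : {set vert n * 'I_n}) F p0 : (forall f, f \in G -> gpair f \in F) -> rotchk n F p0 -> lace G.
Proof.
move=> GF /allP ck; have key (x y : vert n) : ~~ bpar (enc x) -> bpar (enc y) -> ham (adjG G) x y.
  move=> px py; have hc (u : vert n) : enc u \in cube n by rewrite mem_cube size_enc.
  have /allP/(_ _ (hc y)) := ck _ (hc x); rewrite (negPf px) py exE => /hasP[p _].
  case: eqP => // hx; case: eqP => // hy ok; rewrite -[x]encK -[y]encK -hx -hy; exact: ham_ok_sound ok.
move=> x y; rewrite !parity_enc; case px: (bpar (enc x)); case py: (bpar (enc y)) => // _; last by apply: key; rewrite ?px ?py.
by apply: ham_rev; [exact: adjG_sym | apply: key; rewrite ?px ?py].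
Qed.

(** The shapes of the wide sets up to renaming, for [H1] equal to {0,1} and direction 4 outside all
    sets: two common directions outside [H1] with the same or with different third directions, or
    one common direction outside [H1]. *)
Definition pats : seq (seq nat * seq nat) :=
  [:: ([:: 0; 2; 3], [:: 0; 2; 3]); ([:: 0; 2; 3], [:: 1; 2; 3]); ([:: 0; 1; 2], [:: 0; 1; 2])].
(* Configurations not covered by splitting off direction 4, with a Hamiltonian path avoiding the faults. *)
Definition excs := [::
  (([:: 0; 2; 3], [:: 0; 2; 3]), ([:: false; true; true; false], [:: false; true; false; true]), ([:: false; false; false; false; false],
    [:: 1; 2; 0; 2; 3; 0; 2; 0; 1; 0; 2; 0; 4; 0; 1; 0; 2; 0; 1; 0; 3; 1; 0; 2; 0; 1; 0; 2; 4; 0; 2]));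
  (([:: 0; 2; 3], [:: 1; 2; 3]), ([:: false; true; true; false], [:: true; false; true; false]), ([:: false; false; false; false; false],
    [:: 1; 2; 0; 1; 3; 1; 0; 1; 3; 4; 0; 1; 0; 2; 1; 0; 1; 4; 3; 0; 1; 4; 1; 0; 2; 0; 1; 0; 2; 4; 3]));
  (([:: 0; 2; 3], [:: 1; 2; 3]), ([:: false; true; true; false], [:: true; false; false; true]), ([:: true; true; false; false; false],
    [:: 0; 1; 0; 3; 1; 0; 1; 2; 3; 0; 3; 1; 0; 3; 0; 4; 0; 1; 0; 2; 0; 1; 0; 3; 0; 1; 0; 2; 1; 0; 1]));
  (([:: 0; 2; 3], [:: 1; 2; 3]), ([:: false; true; false; true], [:: true; false; true; false]), ([:: false; false; false; false; false],
    [:: 1; 3; 0; 3; 2; 1; 3; 1; 0; 3; 1; 3; 2; 0; 4; 0; 1; 0; 2; 0; 1; 0; 3; 0; 1; 0; 2; 0; 1; 0; 4]));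
  (([:: 0; 2; 3], [:: 1; 2; 3]), ([:: false; true; false; true], [:: true; false; false; true]), ([:: false; false; false; false; false],
    [:: 0; 3; 1; 0; 3; 0; 2; 0; 1; 0; 3; 1; 0; 1; 2; 4; 0; 1; 0; 2; 1; 0; 3; 0; 1; 2; 1; 0; 1; 2; 3]));
  (([:: 0; 2; 3], [:: 0; 2; 3]), ([:: false; true; false; true], [:: false; true; true; false]), ([:: false; false; false; false; false],
    [:: 1; 2; 0; 2; 3; 0; 2; 0; 1; 0; 2; 0; 4; 0; 1; 0; 2; 0; 1; 0; 3; 1; 0; 2; 0; 1; 0; 2; 4; 0; 2]))].
Definition exc q := has (fun e => e.1 == q) excs.
Definition ext5 (w : seq bool) := rcons w false.
Definition fam (p : seq nat * seq nat) (w2 w3 : seq bool) (o : seq bool) := [:: (o, [:: 0; 1]); (w2, p.1); (w3, p.2)].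
Definition chk_pats := let g := groups4x in
  all (fun p => all (fun w2 => all (fun w3 => if exc (p, (w2, w3)) then true else
    if uniq [:: org4; w2; w3] then lace4c g (starE 4 (fam p w2 w3 org4)) else true) (cube 4)) (cube 4)) pats.
Definition chk_excs := all (fun e =>
  rotchk 5 (starE 5 (fam e.1.1 (ext5 e.1.2.1) (ext5 e.1.2.2) (ext5 org4))) (trace e.2.1 e.2.2)) excs.
(** Two fault vertices in Q_4 with disjoint healthy pairs, which allows four faults, one more than
    [bnd] 4. This is reached at the end of the descent in [tri_far_bits]. *)
Definition chk_two := let g := groups4x in all (fun w => if (nth false w 0) then if nth false w 1 then
   lace4c g (starE 4 [:: (org4, [:: 0; 1]); (w, [:: 2; 3])]) else true else true) (cube 4).
Lemma chk_patsE : chk_pats. Proof. by vm_compute. Qed.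
Lemma chk_excsE : chk_excs. Proof. by vm_compute. Qed.
Lemma chk_twoE : chk_two. Proof. by vm_compute. Qed.

(** * Normal forms for the base case in Q_5 *)

Lemma norm_perm n (l : seq 'I_n) : uniq l -> exists s : {perm 'I_n}, forall k (i : 'I_n), k < size l -> s (nth i l k) = k :> nat.
Proof.
move=> ul; pose r := l ++ [seq i <- enum 'I_n | i \notin l].
have ur : uniq r.
  rewrite cat_uniq ul filter_uniq ?enum_uniq // andbT /=; apply/hasPn => i; by rewrite mem_filter => /andP[].
have sr : size r = n.
  have : r =i enum 'I_n by move=> i; rewrite mem_cat mem_filter mem_enum inE andbT orbN.
  move=> e; rewrite (perm_size (uniq_perm ur (enum_uniq 'I_n) e)); exact: size_enum_ord.
have fi : injective (fun k : 'I_n => nth k r k).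
  move=> k k' /= h; apply: val_inj; apply/eqP; rewrite -(nth_uniq k _ _ ur) ?sr ?ltn_ord //.
  by rewrite h; apply/eqP; apply: set_nth_default; rewrite sr ltn_ord.
exists (perm fi)^-1%g; move=> k i hk; have hkn : k < n by rewrite -sr size_cat ltn_addr.
have -> : nth i l k = perm fi (Ordinal hkn).
  by rewrite permE /= nth_cat hk; apply: set_nth_default.
by rewrite permK.
Qed.

Section TriAff.
Variables (n : nat) (G : {set vert n * 'I_n}) (s : {perm 'I_n}) (t : vert n).
Let A := affG s t G.
Let ai := affi s t.

Lemma lace_aff : lace A -> lace G.
Proof.
move=> lA x y xy; rewrite -[x](affiK s t) -[y](affiK s t); apply: aff_ham; apply: lA.
by rewrite -(par_aff s t) !affiK.
Qed.

Lemma isf_affi w i : isf A (ai w) (s i) = isf G w i. Proof. by rewrite isf_aff affiK. Qed.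

Lemma star1_aff w H : star1 G w H -> star1 A (ai w) (s @: H).
Proof. by move=> h i /imsetP[j /h hj ->]; rewrite isf_affi. Qed.

Lemma cov_aff ws : covered G ws -> covered A (map ai ws).
Proof.
move=> h f fA; have [pf fG] : ~~ f.1 f.2 /\ isf G (aff s t f.1) ((s^-1)%g f.2) by move: fA; rewrite inE => /andP[].
have e : f.1 = low f.1 f.2 by rewrite low_id.
have ff : (aff s t f.1 \in ws) || (flip (aff s t f.1) ((s^-1)%g f.2) \in ws) by exact: cov_end h fG.
case/orP: ff => ww.
  by exists f.1; [rewrite -[f.1](affK s t) map_f|rewrite inE fA -e eqxx].
exists (flip f.1 f.2); last by rewrite inE fA low_flip -e eqxx.
apply/mapP; exists (flip (aff s t f.1) ((s^-1)%g f.2)) => //.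
by rewrite -aff_flip permKV /ai affK.
Qed.

Lemma ai_inj : injective ai. Proof. exact: can_inj (affiK s t). Qed.
End TriAff.

Definition org5 : vert 5 := dec 5 (ext5 org4).

Lemma ext5K (w : vert 5) : w ord_max = false -> dec 5 (ext5 (enc (pv ord_max w))) = w.
Proof.
move=> w4; rewrite -[RHS](embP ord_max); apply/ffunP => i; rewrite ffunE /ext5 nth_rcons size_enc.
case: (unliftP ord_max i) => [k|] ->; last by rewrite w4 emb_d.
rewrite emb_lift lift_max ltn_ord -{2}[pv _ w]encK ffunE //.
Qed.

(** The three vertices agree in direction 4, so one half is fault-free and the other is a Q_4 found
    in the table. The listed exceptional positions are laceable only as checked in Q_5, by
    rotations. *)
Lemma base_norm (G : {set vert 5 * 'I_5}) (p : seq nat * seq nat) w2 w3 : properG G -> p \in pats ->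
  covered G [:: org5; w2; w3] -> uniq [:: org5; w2; w3] -> (forall i : 'I_5, (i : nat) \in [:: 0; 1] -> ~~ isf G org5 i) ->
  (forall i : 'I_5, (i : nat) \in p.1 -> ~~ isf G w2 i) -> (forall i : 'I_5, (i : nat) \in p.2 -> ~~ isf G w3 i) ->
  w2 ord_max = false -> w3 ord_max = false -> lace G.
Proof.
move=> pG pp cG uw s1 s2 s3 b2 b3.
have e2 := ext5K b2; have e3 := ext5K b3.
set v2 := enc (pv ord_max w2) in e2; set v3 := enc (pv ord_max w3) in e3.
have c2 : v2 \in cube 4 by rewrite mem_cube size_enc.
have c3 : v3 \in cube 4 by rewrite mem_cube size_enc.
have b1 : org5 ord_max = false by rewrite ffunE.
have eo : enc (pv ord_max org5) = org4.
  apply: (@dec_inj 4); rewrite ?size_enc // encK; apply/ffunP => i; rewrite !ffunE.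
  by rewrite lift_max /org5 /ext5 /org4 !nth_rcons !nth_nseq /=; do 2 case: ifP.
have := chk_patsE; rewrite /chk_pats => /allP/(_ _ pp)/allP/(_ _ c2)/allP/(_ _ c3).
case: ifP => [ex _|_].
  case/hasP: ex => e ee /eqP ep; have ck : rotchk 5 (starE 5 (fam p (ext5 v2) (ext5 v3) (ext5 org4))) (trace e.2.1 e.2.2).
    by have := chk_excsE; rewrite /chk_excs => /allP/(_ _ ee); rewrite ep; exact: id.
  apply: (rotchk_sound _ ck); apply: starE_mem => //.
  - by move=> w; rewrite !inE => /or3P[] /eqP-> /=; rewrite ?size_rcons ?size_enc.
  - by rewrite /= e2 e3.
  by move=> w i; rewrite !inE => /or3P[] /eqP-> /=; rewrite ?e2 ?e3; [exact: s1|exact: s2|exact: s3].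
have pd (w w' : vert 5) : w ord_max = false -> w' ord_max = false -> w != w' -> enc (pv ord_max w) != enc (pv ord_max w') :> seq bool.
  by move=> h h'; apply: contra => /eqP/(can_inj (@encK 4))/(pv_inj (etrans h (esym h')))->.
have [n12 n13 n23] : [/\ org5 != w2, org5 != w3 & w2 != w3].
  by move: uw; rewrite /= !inE negb_or -!andbA andbT => /and3P[].
rewrite /= !inE negb_or -!andbA -{1 2}eo !pd //= => ck.
apply: (@split_center 3 ord_max G org5).
- have : #|G| <= 3 + (2 + 2); last by move=> h; apply: leq_ltn_trans h _.
  apply: leq_trans (cov_card cG) _; rewrite !big_cons big_nil addn0.
  have k w (l : seq nat) m : uniq l -> all (fun i => i < 5) l -> (forall i : 'I_5, (i : nat) \in l -> ~~ isf G w i) ->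
      m + size l = 5 -> fd G w <= m.
    move=> ul /allP l5 hl em; pose H := [set i : 'I_5 | (i : nat) \in l].
    have sH : star1 G w H by move=> i; rewrite inE; exact: hl.
    have : size l <= #|H|.
      rewrite cardE -(size_map val); apply: uniq_leq_size => // i il.
      by apply/mapP; exists (Ordinal (l5 i il)); rewrite // mem_enum inE.
    by move/(star_fdk sH) => h; rewrite -(leq_add2r (size l)) em; exact: h.
  rewrite !leq_add //; first exact: (k _ [:: 0; 1]).
    by apply: (k _ p.1) => //; move: pp; rewrite !inE => /or3P[] /eqP->.
  by apply: (k _ p.2) => //; move: pp; rewrite !inE => /or3P[] /eqP->.
- rewrite b1; apply: (lace4c_sound _ ck); apply: starE_mem.
  + exact: proper_half.
  + by move=> w; rewrite !inE => /or3P[] /eqP-> /=; rewrite ?size_enc.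
  + by have := cov_half (d := ord_max) false cG; rewrite /= b1 b2 b3 eqxx /= -eo !encK.
  have li (w : vert 5) (i : 'I_4) : w ord_max = false -> isf (halfG ord_max G false) (pv ord_max w) i = isf G w (lift ord_max i).
    by move=> h; rewrite isf_lift -h embP.
  move=> w i; rewrite !inE => /or3P[] /eqP-> /=; rewrite -?eo encK li // => hi; [apply: s1|apply: s2|apply: s3];
    by rewrite lift_max.
rewrite b1; have -> : halfG ord_max G (~~ false) = set0.
  by apply: star_none; have := cov_half (d := ord_max) true cG; rewrite /= b1 b2 b3.
by apply: few_lace; rewrite cards0.
Qed.

Lemma star_norm n (G : {set vert n * 'I_n}) (s : {perm 'I_n}) t (l : seq 'I_n) (o : 'I_n) (q : seq nat) w (H : {set 'I_n}) :
  (forall k (i : 'I_n), k < size l -> s (nth i l k) = k :> nat) -> all (fun k => (k < size l) && (nth o l k \in H)) q ->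
  star1 G w H -> forall i : 'I_n, (i : nat) \in q -> ~~ isf (affG s t G) (affi s t w) i.
Proof.
move=> hs /allP hq st i /hq/andP[hk hH]; have -> : i = s (nth o l i) by apply: ord_inj; rewrite hs.
by rewrite isf_affi; exact: st.
Qed.

(** A direction [e] outside the three sets either separates the vertices, so that [tri_sep] with
    [T4] applies, or becomes direction 4. The other directions are then ordered so that the sets
    take one of the shapes in [pats], according to the size of the common part outside [H1]. *)
Lemma base5P : base5.
Proof.
move=> G w1 H1 w2 H2 w3 H3 tr al; have [e] := aligned_none (isT : 4 < 5) al.
rewrite !in_setU -orbA => /norP[e1 /norP[e2 e3]].
have [/andP[/eqP e12 /eqP e13]|ns] := boolP ((w1 e == w2 e) && (w1 e == w3 e)); last first.
  by apply: (@tri_sep 3 G w1 w2 w3 H1 H2 H3 e tr isT T4 e1 _ _ ns); rewrite ?(negPf e2) // in_setU negb_or e2 e3; right.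
case: (tr) => pG cG [s1 s2 s3] [n12 n13 n23] _; case: al => c1 c2 c3 eJ mt.
have main (l : seq 'I_5) p : uniq l -> size l = 5 -> nth e l 4 = e -> p \in pats ->
    all (fun k => (k < size l) && (nth e l k \in H1)) [:: 0; 1] ->
    all (fun k => (k < size l) && (nth e l k \in H2)) p.1 ->
    all (fun k => (k < size l) && (nth e l k \in H3)) p.2 -> lace G.
  move=> ul sl le pp q1 q2 q3; have [s hs] := norm_perm ul.
  have eo : affi s w1 w1 = org5.
    apply/ffunP => i; rewrite !ffunE addbb /ext5 /org4 nth_rcons nth_nseq /=; by do 2 case: ifP.
  have se : s e = ord_max by apply: ord_inj; rewrite -[in LHS]le hs ?sl.
  have ee : (s^-1)%g ord_max = e by rewrite -se permK.
  apply: (@lace_aff _ _ s w1); apply: (@base_norm _ p (affi s w1 w2) (affi s w1 w3)) => //.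
  - exact: proper_aff.
  - by have := cov_aff (s := s) (t := w1) cG; rewrite /= eo.
  - by rewrite -eo /= !inE !(inj_eq (@ai_inj _ s w1)) negb_or n12 n13 n23.
  - by move=> i hi; rewrite -eo; apply: (star_norm w1 hs q1 s1 hi).
  - exact: (star_norm w1 hs q2 s2).
  - exact: (star_norm w1 hs q3 s3).
  - by rewrite ffunE ee e12 addbb.
  by rewrite ffunE ee e13 addbb.
have J2 j : j \in H2 :\: H1 -> [/\ j \in H2, j \in H3, j \notin H1 & j != e].
  move=> hj; have : j \in H3 :\: H1 by rewrite -eJ.
  move: hj; rewrite !inE => /andP[-> h2] /andP[_ h3]; split=> //.
  by apply: contraNneq e2 => <-.
have nH1 z : z \in H1 -> z != e by move=> hz; apply: contraNneq e1 => <-.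
have ne z y : z \in H1 -> y \notin H1 -> z != y by move=> h; apply: contraNneq => <-.
have k2 := cardsID H1 H2; have k3 := cardsID H1 H3.
have cJ : #|H2 :\: H1| = 1 \/ #|H2 :\: H1| = 2.
  have l2 : #|H2 :&: H1| <= 2 by apply: leq_trans (eq_leq c1); rewrite subset_leq_card // subsetIr.
  have : 0 < #|H2 :&: H1| + #|H3 :&: H1|.
    case/set0Pn: mt => z /setIP[/setUP[] hz hz1]; rewrite addn_gt0; apply/orP; [left|right];
      by apply/card_gt0P; exists z; rewrite inE hz.
  by move: l2 k2 k3; rewrite -eJ c2 c3; clear; lia.
case: cJ => cJ.
  have /cards1P[j ej] : #|H2 :\: H1| == 1 by rewrite cJ.
  have [j2 j3 j1 je] := J2 j (ltac:(by rewrite ej inE eqxx)).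
  have sub (H : {set 'I_5}) : #|H| = 3 -> #|H :\: H1| = 1 -> #|H :&: H1| + #|H :\: H1| = #|H| -> H1 \subset H.
    move=> cH cD cc; have : H :&: H1 == H1.
      by rewrite eqEcard subsetIr c1; move: cc; rewrite cH cD; clear; lia.
    by move/eqP <-; exact: subsetIl.
  have sH2 := sub _ c2 cJ k2; have sH3 := sub _ c3 (etrans (congr1 (fun A : {set 'I_5} => #|A|) (esym eJ)) cJ) k3.
  have /cards2P[a [a' [aa' eH]]] : #|H1| == 2 by rewrite c1.
  have a1 : a \in H1 by rewrite eH !inE eqxx.
  have a1' : a' \in H1 by rewrite eH !inE eqxx orbT.
  case: (ex_dir (fun z : 'I_5 => z \notin [:: a; a'; j; e])) => [[z hz]|no]; last first.
    have : 5 <= #|[:: a; a'; j; e]|.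
      by rewrite -[X in X <= _](card_ord 5); apply/subset_leq_card/subsetP => i _; have := no i; rewrite negbK.
    by move/leq_trans/(_ (card_size _)).
  move: hz; rewrite !inE !negb_or => /and4P[za za' zj ze].
  apply: (main [:: a; a'; j; z; e] ([:: 0; 1; 2], [:: 0; 1; 2])) => //=.
  - by rewrite !inE !negb_or aa' (ne a j) // (ne a' j) // (nH1 a) // (nH1 a') // je ze !(eq_sym _ z) za za' zj.
  - by rewrite a1 a1'.
  - by rewrite (subsetP sH2) // (subsetP sH2) // j2.
  by rewrite (subsetP sH3) // (subsetP sH3) // j3.
have /cards2P[j [j' [jj' ej]]] : #|H2 :\: H1| == 2 by rewrite cJ.
have [j2 j3 j1 je] := J2 j (ltac:(by rewrite ej !inE eqxx)).
have [j2' j3' j1' je'] := J2 j' (ltac:(by rewrite ej !inE eqxx orbT)).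
have /cards1P[b eb] : #|H2 :&: H1| == 1 by move: k2; rewrite cJ c2; clear; lia.
have /cards1P[b' eb'] : #|H3 :&: H1| == 1 by move: k3; rewrite -eJ cJ c3; clear; lia.
have /setIP[b2 b1] : b \in H2 :&: H1 by rewrite eb inE.
have /setIP[b3 b1'] : b' \in H3 :&: H1 by rewrite eb' inE.
have /cards1P[x ex] : #|H1 :\ b| == 1 by have := cardsD1 b H1; rewrite b1 c1; clear; lia.
have /setD1P[xb x1] : x \in H1 :\ b by rewrite ex inE.
have ul : uniq [:: b; x; j; j'; e].
  rewrite /= !inE !negb_or (eq_sym b x) xb jj' je je' (nH1 b) // (nH1 x) //.
  by rewrite !ne.
have [bb|bb] := eqVneq b' b.
  apply: (main [:: b; x; j; j'; e] ([:: 0; 2; 3], [:: 0; 2; 3])) => //=.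
  - by rewrite b1 x1.
  - by rewrite b2 j2 j2'.
  by rewrite -bb b3 j3 j3'.
have xb' : b' = x by apply/set1P; rewrite -ex !inE bb b1'.
apply: (main [:: b; x; j; j'; e] ([:: 0; 2; 3], [:: 1; 2; 3])) => //=.
- by rewrite b1 x1.
- by rewrite b2 j2 j2'.
by rewrite -xb' b3 j3 j3'.
Qed.

(** * Narrow healthy set disjoint from the wide ones *)

Lemma two4 (G : {set vert 4 * 'I_4}) w1 w2 (H I : {set 'I_4}) : properG G -> covered G [:: w1; w2] ->
  star1 G w1 H -> star1 G w2 I -> #|H| = 2 -> #|I| = 2 -> H :&: I = set0 -> (forall i, i \in H -> w2 i != w1 i) -> lace G.
Proof.
move=> pG cG s1 s2 cH cI HI df.
have /cards2P[a [b [ab eH]]] : #|H| == 2 by rewrite cH.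
have /cards2P[c [e [ce eI]]] : #|I| == 2 by rewrite cI.
have [aH bH] : a \in H /\ b \in H by rewrite eH !inE !eqxx orbT.
have [cI' eI'] : c \in I /\ e \in I by rewrite eI !inE !eqxx orbT.
have ne z y : z \in H -> y \in I -> z != y.
  move=> hz; apply: contraTneq => <-; apply/negP => hy.
  by have := in_set0 z; rewrite -HI inE hz hy.
have ul : uniq [:: a; b; c; e] by rewrite /= !inE !negb_or ab ce !ne.
have [s hs] := norm_perm ul.
have eo : affi s w1 w1 = dec 4 org4.
  by apply/ffunP => i; rewrite !ffunE addbb /org4 nth_nseq; case: ifP.
apply: (@lace_aff _ _ s w1); set v2 := enc (affi s w1 w2).
have c2 : v2 \in cube 4 by rewrite mem_cube size_enc.
have bit (k : 'I_4) : (k : nat) < 2 -> affi s w1 w2 k = true.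
  move=> hk; have hH : nth a [:: a; b; c; e] k \in H by case: k hk => -[|[|]].
  have -> : k = s (nth a [:: a; b; c; e] k) by apply: ord_inj; rewrite hs ?ltn_ord.
  by rewrite ffunE permK; have := df _ hH; case: (w2 _); case: (w1 _).
have nb (k : 'I_4) : nth false v2 k = affi s w1 w2 k by rewrite -[in RHS](encK (affi s w1 w2)) ffunE.
have := chk_twoE; rewrite /chk_two => /allP/(_ _ c2).
have := nb (inord 0); have := nb (inord 1); rewrite !inordK // => -> ->; rewrite !bit ?inordK // => ck.
apply: (lace4c_sound _ ck); apply: starE_mem.
- exact: proper_aff.
- by move=> w; rewrite !inE => /orP[] /eqP-> /=; rewrite ?size_enc.
- by have := cov_aff (s := s) (t := w1) cG; rewrite /= eo /v2 encK.
move=> w i; rewrite !inE => /orP[] /eqP-> /= hi; rewrite -?eo ?encK.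
  by apply: (star_norm w1 (o := a) (q := [:: 0; 1]) hs _ s1) => //=; rewrite aH bH.
by apply: (star_norm w1 (o := a) (q := [:: 2; 3]) hs _ s2) => //=; rewrite cI' eI'.
Qed.

Lemma setI_pH n d (H K : {set 'I_n.+1}) : H :&: K = set0 -> pH d H :&: pH d K = set0.
Proof. by move=> h; apply/setP => k; have := in_set0 (lift d k); rewrite -h !inE. Qed.

Lemma pv_val n (d : 'I_n.+1) (w : vert n.+1) k : pv d w k = w (lift d k). Proof. by rewrite ffunE. Qed.

(** Directions outside [H] and [I] are split off until dimension five, where [H] and [I] together
    are all directions. There the direction [d] isolates [w3] and leaves [w1], [w2] with two healthy
    directions each in Q_4, the situation of [two4]. *)
Lemma tri_far_bits n (G : {set vert n.+2 * 'I_n.+2}) w1 H w2 I w3 d : (forall m, m <= n.+1 -> T m) -> 3 <= n ->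
  tri G w1 H w2 I w3 I -> #|H| = 2 -> #|I| = 3 -> H :&: I = set0 -> (forall i, i \in H -> w2 i != w1 i) ->
  d \in I -> w2 d = w1 d -> w3 d != w1 d -> lace G.
Proof.
move=> Ta; elim: n Ta G w1 H w2 I w3 d => // n IHn Ta G w1 H w2 I w3 d n3 tr cH cI HI df dI e2 e3.
have tm : T n.+2 by exact: Ta.
have out i : i \in I -> i \notin H by move=> hi; apply/negP => hh; have := in_set0 i; rewrite -HI inE hi hh.
case: (tr) => pG cG [s1 s2 s3] [n12 n13 n23] _.
move: n3; rewrite leq_eqVlt => /orP[/eqP n3|n3].
  case: n3 => n3; move: Ta G w1 H w2 I w3 d tr cH cI HI df dI e2 e3 tm out pG cG s1 s2 s3 n12 n13 n23 {IHn}.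
  rewrite -n3 => _ G w1 H w2 I w3 d tr cH cI HI df dI e2 e3 _ out pG cG s1 s2 s3 n12 n13 n23.
  have kI : #|pH d I| = 2 by apply: succn_inj; rewrite pH_mem.
  apply: (@split_center 3 d G w1); first exact: (tri_exp tr).
    apply: (@two4 _ (pv d w1) (pv d w2) (pH d H) (pH d I)) => //.
    - exact: proper_half.
    - by have := cov_half (d := d) (w1 d) cG; rewrite /= e2 eqxx (negPf e3).
    - exact: star_half.
    - by have := star_half d s2; rewrite e2.
    - by rewrite pH_out ?out.
    - exact: setI_pH.
    by move=> k; rewrite inE !pv_val => /df.
  have e3' : ~~ w1 d = w3 d by move: e3; case: (w3 d); case: (w1 d).
  apply: (@star_one _ _ (pv d w3) (pH d I)).
  - by have := cov_half (d := d) (~~ w1 d) cG; rewrite /= e2 e3' eqxx eq_sym (negPf e3).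
  - by have := star_half d s3; rewrite e3'.
  by rewrite kI.
case: (ex_dir (fun e => e \notin H :|: I)) => [[e]|no]; last first.
  have : n.+3 <= #|H :|: I|.
    by rewrite -[X in X <= _](card_ord n.+3); apply/subset_leq_card/subsetP => i _; have := no i; rewrite negbK.
  by move=> h; have := leq_trans h (leq_card_setU _ _); rewrite cH cI; move: n3; clear; lia.
rewrite in_setU negb_or => /andP[eH eI]; have n3' : 2 < n.+1 by move: n3; clear; lia.
have [/andP[/eqP e12 /eqP e13]|ns] := boolP ((w1 e == w2 e) && (w1 e == w3 e)); last first.
  by apply: (tri_sep tr n3' tm eH _ _ ns); rewrite ?(negPf eI) //; left.
apply: (tri_join tr e12 e13) => //.
have de : d != e by apply: contraNneq eI => <-.
have [k ek kI] := pH_in dI de.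
have kk : 2 < #|pH e I| by rewrite pH_out ?cI.
have tH : tri (halfG e G (w1 e)) (pv e w1) (pH e H) (pv e w2) (pH e I) (pv e w3) (pH e I).
  by apply: (tri_half tr e12 e13) => //; rewrite pH_out ?cH.
apply: (IHn _ _ _ _ _ _ _ k _ tH) => //; rewrite ?pH_out // ?pv_val -?ek //.
- by move=> m hm; apply: Ta; exact: leq_trans hm _.
- exact: setI_pH.
by move=> i; rewrite inE !pv_val => /df.
Qed.

Section FixNarrow.
Variables (n : nat) (G : {set vert n.+3 * 'I_n.+3}) (w1 w2 w3 : vert n.+3) (I : {set 'I_n.+3}) (d h : 'I_n.+3).
Let H := [set d; h].
Hypotheses (Ta : forall m, m <= n.+2 -> T m) (n4 : 4 <= n) (tr : tri G w1 H w2 I w3 I).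
Hypotheses (dh : d != h) (cI : #|I| = 3) (dI : d \notin I) (hI : h \notin I).
Hypotheses (x1 : forall i, i \notin H -> isf G w1 i) (x2 : forall i, i \notin I -> isf G w2 i) (x3 : forall i, i \notin I -> isf G w3 i).
Hypotheses (e2 : w2 d = w1 d) (nb : forall w, w \in [:: w2; w3] -> flip (flip w1 h) d != w).

(** Splitting along the healthy direction [d] of [w1] and restoring its edge in a direction [j] of
    [I] turns the narrow set into {h, j}. It now meets [I], so [tri_meet] applies when [w3] is in
    the same half, and [T_pair] otherwise. The exit at [w1] goes through [h]; by [nb] this neighbour
    crosses safely. *)
Lemma fix_narrow : lace G.
Proof.
have tm : T n.+2 by exact: Ta.
case: (tr) => pG cG [s1 s2 s3] [n12 n13 n23] [c1 c2 c3].
have hH : h \in H by rewrite !inE eqxx orbT.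
have dH : d \in H by rewrite !inE eqxx.
have [|||j jI /andP[q3 _]] := @pick_dir n.+1 I (fun j => flip (flip w1 j) d == w3) (fun _ => false).
- by rewrite cI.
- by move=> i j /eqP ei /eqP ej; apply: (@flip_inj _ w1); rewrite -[LHS](flipK _ d) ei -ej flipK.
- by [].
have jH : j \notin H by rewrite !inE negb_or; apply/andP; split; apply: contraTneq jI => ->.
have wj : isf G w1 j by exact: x1.
have jd : j != d by apply: contraNneq jH => ->.
set q := flip w1 j in q3; have qd : q d = w1 d by rewrite flipE eq_sym (negPf jd).
have par (w : vert n.+3) i : flip w i != w.
  by apply/eqP => /(congr1 (@parity n.+3)); rewrite parity_flip; case: (parity w).
have qw : q \notin [:: w1; w2; w3].
  rewrite !inE (negPf (par _ _)) /=; apply/norP; split; apply/eqP => e.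
    by have := s2 j jI; rewrite -e isf_flip wj.
  by have := s3 j jI; rewrite -e isf_flip wj.
have fq : fd G q <= 3 by exact: (cov_fd cG qw).
have w1d : ~~ isf G w1 d by exact: s1.
have X2 : #|crossG d G| <= 2.
  apply: leq_trans (cross_card d cG) _; rewrite /= (negPf w1d); by case: (isf _ _ _); case: (isf _ _ _).
have qf : ~~ isf G q d.
  apply: contra qw => /(cov_end cG)/orP[//|]; rewrite !inE (negPf q3) orbF => /orP[]/eqP e.
    by have := congr1 (fun z : vert n.+3 => z d) e; rewrite flipE eqxx qd; case: (w1 d).
  by have := congr1 (fun z : vert n.+3 => z d) e; rewrite flipE eqxx qd e2; case: (w1 d).
have sub : G :\ (low w1 j, j) \subset G by exact: subD1set.
have s1' := star1_add (j := j) s1.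
have k1 : #|pH d (j |: H)| = 2.
  have djH : d \in j |: H by rewrite in_setU1 dH orbT.
  by apply: succn_inj; rewrite (pH_mem djH) cardsU1 jH cards2 dh.
have kI : #|pH d I| = 3 by rewrite pH_out.
have pG' : properG (G :\ (low w1 j, j)) by move=> f /(subsetP sub); exact: pG.
have c12 : pv d w1 != pv d w2 by apply: contra n12 => /eqP/pv_inj->.
have cv3 : w3 d != w1 d -> ~~ w1 d = w3 d by case: (w3 d); case: (w1 d).
apply: (@fix_gen n.+1 d G w1 j (pv d w3) (pv d w2)) => //.
- by move: n4; clear; lia.
- move=> v /(cov_cross cG)[w ww [wd <-]]; move: ww; rewrite !inE => /or3P[] /eqP hw; subst w; rewrite ?eqxx ?orbT //.
  by rewrite wd in w1d.
- have := cov_half (d := d) (~~ w1 d) cG; rewrite /= e2; by case: (w1 d); case: (w3 d) => //= cc f /cc[w]; rewrite in_nil.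
- have [e3|/cv3 e3] := eqVneq (w3 d) (w1 d).
    by rewrite (tri_far tr (esym e2) (esym e3)) cards0.
  have cc : covered (halfG d G (~~ w1 d)) [:: pv d w3].
    by have := cov_half (d := d) (~~ w1 d) cG; rewrite /= e2 e3; move: e3; case: (w1 d); case: (w3 d).
  have s3' := star_half d s3; rewrite -e3 in s3'.
  have := cov_card cc; rewrite big_seq1 => k; apply: leq_trans k _.
  by have := star_fdk s3' (eq_leq (esym kI)); move: n4; clear; lia.
- have [e3|e3] := eqVneq (w3 d) (w1 d); last first.
    apply: (@T_pair _ _ (pv d w1) (pv d w2) (pH d (j |: H)) (pH d I)) => //.
    + by move: n4; clear; lia.
    + exact: proper_half.
    + by have := cov_half (d := d) (w1 d) (covered_sub sub cG); rewrite /= e2 eqxx (negPf e3).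
    + exact: star_half.
    + by have := star_half d (star1_sub sub s2); rewrite e2.
    + by rewrite k1.
    by rewrite kI.
  apply: (@tri_meet base5P n _ (pv d w1) (pH d (j |: H)) (pv d w2) (pH d I) (pv d w3) (pH d I)) => //.
  + by move=> m hm; apply: Ta; exact: leq_trans hm _.
  + by move: n4; clear; lia.
  + split=> //.
    * exact: proper_half.
    * by have := cov_half (d := d) (w1 d) (covered_sub sub cG); rewrite /= e2 e3 eqxx.
    * split; first exact: star_half.
        by have := star_half d (star1_sub sub s2); rewrite e2.
      by have := star_half d (star1_sub sub s3); rewrite e3.
    * split=> //; [apply: contra n13|apply: contra n23] => /eqP/pv_inj->; by rewrite // e2 e3.
    by rewrite k1 kI.
  + have [k ek kk] := pH_in jI jd; apply/set0Pn; exists k; rewrite !inE -ek jI /=.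
    by rewrite eqxx.
  by left.
- apply: Or31; exists h; split; [by rewrite eq_sym|exact: s1|].
  apply/negP => /(cov_end cG); rewrite !inE (negPf (par _ _)) /= => /orP[/orP[]/eqP e|/or3P[]].
  + by have := x2 hI; rewrite -e isf_flip; apply/negP; exact: s1.
  + by have := x3 hI; rewrite -e isf_flip; apply/negP; exact: s1.
  + by move/eqP/(congr1 (fun z : vert n.+3 => z d)); rewrite !flipE eqxx (negPf dh); case: (w1 d).
  + by apply/negP/nb; rewrite !inE eqxx.
  by apply/negP/nb; rewrite !inE eqxx orbT.
rewrite -/q; have [|i hi] := alpha_count qf; last by apply: Or31; exists i.
by apply: (leq_trans (leq_add fq X2)); move: n4; clear; lia.
Qed.
End FixNarrow.

Lemma differ n (u v : vert n) : u != v -> exists i, u i != v i.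
Proof.
move=> uv; case: (ex_dir (fun i => u i != v i)) => // no; case/eqP: uv; apply/ffunP => i.
by apply/eqP; have := no i; rewrite negbK.
Qed.

Definition exact n (G : {set vert n * 'I_n}) w (H : {set 'I_n}) := forall i, i \notin H -> isf G w i.

(** A separating direction outside both sets settles the matter. If both wide vertices differ from
    [w1] in all of [H1], they are distinguished by a direction in [I], and [tri_far_bits] applies.
    Otherwise one of them agrees with [w1] in some [d] of [H1], and [fix_narrow] applies unless the
    other is obtained from [w1] by flipping both directions of [H1]. Then [tri_far_bits] is used
    again, or the first is a neighbour of [w1] along an edge that would be both healthy and
    faulty. *)
Lemma pure_same n (G : {set vert n.+3 * 'I_n.+3}) w1 H1 w2 w3 I : (forall m, m <= n.+2 -> T m) -> 4 <= n ->
  tri G w1 H1 w2 I w3 I -> #|H1| = 2 -> #|I| = 3 -> H1 :&: I = set0 ->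
  exact G w1 H1 -> exact G w2 I -> exact G w3 I -> lace G.
Proof.
move=> Ta n4 tr c1 cI HI x1 x2 x3; have tm : T n.+2 by exact: Ta.
have n3 : 2 < n.+1 by move: n4; clear; lia.
have n4' : 3 < n.+1 by exact: leqW n4.
have out i : i \in H1 -> i \notin I by move=> hh; apply/negP => hi; have := in_set0 i; rewrite -HI inE hi hh.
case: (ex_dir (fun e => (e \notin H1 :|: I) && ~~ ((w1 e == w2 e) && (w1 e == w3 e)))) => [[e /andP[]]|no].
  rewrite in_setU negb_or => /andP[e1 eI] ns.
  by apply: (tri_sep tr n3 tm e1 _ _ ns); rewrite ?(negPf eI) //; left.
have agree e : e \notin H1 -> e \notin I -> w2 e = w1 e /\ w3 e = w1 e.
  move=> h h'; have := no e; rewrite in_setU negb_or h h' negbK => /andP[/eqP<- /eqP<-] //.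
pose far (w : vert n.+3) := [forall i in H1, w i != w1 i].
have farP (w : vert n.+3) : far w -> forall i, i \in H1 -> w i != w1 i.
  by move/forallP => h i hi; have /implyP := h i; apply.
have nI w2' w3' d : tri G w1 H1 w2' I w3' I -> far w2' -> d \in I -> w2' d = w1 d -> w3' d != w1 d -> lace G.
  move=> tr' /farP fw dI e2 e3; apply: (tri_far_bits (n := n.+1) Ta n3 tr' c1 cI HI fw dI e2 e3).
have [/andP[f2 f3]|nf] := boolP (far w2 && far w3).
  case: (tr) => _ _ _ [_ _ /differ[d hd]] _.
  have d1 : d \notin H1.
    by apply: contra hd => d1; move: (farP _ f2 _ d1) (farP _ f3 _ d1); case: (w1 d); case: (w2 d); case: (w3 d).
  have dI : d \in I by apply: contraT => dI; have [h2 h3] := agree d d1 dI; move: hd; rewrite h2 h3 eqxx.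
  have [e2|e2] := eqVneq (w2 d) (w1 d); first by apply: (nI _ _ d tr); rewrite // -e2 eq_sym.
  by apply: (nI _ _ d (tri_swap tr)) => //; move: hd e2; case: (w1 d); case: (w2 d); case: (w3 d).
have main w2' w3' d : tri G w1 H1 w2' I w3' I -> exact G w2' I -> exact G w3' I -> d \in H1 -> w2' d = w1 d ->
    (forall e, e \notin H1 -> e \notin I -> w2' e = w1 e /\ w3' e = w1 e) -> lace G.
  move=> tr' x2' x3' d1 e2 ag.
  have /cards1P[h eh] : #|H1 :\ d| == 1 by have := cardsD1 d H1; rewrite d1 c1; clear; lia.
  have /setD1P[hd h1] : h \in H1 :\ d by rewrite eh inE.
  have hdF : (h == d) = false := negPf hd.
  have dhF : (d == h) = false by rewrite eq_sym.
  have eH : H1 = [set d; h] by rewrite -(setD1K d1) eh.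
  have [e3|e3] := eqVneq (flip (flip w1 h) d) w3'; last first.
    rewrite eH in tr' x1; apply: (fix_narrow Ta n4 tr' _ cI) => //; rewrite ?out // 1?eq_sym //.
    move=> w; rewrite !inE => /orP[]/eqP->; last by [].
    by apply: contra_eq_neq e2 => <-; rewrite !flipE eqxx dhF; case: (w1 d).
  have f3 : far w3'.
    by apply/forallP => i; apply/implyP; rewrite eH !inE => /orP[]/eqP->; rewrite -e3 !flipE eqxx ?hdF ?dhF; case: (w1 _).
  case: (ex_dir (fun e => (e \in I) && (w2' e != w1 e))) => [[e /andP[eI ne]]|no'].
    apply: (nI _ _ e (tri_swap tr')) => //; rewrite -e3 !flipE.
    have ed : (e == d) = false by apply/negbTE; apply: contraTneq eI => ->; exact: out.
    have ef : (e == h) = false by apply/negbTE; apply: contraTneq eI => ->; exact: out.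
    by rewrite ed ef.
  case: (tr') => _ _ [s1 _ _] [n12 _ _] _; rewrite eq_sym in n12; case: (differ n12) => e ne.
  have e1 : e \in H1.
    apply: contraT => h1'; have [eI|eI] := boolP (e \in I); first by have := no' e; rewrite eI ne.
    by have [k _] := ag e h1' eI; rewrite k eqxx in ne.
  have ew : w2' = flip w1 h.
    apply/ffunP => k; rewrite flipE; have [kI|kI] := boolP (k \in I).
      have := no' k; rewrite kI negbK => /eqP->.
      have -> : (k == h) = false by apply/negbTE; apply: contraTneq kI => ->; exact: out.
      by rewrite addFb.
    have [k1|k1] := boolP (k \in H1); last first.
      have [-> _] := ag k k1 kI; have -> : (k == h) = false by apply/negbTE; apply: contraNneq k1 => ->.
      by rewrite addFb.
    move: k1; rewrite eH !inE => /orP[]/eqP->; first by rewrite e2 dhF.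
    rewrite eqxx; have eh' : e = h.
      by move: e1; rewrite eH !inE => /orP[]/eqP// ed; move: ne; rewrite ed e2 eqxx.
    by move: ne; rewrite eh'; case: (w1 h); case: (w2' h).
  by have := x2' h (out _ h1); rewrite ew isf_flip (negPf (s1 h h1)).
move: nf; rewrite negb_and => /orP[] /forallPn[d]; rewrite negb_imply negbK => /andP[d1 /eqP e].
  by apply: (main w2 w3 d tr x2 x3 d1 e agree).
by apply: (main w3 w2 d (tri_swap tr) x3 x2 d1 e) => z z1 zI; have [? ?] := agree z z1 zI.
Qed.

(** One [tri_step] exchanges a direction of [H2] for one of [H1], after which the wide sets meet
    [H1]. Of the two directions in [H1] at least one does not lead from [w2] to [w3]. *)
Theorem pure_diff n (G : {set vert n.+3 * 'I_n.+3}) w1 H1 w2 H2 w3 H3 : (forall m, m <= n.+2 -> T m) -> 4 <= n ->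
  tri G w1 H1 w2 H2 w3 H3 -> #|H1| = 2 -> #|H2| = 3 -> #|H3| = 3 -> H2 != H3 ->
  (H2 :|: H3) :&: H1 = set0 -> #|H2 :|: H3| <= n -> lace G.
Proof.
move=> Ta n4 tr c1 c2 c3 n23 m0 hU'; have tm : T n.+2 by exact: Ta.
have n3 : 2 < n.+1 by move: n4; clear; lia.
have n4' : 3 < n.+1 by exact: leqW n4.
have m2 : H2 :&: H1 = set0 by apply/eqP; rewrite -subset0 -m0 setSI // subsetUl.
have [d d2 d3] : exists2 d, d \in H2 & d \notin H3.
  apply/subsetPn; apply: contra n23 => s; by rewrite eqEcard s c2 c3.
have out (H : {set 'I_n.+3}) i : H :&: H1 = set0 -> i \in H -> i \notin H1.
  by move=> h hi; apply/negP => h1; have := in_set0 i; rewrite -h inE hi h1.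
have d1 : d \notin H1 by exact: out m2 d2.
have [/andP[/eqP e12 /eqP e13]|ns] := boolP ((w1 d == w2 d) && (w1 d == w3 d)); last first.
  by apply: (tri_sep tr n3 tm d1 _ _ ns); rewrite ?(negPf d3) ?andbF //; left.
have [f f1 nf] : exists2 f, f \in H1 & flip w2 f != w3.
  have /cards2P[a [b [ab eH]]] : #|H1| == 2 by rewrite c1.
  have [ea|na] := eqVneq (flip w2 a) w3; last by exists a; rewrite // eH !inE eqxx.
  exists b; first by rewrite eH !inE eqxx orbT.
  by rewrite -ea (inj_eq (@flip_inj _ w2)) eq_sym.
have f2 : f \notin H2 by apply: contraL f1; exact: out m2.
have fd' : f != d by apply: contraNneq d1 => <-.
apply: (tri_step tr e12 e13 (f := f) n4' tm d1 d2 d3 _ f2) => [/eqP|K tK]; first by rewrite (negPf nf).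
have df : d \in f |: H2 by rewrite in_setU1 d2 orbT.
have dU : d \in (f |: H2) :|: H3 by rewrite in_setU df.
apply: (@tri_meet base5P n K _ _ _ _ _ _ _ _ tK); rewrite ?(pH_out d1) ?(pH_out d3) //.
- by move=> m hm; apply: Ta; exact: leq_trans hm _.
- by apply/eqP; rewrite -eqSS pH_mem // cardsU1 f2 c2.
- have [k ek kk] := pH_in f1 fd'; apply/set0Pn; exists k.
  by rewrite in_setI kk andbT in_setU inE -ek in_setU1 eqxx.
right; rewrite -pHU -ltnS (pH_mem dU) -setUA; apply: leq_trans (leq_card_setU _ _) _.
by rewrite cards1 add1n ltnS.
Qed.

Theorem pure_top n (G : {set vert n.+3 * 'I_n.+3}) w1 H1 w2 H2 w3 H3 : (forall m, m <= n.+2 -> T m) -> 4 <= n ->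
  tri G w1 H1 w2 H2 w3 H3 -> #|H1| = 2 -> #|H2| = 3 -> #|H3| = 3 -> exact G w1 H1 -> exact G w2 H2 -> exact G w3 H3 ->
  ((H2 :|: H3) :&: H1 != set0 /\ #|H2 :|: H3| <= n.+1) \/ #|H2 :|: H3| <= n -> lace G.
Proof.
move=> Ta n4 tr c1 c2 c3 x1 x2 x3 hU; have tm : T n.+2 by exact: Ta.
have n3 : 2 < n.+1 by move: n4; clear; lia.
have n4' : 3 < n.+1 by exact: leqW n4.
have [mt|nm] := boolP ((H2 :|: H3) :&: H1 != set0).
  apply: (@tri_meet base5P n.+1 G w1 H1 w2 H2 w3 H3) => //; right.
  by case: hU => [[_ ->]|/leqW].
have hU' : #|H2 :|: H3| <= n by case: hU => // -[h]; rewrite h in nm.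
move: nm; rewrite negbK => /eqP m0.
have m2 : H2 :&: H1 = set0 by apply/eqP; rewrite -subset0 -m0 setSI // subsetUl.
have [e23|n23] := eqVneq H2 H3.
  by subst H3; apply: (pure_same Ta n4 tr c1 c2 _ x1 x2 x3); rewrite setIC.
exact: (pure_diff Ta n4 tr).
Qed.

(** If the direction [s] of the shared fault is not healthy at [w1], it separates and [tri_sep]
    applies. Otherwise the cube is split along [s], which puts [w2] and [w3] in different halves
    over the same vertex, so that there is at most one crossing fault; an edge at [w1] is restored
    to make up for the loss of [s]. *)
Lemma pure_shared n (G : {set vert n.+2 * 'I_n.+2}) w1 H1 w2 H2 w3 H3 s : T n.+1 -> 5 <= n ->
  tri G w1 H1 w2 H2 w3 H3 -> #|H1| = 2 -> exact G w1 H1 -> isf G w2 s -> w3 = flip w2 s -> lace G.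
Proof.
move=> tm n5 tr c1 x1 w2s e23; have n3 : 2 < n by move: n5; clear; lia.
have n4 : 3 < n by move: n5; clear; lia.
have out u H : star1 G u H -> isf G u s -> s \notin H by move=> h hs; apply/negP => /h; rewrite hs.
have w3s : isf G w3 s by rewrite e23 isf_flip.
have [s1|s1] := boolP (s \in H1); last first.
  case: (tr) => _ _ [_ st2 _] _ _; apply: (tri_sep tr n3 tm s1 _ _ _).
  - by rewrite (negPf (out _ _ st2 w2s)).
  - by left.
  by rewrite e23 flipE eqxx; case: (w1 s); case: (w2 s).
have main v2 K2 v3 K3 : tri G w1 H1 v2 K2 v3 K3 -> isf G v2 s -> v3 = flip v2 s -> v2 s = w1 s -> lace G.
  move=> tr' v2s e e2; case: (tr') => pG cG [st1 st2 st3] [n12 n13 n23'] [_ k2 k3].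
  have v3s : isf G v3 s by rewrite e isf_flip.
  have d2 := out _ _ st2 v2s; have d3 := out _ _ st3 v3s.
  have e3 : ~~ w1 s = v3 s by rewrite e flipE eqxx e2.
  have ne3 : (v3 s == w1 s) = false by rewrite -e3; case: (w1 s).
  have [|||j jS /andP[q2 _]] := @pick_dir n (~: H1) (fun j => flip w1 j == v2) (fun _ => false).
  - by have := cardsC H1; rewrite card_ord c1; move: n5; clear; lia.
  - by move=> i j /eqP<- /eqP/flip_inj->.
  - by [].
  rewrite in_setC in jS; have js : j != s by apply: contraNneq jS => ->.
  have wj := x1 j jS; set q := flip w1 j in q2.
  have qs : q s = w1 s by rewrite flipE eq_sym (negPf js).
  have qw : q \notin [:: w1; v2; v3].
    rewrite !inE (negPf q2) /=; apply/norP; split; apply/eqP => h.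
      by have := congr1 (@parity n.+2) h; rewrite parity_flip; case: (parity w1).
    by move: ne3; rewrite -h qs eqxx.
  have fq : fd G q <= 3 by exact: (cov_fd cG qw).
  have w1d : ~~ isf G w1 s by exact: st1.
  have pve : pv s v2 = pv s v3.
    by rewrite e -{2}(embP s v2) flip_emb /pv embK.
  have hX v : crossG s G v -> v \in [:: pv s v3].
    move=> /(cov_cross cG)[w ww [wd <-]]; move: ww; rewrite !inE => /or3P[] /eqP hw; subst w; rewrite ?eqxx ?pve //.
    by rewrite wd in w1d.
  have X1 : #|crossG s G| <= 1.
    by apply: leq_trans (card_size [:: pv s v3]); apply/subset_leq_card/subsetP => v; exact: hX.
  have qf : ~~ isf G q s.
    apply: contra qw => /(cov_end cG)/orP[//|]; rewrite !inE => h; exfalso.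
    have kk w : flip q s = w -> w s <> w1 s by move=> <-; rewrite flipE eqxx qs; case: (w1 s).
    case/or3P: h => /eqP h; [exact: (kk _ h)|exact: (kk _ h)|].
    by case/eqP: q2; rewrite -[LHS](flipK _ s) h e flipK.
  have f1 := star_fdk st1 (eq_leq (esym c1)).
  apply: (@fix_gen n s G w1 j (pv s v3) (pv s v3)) => //.
  - by move=> v /hX; rewrite !inE => ->.
  - by have := cov_half (d := s) (~~ w1 s) cG; rewrite /= e2 e3 eqxx eq_sym ne3.
  - have cc : covered (halfG s G (~~ w1 s)) [:: pv s v3].
      by have := cov_half (d := s) (~~ w1 s) cG; rewrite /= e2 e3 eqxx eq_sym ne3.
    have st3' := star_half s st3; rewrite -e3 in st3'.
    have k3' : 2 < #|pH s K3| by rewrite pH_out.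
    have := cov_card cc; rewrite big_seq1 => k; apply: leq_trans k _.
    by have := star_fdk st3' k3'; move: n4; clear; lia.
  - have sub : G :\ (low w1 j, j) \subset G by exact: subD1set.
    have djH : s \in j |: H1 by rewrite in_setU1 s1 orbT.
    apply: (@T_pair _ _ (pv s w1) (pv s v2) (pH s (j |: H1)) (pH s K2)) => //.
    + by apply: proper_half => f /(subsetP sub); exact: pG.
    + by apply: contra n12 => /eqP/pv_inj->.
    + by have := cov_half (d := s) (w1 s) (covered_sub sub cG); rewrite /= e2 eqxx ne3.
    + by apply: star_half; exact: star1_add.
    + by have := star_half s (star1_sub sub st2); rewrite e2.
    + by rewrite -ltnS (pH_mem djH) cardsU1 jS c1.
    by rewrite pH_out.
  - apply: Or32; split; last by apply: (leq_trans (leq_add fq (leqnn 2))); move: n4; clear; lia.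
    by apply: (leq_trans (leq_add (leqnn _) X1)); move: f1; clear; lia.
  rewrite -/q; have [|i hi] := alpha_count qf; last by apply: Or31; exists i.
  by apply: (leq_trans (leq_add fq X1)).
have [h|h] := eqVneq (w2 s) (w1 s); first exact: (main _ _ _ _ tr).
apply: (main _ _ _ _ (tri_swap tr)) => //; first by rewrite e23 flipK.
by move: h; rewrite e23 flipE eqxx; case: (w2 s); case: (w1 s).
Qed.

(** * Splittings in the presence of several vertices of low degree *)

Section Main.
Variables (n : nat) (G : {set vert n.+2 * 'I_n.+2}).
Hypotheses (Ta : forall m, m <= n.+1 -> T m) (pG : properG G) (n5 : 5 <= n) (cG : #|G| <= bnd n.+2).

Let tm : T n.+1. Proof. exact: Ta. Qed.
Let n4 : 4 <= n. Proof. exact: ltnW. Qed.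
Let n3 : 3 <= n. Proof. exact: ltnW. Qed.

(* Vertices which may get degree two in the halves of the splitting in direction d lie on different sides. *)
Definition fits d := (forall u : vert n.+2, fd G u + 1 <= n + isf G u d) /\
  (forall u v : vert n.+2, u d = v d -> fd G u + 1 = n + isf G u d -> fd G v + 1 = n + isf G v d -> u = v).

Lemma cG9 : #|G| <= 4 * n - 9.
Proof. by have := bndP n4; move: cG n5; clear; lia. Qed.

Lemma bnd1 : #|G| <= bnd n.+1 + 3 + (5 < n).
Proof. by have := bndP n4; move: cG n5; case: ltnP; clear; lia. Qed.

Lemma fits_join d w : fits d -> n.-1 <= fd G w -> #|G| <= vnum G w d + bnd n.+1 -> lace G.
Proof.
move=> [h3 h4] fw hv; apply: (@join_T n d G w) => //.
- by move: cG9 n5; clear; lia.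
- by have := other_half d G w; have := bndP n4; move: cG fw n5; clear; lia.
by move=> u v ud hu hv'; right; exact: h4.
Qed.

(** All faults at [w'] violate [d] as seen from [w], and these are already enough. *)
Lemma sep_join d w w' : fits d -> n.-1 <= fd G w -> n.-1 <= fd G w' -> w d != w' d -> lace G.
Proof.
move=> ft fw fw' ne; apply: (fits_join ft fw).
have : fd G w' <= vnum G w d; last by have := bndP n4; move: cG fw' n5; clear; lia.
rewrite -card_inc; apply/subset_leq_card/subsetP => f; rewrite !inE => /andP[-> /eqP e] /=.
rewrite e ffunE (eq_sym d); case: eqP => //= _; by rewrite eq_sym.
Qed.

Lemma restore_T d c f : fits d -> f \in G -> d \notin viol c f -> (forall y, f \in inc G y -> ~~ isf G y d) ->
  #|G| <= vnum G c d + (bnd n.+1).+1 -> vnum G c d <= n.-2 ->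
  (forall y, f \in inc G y -> fd G y + vnum G c d <= n.+1 /\ fd G y + 2 <= n.+1) -> lace G.
Proof.
move=> [h3 h4] fG fv hX hv v2 hy; have sG : G :\ f \subset G by exact: subD1set.
apply: (@restore_v n d G c f) => //.
have le (u : vert n.+2) : fd (G :\ f) u <= fd G u := fdS u sG.
have iE (u : vert n.+2) : isf (G :\ f) u d = isf G u d.
  rewrite /isf in_setD1; case: eqP => // ef; case/negP: fv; rewrite -ef; exact: viol_self.
apply: tm; first by move: n4; clear; lia.
apply: good_half.
- by move=> g /(subsetP sG); exact: pG.
- have [|||u [k [ef uk]]] := @half_elem _ d G (c d) f => //.
  + by move: fv; rewrite inE negb_or => /andP[].
  + by move: fv; rewrite inE negb_or negbK => /andP[_ /eqP].
  rewrite ef halfD1; have e2 := cardsD1 (u, k) (halfG d G (c d)); rewrite uk add1n in e2.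
  rewrite -ltnS -e2 -(leq_add2r (vnum G c d)) half_vnum; apply: leq_trans hv _.
  by rewrite addnC.
- by move=> u _; rewrite iE; apply: leq_trans (h3 u); rewrite leq_add2r.
- by move: n5; clear; lia.
move=> u v ud vd; rewrite !iE => hu hv'; right; apply: h4; first by rewrite ud vd.
  by have := h3 u; have := le u; move: hu; clear; lia.
by have := h3 v; have := le v; move: hv'; clear; lia.
Qed.

(** All violations are edges in direction [d] at vertices of [L], so an end of [f] in the half of
    [c], not being in [L], crosses safely and [f] can be restored. *)
Lemma single_other d c (L : seq (vert n.+2)) f : fits d ->
  (forall g, g \in G -> d \in viol c g -> exists w, [/\ w \in L, w d = c d & g = (low w d, d)]) ->
  f \in G -> d \notin viol c f -> (forall w, w \in L -> f \notin inc G w) -> (forall u : vert n.+2, u \notin L -> fd G u + 2 <= n) ->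
  #|G| <= vnum G c d + (bnd n.+1).+1 -> vnum G c d <= 3 -> lace G.
Proof.
move=> ft hV fG fv fL hL hv v3.
have yL y : f \in inc G y -> y \notin L by move=> fy; apply: contraL fy; exact: fL.
apply: (restore_T ft fG fv) => //.
- move=> y fy; apply/negP => yd; have := isf_viol c yd; rewrite inE => /andP[g1 g2].
  have [w [wL wd [e]]] := hV _ g1 g2; have yc := inc_end fy fv.
  by have := yL y fy; rewrite (low_same e _) ?wL // yc wd.
- by move: v3 n5; clear; lia.
by move=> y /yL/hL; move: v3 n5; clear; lia.
Qed.

Lemma inc_viol_self (w : vert n.+2) f d : f \in inc G w -> d \in viol w f -> f = (low w d, d).
Proof.
case: f => a i; rewrite inE /= => /andP[_ /eqP ->]; rewrite inE /= ffunE eq_sym.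
by case: eqP => [->|_] //=; rewrite eqxx.
Qed.

Lemma inc_viol_other (c w : vert n.+2) f d : w d = c d -> f \in inc G w -> d \in viol c f -> f = (low w d, d).
Proof.
move=> e fw h; apply: (inc_viol_self fw); move: h; rewrite !inE e //.
Qed.

Section Two.
Variables w1 w2 : vert n.+2.
Hypotheses (n12 : w1 != w2) (f2 : fd G w2 = n.-1).
Hypothesis ho : forall u : vert n.+2, u \notin [:: w1; w2] -> fd G u + 2 <= n.

Lemma fits_two d : fd G w1 + 1 <= n + isf G w1 d ->
  (w1 d != w2 d) || (fd G w1 + 1 < n + isf G w1 d) || isf G w2 d -> fits d.
Proof.
move=> h1 h; have hu (u : vert n.+2) : fd G u + 1 <= n + isf G u d.
  have [->//|u1] := eqVneq u w1; have [->|u2] := eqVneq u w2; first by rewrite f2; move: n5; clear; lia.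
  by have := ho (u := u); rewrite !inE (negPf u1) (negPf u2) => /(_ isT); clear; lia.
have h2 (u : vert n.+2) : fd G u + 1 = n + isf G u d -> u = w1 \/ u = w2.
  move=> e; have [->|u1] := eqVneq u w1; first by left. 
  have [->|u2] := eqVneq u w2; first by right.
  by have := ho (u := u); rewrite !inE (negPf u1) (negPf u2) => /(_ isT); move: e; clear; lia.
split=> // u v uv eu ev.
have no : w1 d = w2 d -> fd G w1 + 1 = n + isf G w1 d -> fd G w2 + 1 = n + isf G w2 d -> False.
  move=> e e1 e2; move: h; rewrite e eqxx /= e1 ltnn /= => hi; move: e2; rewrite hi f2; move: n5; clear; lia.
case: (h2 u eu) => e; case: (h2 v ev) => e'; rewrite e e' in uv eu ev *; rewrite //; exfalso; first exact: no.
exact: no (esym uv) ev eu.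
Qed.
End Two.
End Main.

Definition hl n (G : {set vert n * 'I_n}) w := [set i | ~~ isf G w i].
Lemma hl_card n (G : {set vert n * 'I_n}) w k : fd G w + k = n -> #|hl G w| = k.
Proof. by move=> e; apply/eqP; rewrite -(eqn_add2r (fd G w)) card_healthy addnC e. Qed.
Lemma hl_star n (G : {set vert n * 'I_n}) w : star1 G w (hl G w).
Proof. by move=> i; rewrite inE. Qed.
Lemma hl_exact n (G : {set vert n * 'I_n}) w : exact G w (hl G w).
Proof. by move=> i; rewrite inE negbK. Qed.
Lemma star1S n (G : {set vert n * 'I_n}) w (H K : {set 'I_n}) : K \subset H -> star1 G w H -> star1 G w K.
Proof. by move=> s h i /(subsetP s)/h. Qed.

(** An exceptional case in dimension 8. One of the four healthy directions of [x] is dropped, chosen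
    so that [tri_meet] or [pure_diff] applies to the remaining three. *)
Lemma star8 (G : {set vert 8 * 'I_8}) w1 w2 x : (forall m, m <= 7 -> T m) -> properG G ->
  covered G [:: w1; w2; x] -> w1 != w2 -> w1 != x -> w2 != x -> fd G w1 = 6 -> fd G w2 = 5 -> fd G x = 4 -> lace G.
Proof.
move=> Ta pG cG n12 n1x n2x f1 f2 fx.
have c1 : #|hl G w1| = 2 by apply: hl_card; rewrite f1.
have c2 : #|hl G w2| = 3 by apply: hl_card; rewrite f2.
have cx : #|hl G x| = 4 by apply: hl_card; rewrite fx.
have pick h y : exists2 z, z \in hl G x & (z != h) && (z != y).
  have : 0 < #|hl G x :\: [set h; y]|.
    have : #|hl G x :&: [set h; y]| <= 2.
      by apply: leq_trans (subset_leq_card (subsetIr _ _)) _; rewrite cards2; case: (h == y).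
    by have := cardsID [set h; y] (hl G x); rewrite cx; clear; lia.
  by case/card_gt0P => z; rewrite !inE negb_or => /andP[zh zx]; exists z; rewrite ?inE.
have key h y : exists z, [/\ z != h, z != y & tri G w1 (hl G w1) w2 (hl G w2) x (hl G x :\ z)] /\ #|hl G x :\ z| = 3.
  have [z zx /andP[zh zy]] := pick h y; exists z.
  have c3 : #|hl G x :\ z| = 3 by have := cardsD1 z (hl G x); rewrite zx cx; clear; lia.
  split=> //; split=> //; split=> //; rewrite ?c1 ?c2 ?c3 //.
  by split; [exact: hl_star|exact: hl_star|apply: star1S (@hl_star _ _ _); exact: subD1set].
have [/set0Pn[h /setIP[hU h1]]|nm] := boolP ((hl G w2 :|: hl G x) :&: hl G w1 != set0).
  have [z [[zh _ tr] c3]] := key h h.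
  apply: (@tri_meet base5P 6 G _ _ _ _ _ _ Ta isT tr) => //.
    apply/set0Pn; exists h; rewrite in_setI h1 andbT; move: hU; rewrite !in_setU => /orP[->//|hx].
    by rewrite in_setD1 eq_sym zh hx orbT.
  by right; apply: leq_trans (leq_card_setU _ _) _; rewrite c2 c3.
move: nm; rewrite negbK => /eqP m0.
(* Outside the narrow set six directions remain for healthy sets of sizes three and four, so they
   meet. Keeping a common direction [h] bounds the union by five; keeping [y] makes the sets
   different. *)
have [h /setIP[h2 hx]] : exists h, h \in hl G w2 :&: hl G x.
  apply/set0Pn; rewrite -card_gt0; have := cardsUI (hl G w2) (hl G x); rewrite c2 cx.
  have := cardsUI (hl G w2 :|: hl G x) (hl G w1); rewrite m0 cards0 c1.
  have : #|hl G w2 :|: hl G x :|: hl G w1| <= 8 by rewrite -[X in _ <= X](card_ord 8) max_card.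
  by clear; lia.
have [y yx y2] : exists2 y, y \in hl G x & y \notin hl G w2.
  by apply/subsetPn; apply/negP => /subset_leq_card; rewrite c2 cx.
have [z [[zh zy tr] c3]] := key h y.
have s0 : hl G w2 :|: hl G x :\ z \subset hl G w2 :|: hl G x by apply: setUS; exact: subD1set.
apply: (@pure_diff 5 G _ _ _ _ _ _ Ta isT tr) => //.
- by apply: contraNneq y2 => ->; rewrite in_setD1 eq_sym zy.
- by apply/eqP; rewrite -subset0 -m0 setSI.
have i0 : 0 < #|hl G w2 :&: (hl G x :\ z)|.
  by apply/card_gt0P; exists h; rewrite in_setI h2 in_setD1 eq_sym zh.
rewrite -(leq_add2r #|hl G w2 :&: (hl G x :\ z)|) cardsUI c2 c3 -[3 + 3]/(5 + 1).
by rewrite leq_add2l.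
Qed.

(** * Two vertices of low degree *)

Section TwoLow.
Variables (n : nat) (G : {set vert n.+2 * 'I_n.+2}).
Hypotheses (Ta : forall m, m <= n.+1 -> T m) (pG : properG G) (n5 : 5 <= n) (cG : #|G| <= bnd n.+2).
Variables w1 w2 : vert n.+2.
Hypotheses (n12 : w1 != w2) (f2 : fd G w2 = n.-1).
Hypothesis ho : forall u : vert n.+2, u \notin [:: w1; w2] -> fd G u + 2 <= n.
Let n4 : 4 <= n. Proof. exact: ltnW. Qed.

Lemma two_33 : fd G w1 = n.-1 -> lace G.
Proof.
move=> f1; have [d hd] := differ n12; apply: (@sep_join n G Ta pG n5 cG d w1 w2) => //; rewrite ?f1 ?f2 //.
by apply: (fits_two n5 f2 ho); rewrite ?hd // f1; move: n5; clear; lia.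
Qed.

Hypothesis f1 : fd G w1 = n.

Lemma two_sep d : isf G w1 d -> w1 d != w2 d -> lace G.
Proof.
move=> wd hd; apply: (@sep_join n G Ta pG n5 cG d w1 w2) => //; rewrite ?f1 ?f2 ?leq_pred //.
by apply: (fits_two n5 f2 ho); rewrite ?hd // f1 wd.
Qed.

Hypothesis hs : forall d, isf G w1 d -> w2 d = w1 d.
Let O := G :\: (inc G w1 :|: inc G w2).

Lemma two_apart f : f \in inc G w1 -> f \in inc G w2 -> False.
Proof.
move=> h1 h2; have [e i] := inc2 h1 h2 n12; have := hs (d := f.2).
by rewrite e isf_flip => /(_ i)/eqP; rewrite flipE eqxx; case: (w2 _).
Qed.

Lemma two_others : #|O| + (n + n.-1) = #|G|.
Proof.
have := cardsID (inc G w1 :|: inc G w2) G; rewrite -/O => <-; rewrite addnC; congr (_ + _).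
have -> : G :&: (inc G w1 :|: inc G w2) = inc G w1 :|: inc G w2.
  by apply/setIidPr; rewrite subUset !inc_sub.
have := cardsUI (inc G w1) (inc G w2); rewrite !card_inc f1 f2 => <-.
rewrite (_ : _ :&: _ = set0) ?cards0 ?addn0 //; apply/setP => f; rewrite in_setI in_set0.
by apply/negP => /andP[h1 h2]; exact: two_apart h1 h2.
Qed.

Lemma OP f : f \in O -> [/\ f \in G, f \notin inc G w1 & f \notin inc G w2].
Proof. by rewrite in_setD in_setU negb_or => /andP[/andP[h1 h2] h]. Qed.

Let A d := [set f in O | d \in viol w1 f].

Lemma viol_two d g : isf G w1 d -> g \in G -> d \in viol w1 g -> [\/ g = (low w1 d, d), g = (low w2 d, d) | g \in A d].
Proof.
move=> wd gG gv; have [h|h] := boolP (g \in inc G w1); first by apply: Or31; exact: inc_viol_self h gv.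
have [h'|h'] := boolP (g \in inc G w2); first by apply: Or32; exact: inc_viol_other (hs wd) h' gv.
by apply: Or33; rewrite inE gv in_setD in_setU negb_or h h' gG.
Qed.

Lemma vnum_two d : isf G w1 d -> isf G w2 d -> vnum G w1 d = #|A d| + 2.
Proof.
move=> h1 h2; have i1 := inc_isf h1; have i2 := inc_isf h2.
have nA w (e : vert n.+2 * 'I_n.+2) : w \in [:: w1; w2] -> e \in inc G w -> e \notin A d.
  move=> ww h; apply/negP; rewrite inE => /andP[/OP[_ g1 g2] _]; move: ww h.
  by rewrite inE (inE) => /orP[]/eqP-> h; [case/negP: g1|case/negP: g2].
have e12 : (low w1 d, d) \notin (low w2 d, d) |: A d.
  rewrite in_setU1 negb_or (nA w1) // ?mem_head // andbT; apply/negP => /eqP e.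
  by apply: (two_apart i1); rewrite e.
rewrite addn2; transitivity #|(low w1 d, d) |: ((low w2 d, d) |: A d)|; last first.
  have e2 : (low w2 d, d) \notin A d by apply: (nA w2) i2; rewrite inE mem_head orbT.
  by rewrite cardsU1 e12 cardsU1 e2.
apply: eq_card => g; rewrite !in_setU1 [in LHS]inE; apply/andP/or3P => [[gG gv]|].
  by case: (viol_two h1 gG gv) => h; [apply: Or31; rewrite h|apply: Or32; rewrite h|apply: Or33; exact: h].
case=> [/eqP->|/eqP->|]; first by split; [exact: (subsetP (inc_sub _ _) _ i1)|exact: viol_self].
  by split; [exact: (subsetP (inc_sub _ _) _ i2)|exact: viol_self].
by rewrite inE => /andP[/OP[gG _ _] gv].
Qed.

(** For a direction faulty at both low vertices, the violations are their two edges and the other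
    faults in [A d]. If these suffice, the cube is split. If one is missing, a fault of [O] is
    restored, which fails only when all of [O] sits at one vertex [x]; then the dimension is 8 and
    [star8] applies. If more are missing for all these directions, then each [A d] is empty and the
    fault number is maximal, which is left to [far]. *)
Lemma two_short (far : n >= 6 -> #|G| = 4 * n - 9 -> (forall d, isf G w1 d -> isf G w2 d -> A d = set0) -> lace G) : lace G.
Proof.
have B := bndP n4; have b1 := bnd1 n5 cG; have c9 := cG9 n5 cG; have o2 := two_others.
have ft d : isf G w1 d -> isf G w2 d -> fits G d.
  by move=> h1 h2; apply: (fits_two n5 f2 ho); rewrite ?h2 ?orbT // f1 h1.
case: (ex_dir (fun d => [&& isf G w1 d, isf G w2 d & #|G| <= #|A d| + 2 + bnd n.+1])) => [[d /and3P[h1 h2 hv]]|nJ].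
  by apply: (@fits_join n G Ta pG n5 cG d w1); rewrite ?vnum_two //; [exact: ft|rewrite f1 leq_pred].
have hJ d : isf G w1 d -> isf G w2 d -> #|A d| + 2 + bnd n.+1 < #|G|.
  by move=> h1 h2; have := nJ d; rewrite h1 h2 -ltnNge.
have offO d g : isf G w1 d -> g \in O -> d \notin viol w1 g -> forall y, g \in inc G y -> isf G y d -> (low y d, d) \in A d.
  move=> h1 gO gv y gy yd; have := isf_viol w1 yd; rewrite inE => /andP[k1 k2].
  have [_ g1 g2] := OP gO; have yc := inc_end gy gv.
  case: (viol_two h1 k1 k2) => // -[e].
    by case/negP: g1; rewrite -(low_same e yc).
  by case/negP: g2; rewrite -(low_same e _) // yc hs.
have fdO y f : f \in O -> f \in inc G y -> fd G y + 2 <= n.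
  move=> /OP[_ g1 g2] fy; apply: ho; rewrite !inE; apply/norP; split; apply: contraTneq fy => ->; by [].
case: (ex_dir (fun d => [&& isf G w1 d, isf G w2 d & #|G| <= #|A d| + 3 + bnd n.+1])) => [[d /and3P[h1 h2 hv]]|nS].
  have hj := hJ d h1 h2; have vE := vnum_two h1 h2.
  have run f : f \in O -> d \notin viol w1 f -> (forall y, f \in inc G y -> ~~ isf G y d) -> lace G.
    move=> fO fv sf; have [fG _ _] := OP fO; apply: (@restore_T n G Ta pG n5 d w1 f) => //.
    - exact: ft.
    - by rewrite vE; move: hv; clear; lia.
    - by rewrite vE; move: hj b1 n5 B c9; case: ltnP; clear; lia.
    by move=> y fy; have := fdO y f fO fy; rewrite vE; move: hj b1 n5; case: ltnP; clear; lia.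
  have cA1 : #|A d| <= 1 by move: hj b1; case: (5 < n); clear; lia.
  have sA : A d \subset O by apply/subsetP => g; rewrite inE => /andP[].
  have [A0|/set0Pn[g gA]] := eqVneq (A d) set0.
    have /card_gt0P[f fO] : 0 < #|O| by move: o2 hj b1 B n5 c9; rewrite A0 cards0; case: ltnP; clear; lia.
    have [fG _ _] := OP fO; have fv : d \notin viol w1 f.
      by apply/negP => h; have : f \in A d by [rewrite inE fO h]; rewrite A0 inE.
    by apply: (run f fO fv) => y fy; apply/negP => yd; have := offO d f h1 fO fv y fy yd; rewrite A0 inE.
  have eA g' : g' \in A d -> g' = g by move=> h; apply: (card_le1_eqP cA1).
  have gO := subsetP sA g gA.
  pose x := if g.1 d == w1 d then g.1 else flip g.1 d.
  case: (ex_fin (fun f : vert n.+2 * 'I_n.+2 => [&& f \in O, f != g & ~~ ((g.2 == d) && (f \in inc G x))])) => [[f /and3P[fO fg fx]]|no].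
    have fv : d \notin viol w1 f.
      by apply: contra fg => h; rewrite (eA f) // inE fO h.
    apply: (run f fO fv) => y fy; apply/negP => yd; have /eA eg := offO d f h1 fO fv y fy yd.
    case/negP: fx; rewrite -eg eqxx /=; suff -> : x = y by [].
    have yc := inc_end fy fv; apply: (@low_same _ _ _ d); last first.
      by rewrite yc /x; case: eqP => // /eqP; rewrite flipE eqxx; case: (g.1 d); case: (w1 d).
    have [gG _ _] := OP gO; have := pG gG; rewrite -eg /= => hl'.
    by rewrite /x; case: ifP => _; rewrite ?low_flip -eg /= low_id.
  have cA : #|A d| = 1 by apply/eqP; rewrite eqn_leq cA1 card_gt0; apply/set0Pn; exists g.
  have inx f : f \in O -> f != g -> g.2 = d /\ f \in inc G x.
    by move=> fO fg; have := no f; rewrite fO fg negbK => /andP[/eqP].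
  have O4 : 4 <= #|O| by move: o2 hj b1 B n5 c9; rewrite cA; case: ltnP; clear; lia.
  have /card_gt0P[f0] : 0 < #|O :\ g| by have := cardsD1 g O; rewrite gO; move: O4; clear; lia.
  rewrite in_setD1 => /andP[fg0 fO0]; have [g2 fx0] := inx f0 fO0 fg0.
  have gx : g \in inc G x.
    have [gG _ _] := OP gO; rewrite inE gG g2 /= /x; have := pG gG; rewrite g2 => hl'.
    by case: ifP => _; rewrite ?low_flip low_id.
  have Ox : O \subset inc G x.
    by apply/subsetP => f fO; have [->//|fg] := eqVneq f g; case: (inx f fO fg).
  have [_ gw1 gw2] := OP gO.
  have xw1 : w1 != x by apply: contraNneq gw1 => ->.
  have xw2 : w2 != x by apply: contraNneq gw2 => ->.
  have fx := fdO x g gO gx; have := subset_leq_card Ox; rewrite card_inc => Ofd.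
  have [n6 fx4] : n = 6 /\ fd G x = 4.
    by move: o2 hj b1 B n5 c9 fx Ofd; rewrite cA; case: ltnP; clear; lia.
  have cov : covered G [:: w1; w2; x].
    move=> f fG; have [h|h] := boolP (f \in inc G w1); first by exists w1; rewrite ?mem_head.
    have [h'|h'] := boolP (f \in inc G w2); first by exists w2; rewrite // !inE eqxx orbT.
    exists x; first by rewrite !inE eqxx !orbT.
    by apply: (subsetP Ox); rewrite in_setD in_setU negb_or h h' fG.
  clear -n6 Ta pG n12 f1 f2 fx4 cov xw1 xw2; subst n.
  exact: (star8 Ta pG cov n12 xw1 xw2 f1 f2 fx4).
have hS d : isf G w1 d -> isf G w2 d -> #|A d| + 3 + bnd n.+1 < #|G|.
  by move=> h1 h2; have := nS d; rewrite h1 h2 -ltnNge.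
have [d d1 d2] : exists2 d, isf G w1 d & isf G w2 d.
  case: (ex_dir (fun d => isf G w1 d && isf G w2 d)) => [[d /andP[h1 h2]]|no]; first by exists d.
  have : fd G w1 + fd G w2 <= n.+2.
    rewrite -[X in _ <= X](card_ord n.+2) /fd; set S1 := [set i | isf G w1 i]; set S2 := [set i | isf G w2 i].
    rewrite -cardsUI (_ : S1 :&: S2 = set0) ?cards0 ?addn0 ?max_card //.
    by apply/setP => i; rewrite !inE; apply/negbTE.
  by rewrite f1 f2; move: n5; clear; lia.
have := hS d d1 d2 => hd; apply: far.
- by move: hd b1; case: ltnP; clear; lia.
- by move: hd b1 B n5 c9; case: ltnP; clear; lia.
move=> e e1 e2; apply/eqP; rewrite -cards_eq0; have := hS e e1 e2.
by move: b1; case: ltnP; clear; lia.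
Qed.
End TwoLow.

(** * Two low vertices whose common faulty directions are not violated elsewhere *)

Lemma stro_by n d (Q : {set vert n.+1 * 'I_n.+1}) : 6 <= n -> #|Q| <= 2 * n - 8 ->
  (forall b, exists K : {set vert n * 'I_n}, #|K| <= n - 3 /\ halfG d Q b = K) -> stro Q.
Proof.
case: n d Q => // n d Q n6 cQ h; have cX : #|crossG d Q| <= #|Q|.
  by apply: leq_trans (half_le d Q false); exact: leq_addl.
have e : 2 * n.+1 - 8 < 2 ^ n.-1 by apply: exp_gt; move: n6; clear; lia.
have e2 : 2 ^ n = 2 * 2 ^ n.-1 by rewrite -expnS prednK //; move: n6; clear; lia.
have st b : stro (halfG d Q b).
  by have [K [cK ->]] := h b; apply: few_stro'; move: cK n6; clear; lia.
apply: (@split_stro n d Q); [| |exact: st|exact: st];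
  by move: cX cQ e n6; rewrite e2; move: #|crossG d Q| (2 ^ n.-1) => a p; clear; lia.
Qed.

(* All faults lie within a subcube of dimension at most four around [p]. *)
Lemma stro_flat n (Q : {set vert n.+1 * 'I_n.+1}) (D : {set 'I_n.+1}) p : 6 <= n -> properG Q -> #|Q| <= 2 * n - 8 -> #|D| <= 4 ->
  (forall f k, f \in Q -> k \notin D -> f.2 != k /\ f.1 k = p k) -> stro Q.
Proof.
move=> n6 pQ cQ cD hD; have [h|h] := leqP #|Q| n.-2; first by apply: few_stro' h; move: n6; clear; lia.
pose c : vert n.+1 := [ffun k => if k \in D then heavy Q k else p k].
have vD f : f \in Q -> viol c f \subset D.
  move=> fQ; apply/subsetP => k; rewrite inE => kv; apply: contraT => kD.
  have [k1 k2] := hD f k fQ kD; move: kv; rewrite (negPf k1) k2 ffunE (negPf kD) eqxx //.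
have fc : fd Q c <= 4.
  apply: leq_trans cD; apply/subset_leq_card/subsetP => k; rewrite inE => ck; apply: contraT => kD.
  by have [/eqP] := hD _ k ck kD.
have [d dD hd] : exists2 d, d \in D & #|Q| <= vnum Q c d + (n - 3).
  case: (ex_dir (fun d => (d \in D) && (#|Q| <= vnum Q c d + (n - 3)))) => [[d /andP[h1 h2]]|no]; first by exists d.
  have := viol_total c pQ; rewrite (eq_bigr (fun f => #|viol c f :&: D|)); last by move=> f /vD/setIidPl->.
  have := @viol_avg _ Q c D (#|Q| - (n - 2)) _.
  have k d : d \in D -> vnum Q c d <= #|Q| - (n - 2) by move=> dD; have := no d; rewrite dD /=; move: n6; clear; lia.
  move=> /(_ k); move: (\sum_(_ in _) _) => s s1 s2.
  have s3 : (#|Q| - (n - 2)) * #|D| <= (#|Q| - (n - 2)) * 4 by rewrite leq_mul2l cD orbT.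
  by move: s1 s2 s3 fc cQ n6 h; move: ((#|Q| - (n - 2)) * #|D|) => x; clear; lia.
apply: (@stro_by n d Q) => // b; exists (halfG d Q b); split=> //.
have ec : c d = heavy Q d by rewrite ffunE dD.
have k1 := half_vnum d Q c; have k2 := heavyP Q d.
have [->|nb] := eqVneq b (c d); first by move: k1 hd; clear; lia.
have -> : b = ~~ heavy Q d by rewrite -ec; move: nb; case: (b); case: (c d).
rewrite -leq_double; apply: leq_trans k2 _; apply: leq_trans cQ _; clear -n6; lia.
Qed.

Section TwoFar.
Variables (n : nat) (G : {set vert n.+2 * 'I_n.+2}).
Hypotheses (Ta : forall m, m <= n.+1 -> T m) (pG : properG G) (n6 : 6 <= n) (cG : #|G| = 4 * n - 9).
Variables w1 w2 : vert n.+2.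
Hypotheses (n12 : w1 != w2) (f1 : fd G w1 = n) (f2 : fd G w2 = n.-1).
Hypothesis ho : forall u : vert n.+2, u \notin [:: w1; w2] -> fd G u + 2 <= n.
Hypothesis hs : forall d, isf G w1 d -> w2 d = w1 d.
Let O := G :\: (inc G w1 :|: inc G w2).
Hypothesis hz : forall d f, isf G w1 d -> isf G w2 d -> f \in O -> d \notin viol w1 f.
Hypothesis oc : #|O| + (n + n.-1) = #|G|.

Let W := hl G w1 :|: hl G w2.
Lemma farW k : k \notin W -> isf G w1 k /\ isf G w2 k.
Proof. by rewrite !inE negb_or !negbK => /andP. Qed.

Lemma farO f k : f \in O -> k \notin W -> f.2 != k /\ f.1 k = w1 k.
Proof.
by move=> fO /farW[h1 h2]; have := hz h1 h2 fO; rewrite inE negb_or negbK => /andP[-> /eqP->].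
Qed.

Let D := hl G w2 :\: hl G w1.
Let A d := [set f in O | d \in viol w1 f].

(** A fault of [O] violating no direction of [D] violates exactly the two healthy directions [a],
    [b] of [w1], so it is at the corner [c] opposite to [w1] in their square. If [w2] is that
    corner, there are none, and [D] has at most three elements. If [w2] is the neighbour of [w1] in
    direction [a], there is at most one, and [D] has at most two. As [O] has at least four faults,
    two of them violate a common direction of [D]. *)
Lemma far_dir : exists2 d, d \in D & 2 <= #|A d|.
Proof.
have c1 : #|hl G w1| = 2 by apply: hl_card; rewrite f1 addn2.
have c2 : #|hl G w2| = 3 by apply: hl_card; rewrite f2; move: n6; clear; lia.
have [a na] := differ n12; rewrite eq_sym in na.
have a1 : a \in hl G w1 by rewrite inE; apply: contra na => /hs->.
have /cards1P[b eb] : #|hl G w1 :\ a| == 1 by have := cardsD1 a (hl G w1); rewrite a1 c1; clear; lia.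
have /setD1P[ba b1] : b \in hl G w1 :\ a by rewrite eb inE.
have eH : hl G w1 = [set a; b] by rewrite -(setD1K a1) eb.
pose c := flip (flip w1 a) b.
pose Fl := [set f in O | viol w1 f :&: D == set0].
have flat f : f \in Fl -> [/\ f \in O, f \in inc G c & f.2 = a \/ f.2 = b].
  rewrite inE => /andP[fO /eqP v0]; have [fG g1 g2] := OP fO.
  have vH : viol w1 f \subset hl G w1.
    apply/subsetP => k kv; apply: contraT => kH; have [kW|kW] := boolP (k \in W); last first.
      have [h1 h2] := farO fO kW; move: kv; by rewrite inE (negPf h1) h2 eqxx.
    have kD : k \in D by rewrite in_setD kH; move: kW; rewrite in_setU (negPf kH).
    by have := in_set0 k; rewrite -v0 in_setI kv kD.
  have vE : viol w1 f = [set a; b].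
    apply/eqP; rewrite -eH eqEcard vH c1 ltnNge; apply: contra g1 => h; exact: viol_center.
  have vP k : (k \in viol w1 f) = (k == a) || (k == b) by rewrite vE !inE.
  split=> //; last by have := vP f.2; rewrite viol_self => /esym/orP[]/eqP; [left|right].
  rewrite inE fG; apply/eqP/ffunP => k; rewrite ffunE; have [->|kf] := eqVneq k f.2.
    by rewrite (negPf (pG fG)).
  rewrite /c !flipE /=; have := vP k; rewrite inE eq_sym (negPf kf) /= => e.
  by case: (k =P a) (k =P b) e => [->|_] [kb|_]; rewrite ?addbF ?addFb; [move: ba; rewrite -kb eqxx| | |];
    case: (f.1 _); case: (w1 _).
have Ob g : g \in O -> g \notin Fl -> exists2 d, d \in D & g \in A d.
  move=> gO; rewrite inE gO => /set0Pn[d /setIP[h1 h2]]; exists d => //; by rewrite inE gO h1.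
case: (ex_dir (fun d => (d \in D) && (2 <= #|A d|))) => [[d /andP[h1 h2]]|no]; first by exists d.
have le1 : #|O :\: Fl| <= #|D|.
  apply: (@leq_trans #|\bigcup_(d in D) A d|).
    apply/subset_leq_card/subsetP => g; rewrite in_setD => /andP[gF gO]; have [d dD gA] := Ob g gO gF.
    by apply/bigcupP; exists d.
  rewrite -[X in _ <= X]sum1_card; elim/big_rec2: _ => [|d k B dD IH]; first by rewrite cards0.
  apply: leq_trans (leq_card_setU _ _) _; apply: leq_add IH.
  by have := no d; rewrite dD /= -ltnNge ltnS.
have O4 : 4 <= #|O| by move: oc cG n6; clear; lia.
have cF : #|O| <= #|O :\: Fl| + #|Fl|.
  by rewrite -(cardsID Fl O) addnC leq_add2l subset_leq_card // subsetIr.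
have [e|e] := eqVneq (w2 b) (w1 b); last first.
  have ew : w2 = c.
    apply/ffunP => k; rewrite !flipE; case: (k =P b) => [->|/eqP kb].
      by rewrite (negPf ba); move: e; case: (w2 b); case: (w1 b).
    case: (k =P a) => [->|/eqP ka]; first by move: na; case: (w2 a); case: (w1 a).
    apply: hs; apply: contraT => h; have : k \in hl G w1 by rewrite inE.
    by rewrite eH !inE (negPf ka) (negPf kb).
  have F0 : Fl = set0.
    apply/setP => f; rewrite in_set0; apply/negP => /flat[/OP[_ _]]; by rewrite ew => /negPf->.
  have cD : #|D| <= 3 by rewrite -c2 subset_leq_card // subsetDl.
  by move: O4 cF le1 cD; rewrite F0 cards0 setD0; clear; lia.
have ew : w2 = flip w1 a.
  apply/ffunP => k; rewrite flipE; case: (k =P a) => [->|/eqP ka]; first by move: na; case: (w2 a); case: (w1 a).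
  case: (k =P b) => [->|/eqP kb]; first by rewrite e.
  apply: hs; apply: contraT => h; have : k \in hl G w1 by rewrite inE.
  by rewrite eH !inE (negPf ka) (negPf kb).
have cF1 : #|Fl| <= 1.
  have fa f : f \in Fl -> f = (low c a, a).
    move=> /flat[/OP[_ _ g2] fc [fa|fb]].
      by move: fc; rewrite inE fa => /andP[_ /eqP<-]; rewrite -fa -surjective_pairing.
    case/negP: g2; move: fc; rewrite !inE => /andP[-> /eqP->]; by rewrite ew /c fb low_flip eqxx.
  rewrite -(cards1 (low c a, a)); apply/subset_leq_card/subsetP => f /fa ->; by rewrite set11.
have cD : #|D| <= 2.
  have a2 : a \in hl G w2 by rewrite ew inE isf_flip; move: a1; rewrite inE.
  have := cardsID (hl G w1) (hl G w2); have : 0 < #|hl G w2 :&: hl G w1| by apply/card_gt0P; exists a; rewrite inE a2.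
  by rewrite -/D c2; clear; lia.
by move: O4 cF le1 cD cF1; clear; lia.
Qed.

(** The cube is split along the direction [d] of [far_dir], healthy at [w2], and an edge at [w2] is
    restored in a direction [j] faulty at both low vertices. Every faulty edge in direction [d]
    agrees with [w1] in coordinate [j] ([faulty]), while the other end [q] of the restored edge does
    not; this provides the exits. The faults of the far half lie in a subcube of dimension at most
    four, so [stro_flat] makes that half strong. *)
Lemma two_far : lace G.
Proof.
have [d dD A2] := far_dir; move: dD; rewrite in_setD => /andP[dh1 dh2].
have w1d : isf G w1 d by move: dh1; rewrite inE negbK.
have w2d : ~~ isf G w2 d by move: dh2; rewrite inE.
have e2 : w2 d = w1 d by exact: hs.
have dW : d \in W by rewrite in_setU dh2 orbT.
have cW : #|W| <= 5.
  apply: leq_trans (leq_card_setU _ _) _; rewrite (@hl_card _ _ _ 2) ?f1 ?addn2 // (@hl_card _ _ _ 3) // f2.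
  by move: n6; clear; lia.
have [j jW] : exists j, j \notin W.
  case: (ex_dir (fun j => j \notin W)) => // no; have : n.+2 <= #|W|.
    by rewrite -[X in X <= _](card_ord n.+2); apply/subset_leq_card/subsetP => i _; have := no i; rewrite negbK.
  by move: cW n6; clear; lia.
have [j1 j2] := farW jW; have jd : j != d by apply: contraNneq jW => ->.
set q := flip w2 j.
have qj : q j != w1 j by rewrite flipE eqxx (hs j1); case: (w1 j).
have faulty z : isf G z d -> z j = w1 j.
  move=> zd; have [h|h] := boolP ((low z d, d) \in inc G w1).
    move: h; rewrite inE /= => /andP[_ /eqP/low_inj2[->//|->]]; by rewrite flipE (negPf jd).
  have [h'|h'] := boolP ((low z d, d) \in inc G w2).
    by case/negP: w2d; move: h'; rewrite inE /isf /= => /andP[h' /eqP<-].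
  have [|_] := farO (f := (low z d, d)) (k := j) _ jW; first by rewrite in_setD in_setU negb_or h h'.
  by rewrite ffunE jd.
have qd : ~~ isf G q d by apply/negP => /faulty /eqP; rewrite (negPf qj).
have qw : q \notin [:: w1; w2].
  rewrite !inE; apply/norP; split; first by apply: contra qj => /eqP->.
  by apply/eqP => /(congr1 (@parity n.+2)); rewrite parity_flip; case: (parity w2).
have n5 : 4 < n by exact: ltnW.
have B := bndP (ltnW n5).
pose V := [set f in G | d \in viol w1 f].
have vU : vnum G w1 d <= #|O| + 1.
  apply: (@leq_trans #|(low w1 d, d) |: O|); last by rewrite cardsU1; case: (_ \notin _); rewrite ?addn1 ?add1n // addnC.
  apply/subset_leq_card/subsetP => f; rewrite inE => /andP[fG fv]; rewrite in_setU1.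
  have [h|h] := boolP (f \in inc G w1); first by rewrite (inc_viol_self h fv) eqxx.
  have [h'|h'] := boolP (f \in inc G w2).
    by case/negP: w2d; have := inc_viol_other e2 h' fv => ef; move: fG; rewrite ef.
  by rewrite in_setD in_setU negb_or h h' fG orbT.
have vL : #|A d| + 1 <= vnum G w1 d.
  have i1 := inc_isf w1d.
  apply: (@leq_trans #|(low w1 d, d) |: A d|).
    by rewrite cardsU1 inE in_setD in_setU i1 addnC.
  apply/subset_leq_card/subsetP => f; rewrite in_setU1 => /orP[/eqP->|]; first exact: isf_viol.
  by rewrite [in X in X -> _]inE => /andP[/OP[fG _ _] fv]; rewrite inE fG.
have lv := light_vnum d G w1; rewrite -e2 in lv.
pose D' := pH d W; pose p := pv d w1.
have cD' : #|D'| <= 4 by rewrite -ltnS (pH_mem dW).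
have kD k : k \notin D' -> lift d k \notin W by rewrite inE.
have pE (k : 'I_n.+1) : p k = w1 (lift d k) by rewrite /p pv_val.
have Qz f k : f \in halfG d G (~~ w2 d) -> k \notin D' -> f.2 != k /\ f.1 k = p k.
  case: f => u i; rewrite inE /= => fG /kD kW; pose F := (emb d (~~ w2 d, u), lift d i).
  have nF (w : vert n.+2) : w d = w2 d -> F \notin inc G w.
    move=> wd; rewrite inE negb_and fG /=; apply/eqP => /(congr1 (fun z : vert n.+2 => z d)).
    by rewrite emb_d ffunE neq_lift /= wd; case: (w2 d).
  have [|h1 h2] := farO (f := F) _ kW; first by rewrite in_setD in_setU negb_or !nF ?e2.
  by move: h1 h2; rewrite /= (inj_eq lift_inj) emb_lift pE.
have Xz (v : vert n.+1) k : crossG d G v -> k \notin D' -> v k = p k.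
  rewrite -(isf_cross d G false) => vd /kD kW; rewrite pE.
  have [h|h] := boolP ((low (emb d (false, v)) d, d) \in inc G w1).
    move: h; rewrite inE /= low_emb => /andP[_ /eqP h]; have := congr1 (fun z : vert n.+2 => z (lift d k)) h.
    by rewrite emb_lift [in RHS]ffunE eq_sym neq_lift.
  have [h'|h'] := boolP ((low (emb d (false, v)) d, d) \in inc G w2).
    by case/negP: w2d; move: h'; rewrite inE /isf /= => /andP[h' /eqP<-].
  have [|_] := farO (f := (low (emb d (false, v)) d, d)) _ kW; first by rewrite in_setD in_setU negb_or h h'.
  by rewrite /= low_emb emb_lift.
have X1 : 0 < #|crossG d G|.
  by apply/card_gt0P; exists p; rewrite -topredE /= -(isf_cross d G (w1 d)) embP.
have cQ : #|halfG d G (~~ w2 d)| <= 2 * n - 8 by move: lv vU X1 oc cG n6; clear; lia.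
have X2 : #|crossG d G| <= 2 * n - 7 by move: lv vU oc cG n6; clear; lia.
have heal : exists i1 i2, [/\ i1 != i2, i1 != d, i2 != d, ~~ isf G q i1 & ~~ isf G q i2].
  have c : 2 < #|hl G q| by have := card_healthy G q; rewrite -/(hl G q); have := ho qw; clear; lia.
  have : 1 < #|hl G q :\ d| by have := cardsD1 d (hl G q); move: c; case: (d \in _); clear; lia.
  case/card_gt1P => i1 [i2 [/setD1P[a1 b1] /setD1P[a2 b2] i12]]; exists i1, i2.
  by rewrite !inE in b1 b2; split.
have qfj : isf G q j by rewrite isf_flip.
have qi i : ~~ isf G q i -> i != j by apply: contraNneq => ->.
have fq := ho qw.
have pu (k : 'I_n.+1) : k \notin D' -> pv d w2 k = p k.
  by move=> /kD/farW[h _]; rewrite pE pv_val hs.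
apply: (@fix_v n d G w2 j) => //.
- apply: (@leq_ltn_trans (4 * n - 11)); first by move: X2 n6; clear; lia.
  by apply: exp_gt; move: n6; clear; lia.
- have sG : G :\ (low w2 j, j) \subset G by exact: subD1set.
  have le (u : vert n.+2) : fd (G :\ (low w2 j, j)) u <= fd G u := fdS u sG.
  have iE (u : vert n.+2) : isf (G :\ (low w2 j, j)) u d = isf G u d.
    by rewrite /isf in_setD1 xpair_eqE (eq_sym d) (negPf jd) andbF.
  have l2 : fd (G :\ (low w2 j, j)) w2 < fd G w2.
    rewrite -!card_inc; apply: proper_card; apply/properP; split.
      by apply/subsetP => f; rewrite !inE => /andP[/andP[_ ->] ->].
    by exists (low w2 j, j); [exact: inc_isf|rewrite !inE eqxx].
  have hu (u : vert n.+2) : fd (G :\ (low w2 j, j)) u + 1 <= n + isf G u d /\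
      (fd (G :\ (low w2 j, j)) u + 1 = n + isf G u d -> u = w1).
    have [->|u1] := eqVneq u w1; first by rewrite w1d; split=> //; have := le w1; rewrite f1; clear; lia.
    have [->|u2] := eqVneq u w2; first by rewrite (negPf w2d); move: l2 n6; rewrite f2; clear; split; lia.
    have := ho (u := u); rewrite !inE (negPf u1) (negPf u2) => /(_ isT); have := le u; clear; split; lia.
  apply: (Ta (leqnn _)); first by move: n6; clear; lia.
  apply: good_half.
  + by move=> g /(subsetP sG); exact: pG.
  + rewrite e2; have [|||u [k [ef uk]]] := @half_elem _ d G (w1 d) (low w2 j, j) => //.
      by rewrite ffunE eq_sym jd e2.
    rewrite ef halfD1; have e3 := cardsD1 (u, k) (halfG d G (w1 d)); rewrite uk add1n in e3.
    rewrite -ltnS -e3 -(leq_add2r (vnum G w1 d)) half_vnum.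
    by move: vL A2 B cG n6; clear; lia.
  + by move=> u _; rewrite iE; case: (hu u).
  + by move: n6; clear; lia.
  by move=> u v _ _; rewrite !iE => h h'; right; have [_ k1] := hu u; have [_ k2] := hu v; by rewrite (k1 h) (k2 h').
- by apply: (stro_flat n6 (D := D') (p := p)) => //; exact: proper_half.
- have [i1 [i2 [i12 a1 a2 b1 b2]]] := heal; apply: Or33; exists i1, i2; split=> // i hi.
  have [id ij] : i != d /\ i != j.
    by move: hi; rewrite !inE => /orP[]/eqP->; split=> //; exact: qi.
  split=> // k l kl; apply/negP => /andP[/faulty h /faulty h'].
  have key m : (flip (flip q i) m) j = w1 j -> m = j.
    rewrite !flipE -/q (eq_sym j i) (negPf ij) eqxx /= (hs j1) => e.
    by apply/eqP; rewrite eq_sym; move: e; case: (j == m) => //; case: (w1 j).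
  by case/eqP: kl; rewrite (key _ h) (key _ h').
- have [i1 [_ [_ a1 _ b1 _]]] := heal; apply: Or31; exists i1; split=> //.
  apply/negP => /faulty; rewrite !flipE eq_sym (negPf (qi _ b1)) eqxx /= (hs j1); by case: (w1 j).
move=> u k ew ek; have pk : pv d w2 = u by rewrite ew /pv embK.
have kk : k \notin D' by rewrite inE -ek.
have Xu (v : vert n.+1) : crossG d G v -> v != u /\ v != flip u k.
  move=> Xv; split; apply: contraTneq Xv => ->; first by rewrite -(isf_cross d G (w2 d)) -ew.
  by rewrite -(isf_cross d G (w2 d)) -flip_emb_lift -ew -ek.
have fl (v : vert n.+1) i : crossG d G v -> flip v i \in [:: u; flip u k] -> i \in D'.
  move=> Xv h; apply: contraT => iD; have [h1 h2] := Xu v Xv.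
  move: h; rewrite !inE => /orP[]/eqP e.
    have := congr1 (fun z : vert n.+1 => z i) e; rewrite flipE eqxx (Xz v i Xv iD) -pk pu //; by case: (p i).
  have := congr1 (fun z : vert n.+1 => z k) e; rewrite !flipE eqxx (Xz v k Xv kk) -pk pu //.
  case: (k =P i) => [ki _|_]; last by case: (p k).
  by case/eqP: h1; rewrite -[LHS](flipK _ i) e -ki flipK.
have fs z : fd (spec d G (w2 d) u k) z <= 4.
  apply: leq_trans cD'; apply/subset_leq_card/subsetP => i; rewrite inE => /isf_spec[h|[hz' Xv]|[Xv hz']].
  - by apply: contraT => iD; have [/eqP] := Qz _ i h iD.
  - by apply: (fl (flip z i)) => //; rewrite flipK.
  by apply: (fl z).
apply: (Ta (leqnn _)); first by move: n6; clear; lia.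
split.
- exact: proper_spec.
- by apply: leq_trans (card_spec d G (w2 d) u k) _; move: lv vU oc cG B n6; clear; lia.
- by move=> z; have := fs z; move: n6; clear; lia.
by move=> z z' hz'; have := fs z; move: n6 hz'; clear; lia.
Qed.
End TwoFar.

(** * Three vertices of low degree *)

Definition inc3 n (G : {set vert n * 'I_n}) w1 w2 w3 := inc G w1 :|: inc G w2 :|: inc G w3.
Definition shr n (G : {set vert n * 'I_n}) u v := #|inc G u :&: inc G v|.

Lemma shr_card n (G : {set vert n * 'I_n}) w1 w2 w3 :
  fd G w1 + fd G w2 + fd G w3 <= #|inc3 G w1 w2 w3| + shr G w1 w2 + shr G w1 w3 + shr G w2 w3.
Proof.
have k1 := cardsUI (inc G w1) (inc G w2); have k2 := cardsUI (inc G w1 :|: inc G w2) (inc G w3).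
have k3 := leq_card_setU (inc G w1 :&: inc G w3) (inc G w2 :&: inc G w3).
rewrite setIUl !card_inc in k2; rewrite !card_inc -/(shr G w1 w2) in k1; rewrite -/(shr G w1 w3) -/(shr G w2 w3) in k3.
apply: (@leq_trans (#|inc3 G w1 w2 w3| + #|inc G w1 :&: inc G w3 :|: inc G w2 :&: inc G w3| + shr G w1 w2)).
  by rewrite -k1 addnAC leq_add2r -k2.
rewrite -!addnA leq_add2l [X in X <= _]addnC leq_add2l; exact: k3.
Qed.

Lemma shr_ex n (G : {set vert n * 'I_n}) u v : u != v -> 0 < shr G u v -> exists2 s, isf G v s & u = flip v s.
Proof. by move=> uv /card_gt0P[f /setIP[h1 h2]]; have [e i] := inc2 h1 h2 uv; exists f.2. Qed.

(** Vertices sharing a fault are adjacent, and the cube, being bipartite, has no triangle. *)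
Lemma shr_two n (G : {set vert n * 'I_n}) w1 w2 w3 : w1 != w2 -> w1 != w3 -> w2 != w3 ->
  shr G w1 w2 + shr G w1 w3 + shr G w2 w3 <= 2.
Proof.
move=> n12 n13 n23; have m := @inc_meet n G.
have par u v : u != v -> shr G u v <= (parity u != parity v).
  move=> uv; have := m u v uv; rewrite -/(shr G u v); case: (posnP (shr G u v)) => [->//|p].
  by have [s _ ->] := shr_ex uv p; rewrite parity_flip; case: (parity v).
by move: (par _ _ n12) (par _ _ n13) (par _ _ n23); case: (parity w1); case: (parity w2); case: (parity w3) => /=; clear; lia.
Qed.

Lemma out3 n (G : {set vert n * 'I_n}) w1 w2 w3 f : f \in G -> f \notin inc3 G w1 w2 w3 ->
  forall w, w \in [:: w1; w2; w3] -> f \notin inc G w.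
Proof. by rewrite /inc3 !in_setU !negb_or => _ /andP[/andP[h1 h2] h3] w; rewrite inE => /orP[/eqP->//|]; rewrite inE => /orP[/eqP->//|]; rewrite inE => /eqP->. Qed.

Lemma cov3 n (G : {set vert n * 'I_n}) w1 w2 w3 : G \subset inc3 G w1 w2 w3 -> covered G [:: w1; w2; w3].
Proof.
move=> h f /(subsetP h); rewrite /inc3 !in_setU => /orP[/orP[]|] k; [exists w1|exists w2|exists w3] => //;
  by rewrite !inE eqxx ?orbT.
Qed.

Lemma cards_meet (I : finType) (A B C : {set I}) : 0 < #|A :&: B| -> 0 < #|(A :|: B) :&: C| ->
  #|A :|: B :|: C| + 2 <= #|A| + #|B| + #|C|.
Proof. by have := cardsUI A B; have := cardsUI (A :|: B) C; lia. Qed.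

Section Three.
Variables (n : nat) (G : {set vert n.+2 * 'I_n.+2}).
Hypotheses (Ta : forall m, m <= n.+1 -> T m) (pG : properG G) (n5 : 5 <= n) (cG : #|G| <= bnd n.+2).
Let n4 : 4 <= n. Proof. exact: ltnW. Qed.

Lemma fits_list (L : seq (vert n.+2)) d : (forall u : vert n.+2, u \notin L -> fd G u + 2 <= n) ->
  (forall u, u \in L -> fd G u + 1 <= n + isf G u d) ->
  (forall u v, u \in L -> v \in L -> u d = v d -> fd G u + 1 = n + isf G u d -> fd G v + 1 = n + isf G v d -> u = v) -> fits G d.
Proof.
move=> ho h1 h2; have inL (u : vert n.+2) : fd G u + 1 = n + isf G u d -> u \in L.
  by move=> e; apply: contraT => /ho; move: e; clear; lia.
split=> [u|u v uv eu ev]; last by apply: h2 => //; exact: inL.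
by have [/h1//|/ho] := boolP (u \in L); clear; lia.
Qed.

(** If [d] separates the low vertices, [sep_join] applies. Otherwise their three edges in direction
    [d] are violations. Any further violation makes the splitting work; if there is none, the fault
    [f] elsewhere is restored. *)
Lemma three_all w1 w2 w3 d f : w1 != w2 -> w1 != w3 -> w2 != w3 -> fd G w1 <= n ->
  n.-1 <= fd G w1 -> fd G w2 = n.-1 -> fd G w3 = n.-1 -> (forall u : vert n.+2, u \notin [:: w1; w2; w3] -> fd G u + 2 <= n) ->
  isf G w1 d -> isf G w2 d -> isf G w3 d -> f \in G -> f \notin inc3 G w1 w2 w3 -> lace G.
Proof.
move=> n12 n13 n23 f1n f1 f2 f3 ho i1 i2 i3 fG fO.
have ft : fits G d.
  apply: (fits_list ho) => [u|u v]; rewrite !inE.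
    by case/or3P => /eqP->; rewrite ?i1 ?i2 ?i3 ?f2 ?f3; move: f1n n5; clear; lia.
  by case/or3P => /eqP-> /or3P[] /eqP->; rewrite ?i1 ?i2 ?i3 ?f2 ?f3 // => _; move: n5; clear; lia.
have [e12|ne] := eqVneq (w1 d) (w2 d); last by apply: (@sep_join n G Ta pG n5 cG d w1 w2) => //; rewrite f2.
have [e13|ne] := eqVneq (w1 d) (w3 d); last by apply: (@sep_join n G Ta pG n5 cG d w1 w3) => //; rewrite f3.
pose E := [set (low w1 d, d); (low w2 d, d); (low w3 d, d)].
have ne (u v : vert n.+2) : u != v -> u d = v d -> (low u d, d) != (low v d, d).
  by move=> uv e; apply: contra uv => /eqP[] /low_same h; rewrite (h e).
have cE : #|E| = 3.
  have m12 := ne _ _ n12 e12; have m13 := ne _ _ n13 e13; have m23 := ne _ _ n23 (etrans (esym e12) e13).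
  by rewrite /E setUC cardsU1 cards2 in_set2 negb_or m12 eq_sym m13 eq_sym m23.
have EV : E \subset [set g in G | d \in viol w1 g].
  by apply/subsetP => g; rewrite !in_setU !in_set1 => /orP[/orP[]|] /eqP->; exact: isf_viol.
have v3 : 3 <= vnum G w1 d by rewrite -cE; apply: subset_leq_card.
have [h|h] := leqP #|G| (vnum G w1 d + bnd n.+1); first exact: (@fits_join n G Ta pG n5 cG d w1).
have b1 := bnd1 n5 cG.
have vE : vnum G w1 d = 3 by move: h v3 b1; case: (5 < n); clear; lia.
have eE : E = [set g in G | d \in viol w1 g] by apply/eqP; rewrite eqEcard EV cE -vE leqnn.
have fo := out3 fG fO.
have gE g : g \in G -> d \in viol w1 g -> exists w, [/\ w \in [:: w1; w2; w3], w d = w1 d & g = (low w d, d)].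
  move=> gG gv; have : g \in E by rewrite eE inE gG.
  rewrite !in_setU !in_set1 => /orP[/orP[]|] /eqP->; [exists w1|exists w2|exists w3]; by rewrite !inE eqxx ?orbT.
apply: (@single_other n G Ta pG n5 d w1 [:: w1; w2; w3] f) => //; rewrite ?vE //.
  apply/negP => /(gE f fG)[w [wL _ ef]]; have := fo w wL; rewrite inE fG ef /= eqxx //.
by move: b1; case: (5 < n); clear; lia.
Qed.

Lemma all_out (A B C : {set 'I_n.+2}) : #|A :|: B :|: C| < n.+2 -> exists d, [/\ d \notin A, d \notin B & d \notin C].
Proof.
move=> h; case: (ex_dir (fun d => d \notin A :|: B :|: C)) => [[d]|no].
  by rewrite !in_setU !negb_or -andbA => /and3P[]; exists d.
have : n.+2 <= #|A :|: B :|: C|.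
  by rewrite -[X in X <= _](card_ord n.+2); apply/subset_leq_card/subsetP => i _; have := no i; rewrite negbK.
by rewrite leqNgt h.
Qed.

(** The common healthy directions [a] and [b] keep the union of the three healthy sets at most
    seven. If a fault lies elsewhere, counting makes the dimension at least nine, so some direction
    is faulty at all three vertices. If not, {a, b} serves as narrow set and meets the others. *)
Lemma three_bad w1 w2 w3 a b : w1 != w2 -> w1 != w3 -> w2 != w3 -> fd G w1 = n.-1 -> fd G w2 = n.-1 -> fd G w3 = n.-1 ->
  (forall u : vert n.+2, u \notin [:: w1; w2; w3] -> fd G u + 2 <= n) ->
  shr G w1 w2 = 0 -> shr G w1 w3 = 0 -> shr G w2 w3 = 0 ->
  a \in hl G w1 :&: hl G w2 -> b \in hl G w1 :&: hl G w3 -> a != b -> lace G.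
Proof.
move=> n12 n13 n23 f1 f2 f3 ho s12 s13 s23 /setIP[a1 a2] /setIP[b1 b3] ab.
have hc w : fd G w = n.-1 -> #|hl G w| = 3 by move=> e; apply: hl_card; rewrite e; move: n5; clear; lia.
have := shr_card G w1 w2 w3; rewrite s12 s13 s23 f1 f2 f3 !addn0 => cU.
have sU : inc3 G w1 w2 w3 \subset G by rewrite /inc3 !subUset !inc_sub.
have c9 := cG9 n5 cG; have cGU : #|inc3 G w1 w2 w3| <= #|G| by exact: subset_leq_card.
have u1 : 0 < #|hl G w1 :&: hl G w2| by apply/card_gt0P; exists a; rewrite in_setI a1.
have u2 : 0 < #|(hl G w1 :|: hl G w2) :&: hl G w3| by apply/card_gt0P; exists b; rewrite in_setI in_setU b1 b3.
have [/subsetP cov|/subsetPn[f fG fO]] := boolP (G \subset inc3 G w1 w2 w3); last first.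
  have cGf : #|inc3 G w1 w2 w3| < #|G|.
    by apply: proper_card; apply/properP; split=> //; exists f.
  have [|d [d1 d2 d3]] := @all_out (hl G w1) (hl G w2) (hl G w3).
    have := cards_meet u1 u2; rewrite !hc // => cc.
    have k : 7 < n.+2 by move: cU cGf c9; clear; lia.
    by apply: leq_trans k; rewrite ltnS -(leq_add2r 2).
  apply: (@three_all w1 w2 w3 d f) => //; rewrite ?f1 ?leq_pred //.
  - by move: d1; rewrite inE negbK.
  - by move: d2; rewrite inE negbK.
  by move: d3; rewrite inE negbK.
have tr : tri G w1 [set a; b] w2 (hl G w2) w3 (hl G w3).
  split=> //; last by rewrite cards2 ab !hc.
    by apply: cov3; apply/subsetP.
  split; [|exact: hl_star|exact: hl_star].
  by move=> i; rewrite !inE => /orP[]/eqP->; [move: a1|move: b1]; rewrite inE.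
apply: (@tri_meet base5P n G _ _ _ _ _ _ Ta _ tr); rewrite ?hc ?cards2 ?ab //.
- by move: n5; clear; lia.
- by apply/set0Pn; exists a; rewrite !in_setI in_setU a2 !inE eqxx.
right; apply: leq_trans (leq_card_setU _ _) _; rewrite !hc //.
by move: cU cGU c9 n5; clear; lia.
Qed.

(** A separating direction that is faulty at one of any two vertices agreeing in it gives good
    halves. Otherwise every separating direction is healthy at two vertices agreeing in it. This
    excludes shared faults, and two different separating directions supply [a] and [b] for
    [three_bad]. *)
Lemma three_333 w1 w2 w3 : w1 != w2 -> w1 != w3 -> w2 != w3 -> fd G w1 = n.-1 -> fd G w2 = n.-1 -> fd G w3 = n.-1 ->
  (forall u : vert n.+2, u \notin [:: w1; w2; w3] -> fd G u + 2 <= n) -> lace G.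
Proof.
move=> n12 n13 n23 f1 f2 f3 ho; have p1 : n.-1 + 1 = n by move: n5; clear; lia.
pose okp d (u v : vert n.+2) := (u d == v d) ==> isf G u d || isf G v d.
case: (ex_dir (fun d => [&& ~~ ((w1 d == w2 d) && (w1 d == w3 d)), okp d w1 w2, okp d w1 w3 & okp d w2 w3])) => [[d]|no].
  case/and4P => ns k12 k13 k23.
  have ft : fits G d.
    have nt u v : okp d u v -> u d = v d -> n = n + isf G u d -> n = n + isf G v d -> False.
      by rewrite /okp => k e; move: k; rewrite e eqxx /=; case: (isf G u d); case: (isf G v d) => // _; clear; lia.
    apply: (fits_list ho) => [u|u v]; rewrite !inE.
      by case/or3P => /eqP->; rewrite ?f1 ?f2 ?f3 p1 leq_addr.
    case/or3P => /eqP-> /or3P[] /eqP-> //; rewrite ?f1 ?f2 ?f3 p1 => e h h'; exfalso;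
      first [exact: (nt _ _ k12 e h h')|exact: (nt _ _ k13 e h h')|exact: (nt _ _ k23 e h h')
            |exact: (nt _ _ k12 (esym e) h' h)|exact: (nt _ _ k13 (esym e) h' h)|exact: (nt _ _ k23 (esym e) h' h)].
  have [e12|ne] := eqVneq (w1 d) (w2 d); last by apply: (@sep_join n G Ta pG n5 cG d w1 w2) => //; rewrite ?f1 ?f2.
  by apply: (@sep_join n G Ta pG n5 cG d w1 w3) => //; rewrite ?f1 ?f3 //; move: ns; rewrite e12 eqxx.
have bad d : ~~ ((w1 d == w2 d) && (w1 d == w3 d)) -> [\/ w1 d = w2 d /\ d \in hl G w1 :&: hl G w2,
    w1 d = w3 d /\ d \in hl G w1 :&: hl G w3 | w2 d = w3 d /\ d \in hl G w2 :&: hl G w3].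
  move=> ns; have := no d; rewrite ns /= !negb_and /okp !negb_imply !negb_or.
  by case/or3P => /and3P[/eqP e h h']; [apply: Or31|apply: Or32|apply: Or33]; rewrite !inE h h'.
have sep (u v : vert n.+2) d : u d != v d -> forall z, z d = u d \/ z d = v d.
  by move=> uv z; move: uv; case: (u d); case: (v d); case: (z d) => //; auto.
have nsh (u v z : vert n.+2) : u != v -> (forall d, u d != v d -> [\/ z d = u d /\ d \in hl G u :&: hl G z | z d = v d /\ d \in hl G v :&: hl G z]) ->
    shr G u v = 0.
  move=> uv h; apply/eqP; rewrite -leqn0 leqNgt; apply/negP => /(shr_ex uv)[s vs e].
  have [|[_ /setIP[hs _]]|[_ /setIP[hs _]]] := h s; first by rewrite e flipE eqxx; case: (v s).
    by move: hs; rewrite inE e isf_flip vs.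
  by move: hs; rewrite inE vs.
have b12 d : w1 d != w2 d -> [\/ w3 d = w1 d /\ d \in hl G w1 :&: hl G w3 | w3 d = w2 d /\ d \in hl G w2 :&: hl G w3].
  move=> ne; have [|[e _]|[e h]|[e h]] := bad d; first by rewrite (negPf ne).
  - by rewrite e eqxx in ne.
  - by left.
  by right.
have b13 d : w1 d != w3 d -> [\/ w2 d = w1 d /\ d \in hl G w1 :&: hl G w2 | w2 d = w3 d /\ d \in hl G w3 :&: hl G w2].
  move=> ne; have [|[e h]|[e _]|[e h]] := bad d; first by rewrite (negPf ne) andbF.
  - by left.
  - by rewrite e eqxx in ne.
  by right; rewrite setIC.
have b23 d : w2 d != w3 d -> [\/ w1 d = w2 d /\ d \in hl G w2 :&: hl G w1 | w1 d = w3 d /\ d \in hl G w3 :&: hl G w1].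
  move=> ne; have [|[e h]|[e h]|[e _]] := bad d; first by apply: contra ne => /andP[/eqP<- /eqP<-].
  - by left; rewrite setIC.
  - by right; rewrite setIC.
  by rewrite e eqxx in ne.
have s12 := nsh _ _ _ n12 b12; have s13 := nsh _ _ _ n13 b13; have s23 := nsh _ _ _ n23 b23.
have sC (u v : vert n.+2) : shr G u v = shr G v u by rewrite /shr setIC.
have n21 : w2 != w1 by rewrite eq_sym.
have n31 : w3 != w1 by rewrite eq_sym.
have n32 : w3 != w2 by rewrite eq_sym.
have hop (L : seq (vert n.+2)) : L =i [:: w1; w2; w3] -> forall u : vert n.+2, u \notin L -> fd G u + 2 <= n.
  by move=> e u; rewrite e; exact: ho.
have ho2 : forall u : vert n.+2, u \notin [:: w2; w1; w3] -> fd G u + 2 <= n.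
  by apply: hop => z; rewrite !inE; case: (z == w1); case: (z == w2); case: (z == w3).
have ho3 : forall u : vert n.+2, u \notin [:: w3; w1; w2] -> fd G u + 2 <= n.
  by apply: hop => z; rewrite !inE; case: (z == w1); case: (z == w2); case: (z == w3).
have [d hd] := differ n12; case: (b12 d hd) => -[e h].
  have [d' hd'] := differ n13; have dd : d' != d by apply: contraNneq hd' => ->; rewrite e.
  case: (b13 d' hd') => -[_ h'].
    exact: (three_bad n12 n13 n23 f1 f2 f3 ho s12 s13 s23 h' h dd).
  rewrite setIC in h; rewrite eq_sym in dd.
  by apply: (three_bad n31 n32 n12 f3 f1 f2 ho3 _ _ s12 h h' dd); rewrite sC.
have [d' hd'] := differ n23; have dd : d' != d by apply: contraNneq hd' => ->; rewrite e.
case: (b23 d' hd') => -[_ h'].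
  by apply: (three_bad n21 n23 n13 f2 f1 f3 ho2 _ s23 s13 h' h dd); rewrite sC.
rewrite setIC in h.
by apply: (three_bad n31 n32 n12 f3 f1 f2 ho3 _ _ s12 h' h dd); rewrite sC.
Qed.

(** If all faults are at the three vertices, this is [tri_sep], [pure_shared] or [pure_top],
    depending on shared faults. If not, a direction faulty at all three gives [three_all]. Failing
    that, the healthy sets, of sizes 2, 3 and 3, cover all directions; counting then forces
    dimension 8, 15 faults and two shared faults. Either a shared direction separates [w1] from the
    others, or [w1] takes part in both shared faults, the case of [hpart]. *)
Lemma three_233 w1 w2 w3 : w1 != w2 -> w1 != w3 -> w2 != w3 -> fd G w1 = n -> fd G w2 = n.-1 -> fd G w3 = n.-1 ->
  (forall u : vert n.+2, u \notin [:: w1; w2; w3] -> fd G u + 2 <= n) ->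
  (n = 6 -> hl G w1 :&: hl G w2 = set0 -> (hl G w1 :|: hl G w2) :&: hl G w3 = set0 ->
   0 < shr G w1 w2 -> 0 < shr G w1 w3 -> #|G| = 15 -> #|G| <= #|inc3 G w1 w2 w3| + 1 -> ~~ (G \subset inc3 G w1 w2 w3) -> lace G) -> lace G.
Proof.
move=> n12 n13 n23 f1 f2 f3 ho hpart.
have hc2 w : fd G w = n.-1 -> #|hl G w| = 3 by move=> e; apply: hl_card; rewrite e; move: n5; clear; lia.
have hc1 : #|hl G w1| = 2 by apply: hl_card; rewrite f1 addn2.
have cU := shr_card G w1 w2 w3; rewrite f1 f2 f3 in cU.
have sU : inc3 G w1 w2 w3 \subset G by rewrite /inc3 !subUset !inc_sub.
have c9 := cG9 n5 cG; have cGU : #|inc3 G w1 w2 w3| <= #|G| by exact: subset_leq_card.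
have s2 := shr_two G n12 n13 n23; have tm : T n.+1 by exact: Ta.
have n3 : 2 < n by move: n5; clear; lia.
have [cov|ncov] := boolP (G \subset inc3 G w1 w2 w3).
  have tr : tri G w1 (hl G w1) w2 (hl G w2) w3 (hl G w3).
    split=> //; first exact: cov3.
      by split; exact: hl_star.
    by rewrite hc1 !hc2.
  have sepw j : j \in [:: w2; w3] -> 0 < shr G w1 j -> lace G.
    move=> hj p; have n1j : w1 != j by move: hj; rewrite !inE => /orP[]/eqP->.
    have [s js e] := shr_ex n1j p.
    have s1 : s \notin hl G w1 by rewrite inE negbK e isf_flip.
    apply: (tri_sep tr n3 tm s1); [|by left|].
      by move: hj js; rewrite !inE negb_and !negbK => /orP[]/eqP-> ->; rewrite ?orbT.
    by rewrite negb_and; move: hj e; rewrite !inE => /orP[]/eqP-> ->; rewrite flipE eqxx; case: (_ s); rewrite ?orbT.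
  have [h|/negbTE] := boolP (0 < shr G w1 w2); first by apply: (sepw w2) => //; rewrite mem_head.
  rewrite lt0n => /negbFE/eqP s12.
  have [h|/negbTE] := boolP (0 < shr G w1 w3); first by apply: (sepw w3) => //; rewrite !inE eqxx orbT.
  rewrite lt0n => /negbFE/eqP s13.
  have [h|/negbTE] := boolP (0 < shr G w2 w3).
    have [s is3 e] := shr_ex n23 h.
    apply: (@pure_shared n G w1 (hl G w1) w2 (hl G w2) w3 (hl G w3) s tm n5 tr hc1 (@hl_exact _ _ _)).
      by rewrite e isf_flip.
    by rewrite e flipK.
  rewrite lt0n => /negbFE/eqP s23.
  have n7 : 6 < n by move: cU cGU c9 n5; rewrite s12 s13 s23; clear; lia.
  move: n7 Ta tr c9 hc1 hc2 f2 f3; clear; case: (n) G w1 w2 w3 => // m G' v1 v2 v3 n7 Ta' tr c9 hc1 hc2 f2 f3.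
  apply: (@pure_top m G' _ _ _ _ _ _ Ta' _ tr hc1 (hc2 _ f2) (hc2 _ f3)); try exact: hl_exact.
    by move: n7; clear; lia.
  by right; apply: leq_trans (leq_card_setU _ _) _; rewrite !hc2.
have [f fG fO] := subsetPn ncov.
have cGf : #|inc3 G w1 w2 w3| < #|G| by apply: proper_card; apply/properP; split=> //; exists f.
have [h|h] := ltnP #|hl G w1 :|: hl G w2 :|: hl G w3| n.+2.
  have [d [d1 d2 d3]] := all_out h.
  by apply: (@three_all w1 w2 w3 d f) => //; rewrite ?f1 ?leq_pred //; [move: d1|move: d2|move: d3]; rewrite inE negbK.
have u1 := leq_card_setU (hl G w1) (hl G w2); have u2 := leq_card_setU (hl G w1 :|: hl G w2) (hl G w3).
rewrite hc1 hc2 // in u1; rewrite (hc2 w3) // in u2.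
have n8 : n.+2 <= 8 by apply: leq_trans h (leq_trans u2 _); rewrite -[8]/(5 + 3) leq_add2r; exact: u1.
have n6 : n = 6 by move: n8 cU cGf c9 s2 n5; clear; lia.
have S2 : shr G w1 w2 + shr G w1 w3 + shr G w2 w3 = 2 by move: n6 cU cGf c9 s2; clear; lia.
have cG15 : #|G| = 15 by move: n6 cU cGf c9 s2; clear; lia.
have le1 u v : u != v -> shr G u v <= 1 by exact: inc_meet.
have ft s : isf G w1 s -> (isf G w2 s \/ isf G w3 s) -> w1 s != w2 s -> w1 s != w3 s -> lace G.
  move=> i1 i23 e2 e3; apply: (@sep_join n G Ta pG n5 cG s w1 w2) => //; rewrite ?f1 ?f2 ?leq_pred //.
  apply: (fits_list ho) => [u|u v]; rewrite !inE.
    by case/or3P => /eqP->; rewrite ?f1 ?f2 ?f3 ?i1; move: n5; clear; lia.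
  have nt (u' v' : vert n.+2) : isf G w2 s \/ isf G w3 s -> n.-1 + 1 = n + isf G w2 s -> n.-1 + 1 = n + isf G w3 s -> u' = v'.
    by move=> [->|->]; move: n5; clear; lia.
  case/or3P => /eqP-> /or3P[] /eqP-> //; rewrite ?f1 ?f2 ?f3 => e h1 h2.
  - by rewrite e eqxx in e2.
  - by rewrite e eqxx in e3.
  - by rewrite e eqxx in e2.
  - exact: (nt _ _ i23 h1 h2).
  - by rewrite e eqxx in e3.
  exact: (nt _ _ i23 h2 h1).
have [h23|h23] := posnP (shr G w2 w3).
  have l12 := le1 _ _ n12; have l13 := le1 _ _ n13.
  apply: hpart => //.
  - apply/eqP; rewrite -cards_eq0; have k := cardsUI (hl G w1) (hl G w2); rewrite hc1 hc2 // in k.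
    have k5 : 5 <= #|hl G w1 :|: hl G w2| by rewrite -(leq_add2r 3); apply: leq_trans u2; apply: leq_trans h; rewrite n6.
    by rewrite -leqn0 -(leq_add2l 5) addn0 -[X in _ <= X]k leq_add2r.
  - apply/eqP; rewrite -cards_eq0; have k := cardsUI (hl G w1 :|: hl G w2) (hl G w3); rewrite (hc2 w3) // in k.
    have k8 : 8 <= #|hl G w1 :|: hl G w2 :|: hl G w3| by apply: leq_trans h; rewrite n6.
    rewrite -leqn0 -(leq_add2l 8) addn0; apply: (leq_trans (leq_add k8 (leqnn _))); rewrite k.
    by rewrite -[8]/(5 + 3) leq_add2r; exact: u1.
  - by move: S2 l12 l13; rewrite h23; clear; lia.
  - by move: S2 l12 l13; rewrite h23; clear; lia.
  by move: n6 cU cG15 s2; clear; lia.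
have [s i3 e23] := shr_ex n23 h23.
have [h12|h12] := posnP (shr G w1 w2).
  have h13 : 0 < shr G w1 w3 by move: S2 (le1 _ _ n13) (le1 _ _ n23); rewrite h12; clear; lia.
  have [t it e13] := shr_ex n13 h13.
  have st : (t == s) = false by apply/negbTE; apply: contraNneq n12 => ts; rewrite e13 e23 ts.
  apply: (ft t); first by rewrite e13 isf_flip.
  - by right.
  - by rewrite e13 e23 !flipE eqxx st; case: (w3 t).
  by rewrite e13 flipE eqxx; case: (w3 t).
have [t it e12] := shr_ex n12 h12.
have e32 : w3 = flip w2 s by rewrite e23 flipK.
have st : (t == s) = false by apply/negbTE; apply: contraNneq n13 => ts; rewrite e12 e32 ts.
apply: (ft t); first by rewrite e12 isf_flip.
- by left.
- by rewrite e12 flipE eqxx; case: (w2 t).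
by rewrite e12 e32 !flipE eqxx st; case: (w2 t).
Qed.
End Three.

Lemma cardsD_two (I : finType) (S : {set I}) s t k : k + 2 <= #|S| -> k <= #|S :\: [set s; t]|.
Proof.
have := cardsID [set s; t] S.
have : #|S :&: [set s; t]| <= 2 by apply: leq_trans (subset_leq_card (subsetIr _ _)) _; rewrite cards2; case: (s == t).
by lia.
Qed.

(** * Dimension 8 partitioned by three healthy sets, with one fault elsewhere *)

Section Part.
Variables (n : nat) (G : {set vert n.+2 * 'I_n.+2}) (f : vert n.+2 * 'I_n.+2).
Hypotheses (tm : T n.+1) (pG : properG G) (n6 : n = 6) (cG : #|G| = 15) (fG : f \in G).

Section Fixed.
Variables (w a b : vert n.+2) (d j : 'I_n.+2).
Hypotheses (cov : forall g, g \in G -> [\/ g \in inc G w, g \in inc G a, g \in inc G b | g = f]).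
Hypotheses (fo : forall u : vert n.+2, u \in [:: w; a; b] -> f \notin inc G u) (ab : a != b).
Hypotheses (ea : a d = w d) (eb : b d = w d) (ia : isf G a d) (ib : isf G b d) (iw : ~~ isf G w d) (fv : d \in viol w f).

Lemma part_viol g : g \in G -> d \in viol w g -> [\/ g = (low a d, d), g = (low b d, d) | g = f].
Proof.
move=> gG gv; case: (cov gG) => h; last by apply: Or33.
- by case/negP: iw; have e := inc_viol_self h gv; move: gG; rewrite e.
- by apply: Or31; exact: inc_viol_other ea h gv.
by apply: Or32; exact: inc_viol_other eb h gv.
Qed.

Lemma part_faulty (z : vert n.+2) : z d = w d -> z \notin [:: a; b] -> isf G z d -> (low z d, d) = f.
Proof.
move=> zd zab zi; have := isf_viol w zi; rewrite inE => /andP[h1 h2].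
case: (part_viol h1 h2) => // -[e]; case/negP: zab; rewrite !inE.
  by rewrite (low_same e) ?eqxx // zd.
by rewrite (low_same e) ?eqxx ?orbT // zd.
Qed.

Lemma part_vnum : vnum G w d = 3.
Proof.
have i1 := inc_isf ia; have i2 := inc_isf ib.
have e1 : (low a d, d) != f by apply/eqP => e; have := fo (u := a); rewrite -e i1 !inE eqxx orbT => /(_ isT).
have e2 : (low b d, d) != f by apply/eqP => e; have := fo (u := b); rewrite -e i2 !inE eqxx !orbT => /(_ isT).
have e3 : (low a d, d) != (low b d, d) by apply: contra ab => /eqP[e]; rewrite (low_same e) // ea.
transitivity #|[set (low a d, d); (low b d, d); f]|; last first.
  by rewrite setUC cardsU1 cards2 in_set2 negb_or e3 eq_sym e1 eq_sym e2.
apply: eq_card => g; rewrite inE !in_setU !in_set1 -orbA; apply/andP/or3P => [[gG gv]|].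
  by case: (part_viol gG gv) => h; [apply: Or31|apply: Or32|apply: Or33]; rewrite h.
have k (z : vert n.+2) : isf G z d -> (low z d, d) \in G /\ d \in viol w (low z d, d) by move=> zi; split=> //; exact: viol_self.
by case=> /eqP->; [exact: k|exact: k|].
Qed.

Hypotheses (wj : isf G w j) (qL : flip w j \notin [:: w; a; b]) (qf : (low (flip w j) d, d) != f).
Hypotheses (ex1 : exitv d G w j) (ex2 : exitv d G (flip w j) j).
Variable w1 : vert n.+2.
Hypothesis hfit : forall u : vert n.+2, fd (G :\ (low w j, j)) u + 1 <= n + isf G u d /\
  (fd (G :\ (low w j, j)) u + 1 = n + isf G u d -> u = w1).

(** Seen from [w], the direction [d] has exactly three violations: the edges at [a] and [b], and
    [f]. So the far half together with the crossings has at most three faults, and even [spec] is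
    covered by [few_lace]. *)
Lemma part_fix : lace G.
Proof.
have jd : j != d by apply: contraNneq iw => <-.
have qd : flip w j d = w d by rewrite flipE eq_sym (negPf jd).
have vn := part_vnum; have lv := light_vnum d G w; rewrite vn in lv.
have sG : G :\ (low w j, j) \subset G by exact: subD1set.
apply: (@fix_v n d G w j) => //.
- apply/negP => h; case/eqP: qf; apply: part_faulty => //.
  by move: qL; rewrite !inE !negb_or => /and3P[_ -> ->].
- apply: (@leq_ltn_trans 9); first by move: lv; clear; lia.
  by apply: exp_gt; rewrite n6.
- apply: tm; first by rewrite n6.
  have iE (u : vert n.+2) : isf (G :\ (low w j, j)) u d = isf G u d.
    by rewrite /isf in_setD1 xpair_eqE (eq_sym d) (negPf jd) andbF.
  apply: good_half.
  + by move=> g /(subsetP sG); exact: pG.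
  + have [|||u [k [ef uk]]] := @half_elem _ d G (w d) (low w j, j) => //.
      by rewrite ffunE eq_sym jd.
    rewrite ef halfD1; have e3 := cardsD1 (u, k) (halfG d G (w d)); rewrite uk add1n in e3.
    by rewrite -ltnS -e3 -(leq_add2r (vnum G w d)) half_vnum vn cG n6.
  + by move=> u _; rewrite iE; case: (hfit u).
  + by rewrite n6.
  by move=> u v _ _; rewrite !iE => h h'; right; have [_ k1] := hfit u; have [_ k2] := hfit v; rewrite (k1 h) (k2 h').
- apply: few_stro'; first by rewrite n6.
  by apply: (@leq_trans 3); [apply: leq_trans lv; exact: leq_addr|rewrite n6].
move=> u k _ _; apply: few_lace; apply: leq_trans (card_spec d G (w d) u k) _.
by apply: leq_trans lv _; rewrite n6.
Qed.
End Fixed.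

Variables (w1 w2 w3 : vert n.+2) (s t : 'I_n.+2).
Hypotheses (n12 : w1 != w2) (n13 : w1 != w3) (n23 : w2 != w3) (f1 : fd G w1 = n) (f2 : fd G w2 = n.-1) (f3 : fd G w3 = n.-1).
Hypothesis ho : forall u : vert n.+2, u \notin [:: w1; w2; w3] -> fd G u + 2 <= n.
Hypothesis cov : forall g, g \in G -> [\/ g \in inc G w1, g \in inc G w2, g \in inc G w3 | g = f].
Hypothesis fo : forall u, u \in [:: w1; w2; w3] -> f \notin inc G u.
Hypotheses (e2 : w2 = flip w1 s) (e3 : w3 = flip w1 t) (is1 : isf G w1 s) (it1 : isf G w1 t).

Let st : s != t. Proof. by apply: contra n23 => /eqP st; rewrite e2 e3 st. Qed.

Lemma del_fd w j (u : vert n.+2) : fd (G :\ (low w j, j)) u <= fd G u. Proof. by apply: fdS; exact: subD1set. Qed.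
Lemma del_fdw w j : isf G w j -> fd (G :\ (low w j, j)) w < fd G w.
Proof.
move=> wj; rewrite -!card_inc; apply: proper_card; apply/properP; split.
  by apply/subsetP => g; rewrite !inE => /andP[/andP[_ ->] ->].
by exists (low w j, j); [exact: inc_isf|rewrite !inE eqxx].
Qed.

Lemma low_dir (w : vert n.+2) d i j (x : vert n.+2) : i != d -> j != d -> low (flip w i) d = x -> low (flip w j) d = x -> i = j.
Proof.
move=> id jd h1 h2; apply: (@flip_inj _ w); apply: (@low_same _ _ _ d); first by rewrite h1 h2.
by rewrite !flipE (eq_sym d) (negPf id) (eq_sym d) (negPf jd).
Qed.

(** The direction [d] is healthy only at the narrow vertex, where an edge in a direction [j] is
    restored. The choice of [j] keeps its other end away from [w2], [w3] and from [f] as crossing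
    fault; the exit at [w1] uses its second healthy direction [h]. *)
Lemma part_narrow d h : d != h -> d != s -> d != t -> h != s -> h != t -> ~~ isf G w1 d -> ~~ isf G w1 h ->
  isf G w2 d -> isf G w3 d -> d \in viol w1 f -> (low (flip w1 h) d, d) != f -> lace G.
Proof.
move=> dh ds dt hs ht i1 h1 i2 i3 fv fh.
have [|||j /setDP[jS jst] /andP[qf _]] := @pick_dir n ([set i | isf G w1 i] :\: [set s; t])
    (fun i => (i != d) && ((low (flip w1 i) d, d) == f)) (fun _ => false).
- by apply: cardsD_two; change #|[set i | isf G w1 i]| with (fd G w1); rewrite f1 n6.
- by move=> i j /andP[id /eqP<-] /andP[jd /eqP[e]]; exact: (low_dir id jd (erefl _) e).
- by [].
have wj : isf G w1 j by move: jS; rewrite inE.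
have jd : j != d by apply: contraNneq i1 => <-.
rewrite jd /= in qf; move: jst; rewrite !inE negb_or => /andP[js jt].
have e2d : w2 d = w1 d by rewrite e2 flipE (negPf ds).
have e3d : w3 d = w1 d by rewrite e3 flipE (negPf dt).
have par i : flip w1 i != w1 by apply/eqP => /(congr1 (@parity n.+2)); rewrite parity_flip; case: (parity w1).
have notL i : i != s -> i != t -> flip w1 i \notin [:: w1; w2; w3].
  move=> k k'; by rewrite !inE (negPf (par i)) e2 e3 !(inj_eq (@flip_inj _ w1)) (negPf k) (negPf k').
have qL := notL j js jt.
have qd : flip w1 j d = w1 d by rewrite flipE eq_sym (negPf jd).
have noq z : z \in [:: w2; w3] -> forall i, flip w1 j <> flip z i.
  move=> hz i /(congr1 (@parity n.+2)); move: hz; rewrite !inE => /orP[]/eqP->; rewrite ?e2 ?e3 !parity_flip; by case: (parity w1).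
have fq : fd G (flip w1 j) <= 2.
  rewrite -card_inc; apply: (@leq_trans #|[set (low w1 j, j); f]|); last by rewrite cards2; case: (_ == _).
  apply/subset_leq_card/subsetP => g gq; rewrite in_set2; have gG := subsetP (inc_sub _ _) g gq.
  case: (cov gG) => gh.
  - have [/flip_inj e _] := inc2 gq gh (par j); move: gh; rewrite inE -e => /andP[_ /eqP<-].
    by rewrite {1}e -surjective_pairing eqxx.
  - have [|e _] := inc2 gq gh; last by case: (noq w2 _ _ e); rewrite mem_head.
    by apply: contraNneq qL => ->; rewrite !inE eqxx orbT.
  - have [|e _] := inc2 gq gh; last by case: (noq w3 _ _ e); rewrite !inE eqxx orbT.
    by apply: contraNneq qL => ->; rewrite !inE eqxx !orbT.
  by rewrite gh eqxx orbT.
have lv := light_vnum d G w1; rewrite (part_vnum cov fo n23 e2d e3d i2 i3 i1 fv) in lv.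
have nf (z : vert n.+2) : z d = w1 d -> z \notin [:: w1; w2; w3] -> (low z d, d) != f -> ~~ isf G z d.
  move=> zd zL zf; apply/negP => zi; case/eqP: zf; apply: (part_faulty cov e2d e3d i1 zd _ zi).
  by move: zL; rewrite !inE !negb_or => /and3P[_ -> ->].
apply: (part_fix cov fo n23 e2d e3d i2 i3 i1 fv wj qL qf _ _ (w1 := w1)).
- apply: Or31; exists h; split=> //; first by rewrite eq_sym.
  apply: nf => //; last exact: notL.
  by rewrite flipE (negPf dh).
- have [||i hi] := @alpha_count n d G (flip w1 j); [exact: nf| |by apply: Or31; exists i].
  by move: fq lv n6; clear; lia.
move=> u; have l1 := del_fd w1 j u.
have [->|u1] := eqVneq u w1; first by split=> //; have := del_fdw wj; rewrite f1; clear; lia.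
have [->|u2] := eqVneq u w2; first by rewrite i2; have := del_fd w1 j w2; rewrite f2; move: n6; clear; split; lia.
have [->|u3] := eqVneq u w3; first by rewrite i3; have := del_fd w1 j w3; rewrite f3; move: n6; clear; split; lia.
have := ho (u := u); rewrite !inE (negPf u1) (negPf u2) (negPf u3) => /(_ isT); move: l1; clear; split; lia.
Qed.

(** Here [d] is healthy only at the wide vertex [w2] and an edge at [w2] is restored. Of its two
    other healthy directions at least one leads to a vertex that crosses safely. *)
Lemma part_wide d : d != s -> d != t -> ~~ isf G w2 d -> isf G w1 d -> isf G w3 d -> d \in viol w1 f -> lace G.
Proof.
move=> ds dt i2 i1 i3 fv.
have e2d : w2 d = w1 d by rewrite e2 flipE (negPf ds).
have e3d : w3 d = w2 d by rewrite e2d e3 flipE (negPf dt).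
have fv2 : d \in viol w2 f by move: fv; rewrite !inE e2d.
have cov2 g : g \in G -> [\/ g \in inc G w2, g \in inc G w1, g \in inc G w3 | g = f].
  by case/cov => h; [apply: Or42|apply: Or41|apply: Or43|apply: Or44].
have fo2 u : u \in [:: w2; w1; w3] -> f \notin inc G u.
  by move=> h; apply: fo; move: h; rewrite !inE; case: (u == w1); case: (u == w2); case: (u == w3).
have p2 : parity w2 = ~~ parity w1 by rewrite e2 parity_flip.
have p3 : parity w3 = ~~ parity w1 by rewrite e3 parity_flip.
have is2 : isf G w2 s by rewrite e2 isf_flip.
have notL i : i != s -> flip w2 i \notin [:: w2; w1; w3].
  move=> k; rewrite !inE !negb_or; apply/and3P; split.
  - by apply/eqP => /(congr1 (@parity n.+2)); rewrite parity_flip; case: (parity w2).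
  - by apply: contra k => /eqP e; apply/eqP; apply: (@flip_inj _ w2); rewrite e e2 flipK.
  by apply/eqP => /(congr1 (@parity n.+2)); rewrite parity_flip p2 p3; case: (parity w1).
have nf i : i != s -> i != d -> (low (flip w2 i) d, d) != f -> ~~ isf G (flip w2 i) d.
  move=> k id; apply: contra => zi; apply/eqP; apply: (part_faulty cov2 (esym e2d) e3d i2 _ _ zi).
    by rewrite flipE eq_sym (negPf id).
  by have := notL i k; rewrite !inE !negb_or => /and3P[_ -> ->].
have [|||j /setDP[jS jst] /andP[qf _]] := @pick_dir n ([set i | isf G w2 i] :\: [set s; s])
    (fun i => (i != d) && ((low (flip w2 i) d, d) == f)) (fun _ => false).
- by apply: cardsD_two; change #|[set i | isf G w2 i]| with (fd G w2); rewrite f2 n6.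
- by move=> i j /andP[id /eqP<-] /andP[jd /eqP[e]]; exact: (low_dir id jd (erefl _) e).
- by [].
have wj : isf G w2 j by move: jS; rewrite inE.
have jd : j != d by apply: contraNneq i2 => <-.
rewrite jd /= in qf; have js : j != s by move: jst; rewrite !inE orbb.
have [i [id hi is_ qi]] : exists i, [/\ i != d, ~~ isf G w2 i, i != s & (low (flip w2 i) d, d) != f].
  have c2 : #|hl G w2 :\ d| = 2.
    apply: succn_inj; have := cardsD1 d (hl G w2); rewrite inE i2 add1n => <-.
    by apply: hl_card; rewrite f2 n6.
  have /cards2P[a [b [ab eab]]] : #|hl G w2 :\ d| == 2 by rewrite c2.
  have ok i : i \in hl G w2 :\ d -> [/\ i != d, ~~ isf G w2 i & i != s].
    by rewrite !inE => /andP[k1 k2]; split=> //; apply: contraNneq k2 => ->.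
  have [|a1 a2 a3] := ok a; first by rewrite eab !inE eqxx.
  have [|b1 b2 b3] := ok b; first by rewrite eab !inE eqxx orbT.
  have [ea|na] := eqVneq (low (flip w2 a) d, d) f; last by exists a.
  exists b; split=> //; apply: contra ab => /eqP eb; apply/eqP.
  by move: eb; rewrite -ea => -[e]; exact: (low_dir a1 b1 (erefl _) e).
have lv := light_vnum d G w2; rewrite (part_vnum cov2 fo2 n13 (esym e2d) e3d i1 i3 i2 fv2) in lv.
apply: (part_fix cov2 fo2 n13 (esym e2d) e3d i1 i3 i2 fv2 wj (notL j js) qf _ _ (w1 := w1)).
- by apply: Or31; exists i; split=> //; exact: nf.
- apply: Or32; rewrite flipK f2; split; last by rewrite n6.
  have h : fd G (flip w2 j) + 2 <= n.
    by apply: ho; have := notL j js; rewrite !inE !negb_or => /and3P[-> -> ->].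
  by move: h lv n6; clear; lia.
move=> u; have l1 := del_fd w2 j u.
have [->|u2] := eqVneq u w2; first by have := del_fdw wj; rewrite f2; move: n6; clear; split; lia.
have [->|u1] := eqVneq u w1; first by split=> //; have := del_fd w2 j w1; rewrite f1 i1; clear; lia.
have [->|u3] := eqVneq u w3; first by rewrite i3; have := del_fd w2 j w3; rewrite f3; move: n6; clear; split; lia.
have := ho (u := u); rewrite !inE (negPf u1) (negPf u2) (negPf u3) => /(_ isT); move: l1; clear; split; lia.
Qed.
End Part.

Lemma two_viol n (G : {set vert n * 'I_n}) w f s t : properG G -> f \in G -> s != t -> viol w f = [set s; t] -> f.2 = s ->
  f \in inc G (flip w t).
Proof.
move=> pG fG st ev fs; apply: (viol_center pG fG); rewrite -(cards1 s); apply/subset_leq_card/subsetP => k.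
rewrite !inE fs => /orP[|kv]; first by rewrite eq_sym.
have [kt|kt] := eqVneq k t.
  have : t \in viol w f by rewrite ev !inE eqxx orbT.
  by rewrite inE fs (negPf st) /=; move: kv; rewrite kt flipE eqxx; case: (f.1 t); case: (w t).
have : k \in viol w f by rewrite inE; move: kv; rewrite flipE (negPf kt) /= => ->; rewrite orbT.
by rewrite ev !inE (negPf kt) orbF.
Qed.

(** The healthy sets partition the eight directions and [f] is the only fault elsewhere. It violates
    a direction other than [s] and [t], for otherwise it would be incident with one of the three
    vertices. The vertex at which that direction is healthy decides between [part_narrow] and
    [part_wide]. *)
Lemma part_lace n (G : {set vert n.+2 * 'I_n.+2}) w1 w2 w3 : T n.+1 -> properG G -> n = 6 -> #|G| = 15 ->
  w1 != w2 -> w1 != w3 -> w2 != w3 -> fd G w1 = n -> fd G w2 = n.-1 -> fd G w3 = n.-1 ->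
  (forall u : vert n.+2, u \notin [:: w1; w2; w3] -> fd G u + 2 <= n) ->
  hl G w1 :&: hl G w2 = set0 -> (hl G w1 :|: hl G w2) :&: hl G w3 = set0 -> 0 < shr G w1 w2 -> 0 < shr G w1 w3 ->
  #|G| <= #|inc3 G w1 w2 w3| + 1 -> ~~ (G \subset inc3 G w1 w2 w3) -> lace G.
Proof.
move=> tm pG n6 cG n12 n13 n23 f1 f2 f3 ho d12 d123 h12 h13 cI ncov.
have [s is2 e1] := shr_ex n12 h12; have [t it3 e1'] := shr_ex n13 h13.
have e2 : w2 = flip w1 s by rewrite e1 flipK.
have e3 : w3 = flip w1 t by rewrite e1' flipK.
have is1 : isf G w1 s by rewrite e1 isf_flip.
have it1 : isf G w1 t by rewrite e1' isf_flip.
have st : s != t by apply: contra n23 => /eqP st; rewrite e2 e3 st.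
have [f fG fO] := subsetPn ncov.
have cov g : g \in G -> [\/ g \in inc G w1, g \in inc G w2, g \in inc G w3 | g = f].
  move=> gG; have [gf|gf] := eqVneq g f; first by apply: Or44.
  have [|gO] := boolP (g \in inc3 G w1 w2 w3).
    by rewrite /inc3 !in_setU => /orP[/orP[]|] h; [apply: Or41|apply: Or42|apply: Or43].
  have : inc3 G w1 w2 w3 \subset G :\ f :\ g.
    apply/subsetP => k kI; rewrite !in_setD1; apply/and3P; split.
    - by apply: contraNneq gO => <-.
    - by apply: contraNneq fO => <-.
    by apply: subsetP kI; rewrite /inc3 !subUset !inc_sub.
  move/subset_leq_card; have := cardsD1 f G; have := cardsD1 g (G :\ f); rewrite fG in_setD1 gf gG.
  by move: cI; clear; lia.
have fo := out3 fG fO.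
have [d dv /andP[ds dt]] : exists2 d, d \in viol w1 f & (d != s) && (d != t).
  case: (ex_dir (fun d => (d \in viol w1 f) && ((d != s) && (d != t)))) => [[d /andP[]]|no]; first by exists d.
  have sub : viol w1 f \subset [set s; t].
    by apply/subsetP => k kv; have := no k; rewrite kv !inE /= -negb_or negbK.
  have ev : viol w1 f = [set s; t].
    apply/eqP; rewrite eqEcard sub cards2 st /= ltnNge; apply/negP => /(viol_center pG fG).
    by apply/negP/fo; rewrite !inE eqxx.
  have : f.2 \in viol w1 f by rewrite inE eqxx.
  rewrite ev !inE => /orP[]/eqP fe.
    by have := two_viol pG fG st ev fe; rewrite -e3 (negPf (fo w3 _)) // !inE eqxx !orbT.
  have ev' : viol w1 f = [set t; s] by rewrite ev setUC.
  rewrite eq_sym in st.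
  by have := two_viol pG fG st ev' fe; rewrite -e2 (negPf (fo w2 _)) // !inE eqxx !orbT.
have nb k : [&& ~~ isf G w1 k & ~~ isf G w2 k] = false by have := in_set0 k; rewrite -d12 !inE.
have nb' k : (~~ isf G w1 k || ~~ isf G w2 k) && ~~ isf G w3 k = false by have := in_set0 k; rewrite -d123 !inE.
have c1 : #|hl G w1| = 2 by apply: hl_card; rewrite f1 addn2.
have c2 w : fd G w = n.-1 -> #|hl G w| = 3 by move=> e; apply: hl_card; rewrite e n6.
have dU : d \in hl G w1 :|: hl G w2 :|: hl G w3.
  suff -> : hl G w1 :|: hl G w2 :|: hl G w3 = setT by rewrite inE.
  apply/eqP; rewrite eqEcard subsetT cardsT card_ord.
  have k1 := cardsUI (hl G w1 :|: hl G w2) (hl G w3); have k2 := cardsUI (hl G w1) (hl G w2).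
  rewrite d123 cards0 addn0 c2 // in k1; rewrite d12 cards0 addn0 c1 c2 // in k2.
  by rewrite k1 k2 n6.
move: dU; rewrite !in_setU => /orP[/orP[]|].
- move=> dH; have i1 : ~~ isf G w1 d by move: dH; rewrite inE.
  have both k : ~~ isf G w1 k -> isf G w2 k /\ isf G w3 k.
    by move=> h; have := nb k; have := nb' k; rewrite h /= => /negbFE -> /negbFE ->.
  have [h hd hH] : exists2 h, h != d & ~~ isf G w1 h.
    have : 0 < #|hl G w1 :\ d| by rewrite -ltnS -[X in _ < X]add1n -[X in X + _]/(nat_of_bool true) -dH -cardsD1 c1.
    by case/card_gt0P => h; rewrite !inE => /andP[k1 k2]; exists h.
  have hs : h != s by apply: contraNneq hH => ->.
  have ht : h != t by apply: contraNneq hH => ->.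
  have [i2 i3] := both d i1; have [j2 j3] := both h hH.
  (* If the neighbour of [w1] in direction [h] meets [f] as a crossing fault, then [f] also violates
     [h], and the two healthy directions of [w1] exchange roles. *)
  have [ef|nf] := eqVneq (low (flip w1 h) d, d) f; last first.
    by apply: (part_narrow tm pG n6 cG fG n23 f1 f2 f3 ho cov fo e2 e3 (d := d) (h := h)) => //; rewrite eq_sym.
  apply: (part_narrow tm pG n6 cG fG n23 f1 f2 f3 ho cov fo e2 e3 (d := h) (h := d)) => //.
    by rewrite -ef !inE /= ffunE hd flipE eqxx; case: (w1 h); rewrite orbT.
  by rewrite -ef; apply: contra hd => /eqP[_ ->].
- rewrite inE => i2.
  have i1 : isf G w1 d by have := nb d; rewrite i2 andbT => /negbFE.
  have i3 : isf G w3 d by have := nb' d; rewrite i2 orbT => /negbFE.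
  exact: (part_wide tm pG n6 cG fG n13 f1 f2 f3 ho cov fo e2 e3 is1 ds dt i2 i1 i3 dv).
rewrite inE => i3; have := nb' d; rewrite i3 andbT => /norP[/negPn i1 /negPn i2].
have cov' g : g \in G -> [\/ g \in inc G w1, g \in inc G w3, g \in inc G w2 | g = f].
  by case/cov => h; [apply: Or41|apply: Or43|apply: Or42|apply: Or44].
have sw u : (u \in [:: w1; w3; w2]) = (u \in [:: w1; w2; w3]).
  by rewrite !inE; case: (u == w1); case: (u == w2); case: (u == w3).
have fo' u : u \in [:: w1; w3; w2] -> f \notin inc G u by rewrite sw; exact: fo.
have ho' (u : vert n.+2) : u \notin [:: w1; w3; w2] -> fd G u + 2 <= n by rewrite sw; exact: ho.
have n32 : w3 != w2 by rewrite eq_sym.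
exact: (part_wide tm pG n6 cG fG n12 f1 f3 f2 ho' cov' fo' e3 e2 it1 dt ds i3 i1 i2 dv).
Qed.

(** * The induction step *)

Lemma shr_par n (G : {set vert n * 'I_n}) u v : u != v -> shr G u v <= (parity u != parity v).
Proof.
move=> uv; have := @inc_meet n G u v uv; rewrite -/(shr G u v); case: (posnP (shr G u v)) => [->//|p].
by have [s _ ->] := shr_ex uv p; rewrite parity_flip; case: (parity v).
Qed.

(* Four vertices share at most four edges, since the hypercube is bipartite. *)
Lemma four_inc n (G : {set vert n * 'I_n}) w1 w2 w3 w4 : uniq [:: w1; w2; w3; w4] ->
  fd G w1 + fd G w2 + fd G w3 + fd G w4 <= #|G| + 4.
Proof.
rewrite /= !inE !negb_or -!andbA => /and5P[n12 n13 n14 n23 /and3P[n24 n34 _]].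
have k1 := shr_card G w1 w2 w3; have k2 := cardsUI (inc3 G w1 w2 w3) (inc G w4).
have k3 : #|inc3 G w1 w2 w3 :&: inc G w4| <= shr G w1 w4 + shr G w2 w4 + shr G w3 w4.
  rewrite /inc3 !setIUl; apply: leq_trans (leq_card_setU _ _) _; rewrite leq_add2r; exact: leq_card_setU.
have k4 : #|inc3 G w1 w2 w3 :|: inc G w4| <= #|G|.
  by apply: subset_leq_card; rewrite /inc3 !subUset !inc_sub.
rewrite card_inc in k2; move: k1 k2 k3 k4 (shr_par G n12) (shr_par G n13) (shr_par G n14) (shr_par G n23) (shr_par G n24) (shr_par G n34).
move: #|inc3 G w1 w2 w3 :|: _| #|inc3 G w1 w2 w3 :&: _| #|inc3 G w1 w2 w3| #|G| (shr G w1 w2) (shr G w1 w3) (shr G w1 w4) (shr G w2 w3) (shr G w2 w4) (shr G w3 w4).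
by case: (parity w1); case: (parity w2); case: (parity w3); case: (parity w4) => /=; clear; lia.
Qed.

Section Step.
Variables (n : nat) (G : {set vert n.+2 * 'I_n.+2}).
Hypotheses (Ta : forall m, m <= n.+1 -> T m) (pG : properG G) (n5 : 5 <= n) (cG : #|G| <= bnd n.+2).
Let n4 : 4 <= n. Proof. exact: ltnW. Qed.
Let tm : T n.+1. Proof. exact: Ta. Qed.

Lemma two_low w1 w2 : w1 != w2 -> fd G w1 <= n -> n.-1 <= fd G w1 -> fd G w2 = n.-1 ->
  (forall u : vert n.+2, u \notin [:: w1; w2] -> fd G u + 2 <= n) -> lace G.
Proof.
move=> n12 l1 g1 f2 ho; have [f1|f1] := eqVneq (fd G w1) n; last first.
  by apply: (@two_33 n G Ta pG n5 cG w1 w2) => //; move: l1 g1 f1; clear; lia.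
case: (ex_dir (fun d => isf G w1 d && (w1 d != w2 d))) => [[d /andP[i1 e]]|no].
  exact: (two_sep Ta pG n5 cG f2 ho f1 i1 e).
have hs d : isf G w1 d -> w2 d = w1 d.
  by move=> i1; have := no d; rewrite i1 /= negbK => /eqP.
have oc := @two_others n G w1 w2 n12 f2 f1 hs.
apply: (@two_short n G Ta pG n5 cG w1 w2) => // n6 c hz.
apply: (@two_far n G Ta pG n6 c w1 w2) => //.
move=> d f i1 i2 fO; apply/negP => fv; have := hz d i1 i2 => e.
by have := in_set0 f; rewrite -e inE fO fv.
Qed.

Lemma three_low w1 w2 w3 : w1 != w2 -> w1 != w3 -> w2 != w3 -> fd G w1 <= n -> n.-1 <= fd G w1 ->
  fd G w2 = n.-1 -> fd G w3 = n.-1 -> (forall u : vert n.+2, u \notin [:: w1; w2; w3] -> fd G u + 2 <= n) -> lace G.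
Proof.
move=> n12 n13 n23 l1 g1 f2 f3 ho; have [f1|f1] := eqVneq (fd G w1) n.
  by apply: (@three_233 n G Ta pG n5 cG w1 w2 w3) => // n6 d1 d2 s1 s2 c15; apply: part_lace.
by apply: (@three_333 n G Ta pG n5 cG w1 w2 w3) => //; move: l1 g1 f1; clear; lia.
Qed.

Lemma more_low (L : seq (vert n.+2)) : (forall u : vert n.+2, u \notin L -> fd G u <= n.-1) ->
  (exists w, [/\ w \notin L, fd G w = n.-1 & forall u : vert n.+2, u \notin rcons L w -> fd G u <= n.-1]) \/ (forall u : vert n.+2, u \notin L -> fd G u + 2 <= n).
Proof.
move=> h; case: (ex_vert (fun w : vert n.+2 => (w \notin L) && (fd G w == n.-1))) => [[w /andP[wL /eqP fw]]|no]; [left|right].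
  by exists w; split=> // u; rewrite mem_rcons inE negb_or => /andP[_ /h].
by move=> u uL; have := no u; have := h u uL; rewrite uL /=; move: n5; clear; lia.
Qed.

(** Vertices of degree at most three are collected one at a time. Four of them would carry at least
    4(n-1) faults counted with multiplicity, while [four_inc] and [cG9] allow only 4n-5. *)
Lemma low_step w1 : fd G w1 <= n -> n.-1 <= fd G w1 -> (forall u : vert n.+2, u \notin [:: w1] -> fd G u <= n.-1) -> lace G.
Proof.
move=> l1 g1 /more_low[[w2 [n2 f2]]|ho]; last first.
  have [f1|f1] := eqVneq (fd G w1) n.
    apply: (@one_low n G tm pG n4 cG w1 (n - 3)) => //.
    - by move=> u u1; have := ho u; rewrite inE u1 => /(_ isT); clear; lia.
    - by move: n5; clear; lia.
    by right; move: n5; clear; lia.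
  have hw : fd G w1 + 1 = n by move: l1 g1 f1 n5; clear; lia.
  have un (u : vert n.+2) : fd G u + 1 = n -> u = w1.
    by move=> e; apply/eqP; apply: contraT => u1; have := ho u; rewrite inE u1 => /(_ isT); move: e; clear; lia.
  apply: (@no_low n G tm pG n4 cG) => [u|u v hu hv]; last by right; rewrite (un u hu) (un v hv).
  have [->|u1] := eqVneq u w1; first by rewrite hw.
  by have := ho u; rewrite inE u1 => /(_ isT); clear; lia.
rewrite inE eq_sym in n2; case/more_low => [[w3 [n3 f3]]|ho]; last exact: (two_low n2 l1 g1 f2 ho).
move: n3; rewrite /= !inE negb_or eq_sym (eq_sym w3) => /andP[n13 n23].
case/more_low => [[w4 [n4' f4 _]]|ho]; last exact: (three_low n2 n13 n23 l1 g1 f2 f3 ho).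
move: n4'; rewrite /= !inE !negb_or => /and3P[n14 n24 n34].
have u4 : uniq [:: w1; w2; w3; w4].
  by rewrite /= !inE !negb_or n2 n13 n23 (eq_sym w1 w4) n14 (eq_sym w2 w4) n24 (eq_sym w3 w4) n34.
have := four_inc G u4; rewrite f2 f3 f4.
by have := cG9 n5 cG; move: g1 n5; clear; lia.
Qed.

Lemma step : (forall u : vert n.+2, fd G u <= n) -> (forall u v : vert n.+2, fd G u = n -> fd G v = n -> u = v) -> lace G.
Proof.
move=> h1 h2; case: (ex_vert (fun w : vert n.+2 => fd G w == n)) => [[w /eqP fw]|no].
  apply: (@low_step w); rewrite ?fw ?leq_pred // => u; rewrite inE => uw.
  have : fd G u != n by apply: contra uw => /eqP fu; apply/eqP; exact: h2.
  by have := h1 u; clear; lia.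
have h3 (u : vert n.+2) : fd G u <= n.-1 by have := no u; have := h1 u; clear; lia.
case: (@more_low [::]) => // [[w [_ fw _]]|ho].
  by apply: (@low_step w) => //; rewrite fw // leq_pred.
apply: (@no_low n G tm pG n4 cG) => [u|u v hu]; first by have := ho u isT; clear; lia.
by have := ho u isT; move: hu; clear; lia.
Qed.
End Step.

Theorem T_all m : T m.
Proof.
elim/ltn_ind: m => m IH; have [|m7] := leqP 7 m; last first.
  by case: m IH m7 => [|[|[|[|[|[|[|]]]]]]] // _ _; [exact: T4|exact: T5|exact: T6].
case: m IH => [|[|n]] // IH m7 m4 G [pG cG h1 h2].
apply: (@step n G _ pG m7 cG) => [k hk|u|u v hu hv]; first exact: IH.
  by have := h1 u; rewrite addn2.
by have [||h|//] := h2 u v; rewrite ?hu ?hv ?addn2 //; move: m7 h; clear; lia.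
Qed.

(** * From sets of faulty edges to pairs of endpoint and direction *)

Definition faults n (F : {set {set vert n}}) : {set vert n * 'I_n} :=
  [set f : vert n * 'I_n | ~~ f.1 f.2 && ([set f.1; flip f.1 f.2] \in F)].

Lemma flip_neq n (u : vert n) i : flip u i != u.
Proof. by apply/eqP => /(congr1 (@parity n)); rewrite parity_flip; case: (parity u). Qed.

Lemma isf_faults n (F : {set {set vert n}}) u i : isf (faults F) u i = ([set u; flip u i] \in F).
Proof.
rewrite /isf inE /= ffunE eqxx /=; case e: (u i).
  have -> : low u i = flip u i by apply/ffunP => j; rewrite !ffunE; case: eqP => [->|] //=; rewrite e.
  by rewrite flipK setUC.
by have -> : low u i = u by apply/ffunP => j; rewrite !ffunE; case: eqP => [->|] //=; rewrite e.
Qed.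

Lemma edge_inj n (u v : vert n) i j : [set u; flip u i] = [set v; flip v j] -> low u i = low v j /\ i = j.
Proof.
move=> e; have : u \in [set v; flip v j] by rewrite -e !inE eqxx.
have : flip u i \in [set v; flip v j] by rewrite -e !inE eqxx orbT.
rewrite !inE => h /orP[]/eqP uv; move: h; rewrite {}uv ?(negPf (flip_neq _ _)) /=.
  by move/eqP/flip_inj => ->.
rewrite orbF => /eqP h.
have ij : i = j by apply: (@flip_inj _ (flip v j)); rewrite h flipK.
by rewrite ij low_flip.
Qed.

Lemma card_faults n (F : {set {set vert n}}) : #|faults F| <= #|F|.
Proof.
rewrite -(card_in_imset (f := fun f : vert n * 'I_n => [set f.1; flip f.1 f.2])).
  by apply/subset_leq_card/subsetP => e /imsetP[f]; rewrite inE => /andP[_ fF] ->.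
have lowE (f : vert n * 'I_n) : f \in faults F -> low f.1 f.2 = f.1.
  rewrite inE => /andP[h _]; apply/ffunP => j; rewrite ffunE; case: eqP => // ->; by rewrite (negPf h).
move=> f g ff gg /edge_inj[]; rewrite !lowE //; by case: f {ff} => a b; case: g {gg} => a' b' /= -> ->.
Qed.

Lemma qadjP n (u v : vert n) : reflect (exists i, v = flip u i) (qadj u v).
Proof.
apply: (iffP cards1P) => -[i e]; exists i.
  apply/ffunP => j; have := in_set1 j i; rewrite -e inE flipE.
  by case: (j == i); case: (u j); case: (v j).
by apply/setP => j; rewrite !inE e flipE; case: (j == i); case: (u j).
Qed.

Lemma adjF_faults n (F : {set {set vert n}}) : adjF F =2 adjG (faults F).
Proof.
move=> u v; apply/andP/adjGP => [[/qadjP[i ->] h]|[i -> h]]; first by exists i; rewrite ?isf_faults.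
by rewrite -isf_faults; split=> //; apply/qadjP; exists i.
Qed.

Lemma fd_faults n (F : {set {set vert n}}) u : fd (faults F) u + degF F u = n.
Proof.
have -> : degF F u = #|~: [set i | isf (faults F) u i]|.
  rewrite -(card_imset _ (@flip_inj _ u)); apply: eq_card => v; rewrite inE adjF_faults.
  by apply/adjGP/imsetP => -[i]; rewrite ?inE => h k; exists i; rewrite ?inE.
by rewrite /fd cardsC card_ord.
Qed.

Lemma ham_pathW n (F : {set {set vert n}}) x y : ham (adjG (faults F)) x y -> exists p, ham_path F x y p.
Proof.
case=> s [p -> [pp lp]] hs; exists (x :: p); split=> //=.
- by apply: (@count_mem_uniq _ (x :: p)) => z; rewrite hs; have := has_pred1 z (x :: p); rewrite has_count hs => <-.
- by move=> z; rewrite -has_pred1 has_count hs.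
by rewrite (eq_path (adjF_faults F)).
Qed.

Theorem theorem2 (n : nat) (F : {set {set vert n}}) :
  5 <= n ->
  (forall e, e \in F -> qedge e) ->
  #|F| <= 4 * n - 17 ->
  (forall u : vert n, 2 <= degF F u) ->
  #|[set u : vert n | degF F u == 2]| <= 1 ->
  forall x y : vert n, parity x != parity y ->
    exists p : seq (vert n), ham_path F x y p.
Proof.
move=> n5 _ cF h2 h1 x y xy; apply: ham_pathW; apply: (@T_all n) xy; first exact: ltnW.
split.
- by move=> f; rewrite inE => /andP[].
(* In dimensions 5 and 6 the values 5 and 8 of [bnd] are above 3 and 7; from 7 on the two bounds
   coincide. *)
- apply: leq_trans (card_faults F) (leq_trans cF _); rewrite /bnd.
  by case: ifP => [|_]; [|case: eqP => [->|_] //; case: eqP => [->|_] //]; move: n5; clear; lia.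
- by move=> u; have := h2 u; have := fd_faults F u; clear; lia.
have d2 w : fd (faults F) w + 2 = n -> w \in [set u | degF F u == 2].
  by move=> hw; rewrite inE -(eqn_add2l (fd (faults F) w)) fd_faults hw.
by move=> u v /d2 hu /d2 hv; right; exact: (card_le1_eqP h1).
Qed.
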